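(* There is a universal constant $c$ such that the following holds. Let $z_0=(x_0,t_0)\in\mathbb{R}^3\times\mathbb{R}$ and let $(u,p)$ be a suitable weak solution to the Navier-Stokes equations in $Q^{+}(z_{0},1)$ near $\Gamma(x_0,1)\times [t_0-1,t_0]$. Then for every $0<r<1$, $$A^{+}(z_{0},r/2;u)+ B^{+}(z_0,r/2;u)\leqslant c\left( C^{+}_{\infty}(z_{0},r;u)^{\frac{4}{3}}+C^{+}_{\infty}(z_{0},r;u)^{\frac{2}{3}}+D^{+}_{1}(z_{0},r;p)^{\frac{2}{3}}\,C_{\infty}^{+}(z_{0},r;u)^{\frac{1}{3}}\right).$$
   Context: Notation. $B(x_0,R)=\{x\in\mathbb{R}^3:|x-x_0|<R\}$, $B^+(x_0,R)=\{x\in B(x_0,R):x_3>x_{03}\}$, $\Gamma(x_0,R)=\{x\in B(x_0,R):x_3=x_{03}\}$, $Q(z_0,R)=B(x_0,R)\times]t_0-R^2,t_0[$, $Q^+(z_0,R)=B^+(x_0,R)\times]t_0-R^2,t_0[$. For $\mathcal Q=\Omega\times]a,b[$: $L_{m,n}(\mathcal Q)=L_n(a,b;L_m(\Omega))$; $W^{1,0}_{m,n}(\mathcal Q)=\{v:v,\nabla v\in L_{m,n}(\mathcal Q)\}$; $W^{2,1}_{m,n}(\mathcal Q)=\{v:v,\nabla v,\nabla^2v,\partial_tv\in L_{m,n}(\mathcal Q)\}$; $W^{1,0}_m=W^{1,0}_{m,m}$. Weak Lebesgue norm: $\|g\|_{L^{p,\infty}(\Omega)}=\sup_{\alpha>0}\alpha|\{x\in\Omega:|g(x)|>\alpha\}|^{1/p}$.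 Scale-invariant quantities: $$A^{+}(z_{0},r;u)= \sup_{t_{0}-r^2\leqslant t\leqslant t_0}r^{-1}\int_{B^{+}(x_{0},r)}|u(x,t)|^2dx,\qquad B^{+}(z_{0},r;u)=r^{-1}\int_{Q^{+}(z_{0},r)}|\nabla u|^2dxdt,$$ $$C^{+}_{\infty}(z_{0},r;u)= r^{-2}\int_{t_{0}-r^2}^{t_0}\|u(\cdot,t)\|_{L^{3,\infty}(B^{+}(x_0,r))}^3 dt,\qquad D_{1}^{+}(z_{0},r;p)=r^{-\frac{3}{2}}\int_{t_0-r^2}^{t_0}\Big(\int_{B^{+}(x_{0},r)}|\nabla p|^{\frac{9}{8}}dx\Big)^{\frac{4}{3}} dt,$$ the supremum in $A^+$ being understood as an essential supremum in $t$. Suitable weak solution in $Q^+(z_0,R)$ near $\Gamma(x_0,R)\times[t_0-R^2,t_0]$: a pair $(v,p)$ with $v\in L_\infty(t_0-R^2,t_0;L_2(B^+(x_0,R)))\cap W^{1,0}_2(Q^+(z_0,R))\cap W^{2,1}_{\frac98,\frac32}(Q^+(z_0,R))$, $p\in W^{1,0}_{\frac98,\frac32}(Q^+(z_0,R))$, satisfying the Navier-Stokes equations $\partial_tv+\operatorname{div}(v\otimes v)-\Delta v=-\nabla p$, $\operatorname{div}v=0$ a.e. in $Q^+(z_0,R)$, the boundary condition $v(x,t)=0$ for $x_3=x_{03}$, $t_0-R^2<t<t_0$, and, for a.a. $t\in]t_0-R^2,t_0[$ and all nonnegative $\phi\in C_0^\infty(\mathbb{R}^4)$ vanishing in a neighbourhood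 of the parabolic boundary $B(x_0,R)\times\{t_0-R^2\}\cup\partial B(x_0,R)\times[t_0-R^2,t_0]$ of $Q(z_0,R)$, the local energy inequality $$\int_{B^+(x_0,R)}\phi(x,t)|v(x,t)|^2dx+2\int_{B^+(x_0,R)\times]t_0-R^2,t[}\phi|\nabla v|^2dxdt'\leqslant\int_{B^+(x_0,R)\times]t_0-R^2,t[}\big[|v|^2(\partial_t\phi+\Delta\phi)+v\cdot\nabla\phi(|v|^2+2p)\big]dxdt'.$$ *)

(* Defs.v *)
From HB Require Import structures.
From mathcomp Require Import all_boot all_order all_algebra.
From mathcomp Require Import all_classical all_reals all_analysis.
From mathcomp Require Import measurable_realfun ess_sup_inf.

Set Implicit Arguments.
Unset Strict Implicit.
Unset Printing Implicit Defensive.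

Import Order.TTheory GRing.Theory Num.Theory.
Import numFieldNormedType.Exports.

Local Open Scope classical_set_scope.
Local Open Scope ring_scope.

(* Points of R^3 are triples ((x1, x2), x3) and points of R^3 x R are pairs
   (x, t). The norm the library puts on these products is the sup norm: it is
   used only through the topology; the balls below are Euclidean. *)
Notation space3 R := (R * R * R)%type.
Notation spacetime R := (R * R * R * R)%type.

(* Lebesgue measure on R, R^2, R^3 and R^4, as iterated products on the Borel
   sets. The library types lebesgue_measure on measurableTypeR R, whose structure
   does not unify with the canonical one on R, and its sigma-finiteness instance
   for products is shadowed by the one for subprobabilities: hence the named
   copies with their own instances. *)
Section lebesgue.
Variable R : realType.

Definition leb1 : set R -> \bar R := @lebesgue_measure R.
Let leb1_0 : leb1 set0 = 0%E. Proof. exact: measure0. Qed.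
Let leb1_ge0 A : (0 <= leb1 A)%E. Proof. exact: measure_ge0. Qed.
Let leb1_additive : semi_sigma_additive leb1.
Proof. exact: (@measure_semi_sigma_additive _ _ _ (@lebesgue_measure R)). Qed.
HB.instance Definition _ :=
  isMeasure.Build _ _ _ leb1 leb1_0 leb1_ge0 leb1_additive.
Let leb1_sigma_finite : sigma_finite setT leb1.
Proof. exact: (sigma_finiteT (@lebesgue_measure R)). Qed.
HB.instance Definition _ :=
  Measure_isSigmaFinite.Build _ _ _ leb1 leb1_sigma_finite.

Let prod_sigma_finite d1 d2 (T1 : measurableType d1) (T2 : measurableType d2)
    (m1 : {sigma_finite_measure set T1 -> \bar R})
    (m2 : {sigma_finite_measure set T2 -> \bar R}) :
  sigma_finite setT (m1 \x m2)%E.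
Proof.
have /sigma_finiteP[F [TF ndF Foo]] := sigma_finiteT m1.
have /sigma_finiteP[G [TG ndG Goo]] := sigma_finiteT m2.
exists (fun n => F n `*` G n).
  apply/esym; rewrite -subTset => -[x y] _.
  have [n _ Fnx] : (\bigcup_n F n) x by rewrite -TF.
  have [k _ Gky] : (\bigcup_n G n) y by rewrite -TG.
  exists (maxn n k) => //; split.
    by move: x Fnx; exact/subsetPset/ndF/leq_maxl.
  by move: y Gky; exact/subsetPset/ndG/leq_maxr.
move=> k; have [mF Fk] := Foo k; have [mG Gk] := Goo k.
split; first exact: measurableX.
by rewrite product_measure1E// lte_mul_pinfty// ge0_fin_numE.
Qed.

Definition leb2 : set (R * R) -> \bar R := (leb1 \x leb1)%E.
HB.instance Definition _ := Measure.on leb2.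
HB.instance Definition _ :=
  Measure_isSigmaFinite.Build _ _ _ leb2 (@prod_sigma_finite _ _ _ _ leb1 leb1).

Definition leb3 : set (R * R * R) -> \bar R := (leb2 \x leb1)%E.
HB.instance Definition _ := Measure.on leb3.
HB.instance Definition _ :=
  Measure_isSigmaFinite.Build _ _ _ leb3 (@prod_sigma_finite _ _ _ _ leb2 leb1).

Definition leb4 : set (R * R * R * R) -> \bar R := (leb3 \x leb1)%E.
HB.instance Definition _ := Measure.on leb4.
HB.instance Definition _ :=
  Measure_isSigmaFinite.Build _ _ _ leb4 (@prod_sigma_finite _ _ _ _ leb3 leb1).

End lebesgue.

Arguments leb1 {R}.
Arguments leb2 {R}.
Arguments leb3 {R}.
Arguments leb4 {R}.

Section geometry.
Variable R : realType.
Implicit Types (x : space3 R) (z : spacetime R) (r : R).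

Definition coords x (i : 'I_3) : R := tnth [tuple x.1.1; x.1.2; x.2] i.

Definition euclid (w : 'I_3 -> R) : R := Num.sqrt (\sum_(i < 3) w i ^+ 2).

Definition eball x0 r : set (space3 R) :=
  [set x | euclid (coords (x - x0)) < r].

Definition esphere x0 r : set (space3 R) :=
  [set x | euclid (coords (x - x0)) = r].

Definition halfball x0 r : set (space3 R) :=
  eball x0 r `&` [set x | x0.2 < x.2].

Definition flatpart x0 r : set (space3 R) :=
  eball x0 r `&` [set x | x.2 = x0.2].

Definition tstart z0 r : R := z0.2 - r ^+ 2.

Definition cyl z0 r : set (spacetime R) :=
  eball z0.1 r `*` `]tstart z0 r, z0.2[%classic.

Definition halfcyl z0 r : set (spacetime R) :=
  halfball z0.1 r `*` `]tstart z0 r, z0.2[%classic.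

Definition parabolic_boundary z0 r : set (spacetime R) :=
  (eball z0.1 r `*` [set tstart z0 r]) `|`
  (esphere z0.1 r `*` `[tstart z0 r, z0.2]%classic).

Definition dirx (i : 'I_3) : spacetime R :=
  ((((i == 0%N :> nat)%:R, (i == 1%N :> nat)%:R), (i == 2%N :> nat)%:R), 0).

Definition dirt : spacetime R := (0, 1).

End geometry.

Arguments dirx {R} i.
Arguments dirt {R}.

Section test_functions.
Variable R : realType.
Implicit Types (phi : spacetime R -> R) (D : set (spacetime R)).

(* all iterated directional derivatives exist and are continuous *)
Definition smooth phi : Prop := forall s : seq (spacetime R),
  let g := foldr (fun h f => 'D_h f) phi s in
  continuous g /\ forall h z, derivable g z h.

Definition test_fun D phi : Prop := smooth phi /\
  exists K : set (spacetime R),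
    [/\ compact K, K `<=` D & forall z, ~ K z -> phi z = 0].

Definition laplacian phi (z : spacetime R) : R :=
  \sum_(i < 3) 'D_(dirx i) ('D_(dirx i) phi) z.

End test_functions.

(* Elements of Lebesgue spaces on a cylinder are represented by
   Borel-measurable functions; only their values on the cylinder matter.
   Weak derivatives, being unique almost everywhere only, are carried along as
   explicit functions. *)
Section function_spaces.
Variable R : realType.
Implicit Types (f g : spacetime R -> R) (D : set (spacetime R)).
Implicit Types (Om : set (space3 R)) (a b : R) (m n : \bar R).

Definition mixed_norm m n Om a b f : \bar R :=
  Lnorm leb1 n ((fun t : R =>
    Lnorm leb3 m ((fun x : space3 R => (f (x, t))%:E) \_ Om)) \_ `]a, b[%classic).

Definition Lmn m n Om a b f : Prop :=
  measurable_fun (Om `*` `]a, b[%classic) f /\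
  (mixed_norm m n Om a b f < +oo)%E.

Definition loc_integrable D f : Prop := forall K : set (spacetime R),
  compact K -> K `<=` D -> leb4.-integrable K (EFin \o f).

Definition weak_deriv D (h : spacetime R) f g : Prop :=
  [/\ loc_integrable D f, loc_integrable D g &
    forall phi, test_fun D phi ->
      \int[leb4]_(z in D) (f z * 'D_h phi z) =
      - \int[leb4]_(z in D) (g z * phi z)].

Definition weak_div D (F : 'I_3 -> spacetime R -> R) g : Prop :=
  [/\ (forall j, loc_integrable D (F j)), loc_integrable D g &
    forall phi, test_fun D phi ->
      \int[leb4]_(z in D) (\sum_(j < 3) F j z * 'D_(dirx j) phi z) =
      - \int[leb4]_(z in D) (g z * phi z)].

Definition W10 m n Om a b f (Df : 'I_3 -> spacetime R -> R) : Prop :=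
  Lmn m n Om a b f /\
  forall i, Lmn m n Om a b (Df i) /\
    weak_deriv (Om `*` `]a, b[%classic) (dirx i) f (Df i).

Definition W21 m n Om a b f (Df : 'I_3 -> spacetime R -> R)
    (D2f : 'I_3 -> 'I_3 -> spacetime R -> R) (ft : spacetime R -> R) : Prop :=
  [/\ W10 m n Om a b f Df,
      (forall i, W10 m n Om a b (Df i) (D2f i)),
      Lmn m n Om a b ft &
      weak_deriv (Om `*` `]a, b[%classic) dirt f ft].

(* g (restricted to the flat part of the boundary) is the trace of f there, in
   the sense of the Green formula with outer normal -e_3; the test functions
   need not vanish on the flat part. D3f is the weak derivative of f in x_3. *)
Definition flat_trace (z0 : spacetime R) (r : R) f (D3f g : spacetime R -> R) :=
  let flat : set (space3 R) :=
    [set y | flatpart z0.1 r (y.1, z0.1.2) /\ tstart z0 r < y.2 < z0.2] in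
  let pt (y : space3 R) : spacetime R := ((y.1, z0.1.2), y.2) in
  forall phi, test_fun (cyl z0 r) phi ->
    leb3.-integrable flat (fun y => (g (pt y) * phi (pt y))%:E) /\
    \int[leb4]_(z in halfcyl z0 r) (f z * 'D_(dirx ord_max) phi z +
                                    D3f z * phi z) =
    - \int[leb3]_(y in flat) (g (pt y) * phi (pt y)).

End function_spaces.

(* In what follows Du i j and Dp i stand for d(u_i)/d(x_j) and dp/d(x_i). *)
Section navier_stokes.
Variable R : realType.
Implicit Types (z : spacetime R) (r : R).
Implicit Types (u : 'I_3 -> spacetime R -> R).
Implicit Types (Du : 'I_3 -> 'I_3 -> spacetime R -> R).
Implicit Types (p : spacetime R -> R) (Dp : 'I_3 -> spacetime R -> R).

Definition sqnorm u (z : spacetime R) : R := \sum_(i < 3) u i z ^+ 2.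

Definition sqnorm_grad Du (z : spacetime R) : R :=
  \sum_(i < 3) \sum_(j < 3) Du i j z ^+ 2.

Definition local_energy_inequality z0 r u Du p : Prop :=
  let Om := halfball z0.1 r in
  {ae leb1, forall t, tstart z0 r < t < z0.2 ->
    forall phi, test_fun setT phi -> (forall z, 0 <= phi z) ->
    (exists U : set (spacetime R), [/\ open U,
      parabolic_boundary z0 r `<=` U & forall z, U z -> phi z = 0]) ->
    \int[leb3]_(x in Om) (phi (x, t) * sqnorm u (x, t)) +
    2 * \int[leb4]_(z in Om `*` `]tstart z0 r, t[%classic)
          (phi z * sqnorm_grad Du z)
    <= \int[leb4]_(z in Om `*` `]tstart z0 r, t[%classic)
         (sqnorm u z * ('D_dirt phi z + laplacian phi z) +
          (\sum_(i < 3) u i z * 'D_(dirx i) phi z) *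
            (sqnorm u z + 2 * p z))}.

Definition suitable z0 r u Du p Dp : Prop :=
  let Om := halfball z0.1 r in
  let a := tstart z0 r in
  let b := z0.2 in
  exists (D2u : 'I_3 -> 'I_3 -> 'I_3 -> spacetime R -> R)
         (ut divuu : 'I_3 -> spacetime R -> R),
  [/\ [/\ forall i, Lmn 2%:E +oo%E Om a b (u i),
          forall i, W10 2%:E 2%:E Om a b (u i) (Du i),
          forall i, W21 (9 / 8)%:E (3 / 2)%:E Om a b
                      (u i) (Du i) (D2u i) (ut i) &
          W10 (9 / 8)%:E (3 / 2)%:E Om a b p Dp],
      (forall i, weak_div (halfcyl z0 r) (fun j z => u i z * u j z) (divuu i)),
      {ae leb4, forall z, halfcyl z0 r z ->
        (forall i, ut i z + divuu i z - \sum_(j < 3) D2u i j j z = - Dp i z) /\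
        \sum_(i < 3) Du i i z = 0},
      (forall i, flat_trace z0 r (u i) (Du i ord_max) (fun=> 0)) &
      local_energy_inequality z0 r u Du p].

End navier_stokes.

Section scale_invariant_quantities.
Variable R : realType.
Implicit Types (z : spacetime R) (r : R).
Implicit Types (u : 'I_3 -> spacetime R -> R).
Implicit Types (Du : 'I_3 -> 'I_3 -> spacetime R -> R).
Implicit Types (Dp : 'I_3 -> spacetime R -> R).
Local Open Scope ereal_scope.

Definition weak_norm (q : R) (Om : set (space3 R)) (g : space3 R -> R) : \bar R :=
  ereal_sup [set alpha%:E *
      (leb3 (Om `&` [set x | (alpha < `|g x|)%R])) `^ (q^-1)
    | alpha in [set alpha : R | (0 < alpha)%R]].

Definition Aplus z0 r u : \bar R :=
  ess_sup leb1 ((fun t : R =>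
    (r^-1)%:E * \int[leb3]_(x in halfball z0.1 r) (sqnorm u (x, t))%:E)
    \_ `[tstart z0 r, z0.2]%classic).

Definition Bplus z0 r Du : \bar R :=
  (r^-1)%:E * \int[leb4]_(z in halfcyl z0 r) (sqnorm_grad Du z)%:E.

Definition Cinfplus z0 r u : \bar R :=
  (r ^- 2)%:E * \int[leb1]_(t in `]tstart z0 r, z0.2[%classic)
    (weak_norm 3 (halfball z0.1 r) (fun x => euclid (fun i => u i (x, t))) ^+ 3).

Definition D1plus z0 r Dp : \bar R :=
  (r `^ (- (3 / 2)))%:E * \int[leb1]_(t in `]tstart z0 r, z0.2[%classic)
    ((\int[leb3]_(x in halfball z0.1 r)
      (euclid (fun i => Dp i (x, t)) `^ (9 / 8))%:E) `^ (4 / 3)).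

End scale_invariant_quantities.

(* Main.v *)
(* Let [N] be the weak L^3 norm on a time slice and [Z], [H] the squared L^2 norms of the velocity and
   of its gradient there. Interpolation with the weak norm and the Gagliardo-Nirenberg inequality on a
   cube of side about r give int |u|^3 <= c r^(1/14) N^(15/7) Z^(5/28) H^(1/4), which grows less than
   linearly in the energy. The pressure may be normalised by a constant on each slice because almost
   every slice is solenoidal with zero normal trace; its oscillation is controlled by its gradient
   through the Poincare-Sobolev inequality. Half cubes replace half balls, so that all slice estimates
   follow from absolute continuity along coordinate lines, up to the flat boundary. The local energy
   inequality, tested with a cutoff between two half cubes of sizes rho < h and combined with Young's
   inequality, bounds the energy at rho by half the energy at h plus c (r / (h - rho))^2 r S, where S is
   the right-hand side of the claim. Iterating along radii from r / 2 up to 11 r / 20 absorbs the energy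
   term, which is finite by assumption. *)

Require Import Defs.
From HB Require Import structures.
From mathcomp Require Import all_boot all_order all_algebra.
From mathcomp Require Import all_classical all_reals all_analysis.
From mathcomp Require Import measurable_realfun ess_sup_inf lra ring.

Set Implicit Arguments.

Import Order.TTheory GRing.Theory Num.Theory.
Import numFieldNormedType.Exports.

Local Open Scope classical_set_scope.
Local Open Scope ring_scope.

(** * Smooth cutoffs and tensor test functions *)

(** The exponent 3 is critical: the weak norm alone does not control the cube of [u]. The cube is
    therefore placed between the exponent 14/5, where the weak norm interpolates with L^2, and 7/2,
    which the Sobolev inequality for [u ^ 2] bounds by the gradient and the same 14/5-integral. The
    energy then has total power 5/28 + 1/4 = 3/7, and Young's inequality gives the data the power
    5/4, between the 2/3 and 4/3 of the claim; the lower order terms, quadratic in [u], produce 2/3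
    by themselves. The Sobolev exponent 3q/2 that comes straight from Loomis-Whitney is below the
    optimal one, but for q = 9/8 its conjugate 27/11 is still below 3, so that the weak norm of [u]
    suffices against the pressure. A half cube of half side h contains the half ball of radius r / 2
    and lies in the ball of radius r if 1/2 <= h / r < 3 ^ (-1/2); this leaves the range up to 11/20
    for the iteration. The energy inequality holds only for almost every time, and its integrals
    count as zero when they diverge, so finiteness has to be known before it can be read as an
    estimate. *)

Section smooth_line.
Variable R : realType.
Implicit Types (f g : R -> R) (n k : nat).

(** Indexed by the order, so that closure under sums, products and affine changes of variable is an
    induction. *)
Fixpoint nsmooth n f : Prop :=
  if n is m.+1 then (forall x, derivable f x 1) /\ nsmooth m (derive1 f)
  else continuous f.

Definition smooth1 f := forall n, nsmooth n f.

Lemma nsmooth_continuous n f : nsmooth n f -> continuous f.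
Proof.
case: n => [//|n] [df _] x; apply: differentiable_continuous.
exact/derivable1_diffP.
Qed.

Lemma nsmoothS n f : nsmooth n.+1 f -> nsmooth n f.
Proof.
elim: n f => [|n IH] f; first exact: nsmooth_continuous.
by move=> [df f'n]; split=> //; exact: IH.
Qed.

Lemma nsmooth_cst n (c : R) : nsmooth n (cst c).
Proof.
elim: n c => [|n IH] c; first exact: cst_continuous.
by split=> // ; rewrite (_ : (derive1 _) = cst 0) //; apply/funext => x; rewrite derive1_cst.
Qed.

Lemma nsmoothD n f g : nsmooth n f -> nsmooth n g -> nsmooth n (f \+ g).
Proof.
elim: n f g => [|n IH] f g.
  by move=> cf cg x; apply: continuousD; [exact: cf|exact: cg].
move=> [df fn] [dg gn]; split; first by move=> x; exact: derivableD.
rewrite (_ : (derive1 _) = (derive1 f) \+ (derive1 g)); first exact: IH.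
by apply/funext => x; rewrite /= !derive1E -deriveD.
Qed.

Lemma nsmoothM n f g : nsmooth n f -> nsmooth n g -> nsmooth n (f \* g).
Proof.
elim: n f g => [|n IH] f g.
  by move=> cf cg x; apply: continuousM; [exact: cf|exact: cg].
move=> fSn gSn; have [df fn] := fSn; have [dg gn] := gSn.
split; first by move=> x; exact: derivableM.
rewrite (_ : (derive1 _) = (f \* (derive1 g)) \+ (g \* (derive1 f))); last first.
  by apply/funext => x; rewrite /= !derive1E [LHS](@deriveM _ _ f g).
by apply: nsmoothD; apply: IH => //; exact: nsmoothS.
Qed.

Lemma smooth1_deriv f : smooth1 f -> smooth1 (derive1 f).
Proof. by move=> sf n; have [] := sf n.+1. Qed.

Lemma smooth1_derivable f x : smooth1 f -> derivable f x 1.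
Proof. by move=> sf; have [] := sf 1%N. Qed.

Lemma smooth1_continuous f : smooth1 f -> continuous f.
Proof. by move/(_ 0%N). Qed.

Lemma smooth1_cst (c : R) : smooth1 (cst c).
Proof. by move=> n; exact: nsmooth_cst. Qed.

Lemma smooth1D f g : smooth1 f -> smooth1 g -> smooth1 (f \+ g).
Proof. by move=> sf sg n; exact: nsmoothD. Qed.

Lemma smooth1M f g : smooth1 f -> smooth1 g -> smooth1 (f \* g).
Proof. by move=> sf sg n; exact: nsmoothM. Qed.

Lemma smooth1_primitive f g : (forall x : R, is_derive x (1 : R) g (f x)) ->
  smooth1 f -> smooth1 g.
Proof.
move=> dg sf [|n].
  by move=> x; apply: differentiable_continuous; exact/derivable1_diffP.
split; first by move=> x; exact: ex_derive.
by rewrite (_ : (derive1 _) = f) //; apply/funext => x; rewrite derive1E derive_val.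
Qed.

Lemma is_derive_affine f (a b x : R) : derivable f (a * x + b) 1 ->
  is_derive x (1 : R) (fun s => f (a * s + b)) (a * (derive1 f) (a * x + b)).
Proof.
move=> df; have ? : is_derive x (1 : R) (fun s => a * s + b) a.
  have : is_derive x (1 : R) (a *: (id : R -> R) + cst b) (a *: 1 + 0) by exact: is_deriveD.
  by rewrite addr0 [a *: 1]mulr1.
have ? : is_derive (a * x + b ) (1 : R) f ((derive1 f) (a * x + b)).
  by apply: DeriveDef => //; rewrite derive1E.
by rewrite mulrC; have := @is_derive1_comp _ f (fun s => a * s + b) x _ _ _ _; apply.
Qed.

Lemma smooth1_affine f (a b : R) : smooth1 f -> smooth1 (fun s => f (a * s + b)).
Proof.
move=> sf n; elim: n f sf => [|n IH] f sf.
  move=> x; apply: (@continuous_comp _ _ _ (fun s => a * s + b) f); last first.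
    exact: smooth1_continuous.
  apply: continuousD; last exact: cst_continuous.
  by apply: continuousM; [exact: cst_continuous|exact: cvg_id].
have D x := @is_derive_affine f a b x (smooth1_derivable (a * x + b) sf).
split; first by move=> x; exact: ex_derive.
rewrite (_ : (derive1 _) = cst a \* (fun s => (derive1 f) (a * s + b))).
  by apply: nsmoothM; [exact: nsmooth_cst|exact/IH/smooth1_deriv].
by apply/funext => x; rewrite derive1E derive_val.
Qed.

End smooth_line.

Arguments nsmooth {R} n f.
Arguments smooth1 {R} f.

(** * The Lebesgue measure of the line and primitives *)

Section lebesgue_transfer.
Variable R : realType.
Let L := @lebesgue_measure R.
Let i : measurableTypeR R -> R := idfun.

Let mi : measurable_fun setT i.
Proof. by move=> _ A mA; rewrite setTI. Qed.

(** [leb1] is the push-forward of the Lebesgue measure along the identity between its two measurable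
    structures on the line, so the change of variables formula applies. *)
Lemma ge0_integral_leb1 (D : set R) (f : R -> \bar R) : measurable D ->
  measurable_fun D f -> {in D, forall x, (0 <= f x)%E} ->
  (\int[leb1]_(x in D) f x = \int[L]_(x in D) f x)%E.
Proof.
move=> mD mf f0; have := ge0_integral_pushforward mi L mD mf f0.
rewrite /= => <-; apply: eq_measure_integral => A mA AD; exact: erefl.
Qed.

Lemma integral_leb1 (D : set R) (f : R -> \bar R) : measurable D ->
  measurable_fun D f ->
  (\int[leb1]_(x in D) f x = \int[L]_(x in D) f x)%E.
Proof.
move=> mD mf; rewrite integralE [RHS]integralE.
congr (_ - _)%E; apply: ge0_integral_leb1 => //.
  exact: measurable_funepos.
exact: measurable_funeneg.
Qed.

Lemma integrable_leb1 (D : set R) (f : R -> \bar R) : measurable D ->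
  L.-integrable D f <-> leb1.-integrable D f.
Proof.
move=> mD; split => /integrableP[mf fi]; apply/integrableP; split => //.
  rewrite ge0_integral_leb1 //; exact: measurableT_comp.
by rewrite -ge0_integral_leb1 //; exact: measurableT_comp.
Qed.

Lemma Rintegral_leb1 (D : set R) (f : R -> R) : measurable D ->
  measurable_fun D f -> \int[leb1]_(x in D) f x = \int[L]_(x in D) f x.
Proof.
move=> mD mf; rewrite /Rintegral integral_leb1 //.
exact/measurable_EFinP.
Qed.

End lebesgue_transfer.

Section primitive.
Variable R : realType.
Let L := @lebesgue_measure R.
Implicit Types (f : R -> R).

Lemma continuous_supp_integrable f (c d : R) : continuous f ->
  (forall s, ~ (c < s < d) -> f s = 0) -> leb1.-integrable setT (EFin \o f).
Proof.
move=> cf f0; apply/integrable_leb1 => //.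
have -> : EFin \o f = (EFin \o f) \_ `[c, d].
  apply/funext => s; rewrite patchE; case: ifPn => //.
  rewrite notin_setE/= in_itv/= => ncd; congr EFin; apply: f0.
  by move=> /andP[cs sd]; apply: ncd; rewrite !ltW.
rewrite -integrable_mkcond //.
apply: continuous_compact_integrable; first exact: segment_compact.
exact: continuous_subspaceT.
Qed.

(** The last two clauses say that the primitive is zero left of the support and constant right of
    it. If the total integral is zero, the primitive is again a test function, which is how
    [kf_orth] uses it. *)
Lemma primitive_supp f (c d : R) : c <= d -> continuous f ->
    (forall s, ~ (c < s < d) -> f s = 0) ->
  let F s := \int[leb1]_(t in `]-oo, s]) f t in
  [/\ forall x : R, is_derive x (1 : R) F (f x),
      forall s, s <= c -> F s = 0
    & forall s, d <= s -> F s = \int[leb1]_t f t].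
Proof.
move=> cd cf f0 F; have fi := continuous_supp_integrable c d cf f0.
split.
- move=> x.
  have mf : measurable_fun setT f by have /integrableP[/measurable_EFinP] := fi.
  have FE : F = fun s => \int[L]_(t in `]-oo, s]) f t.
    by apply/funext => s; apply: Rintegral_leb1 => //; exact: measurable_funTS.
  have [] := @continuous_FTC1 R f -oo%O x (x + 1) _ _ _ (cf x).
  + by rewrite ltrDl.
  + apply: (@integrableS _ _ _ L setT) => //.
    exact/integrable_leb1.
  + by rewrite ltNyr.
  + by move=> dF F'; rewrite FE; apply: DeriveDef => //; rewrite -derive1E.
- move=> s sc; rewrite /F (@eq_Rintegral _ _ _ leb1 _ (cst 0)).
    by rewrite Rintegral_cst // mul0r.
  move=> t; rewrite inE/= in_itv/= => ts.
  by apply: f0 => /andP[ct _]; move: (lt_le_trans ct ts); rewrite ltNge sc.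
- move=> s ds; rewrite /F Rintegral_mkcond; congr Rintegral.
  apply/funext => t; rewrite patchE; case: ifPn => //.
  rewrite notin_setE/= in_itv/= => /negP; rewrite -ltNge => st.
  by apply/esym/f0 => /andP[_ td]; move: (lt_trans st td); rewrite ltNge ds.
Qed.

End primitive.

(** * Smooth step and bump functions on the line *)

Section flat_function.
Variable R : realType.
Implicit Types (k n : nat) (x y : R).

(* The derivative of [x^-k exp(-1/x)] is [x^-(k+2) exp(-1/x) - k x^-(k+1) exp(-1/x)]. *)
Definition flatf k x : R := if 0 < x then (x^-1) ^+ k * expR (- x^-1) else 0.

Lemma flatf_ge0 k x : 0 <= flatf k x.
Proof.
rewrite /flatf; case: ifPn => // x0.
by rewrite mulr_ge0 ?expR_ge0 ?exprn_ge0 ?invr_ge0 ?ltW.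
Qed.

(** With [y = 1 / x], the exponential series gives [y ^ (k+1) <= (k+1)! exp y]. The factor [x] on
    the right makes the difference quotient at the origin, which is [flatf k.+1], tend to zero. *)
Lemma flatf_le k x : 0 <= x -> flatf k x <= k.+1`!%:R * x.
Proof.
rewrite le_eqVlt => /predU1P[<-|x0]; first by rewrite /flatf ltxx mulr0.
rewrite /flatf x0 expRN; set y := x^-1.
have y0 : 0 < y by rewrite invr_gt0.
rewrite ler_pdivrMr ?expR_gt0 // -[x]invrK -/y.
have := expR_ge1Dxn k (ltW y0); have := expR_gt0 y.
set e := expR y => e0 h.
have f0 : 0 < k.+1`!%:R :> R by rewrite ltr0n fact_gt0.
have : y ^+ k.+1 <= k.+1`!%:R * e.
  by rewrite mulrC -ler_pdivrMr //; apply: le_trans h; rewrite lerDr.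
by rewrite exprS mulrAC ler_pdivlMr // mulrC.
Qed.

Lemma is_derive_flatf k x :
  is_derive x (1 : R) (flatf k) (flatf k.+2 x - k%:R * flatf k.+1 x).
Proof.
have [x0|x0|<-] := ltgtP 0 x.
- have e : \forall y \near x, y^-1 ^+ k * expR (- y^-1) = flatf k y.
    near=> y; rewrite /flatf ifT //; near: y; exact: lt_nbhsr.
  apply: (near_eq_is_derive e).
  have xn0 : x != 0 by rewrite gt_eqF.
  have dV : is_derive x (1 : R) (fun y => y^-1) (- x ^- 2 *: 1).
    exact: (@is_deriveV _ id).
  have dX := is_deriveX k dV.
  have dE : is_derive x (1 : R) (fun y => expR (- y^-1)) (expR (- x^-1) *: - (- x ^- 2 *: 1)).
    apply: is_derive1_comp.
  have -> : (fun y : R => y^-1 ^+ k * expR (- y^-1)) =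
      (fun y => y^-1) ^+ k * (fun y => expR (- y^-1)).
    by apply/funext => y; rewrite !fctE.
  have := is_deriveM dX dE => D; apply: is_derive_eq.
  rewrite /flatf x0 /= !fctE /GRing.scale /= !mulr1.
  rewrite -exprVn; set e' := expR _; case: k {e dX D} => [|k] /=.
    by rewrite !expr0; ring.
  by rewrite !exprS; ring.
- have e : \forall y \near x, 0 = flatf k y.
    near=> y; rewrite /flatf ifF //; apply/negbTE; rewrite -leNgt ltW //.
    by near: y; exact: lt_nbhsl.
  apply: (near_eq_is_derive e); rewrite /flatf ltNge (ltW x0) /= mulr0 subr0.
  exact: is_derive_cst.
- have c0 : h^-1 *: (flatf k (h *: 1 + 0) - flatf k 0) @[h --> 0^'] --> (0 : R).
    apply/cvgrPdist_lep; near=> e; near=> h; rewrite sub0r normrN.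
    rewrite addr0 [h *: 1]mulr1 {2}/flatf ltxx subr0 /GRing.scale /=.
    have h0 : h != 0 by near: h; exact: nbhs_dnbhs_neq.
    have [hp|hn] := ltP 0 h; last by rewrite /flatf ltNge hn mulr0 normr0.
    have -> : h^-1 * flatf k h = flatf k.+1 h by rewrite /flatf hp exprS mulrA.
    rewrite ger0_norm ?flatf_ge0 //; have fl := @flatf_le k.+1 h (ltW hp).
    apply: (le_trans fl).
    rewrite mulrC -ler_pdivlMr ?ltr0n ?fact_gt0 // -(ger0_norm (ltW hp)).
    near: h; apply: dnbhs0_le; rewrite divr_gt0 // ltr0n fact_gt0 //.
  rewrite {2 3}/flatf ltxx mulr0 subr0; apply: DeriveDef.
    by apply/cvg_ex; exists 0.
  exact: cvg_lim c0.
Unshelve. all: by end_near.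
Qed.

Lemma nsmooth_flatf n k : nsmooth n (flatf k).
Proof.
elim: n k => [|n IH] k.
  move=> x; apply: differentiable_continuous; apply/derivable1_diffP.
  by have := is_derive_flatf k x => ?; exact: ex_derive.
split; first by move=> x; have := is_derive_flatf k x => ?; exact: ex_derive.
rewrite (_ : derive1 _ = flatf k.+2 \+ (cst (- k%:R) \* flatf k.+1)).
  by apply: nsmoothD => //; apply: nsmoothM => //; exact: nsmooth_cst.
apply/funext => x; have := is_derive_flatf k x => ?.
by rewrite derive1E derive_val /= mulNr.
Qed.

End flat_function.

Arguments flatf {R} k x.

Section bump.
Variable R : realType.
Implicit Types (f : R -> R) (s a b w : R).

Definition bumpf s : R := flatf 0 s * flatf 0 (1 - s).

Lemma smooth1_bumpf : smooth1 bumpf.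
Proof.
apply: smooth1M; first by move=> n; exact: nsmooth_flatf.
have := @smooth1_affine R (flatf 0) (-1) 1 (fun n => @nsmooth_flatf _ n 0).
by congr smooth1; apply/funext => s; rewrite mulN1r addrC.
Qed.

Lemma bumpf_ge0 s : 0 <= bumpf s.
Proof. by rewrite mulr_ge0 ?flatf_ge0. Qed.

Lemma bumpf_gt0 s : 0 < s < 1 -> 0 < bumpf s.
Proof.
move=> /andP[s0 s1]; rewrite /bumpf /flatf s0 subr_gt0 s1 !expr0 !mul1r.
by rewrite mulr_gt0 ?expR_gt0.
Qed.

Lemma bumpf_out s : ~ (0 < s < 1) -> bumpf s = 0.
Proof.
rewrite /bumpf /flatf subr_gt0.
by case: (0 < s); case: (s < 1) => //=; rewrite ?mul0r ?mulr0.
Qed.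

Let F s : R := \int[leb1]_(t in `]-oo, s]) bumpf t.

Let FP := @primitive_supp _ bumpf 0 1 ler01
  (smooth1_continuous smooth1_bumpf) bumpf_out.

Let F_derivable s : derivable F s 1.
Proof. by have [d _ _] := FP; exact: ex_derive. Qed.

Let F'E s : 'D_1 F s = bumpf s.
Proof. by have [d _ _] := FP; exact: derive_val. Qed.

Let F_nd s t : s <= t -> F s <= F t.
Proof.
move=> st; apply: (@ger0_derive1_ndecr _ F s t) => //.
- by move=> x _; rewrite derive1E F'E bumpf_ge0.
- apply: derivable_within_continuous => x _; exact: F_derivable.
Qed.

Let F1_gt0 : 0 < F 1.
Proof.
have [||x x01] := @MVT _ F bumpf 0 1 ltr01.
- by move=> x _; have [d _ _] := FP; exact: d.
- by apply: derivable_within_continuous => x _; exact: F_derivable.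
have [_ F0 _] := FP; rewrite [F 0](F0 0) // !subr0 mulr1 => ->.
by apply: bumpf_gt0; move: x01; rewrite in_itv.
Qed.

Definition stepf s : R := F s / F 1.

Lemma smooth1_stepf : smooth1 stepf.
Proof.
rewrite (_ : stepf = cst (F 1)^-1 \* F); last first.
  by apply/funext => s; rewrite /stepf mulrC.
apply: smooth1M; first exact: smooth1_cst.
by have [d _ _] := FP; apply: smooth1_primitive d smooth1_bumpf.
Qed.

Lemma stepf_le0 s : s <= 0 -> stepf s = 0.
Proof. by have [_ F0 _] := FP => s0; rewrite /stepf [F s]F0 // mul0r. Qed.

Lemma stepf_ge1 s : 1 <= s -> stepf s = 1.
Proof.
have [_ _ F1] := FP => s0; rewrite /stepf.
by rewrite (_ : F s = F 1) ?divff ?gt_eqF // [RHS]F1 // [LHS]F1.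
Qed.

Lemma stepf_nd s t : s <= t -> stepf s <= stepf t.
Proof. by move=> st; rewrite /stepf ler_pM2r ?invr_gt0 //; exact: F_nd. Qed.

Lemma stepf_ge0 s : 0 <= stepf s.
Proof.
have [s0|s0] := leP s 0; first by rewrite stepf_le0.
by rewrite -(@stepf_le0 0) // stepf_nd // ltW.
Qed.

Lemma stepf_le1 s : stepf s <= 1.
Proof.
have [s0|s0] := leP s 1; last by rewrite stepf_ge1 // ltW.
by rewrite -(@stepf_ge1 1) // stepf_nd.
Qed.

Lemma smooth1_supp_bounded f a b : smooth1 f ->
  (forall s, ~ (a < s < b) -> f s = 0) -> exists2 C, 0 <= C & forall s, `|f s| <= C.
Proof.
move=> sf f0.
have [ab|ba] := leP a b; last first.
  exists 0 => // s; rewrite f0 ?normr0 // => /andP[as_ sb].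
  by move: (lt_trans as_ sb); rewrite ltNge ltW.
have cf : {within `[a, b], continuous (fun s => `|f s|)}.
  apply: continuous_subspaceT => s.
  by apply: continuous_comp; [exact: smooth1_continuous|exact: norm_continuous].
have [c cab fc] := EVT_max ab cf.
exists `|f c| => // s; have [sab|] := pselect (s \in `[a, b]); first exact: fc.
move=> sab; rewrite f0 ?normr0 // => /andP[as_ sb]; apply: sab.
by rewrite in_itv /= !ltW.
Qed.

Lemma stepf_deriv_bound : exists2 C, 0 <= C &
  forall s, `|derive1 stepf s| <= C /\ `|derive1 (derive1 stepf) s| <= C.
Proof.
have s1 := smooth1_deriv smooth1_stepf; have s2 := smooth1_deriv s1.
have s1E : derive1 stepf = cst (F 1)^-1 \* bumpf.
  apply/funext => s; rewrite derive1E (_ : stepf = (F 1)^-1 *: F).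
    by rewrite deriveZ ?F'E.
  by apply/funext => t; rewrite /stepf mulrC.
have z1 s : ~ (0 < s < 1) -> derive1 stepf s = 0.
  by move=> s01; rewrite s1E /= bumpf_out // mulr0.
(* The interval is enlarged to []-1, 2[] so that every point outside it has a neighbourhood on which
   the first derivative vanishes. *)
have z2 s : ~ (-1 < s < 2) -> derive1 (derive1 stepf) s = 0.
  move=> s12; rewrite derive1E.
  have e : \forall y \near s, 0 = derive1 stepf y.
    near=> y; rewrite z1 // => /andP[y0 y1]; apply: s12.
    have sy : `|s - y| < 1 by near: y; exact: (nbhsx_ballx s 1 ltr01).
    by move: sy; rewrite ltr_norml => /andP[]; lra.
  by rewrite -(near_eq_derive _ e) derive_cst.
have [C C0 hC] := smooth1_supp_bounded _ _ s1 z1.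
have [D D0 hD] := smooth1_supp_bounded _ _ s2 z2.
exists (C + D); first exact: addr_ge0.
by move=> s; split; [apply: le_trans (hC s) _; rewrite lerDl|
  apply: le_trans (hD s) _; rewrite lerDr].
Unshelve. all: by end_near.
Qed.

(* Rises from 0 to 1 on [[a, a + w]] and falls back on [[b - w, b]]. *)
Definition plateau a b w s : R :=
  stepf (w^-1 * s + - (w^-1 * a)) - stepf (w^-1 * s + (1 - w^-1 * b)).

Lemma smooth1_plateau a b w : smooth1 (plateau a b w).
Proof.
rewrite (_ : plateau a b w = (fun s => stepf (w^-1 * s + - (w^-1 * a))) \+
    (cst (-1) \* (fun s => stepf (w^-1 * s + (1 - w^-1 * b))))); last first.
  by apply/funext => s; rewrite /plateau /= mulN1r.
apply: smooth1D; first exact/smooth1_affine/smooth1_stepf.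
apply: smooth1M; first exact: smooth1_cst.
exact/smooth1_affine/smooth1_stepf.
Qed.

Section plateau_properties.
Variables (a b w : R).
Hypotheses (w0 : 0 < w) (abw : a + w <= b).

Let le0E u s : (w^-1 * s + - (w^-1 * u) <= 0) = (s <= u).
Proof. by rewrite -mulrBr pmulr_rle0 ?invr_gt0 // subr_le0. Qed.

Let ge1E u s : (1 <= w^-1 * s + - (w^-1 * u)) = (u + w <= s).
Proof. by rewrite -mulrBr ler_pdivlMl // mulr1 lerBrDl. Qed.

Let le0E' u s : (w^-1 * s + (1 - w^-1 * u) <= 0) = (s <= u - w).
Proof.
have wn0 : w != 0 by rewrite gt_eqF.
have -> : w^-1 * s + (1 - w^-1 * u) = w^-1 * (s - (u - w)) by field.
by rewrite pmulr_rle0 ?invr_gt0 // subr_le0.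
Qed.

Let ge1E' u s : (1 <= w^-1 * s + (1 - w^-1 * u)) = (u <= s).
Proof. by rewrite addrCA lerDl -mulrBr pmulr_rge0 ?invr_gt0 // subr_ge0. Qed.

Lemma plateau_out s : ~ (a < s < b) -> plateau a b w s = 0.
Proof.
move/negP; rewrite negb_and -!leNgt /plateau => /orP[sa|bs].
  rewrite !stepf_le0 ?subrr // ?le0E ?le0E' //.
  by rewrite (le_trans sa) // lerBrDr.
by rewrite !stepf_ge1 ?subrr // ?ge1E ?ge1E' // (le_trans abw).
Qed.

Lemma plateau_in s : a + w <= s <= b - w -> plateau a b w s = 1.
Proof.
move=> /andP[aw wb]; rewrite /plateau stepf_ge1 ?ge1E //.
by rewrite stepf_le0 ?subr0 // le0E'.
Qed.

Lemma plateau_le1 s : plateau a b w s <= 1.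
Proof. by rewrite lerBlDr (le_trans (stepf_le1 _)) // lerDl stepf_ge0. Qed.

Lemma plateau_ge0 s : 0 <= plateau a b w s.
Proof.
rewrite subr_ge0 stepf_nd // lerD2l.
have wn0 : w != 0 by rewrite gt_eqF.
have -> : 1 - w^-1 * b = w^-1 * (w - b) by field.
rewrite -[X in _ <= X]mulrN ler_pM2l ?invr_gt0 //; move: abw; lra.
Qed.

End plateau_properties.

(** The plateau is a difference of two rescaled copies of the fixed profile [stepf], so one constant
    serves for all intervals and widths; this is what makes the final constant universal. *)
Lemma plateau_deriv_bound : exists2 C, 1 <= C & forall a b w, 0 < w ->
  forall s, `|derive1 (plateau a b w) s| <= C / w /\
            `|derive1 (derive1 (plateau a b w)) s| <= C / w ^+ 2.
Proof.
have [C C0 hC] := stepf_deriv_bound; exists (2 * C + 1); first by lra.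
have B (x y : R) : `|x| <= C -> `|y| <= C -> `|x - y| <= 2 * C + 1.
  by move=> xC yC; rewrite (le_trans (ler_normB _ _)) //; lra.
move=> a b w w0 s.
have w10 : 0 < w^-1 by rewrite invr_gt0.
have I f (c : R) x : smooth1 f -> is_derive x (1 : R) (fun s => f (w^-1 * s + c))
    (w^-1 * derive1 f (w^-1 * x + c)).
  by move=> sf; apply: is_derive_affine; exact: smooth1_derivable.
have E1 : derive1 (plateau a b w) = (fun s =>
    w^-1 * (derive1 stepf (w^-1 * s + - (w^-1 * a)) - derive1 stepf (w^-1 * s + (1 - w^-1 * b)))).
  apply/funext => x; rewrite mulrBr derive1E.
  have D := is_deriveB (I _ (- (w^-1 * a)) x smooth1_stepf)
                       (I _ (1 - w^-1 * b) x smooth1_stepf).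
  exact: (@derive_val _ _ _ _ _ _ _ D).
have E2 : derive1 (derive1 (plateau a b w)) s = w^-1 * (w^-1 *
    (derive1 (derive1 stepf) (w^-1 * s + - (w^-1 * a)) -
     derive1 (derive1 stepf) (w^-1 * s + (1 - w^-1 * b)))).
  rewrite E1 [X in _ = _ * X]mulrBr derive1E.
  have D := is_deriveB (I _ (- (w^-1 * a)) s (smooth1_deriv smooth1_stepf))
                       (I _ (1 - w^-1 * b) s (smooth1_deriv smooth1_stepf)).
  have D' := is_deriveZ w^-1 D.
  exact: (@derive_val _ _ _ _ _ _ _ D').
split.
  rewrite E1 normrM (gtr0_norm w10) mulrC ler_pM2r //.
  by apply: B; [exact: (hC _).1|exact: (hC _).1].
rewrite E2 mulrA normrM -expr2 -exprVn (ger0_norm (exprn_ge0 2 (ltW w10))).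
rewrite mulrC ler_pM2r ?exprn_gt0 //.
by apply: B; [exact: (hC _).2|exact: (hC _).2].
Qed.

End bump.

Arguments bumpf {R} s.
Arguments stepf {R} s.
Arguments plateau {R} a b w s.

(** * Tensor products of one-variable functions as test functions *)

Section tensor.
Variable R : realType.
Implicit Types (f g : R -> R) (z h : spacetime R).

Lemma is_derive_line (phi : spacetime R -> R) z h (d : R) :
  is_derive (0 : R) (1 : R) (fun s : R => phi (s *: h + z)) d ->
  is_derive z h phi d.
Proof.
have E : (fun s : R => s^-1 *: ((phi \o shift z) (s *: h) - phi z)) =
    (fun s => s^-1 *: (((fun s : R => phi (s *: h + z)) \o shift 0) (s *: 1) -
      (fun s : R => phi (s *: h + z)) 0)).
  apply/funext => s /=; rewrite addr0 scale0r add0r.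
  by rewrite [s *: 1 in RHS]mulr1.
case=> D V; split; first by rewrite /derivable E.
by rewrite -V /derive E.
Qed.

Definition tens f1 f2 f3 f4 : spacetime R -> R :=
  fun z => f1 z.1.1.1 * f2 z.1.1.2 * f3 z.1.2 * f4 z.2.

Lemma is_derive_tens f1 f2 f3 f4 z h :
  smooth1 f1 -> smooth1 f2 -> smooth1 f3 -> smooth1 f4 ->
  is_derive z h (tens f1 f2 f3 f4)
    (h.1.1.1 * tens (derive1 f1) f2 f3 f4 z + h.1.1.2 * tens f1 (derive1 f2) f3 f4 z +
     h.1.2 * tens f1 f2 (derive1 f3) f4 z + h.2 * tens f1 f2 f3 (derive1 f4) z).
Proof.
move=> s1 s2 s3 s4; apply: is_derive_line.
case: z => [[[z1 z2] z3] z4]; case: h => [[[h1 h2] h3] h4] /=.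
have L f (a b : R) : smooth1 f -> is_derive (0 : R) (1 : R) (fun s => f (s * a + b)) (a * derive1 f b).
  move=> sf; have := @is_derive_affine _ f a b 0 (smooth1_derivable _ sf).
  by rewrite mulr0 add0r; under eq_fun do rewrite mulrC.
have := is_deriveM (is_deriveM (is_deriveM (L f1 h1 z1 s1) (L f2 h2 z2 s2))
  (L f3 h3 z3 s3)) (L f4 h4 z4 s4).
rewrite /tens /= !fctE !mul0r !add0r /GRing.scale /= => D.
by apply: (is_derive_eq D); ring.
Qed.

Lemma continuous_tens f1 f2 f3 f4 :
  smooth1 f1 -> smooth1 f2 -> smooth1 f3 -> smooth1 f4 ->
  continuous (tens f1 f2 f3 f4).
Proof.
move=> s1 s2 s3 s4 z.
have c4 : {for z, continuous (fun z : spacetime R => f4 z.2)}.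
  by apply: (@continuous_comp _ _ _ snd f4); [exact: cvg_snd|exact: smooth1_continuous].
have c3 : {for z, continuous (fun z : spacetime R => f3 z.1.2)}.
  apply: (@continuous_comp _ _ _ (fun z : spacetime R => z.1.2) f3); last exact: smooth1_continuous.
  by apply: (@continuous_comp _ _ _ fst snd); [exact: cvg_fst|exact: cvg_snd].
have c11 : {for z, continuous (fun z : spacetime R => z.1.1)}.
  by apply: (@continuous_comp _ _ _ fst fst); exact: cvg_fst.
have c1 : {for z, continuous (fun z : spacetime R => f1 z.1.1.1)}.
  apply: (@continuous_comp _ _ _ (fun z : spacetime R => z.1.1.1) f1); last exact: smooth1_continuous.
  by apply: (@continuous_comp _ _ _ (fun z : spacetime R => z.1.1) fst); [exact: c11|exact: cvg_fst].
have c2 : {for z, continuous (fun z : spacetime R => f2 z.1.1.2)}.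
  apply: (@continuous_comp _ _ _ (fun z : spacetime R => z.1.1.2) f2); last exact: smooth1_continuous.
  by apply: (@continuous_comp _ _ _ (fun z : spacetime R => z.1.1) snd); [exact: c11|exact: cvg_snd].
exact: (continuousM (continuousM (continuousM c1 c2) c3) c4).
Qed.

(* Sums of products of smooth functions of one coordinate are closed under all
   directional derivatives. *)
Inductive tensors : (spacetime R -> R) -> Prop :=
| tensors_tens f1 f2 f3 f4 : smooth1 f1 -> smooth1 f2 -> smooth1 f3 -> smooth1 f4 ->
    tensors (tens f1 f2 f3 f4)
| tensors_lin (a b : R) phi psi : tensors phi -> tensors psi ->
    tensors (fun z => a * phi z + b * psi z).

Lemma tensors_continuous phi : tensors phi -> continuous phi.
Proof.
elim => [f1 f2 f3 f4|a b p q _ cp _ cq z]; first exact: continuous_tens.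
have k (c : R) : {for z, continuous (cst c : spacetime R -> R)} by exact: cvg_cst.
exact: (continuousD (continuousM (k a) (cp z)) (continuousM (k b) (cq z))).
Qed.

Lemma tensors_derive phi h : tensors phi ->
  (forall z, derivable phi z h) /\ tensors ('D_h phi).
Proof.
elim => [f1 f2 f3 f4 s1 s2 s3 s4|a b p q tp [dp tp'] tq [dq tq']].
  have D z := is_derive_tens z h s1 s2 s3 s4.
  split; first by move=> z; exact: ex_derive.
  have -> : 'D_h (tens f1 f2 f3 f4) = (fun z => 1 *
      (h.1.1.1 * tens (derive1 f1) f2 f3 f4 z + h.1.1.2 * tens f1 (derive1 f2) f3 f4 z) +
      1 * (h.1.2 * tens f1 f2 (derive1 f3) f4 z + h.2 * tens f1 f2 f3 (derive1 f4) z)).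
    apply/funext => z; rewrite (@derive_val _ _ _ _ _ _ _ (D z)) !mul1r.
    by rewrite !addrA.
  by do 2 apply: tensors_lin; apply: tensors_tens => //; exact: smooth1_deriv.
have D z : is_derive z h (fun z => a * p z + b * q z) (a * 'D_h p z + b * 'D_h q z).
  have Dp : is_derive z h p ('D_h p z) by apply: DeriveDef.
  have Dq : is_derive z h q ('D_h q z) by apply: DeriveDef.
  exact: (is_deriveD (is_deriveZ a Dp) (is_deriveZ b Dq)).
split; first by move=> z; exact: ex_derive.
have -> : 'D_h (fun z => a * p z + b * q z) = (fun z => a * 'D_h p z + b * 'D_h q z).
  by apply/funext => z; rewrite (@derive_val _ _ _ _ _ _ _ (D z)).
exact: tensors_lin.
Qed.

Lemma tensors_smooth phi : tensors phi -> smooth phi.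
Proof.
move=> tp s; have : tensors (foldr (fun (h : spacetime R) (f : spacetime R -> R) => 'D_h f) phi s).
  by elim: s => [//|h s IH] /=; exact: (tensors_derive h IH).2.
move=> tg; split; first exact: tensors_continuous.
by move=> h z; exact: (tensors_derive h tg).1.
Qed.

Lemma test_fun_tens (D : set (spacetime R)) f1 f2 f3 f4 (a1 b1 a2 b2 a3 b3 a4 b4 : R) :
    smooth1 f1 -> smooth1 f2 -> smooth1 f3 -> smooth1 f4 ->
    (forall s, ~ (a1 < s < b1) -> f1 s = 0) ->
    (forall s, ~ (a2 < s < b2) -> f2 s = 0) ->
    (forall s, ~ (a3 < s < b3) -> f3 s = 0) ->
    (forall s, ~ (a4 < s < b4) -> f4 s = 0) ->
    (forall z, a1 <= z.1.1.1 <= b1 -> a2 <= z.1.1.2 <= b2 -> a3 <= z.1.2 <= b3 ->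
      a4 <= z.2 <= b4 -> D z) ->
  test_fun D (tens f1 f2 f3 f4).
Proof.
move=> s1 s2 s3 s4 z1 z2 z3 z4 boxD; split; first exact/tensors_smooth/tensors_tens.
exists (`[a1, b1] `*` `[a2, b2] `*` `[a3, b3] `*` `[a4, b4]); split.
- by do 3 (apply: compact_setX; last exact: segment_compact); exact: segment_compact.
- move=> z /= [[[h1 h2] h3] h4]; move: h1 h2 h3 h4; rewrite !in_itv /=.
  exact: boxD.
- move=> z nz; rewrite /tens.
  have [h1|/z1 ->] := pselect (a1 < z.1.1.1 < b1); last by rewrite !mul0r.
  have [h2|/z2 ->] := pselect (a2 < z.1.1.2 < b2); last by rewrite mulr0 !mul0r.
  have [h3|/z3 ->] := pselect (a3 < z.1.2 < b3); last by rewrite mulr0 !mul0r.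
  have [h4|/z4 ->] := pselect (a4 < z.2 < b4); last by rewrite mulr0.
  exfalso; apply: nz => /=; rewrite !in_itv /=.
  move: h1 h2 h3 h4 => /andP[? ?] /andP[? ?] /andP[? ?] /andP[? ?].
  by do ! split; apply/andP; split; exact: ltW.
Qed.

Lemma derive_dirx_tens f1 f2 f3 f4 (i : 'I_3) :
  smooth1 f1 -> smooth1 f2 -> smooth1 f3 -> smooth1 f4 ->
  'D_(dirx i) (tens f1 f2 f3 f4) =
  tens (if i == 0%N :> nat then derive1 f1 else f1) (if i == 1%N :> nat then derive1 f2 else f2)
       (if i == 2%N :> nat then derive1 f3 else f3) f4.
Proof.
move=> s1 s2 s3 s4; apply/funext => z.
rewrite (@derive_val _ _ _ _ _ _ _ (is_derive_tens z (dirx i) s1 s2 s3 s4)).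
by case: i => [[|[|[|//]]]] ? /=; rewrite ?(mul0r, mul1r, add0r, addr0).
Qed.

Lemma derive_dirt_tens f1 f2 f3 f4 :
  smooth1 f1 -> smooth1 f2 -> smooth1 f3 -> smooth1 f4 ->
  'D_dirt (tens f1 f2 f3 f4) = tens f1 f2 f3 (derive1 f4).
Proof.
move=> s1 s2 s3 s4; apply/funext => z.
rewrite (@derive_val _ _ _ _ _ _ _ (is_derive_tens z dirt s1 s2 s3 s4)).
by rewrite /= ?(mul0r, mul1r, add0r, addr0).
Qed.

Lemma laplacian_tens f1 f2 f3 f4 z :
  smooth1 f1 -> smooth1 f2 -> smooth1 f3 -> smooth1 f4 ->
  laplacian (tens f1 f2 f3 f4) z =
  tens (derive1 (derive1 f1)) f2 f3 f4 z + tens f1 (derive1 (derive1 f2)) f3 f4 z +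
  tens f1 f2 (derive1 (derive1 f3)) f4 z.
Proof.
move=> s1 s2 s3 s4; have s1' := smooth1_deriv s1; have s2' := smooth1_deriv s2.
have s3' := smooth1_deriv s3.
have E (i : 'I_3) : 'D_(dirx i) ('D_(dirx i) (tens f1 f2 f3 f4)) z =
    nth 0 [:: tens (derive1 (derive1 f1)) f2 f3 f4 z; tens f1 (derive1 (derive1 f2)) f3 f4 z;
              tens f1 f2 (derive1 (derive1 f3)) f4 z] i.
  rewrite (derive_dirx_tens i s1 s2 s3 s4).
  case: i => [[|[|[|//]]]] i3 /=.
  - exact: (congr1 (fun g : spacetime R -> R => g z) (derive_dirx_tens (Ordinal i3) s1' s2 s3 s4)).
  - exact: (congr1 (fun g : spacetime R -> R => g z) (derive_dirx_tens (Ordinal i3) s1 s2' s3 s4)).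
  - exact: (congr1 (fun g : spacetime R -> R => g z) (derive_dirx_tens (Ordinal i3) s1 s2 s3' s4)).
rewrite /laplacian (eq_bigr _ (fun i _ => E i)) {E}.
by rewrite !big_ord_recl big_ord0 addr0 /= addrA.
Qed.

End tensor.

Arguments tens {R} f1 f2 f3 f4 z.

(** * Countable separating families *)

Section bounded_multiplier.
Context d (T : measurableType d) (R : realType).
Variable mu : {measure set T -> \bar R}.
Implicit Types (f h : T -> R).

Lemma integrable_bddM (D : set T) f h (C : R) : measurable D ->
  mu.-integrable D (EFin \o f) -> measurable_fun D h ->
  (forall x, D x -> `|h x| <= C) -> mu.-integrable D (EFin \o (f \* h)).
Proof.
move=> mD fi mh hC; have mf : measurable_fun D f by case/integrableP : fi => /measurable_EFinP.
apply: (le_integrable mD _ _ (integrableZl mD C fi)).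
  exact/measurable_EFinP/measurable_funM.
move=> x Dx /=; rewrite lee_fin normrM mulrC normrM ler_wpM2r //.
by rewrite (le_trans (hC x Dx)) // ler_norm.
Qed.

Lemma Rintegral_cvg_bdd (f : T -> R) (u : nat -> T -> R) (v : T -> R) (C : R) :
  mu.-integrable setT (EFin \o f) ->
  (forall n, measurable_fun setT (u n)) -> measurable_fun setT v ->
  (forall n x, `|u n x| <= C) ->
  (forall x, u n x @[n --> \oo] --> v x) ->
  \int[mu]_x (f x * u n x) @[n --> \oo] --> \int[mu]_x (f x * v x).
Proof.
move=> fi mu_ mv uC uv.
have mf : measurable_fun setT f by case/integrableP : fi => /measurable_EFinP.
have [|||||I _ cv] := @dominated_convergence _ _ _ mu setT measurableT
  (fun n => EFin \o (f \* u n)) (EFin \o (f \* v)) (fun x => C%:E * `|(f x)%:E|)%E.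
- by move=> n; exact/measurable_EFinP/measurable_funM.
- exact/measurable_EFinP/measurable_funM.
- apply/aeW => x _ /=; apply: cvg_EFin; first exact: nearW.
  by apply: cvgMr; exact: uv.
- by apply: integrableZl => //; exact: integrable_abse.
- apply/aeW => x n _ /=; rewrite lee_fin normrM mulrC ler_wpM2r //.
- by apply: fine_cvg; rewrite /= fineK //; exact: integrable_fin_num.
Qed.

Lemma Rintegral_zero_lim (f : T -> R) (u : nat -> T -> R) (v : T -> R) (C : R) :
  mu.-integrable setT (EFin \o f) ->
  (forall n, measurable_fun setT (u n)) -> measurable_fun setT v ->
  (forall n x, `|u n x| <= C) ->
  (forall x, u n x @[n --> \oo] --> v x) ->
  (forall n, \int[mu]_x (f x * u n x) = 0) -> \int[mu]_x (f x * v x) = 0.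
Proof.
move=> fi mu_ mv uC uv u0; have := @Rintegral_cvg_bdd f u v C fi mu_ mv uC uv.
under eq_cvg do rewrite u0.
by move=> /(cvg_lim (@Rhausdorff R)) <-; exact: lim_cst.
Qed.

Lemma integrable_fine (D : set T) (F : T -> \bar R) : measurable D ->
  mu.-integrable D F -> mu.-integrable D (EFin \o (fine \o F)).
Proof.
move=> mD Fi; have mF := measurable_int mu Fi.
apply: (le_integrable mD _ _ Fi).
  by apply/measurable_EFinP; apply: measurableT_comp => //; exact: measurable_fine.
by move=> x Dx /=; case: (F x) => [r| |] //=; rewrite normr0 leey.
Qed.

Lemma ae_eq_Rintegral (D : set T) f h : measurable D -> measurable_fun D f ->
  measurable_fun D h -> {ae mu, forall x, D x -> f x = h x} ->
  \int[mu]_(x in D) f x = \int[mu]_(x in D) h x.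
Proof.
move=> mD mf mh fh; rewrite /Rintegral; congr fine.
apply: ae_eq_integral => //; try exact/measurable_EFinP.
by apply: filterS fh => x fh Dx; rewrite fh.
Qed.

End bounded_multiplier.

(** * Fubini's theorem for real-valued integrals *)

Section real_fubini.
Context d1 d2 (T1 : measurableType d1) (T2 : measurableType d2) (R : realType).
Variable m1 : {sigma_finite_measure set T1 -> \bar R}.
Variable m2 : {sigma_finite_measure set T2 -> \bar R}.
Variable f : T1 * T2 -> R.
Hypothesis fi : (m1 \x m2)%E.-integrable setT (EFin \o f).

Lemma ae_integrable_fst : {ae m1, forall x, m2.-integrable setT (EFin \o (fun y => f (x, y)))}.
Proof. exact: (ae_integrable1 fi). Qed.

Lemma ae_integrable_snd : {ae m2, forall y, m1.-integrable setT (EFin \o (fun x => f (x, y)))}.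
Proof. exact: (ae_integrable2 fi). Qed.

Lemma integrable_Rintegral_snd : m1.-integrable setT (EFin \o (fun x => \int[m2]_y f (x, y))).
Proof. exact/integrable_fine/(integrable_fubini_F fi). Qed.

Lemma integrable_Rintegral_fst : m2.-integrable setT (EFin \o (fun y => \int[m1]_x f (x, y))).
Proof.
apply: integrable_fine => //; apply/integrableP; split; first exact: measurable_fubini_G fi.
have mf : measurable_fun setT (EFin \o f) by case/integrableP : fi.
have mnf : measurable_fun setT (abse \o (EFin \o f)) by exact: measurableT_comp.
have [_] := integrableP _ _ _ fi; apply: le_lt_trans.
rewrite -[X in (_ <= X)%E]/(\int[_]_z (abse \o (EFin \o f)) z)%E fubini_tonelli2 //.
apply: ge0_le_integral => //.
- by apply: measurableT_comp => //; exact: measurable_fubini_G fi.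
- by apply: measurable_fun_fubini_tonelli_G; [exact: mnf|move=> z; exact: abse_ge0].
- move=> y _; apply: le_abse_integral => //.
  exact: (measurableT_comp mf (measurable_pair2 y)).
- by move=> z; exact: abse_ge0.
Qed.

Lemma Rintegral_prod1 : \int[(m1 \x m2)%E]_z f z = \int[m1]_x \int[m2]_y f (x, y).
Proof.
rewrite /Rintegral -(integral12_prod_meas1 fi); congr fine.
apply: ae_eq_integral => //.
- exact: measurable_fubini_F fi.
- by case/integrableP: integrable_Rintegral_snd.
- apply: filterS ae_integrable_fst => x xi _.
  by rewrite /= fineK //; exact: integrable_fin_num.
Qed.

Lemma Rintegral_prod2 : \int[(m1 \x m2)%E]_z f z = \int[m2]_y \int[m1]_x f (x, y).
Proof.
rewrite /Rintegral -(integral21_prod_meas1 fi); congr fine.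
apply: ae_eq_integral => //.
- exact: measurable_fubini_G fi.
- by case/integrableP: integrable_Rintegral_fst.
- apply: filterS ae_integrable_snd => x xi _.
  by rewrite /= fineK //; exact: integrable_fin_num.
Qed.

End real_fubini.
Arguments ae_integrable_fst {d1 d2 T1 T2 R m1 m2 f}.
Arguments ae_integrable_snd {d1 d2 T1 T2 R m1 m2 f}.
Arguments integrable_Rintegral_fst {d1 d2 T1 T2 R m1 m2 f}.
Arguments integrable_Rintegral_snd {d1 d2 T1 T2 R m1 m2 f}.
Arguments Rintegral_prod1 {d1 d2 T1 T2 R m1 m2 f}.
Arguments Rintegral_prod2 {d1 d2 T1 T2 R m1 m2 f}.

(** * The fundamental lemma of the calculus of variations *)

Section separation.
Variable R : realType.

(** The fundamental lemma of the calculus of variations as a property of a family of functions, so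
    that it can be transported from intervals to products. *)
Definition separates d (T : measurableType d)
    (m : {measure set T -> \bar R}) (B : set T) (Phi : set (T -> R)) :=
  forall h : T -> R, m.-integrable setT (EFin \o h) ->
    (forall phi, Phi phi -> \int[m]_x (h x * phi x) = 0) ->
    {ae m, forall x, B x -> h x = 0}.

(** The family on the second factor is a sequence because each [psi n] gives a null set of its own
    in the first factor, outside which the slice integral vanishes; the union of these sets has to
    be null. *)
Lemma separates_prod d1 d2 (T1 : measurableType d1) (T2 : measurableType d2)
    (m1 : {sigma_finite_measure set T1 -> \bar R})
    (m2 : {sigma_finite_measure set T2 -> \bar R})
    (B1 : set T1) (B2 : set T2) (Phi : set (T1 -> R)) (psi : nat -> T2 -> R) :
  measurable B1 -> measurable B2 ->
  (forall phi, Phi phi -> measurable_fun setT phi /\ exists C, forall x, `|phi x| <= C) ->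
  (forall n, measurable_fun setT (psi n) /\ exists C, forall x, `|psi n x| <= C) ->
  separates m1 B1 Phi -> separates m2 B2 (range psi) ->
  separates (m1 \x m2)%E (B1 `*` B2)
    [set w | exists phi n, Phi phi /\ w = fun z => phi z.1 * psi n z.2].
Proof.
move=> mB1 mB2 bPhi bpsi s1 s2 h hi h0.
have mh : measurable_fun setT h by case/integrableP : hi => /measurable_EFinP.
pose H n (y : T1) := \int[m2]_t (h (y, t) * psi n t).
have mpsi2 n : measurable_fun setT (fun z : T1 * T2 => psi n z.2).
  by apply: measurableT_comp; [exact: (bpsi n).1|exact: measurable_snd].
have hpsi n : (m1 \x m2)%E.-integrable setT (EFin \o (fun z => h z * psi n z.2)).
  have [_ [C hC]] := bpsi n.
  by apply: (@integrable_bddM _ _ _ _ _ h (fun z => psi n z.2) C).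
have Hi n : m1.-integrable setT (EFin \o H n).
  exact: (@integrable_Rintegral_snd _ _ _ _ _ _ _ (fun z => h z * psi n z.2) (hpsi n)).
have H0 n : {ae m1, forall y, B1 y -> H n y = 0}.
  apply: s1 => // phi Pphi; have [mphi [C phiC]] := bPhi _ Pphi.
  have mphi1 : measurable_fun setT (fun z : T1 * T2 => phi z.1).
    by apply: measurableT_comp => //; exact: measurable_fst.
  have hi2 : (m1 \x m2)%E.-integrable setT (EFin \o (fun z => h z * psi n z.2 * phi z.1)).
    exact: (@integrable_bddM _ _ _ _ _ _ (fun z : T1 * T2 => phi z.1) C _ (hpsi n)).
  transitivity (\int[(m1 \x m2)%E]_z (h z * psi n z.2 * phi z.1)).
    rewrite (Rintegral_prod1 hi2); apply: ae_eq_Rintegral => //.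
    - apply: measurable_funM => //.
      by case/integrableP : (Hi n) => /measurable_EFinP.
    - by case/integrableP : (integrable_Rintegral_snd hi2) => /measurable_EFinP.
    - apply: filterS (ae_integrable_fst (hpsi n)) => y yi _ /=.
      by rewrite RintegralZr.
  rewrite -(h0 (fun z => phi z.1 * psi n z.2)); last by exists phi, n.
  by apply: eq_Rintegral => z _; rewrite mulrAC mulrA.
have : {ae m1, forall y, forall n, B1 y -> H n y = 0} by exact/ae_foralln.
move=> H0'; have Hae := ae_integrable_fst hi.
have : {ae m1, forall y, B1 y -> {ae m2, forall t, B2 t -> h (y, t) = 0}}.
  apply: filterS2 H0' Hae => y Hy yi By; apply: s2 => // _ [n _ <-].
  exact: Hy.
(* Vanishing on almost every slice gives vanishing almost everywhere, by Tonelli's theorem for [|h|]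
   on the product set. *)
move=> aa; have : ae_eq (m1 \x m2)%E (B1 `*` B2) (EFin \o h) (cst 0%E).
  have mB : measurable (B1 `*` B2) by exact: measurableX.
  apply/ae_eq_integral_abs => //; first exact/measurable_EFinP/measurable_funTS.
  rewrite integral_mkcond fubini_tonelli1 //; last 2 first.
  - apply/(measurable_restrictT _ mB); apply: measurableT_comp => //.
    exact/measurable_EFinP/measurable_funTS.
  - by move=> z; rewrite patchE; case: ifP.
  have z0 : (\int[m1]_x 0 = 0)%E by exact: integral0.
  rewrite -[RHS]z0; apply: ae_eq_integral => //.
  - apply: measurable_fun_fubini_tonelli_F.
      apply/(measurable_restrictT _ mB); apply: measurableT_comp => //.
      exact/measurable_EFinP/measurable_funTS.
    by move=> z; rewrite patchE; case: ifP.
  - apply: filterS aa => y hy _; rewrite /fubini_F.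
    have [B1y|nB1y] := pselect (B1 y); last first.
      apply: integral0_eq => t _; rewrite patchE ifF //.
      by apply/negbTE; rewrite notin_setE => -[].
    have z0' : (\int[m2]_x 0 = 0)%E by exact: integral0.
    rewrite -[RHS]z0'; apply: ae_eq_integral => //.
    + apply: (measurableT_comp (f := fun z : T1 * T2 => _ z)); last exact: measurable_pair1.
      apply/(measurable_restrictT _ mB); apply: measurableT_comp => //.
      exact/measurable_EFinP/measurable_funTS.
    + apply: filterS (hy B1y) => t ht _ /=; rewrite patchE; case: ifPn => //.
      by rewrite inE => -[_ /ht] /= ->; rewrite normr0.
by apply: filterS => z + Bz => /(_ Bz) [].
Qed.

End separation.

Lemma smooth1_measurable (R : realType) (f : R -> R) : smooth1 f -> measurable_fun setT f.
Proof. by move=> sf; apply: continuous_measurable_fun; exact: smooth1_continuous. Qed.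

Section line_bumps.
Variable R : realType.
Variables (a b : R).
Hypothesis ab : a < b.

(* A countable family, so that almost-everywhere statements survive the choice of the test function. *)
Definition bumps (k : nat) : R -> R :=
  if unpickle k is Some (c, d, n) then
    let c := ratr c : R in let d := ratr d : R in let w := n.+1%:R^-1 in
    if [&& a < c, d < b & c + w <= d] then plateau c d w else cst 0
  else cst 0.

Lemma bumpsP k : bumps k = cst 0 \/
  exists c d w, [/\ a < c, d < b, 0 < w, c + w <= d & bumps k = plateau c d w].
Proof.
rewrite /bumps; case: unpickle => [[[c d] n]|]; last by left.
case: ifPn => [/and3P[ac db cwd]|_]; last by left.
by right; exists (ratr c), (ratr d), n.+1%:R^-1; split => //; rewrite invr_gt0.
Qed.

Lemma smooth1_bumps k : smooth1 (bumps k).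
Proof.
have [->|[c [d [w [_ _ _ _ ->]]]]] := bumpsP k; first exact: smooth1_cst.
exact: smooth1_plateau.
Qed.

Lemma bumps_bound k s : 0 <= bumps k s <= 1.
Proof.
have [->|[c [d [w [_ _ w0 cwd ->]]]]] := bumpsP k; first by rewrite lexx ler01.
by rewrite plateau_ge0 //= plateau_le1.
Qed.

Lemma bumps_norm k s : `|bumps k s| <= 1.
Proof. by have /andP[b0 b1] := bumps_bound k s; rewrite ger0_norm. Qed.

Lemma bumps_supp k : exists c d, [/\ a < c, c < d, d < b &
  forall s, ~ (c < s < d) -> bumps k s = 0].
Proof.
have [->|[c [d [w [ac db w0 cwd ->]]]]] := bumpsP k.
  by exists ((3 * a + b) / 4), ((a + 3 * b) / 4); split => //; move: ab; lra.
exists c, d; split => //; first by rewrite (lt_le_trans _ cwd) // ltrDl.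
by move=> s; exact: plateau_out.
Qed.

Lemma measurable_bumps k : measurable_fun setT (bumps k).
Proof. by apply: smooth1_measurable; exact: smooth1_bumps. Qed.

Variable h : R -> R.
Hypothesis hi : leb1.-integrable setT (EFin \o h).
Hypothesis h0 : forall k, \int[leb1]_x (h x * bumps k x) = 0.

(** Plateaux over the interval with flanks [1 / (n + 1)] converge pointwise to its indicator
    function; the shift by [n0] skips those whose flanks are too wide. *)
Let rational_interval (p q : rat) : a < ratr p -> ratr q < b -> ratr p < ratr q :> R ->
  \int[leb1]_x (h x * \1_`]ratr p, ratr q[%classic x) = 0.
Proof.
move=> ap qb pq; set c : R := ratr p in ap pq *; set d : R := ratr q in qb pq *.
have [n0 n0P] : exists n0, forall n, c + (n + n0).+1%:R^-1 <= d.
  have dc : 0 < d - c by rewrite subr_gt0.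
  have [N _ hN] := near_infty_natSinv_lt (PosNum dc).
  exists N => n; rewrite -lerBrDl ltW //; apply: hN => /=; exact: leq_addl.
pose w n : R := (n + n0).+1%:R^-1.
have w0 n : 0 < w n by rewrite invr_gt0.
apply: (@Rintegral_zero_lim _ _ _ leb1 h (fun n => plateau c d (w n)) _ 1) => //.
- by move=> n; apply: smooth1_measurable; exact: smooth1_plateau.
- move=> n x; have p0 := @plateau_ge0 R c d (w n) (w0 n) (n0P n) x.
  by rewrite ger0_norm ?plateau_le1.
- move=> x; rewrite indicE; have [xcd|xcd] := boolP (x \in `]c, d[%classic).
    move: xcd; rewrite inE /= in_itv /= => /andP[cx xd].
    apply: cvg_near_cst; have xc : 0 < x - c by rewrite subr_gt0.
    have dx : 0 < d - x by rewrite subr_gt0.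
    have [N1 _ hN1] := near_infty_natSinv_lt (PosNum xc).
    have [N2 _ hN2] := near_infty_natSinv_lt (PosNum dx).
    exists (N1 + N2)%N => // n /= nN; apply/plateau_in => //.
    have /= w1 : w n < x - c.
      by apply: hN1 => /=; apply: leq_trans (leq_addr _ _); apply: leq_trans nN; exact: leq_addr.
    have /= w2 : w n < d - x.
      by apply: hN2 => /=; apply: leq_trans (leq_addr _ _); apply: leq_trans nN; exact: leq_addl.
    by apply/andP; split; move: w1 w2; lra.
  move: xcd; rewrite notin_setE /= in_itv /= => xcd.
  rewrite (_ : (fun n => _) = cst 0); first exact: cvg_cst.
  by apply/funext => n; apply: plateau_out; [exact: w0|exact: n0P|exact: xcd].
- move=> n; rewrite -(h0 (pickle (p, q, (n + n0)%N))); apply: eq_Rintegral => x _.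
  by rewrite /bumps pickleK ap qb n0P.
Qed.

(** The rational endpoints approach [c] and [d] from the right, which is why the limit is the
    indicator of a half-open interval. The number [e] keeps them below [d] and [b]. *)
Let real_interval (c d : R) : a <= c -> c < d -> d < b ->
  \int[leb1]_x (h x * \1_`]c, d]%classic x) = 0.
Proof.
move=> ac cd db.
have [e e0 [ecd edb]] : exists2 e : R, 0 < e & e < d - c /\ e < b - d.
  exists (Num.min (d - c) (b - d) / 2).
    by rewrite divr_gt0 // lt_min !subr_gt0 cd db.
  have : 0 < Num.min (d - c) (b - d) by rewrite lt_min !subr_gt0 cd db.
  by case: (leP (d - c) (b - d)); lra.
pose r n : R := e / n.+1%:R.
have r0 n : 0 < r n by rewrite divr_gt0.
have re n : r n <= e by rewrite /r ler_pdivrMr ?ltr0n // -[X in X <= _]mulr1 ler_pM2l // ler1n.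
have cr n : exists q : rat, ratr q \in `]c, c + r n[.
  by have [|q] := @rat_in_itvoo _ c (c + r n); [rewrite ltrDl|exists q].
have dr n : exists q : rat, ratr q \in `]d, d + r n[.
  by have [|q] := @rat_in_itvoo _ d (d + r n); [rewrite ltrDl|exists q].
have [p hp] := choice cr; have [q hq] := choice dr.
have rcvg : r n @[n --> \oo] --> 0.
  rewrite -(mulr0 e); apply: cvgM; first exact: cvg_cst.
  exact: cvg_harmonic.
apply: (@Rintegral_zero_lim _ _ _ leb1 h
  (fun n => \1_`]ratr (p n), ratr (q n)[%classic) _ 1) => //.
- by move=> n x; rewrite indicE; case: (_ \in _); rewrite ?normr1 ?normr0.
- move=> x; apply: cvg_near_cst; rewrite indicE.
  have [xcd|xcd] := boolP (x \in `]c, d]%classic).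
    move: xcd; rewrite inE /= in_itv /= => /andP[cx xd].
    have xc : 0 < x - c by rewrite subr_gt0.
    move/cvgrPdist_lt : rcvg => /(_ _ xc); apply: filterS => n; rewrite sub0r normrN gtr0_norm // => rn.
    rewrite indicE mem_set //= in_itv /=; have := hp n; have := hq n; rewrite !in_itv /=.
    by move=> /andP[q1 q2] /andP[p1 p2]; apply/andP; split; move: q1 p2 rn xd; lra.
  move: xcd; rewrite notin_setE /= in_itv /= => /negP; rewrite negb_and -!leNgt -ltNge => /orP[xc|dx].
    exists 0%N => // n _ /=; rewrite indicE memNset //= in_itv /=.
    by have := hp n; rewrite in_itv /= => /andP[cp _] /andP[px _]; move: xc cp px; lra.
  have xd : 0 < x - d by rewrite subr_gt0.
  move/cvgrPdist_lt : rcvg => /(_ _ xd); apply: filterS => n; rewrite sub0r normrN gtr0_norm // => rn.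
  rewrite indicE memNset //= in_itv /=; have := hq n; rewrite in_itv /=.
  by move=> /andP[_ q2] /andP[_ xq]; move: q2 xq rn; lra.
- move=> n; have := hp n; have := hq n; rewrite !in_itv /= => /andP[q1 q2] /andP[p1 p2].
  by apply: rational_interval; move: (re n) q1 q2 p1 p2 ac ecd edb; lra.
Qed.

(** The primitive of [h], cut to the interval, vanishes identically there, and Lebesgue's
    differentiation theorem recovers [h] from it almost everywhere. *)
Lemma bumps_separate_proof : {ae leb1, forall x, `]a, b[%classic x -> h x = 0}.
Proof.
pose L := @lebesgue_measure R.
pose f := h \_ `]a, b[.
have fi : L.-integrable setT (EFin \o f).
  rewrite -restrict_EFin -integrable_mkcond //; apply: (integrableS measurableT) => //.
  exact/integrable_leb1.
have mf : measurable_fun setT f by case/integrableP : fi => /measurable_EFinP.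
have F0 x : a < x < b -> \int[L]_(t in `]-oo, x]) f t = 0.
  move=> /andP[ax xb]; rewrite -(real_interval _ _ (lexx a) ax xb).
  rewrite -Rintegral_leb1 //; last exact: measurable_funTS.
  rewrite Rintegral_mkcond; apply: eq_Rintegral => t _.
  rewrite /f indicE !patchE; case: ifPn => [tx|tx].
    case: ifPn => [tab|tab].
      rewrite mem_set ?mulr1 //; move: tx tab; rewrite !inE /= !in_itv /=.
      by move=> -> /andP[-> _].
    rewrite memNset ?mulr0 //; move: tx tab; rewrite !inE !notin_setE /= !in_itv /=.
    by move=> tx tab /andP[at_ _]; apply: tab; rewrite at_ (le_lt_trans tx).
  rewrite memNset ?mulr0 //; move: tx; rewrite notin_setE /= !in_itv /=.
  by move=> tx /andP[_].
have floc : locally_integrable setT f.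
  by apply: open_integrable_locally => //; exact: openT.
have fiy y : L.-integrable `]-oo, y] (EFin \o f) by apply: (@integrableS _ _ _ L setT).
have := FTC1Ny fiy floc.
case=> N [mN N0 sub]; exists N; split => // x nP; apply: sub => -[dF F']; apply: nP.
rewrite /= in_itv /= => axb.
have <- : f x = h x by rewrite /f patchE mem_set //= in_itv.
rewrite -F' derive1E; have /andP[ax xb] := axb.
have e : \forall y \near x, 0 = \int[L]_(t in `]-oo, y]) f t.
  near=> y; rewrite F0 //; apply/andP; split; near: y; [exact: lt_nbhsr|exact: lt_nbhsl].
by rewrite -(near_eq_derive _ e) derive_cst.
Unshelve. all: by end_near.
Qed.

End line_bumps.
Arguments bumps {R} a b k.

Lemma bumps_separate (R : realType) (a b : R) :
  separates leb1 `]a, b[%classic (range (bumps a b)).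
Proof.
move=> h hi h0; have [ab|ba] := ltP a b.
  by apply: bumps_separate_proof => // k; apply: h0; exists k.
apply: aeW => x /=; rewrite in_itv /= => /andP[ax xb].
by move: (lt_trans ax xb); rewrite ltNge ba.
Qed.

(** * Null sets and integrable products on product spaces *)

Section product_ae.
Context d1 d2 (T1 : measurableType d1) (T2 : measurableType d2) (R : realType).
Variable m1 : {sigma_finite_measure set T1 -> \bar R}.
Variable m2 : {sigma_finite_measure set T2 -> \bar R}.

Lemma ae_prod_fst (P : T1 * T2 -> Prop) : {ae (m1 \x m2)%E, forall z, P z} ->
  {ae m1, forall x, {ae m2, forall y, P (x, y)}}.
Proof.
case=> N [mN N0 sub].
have mF : measurable_fun setT (m2 \o xsection N) by exact: measurable_fun_xsection.
have : ae_eq m1 setT (m2 \o xsection N) (cst 0%E).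
  apply/ae_eq_integral_abs => //; rewrite -N0 [RHS]/product_measure1.
  by apply: eq_integral => x _; rewrite gee0_abs.
apply: filterS => x /(_ I) /= Nx0; exists (xsection N x); split => //.
  exact: measurable_xsection.
by move=> y /= nP; rewrite /xsection /=; apply: mem_set; exact: sub.
Qed.

Lemma ae_prod_snd (P : T1 * T2 -> Prop) : {ae (m1 \x m2)%E, forall z, P z} ->
  {ae m2, forall y, {ae m1, forall x, P (x, y)}}.
Proof.
case=> N [mN N0 sub].
have mF : measurable_fun setT (m1 \o ysection N) by exact: measurable_fun_ysection.
have N20 : (m1 \x^ m2)%E N = 0%E.
  rewrite -N0; apply/esym/product_measure_unique => // A B mA mB.
  by rewrite /= product_measure2E.
have : ae_eq m2 setT (m1 \o ysection N) (cst 0%E).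
  apply/ae_eq_integral_abs => //; rewrite -N20 [RHS]/product_measure2.
  by apply: eq_integral => x _; rewrite gee0_abs.
apply: filterS => y /(_ I) /= Nx0; exists (ysection N y); split => //.
  exact: measurable_ysection.
by move=> x /= nP; rewrite /ysection /=; apply: mem_set; exact: sub.
Qed.

Lemma integrable_tensor (u : T1 -> R) (v : T2 -> R) :
  m1.-integrable setT (EFin \o u) -> m2.-integrable setT (EFin \o v) ->
  (m1 \x m2)%E.-integrable setT (EFin \o (fun z => u z.1 * v z.2)).
Proof.
move=> /integrableP[/measurable_EFinP mu ui] /integrableP[/measurable_EFinP mv vi].
have muv : measurable_fun setT (fun z : T1 * T2 => u z.1 * v z.2).
  apply: measurable_funM; first exact: (measurableT_comp mu measurable_fst).
  exact: (measurableT_comp mv measurable_snd).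
apply/integrable12ltyP; first exact/measurable_EFinP.
have E x : (\int[m2]_y `|(EFin \o (fun z : T1 * T2 => u z.1 * v z.2)%R) (x, y)| =
    `|(u x)%:E| * \int[m2]_y `|(v y)%:E|)%E.
  rewrite -ge0_integralZl //; last by apply: measurableT_comp => //; exact/measurable_EFinP.
  by apply: eq_integral => y _; rewrite /= -EFinM normrM.
under eq_integral do rewrite E.
rewrite ge0_integralZr //; last 2 first.
- by apply: measurableT_comp => //; exact/measurable_EFinP.
- exact: integral_ge0.
by rewrite lte_mul_pinfty ?integral_ge0 // ge0_fin_numE ?integral_ge0.
Qed.

End product_ae.

(** Serves to integrate a primitive over its upper limit: the middle variable is that limit, the
    last one the variable under the integral. The measure [m12] is a parameter that equals the
    product, so that [leb4], with its own instance, can be inserted. *)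
Lemma integrable_tensor_mid d1 d2 d3 (T1 : measurableType d1) (T2 : measurableType d2)
    (T3 : measurableType d3) (R : realType)
    (m1 : {sigma_finite_measure set T1 -> \bar R})
    (m2 : {sigma_finite_measure set T2 -> \bar R})
    (m12 : {sigma_finite_measure set (T1 * T2)%type -> \bar R})
    (m3 : {sigma_finite_measure set T3 -> \bar R})
    (u : T1 * T3 -> R) (v : T2 -> R) :
  (forall A, m12 A = (m1 \x m2)%E A) ->
  (m1 \x m3)%E.-integrable setT (EFin \o u) -> m2.-integrable setT (EFin \o v) ->
  (m12 \x m3)%E.-integrable setT (EFin \o (fun z => u (z.1.1, z.2) * v z.1.2)).
Proof.
move=> m12E /integrableP[/measurable_EFinP mu ui] /integrableP[/measurable_EFinP mv vi].
have muv : measurable_fun setT (fun z : T1 * T2 * T3 => u (z.1.1, z.2) * v z.1.2).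
  apply: measurable_funM.
    apply: (measurableT_comp mu); apply: measurable_fun_pair => /=; last exact: measurable_snd.
    exact: (measurableT_comp measurable_fst measurable_fst).
  exact: (measurableT_comp mv (measurableT_comp measurable_snd measurable_fst)).
apply/integrable12ltyP; first exact/measurable_EFinP.
have mu3 x : measurable_fun setT (fun t => u (x, t)) by exact: (measurableT_comp mu (measurable_pair1 x)).
pose U x := (\int[m3]_t `|(u (x, t))%:E|)%E.
have E w : (\int[m3]_t `|(EFin \o (fun z : T1 * T2 * T3 => u (z.1.1, z.2) * v z.1.2)%R) (w, t)| =
    U w.1 * `|(v w.2)%:E|)%E.
  rewrite -ge0_integralZr //; last first.
    by apply: measurableT_comp => //; exact/measurable_EFinP.
  by apply: eq_integral => y _; rewrite /= -EFinM normrM.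
have mabsu : measurable_fun setT (abse \o (EFin \o u)).
  by apply: measurableT_comp => //; exact/measurable_EFinP.
have mU : measurable_fun setT U.
  apply: (measurable_fun_fubini_tonelli_F (abse \o (EFin \o u))) => // z.
  exact: abse_ge0.
have U0 x : (0 <= U x)%E by exact: integral_ge0.
under eq_integral do rewrite E.
rewrite (eq_measure_integral (m1 \x m2)%E); last by move=> A mA _; exact: m12E.
rewrite fubini_tonelli1 /fubini_F /=; last 2 first.
- apply: emeasurable_funM; first by apply: measurableT_comp => //; exact: measurable_fst.
  have mv2 : measurable_fun setT (fun w : T1 * T2 => v w.2) by exact: (measurableT_comp mv measurable_snd).
  by apply/measurable_EFinP; exact: measurableT_comp mv2.
- by move=> w; rewrite mule_ge0.
have E2 x : (\int[m2]_y (U x * `|(v y)%:E|) = U x * \int[m2]_y `|(v y)%:E|)%E.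
  rewrite ge0_integralZl //.
  by apply/measurable_EFinP; exact: measurableT_comp mv.
under eq_integral do rewrite E2.
rewrite ge0_integralZr //; last exact: integral_ge0.
have -> : (\int[m1]_x U x = \int[(m1 \x m3)%E]_z `|(EFin \o u) z|)%E.
  rewrite -[RHS]/(\int[_]_z (abse \o (EFin \o u)) z)%E fubini_tonelli1 //.
  by move=> z; exact: abse_ge0.
by rewrite lte_mul_pinfty ?integral_ge0 // ge0_fin_numE ?integral_ge0.
Qed.

Section by_parts.
Variable R : realType.

(** Fubini on the half plane [t <= s]; in this form integration by parts holds for primitives of
    merely integrable functions. *)
Lemma Rintegral_primitive_parts (g chi : R -> R) :
  leb1.-integrable setT (EFin \o g) -> leb1.-integrable setT (EFin \o chi) ->
  \int[leb1]_s ((\int[leb1]_(t in `]-oo, s]) g t) * chi s) =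
  (\int[leb1]_s g s) * (\int[leb1]_s chi s) -
  \int[leb1]_t (g t * \int[leb1]_(s in `]-oo, t]) chi s).
Proof.
move=> gi chii.
pose ind (z : R * R) : R := \1_[set z | z.2 <= z.1] z.
have mind : measurable_fun setT ind.
  apply: measurable_indic; rewrite -[X in measurable X]setTI.
  rewrite (_ : [set _ | _] = (fun z : R * R => z.2 - z.1) @^-1` `]-oo, 0]); last first.
    by apply/seteqP; split => z /=; rewrite in_itv /= subr_le0.
  have mB : measurable_fun setT (fun z : R * R => z.2 - z.1).
    by apply: measurable_funB; [exact: measurable_snd|exact: measurable_fst].
  exact: mB.
have Fi : (leb1 \x leb1)%E.-integrable setT
    (EFin \o (fun z : R * R => (chi z.1 * g z.2) * ind z)).
  apply: (@integrable_bddM _ _ _ _ _ _ ind 1) => //; first exact: integrable_tensor.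
  by move=> z _; rewrite /ind indicE; case: (_ \in _); rewrite ?normr1 ?normr0.
have := Rintegral_prod1 Fi; rewrite (Rintegral_prod2 Fi).
have -> : \int[leb1]_x \int[leb1]_y (chi (x, y).1 * g (x, y).2 * ind (x, y)) =
    \int[leb1]_s ((\int[leb1]_(t in `]-oo, s]) g t) * chi s).
  apply: eq_Rintegral => s _ /=.
  rewrite [in RHS]Rintegral_mkcond mulrC -RintegralZl //; last first.
    by rewrite -restrict_EFin -integrable_mkcond //; exact: (integrableS measurableT).
  apply: eq_Rintegral => t _; rewrite /ind indicE patchE -mulrA; congr (_ * _).
  case: ifPn => ts; [rewrite mem_set ?mulr1 //|rewrite memNset ?mulr0 //].
    by move: ts; rewrite inE /= in_itv.
  by move: ts; rewrite notin_setE /= in_itv.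
have mchi : measurable_fun setT chi by case/integrableP: chii => /measurable_EFinP.
have indi t (A : set R) : measurable A -> leb1.-integrable setT (EFin \o (chi \* \1_A)).
  move=> mA; apply: (@integrable_bddM _ _ _ leb1 _ chi (\1_A) 1) => //.
  by move=> x _; rewrite indicE; case: (_ \in _); rewrite ?normr1 ?normr0.
(* The two half-lines overlap only at [t], a null set. *)
have half t : \int[leb1]_s (chi s * \1_`[t, +oo[%classic s) =
    \int[leb1]_s chi s - \int[leb1]_(s in `]-oo, t]) chi s.
  transitivity (\int[leb1]_s (chi s - chi s * \1_`]-oo, t]%classic s)).
    apply: ae_eq_Rintegral => //.
    - by apply: measurable_funM => //; exact: measurable_indic.
    - by apply: measurable_funB => //; apply: measurable_funM => //; exact: measurable_indic.
    exists [set t]; split => //; first exact: lebesgue_measure_set1.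
    move=> s /= ns; apply: contrapT => st; apply: ns => _.
    have [ts|ts] := ltP t s.
      rewrite !indicE mem_set /= ?in_itv /= ?(ltW ts) // memNset /= ?in_itv /=.
        by rewrite mulr1 mulr0 subr0.
      by rewrite leNgt ts.
    have {}ts : s < t by rewrite lt_neqAle ts andbT; exact/eqP.
    rewrite !indicE memNset /= ?in_itv /= ?andbT ?leNgt ?ts // mem_set /= ?in_itv /= ?(ltW ts) //.
    by rewrite mulr1 mulr0 subrr.
  rewrite RintegralB //; last exact: indi.
  rewrite [X in _ = _ - X]Rintegral_mkcond; congr (_ - _).
  apply: eq_Rintegral => s _; rewrite indicE patchE.
  by case: (s \in _); rewrite ?mulr1 ?mulr0.
set X := \int[leb1]_s chi s in half *.
have inner t : \int[leb1]_x (chi (x, t).1 * g (x, t).2 * ind (x, t)) =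
    g t * X - g t * \int[leb1]_(s in `]-oo, t]) chi s.
  rewrite -mulrBr -half -RintegralZl //; last exact: indi.
  apply: eq_Rintegral => s _ /=; rewrite mulrAC mulrC; congr (_ * (_ * _)).
  rewrite /ind !indicE; have [ts|ts] := leP t s.
    by rewrite !mem_set //= in_itv /= ts.
  by rewrite !memNset //= ?in_itv /= ?andbT; apply/negP; rewrite -ltNge.
have gXi : leb1.-integrable setT (EFin \o (fun t => g t * X)).
  by have := integrableZr measurableT X gi; exact: eq_integrable.
move=> <-; rewrite -RintegralZr // -RintegralB //.
  by apply: eq_Rintegral => t _; rewrite inner.
have := integrableB measurableT gXi (integrable_Rintegral_fst Fi); apply: eq_integrable => // t _.
by rewrite /= inner -EFinB; congr EFin; ring.
Qed.

End by_parts.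

(** * Absolute continuity on lines *)

Section absolutely_continuous_lines.
Variable R : realType.

(** An absolutely continuous representative with derivative [g], up to a null set of []a, b[]. The
    primitive starts at minus infinity; what [g] contributes left of [a] goes into [C]. *)
Definition acl (a b : R) (f g : R -> R) : Prop :=
  leb1.-integrable setT (EFin \o g) /\
  exists C, {ae leb1, forall s, a < s < b -> f s = C + \int[leb1]_(t in `]-oo, s]) g t}.

Lemma integrable_indic_oo (a b : R) : leb1.-integrable setT (EFin \o \1_`]a, b[%classic).
Proof.
have : (@lebesgue_measure R).-integrable setT (EFin \o \1_`]a, b[%classic).
  exact: integrable_indic_itv.
by move/(integrable_leb1 _ measurableT).
Qed.

(** Otherwise the indicator of the interval would be orthogonal to all bumps and hence vanish almost
    everywhere on it. The bump found here normalises the others in [weak_deriv_acl]. *)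
Lemma bumps_mass (a b : R) : a < b -> exists k, \int[leb1]_s bumps a b k s != 0.
Proof.
move=> ab; apply: contrapT => /forallNP nk.
have := @bumps_separate R a b \1_`]a, b[%classic (integrable_indic_oo a b).
case=> [phi [k _ <-]|N [mN N0 sub]].
  have -> : (fun x : R => \1_`]a, b[%classic x * bumps a b k x) = bumps a b k.
    apply/funext => s; rewrite indicE; have [|ns] := boolP (s \in _); first by rewrite mul1r.
    have [c [d [ac cd db k0]]] := @bumps_supp R a b ab k.
    rewrite mul0r k0 // => /andP[cs sd]; move: ns; rewrite notin_setE /=; apply.
    by rewrite in_itv /= (lt_trans ac cs) (lt_trans sd db).
  by have /negP := nk k; rewrite negbK => /eqP.
have IN : `]a, b[%classic `<=` N.
  move=> s sab; apply: sub => /= /(_ sab) /eqP.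
  by rewrite indicE mem_set // oner_eq0.
have : (leb1 `]a, b[%classic <= leb1 N)%E by rewrite le_measure // inE.
rewrite N0 /leb1 lebesgue_measure_itv /= lte_fin ab -EFinB lee_fin subr_le0.
by rewrite leNgt ab.
Qed.

(** * From weak derivatives to absolute continuity on lines (du Bois-Reymond) *)

Section weak_to_acl.
Variables (B3 : set (space3 R)) (Phi : set (space3 R -> R)) (a b : R).
Variables (f g : spacetime R -> R).
Hypotheses (ab : a < b) (mB3 : measurable B3).
Hypothesis bPhi : forall phi, Phi phi ->
  measurable_fun setT phi /\ exists C, forall x, `|phi x| <= C.
Hypothesis sPhi : separates leb3 B3 Phi.
Hypothesis fi : leb4.-integrable setT (EFin \o f).
Hypothesis gi : leb4.-integrable setT (EFin \o g).
Hypothesis weak_fg : forall beta alpha, Phi beta -> smooth1 alpha ->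
  (exists c d, [/\ a < c, d < b & forall s, ~ (c < s < d) -> alpha s = 0]) ->
  \int[leb4]_z (f z * (beta z.1 * derive1 alpha z.2)) =
  - \int[leb4]_z (g z * (beta z.1 * alpha z.2)).

Let Gam (z : spacetime R) : R := \int[leb1]_(t in `]-oo, z.2]) g (z.1, t).
Let I1 : R -> R := \1_`]a, b[%classic.

Let I1_norm s : `|I1 s| <= 1.
Proof. by rewrite /I1 indicE; case: (_ \in _); rewrite ?normr1 ?normr0. Qed.

Let mI1 : measurable_fun setT (fun z : spacetime R => I1 z.2).
Proof. by apply: (measurableT_comp _ measurable_snd); exact: measurable_indic. Qed.

Let I1E s (c d : R) phi : (forall s, ~ (c < s < d) -> phi s = 0) -> a < c -> d < b ->
  I1 s * phi s = phi s.
Proof.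
move=> phi0 ac db; rewrite /I1 indicE; have [|ns] := boolP (s \in _); first by rewrite mul1r.
rewrite mul0r phi0 // => /andP[cs sd]; move: ns; rewrite notin_setE /=; apply.
by rewrite in_itv /= (lt_trans ac cs) (lt_trans sd db).
Qed.

(** The primitive is an integral of [g] over [t <= s]; Fubini in one more variable gives its
    integrability over the bounded range of [s]. *)
Let GamIi : leb4.-integrable setT (EFin \o (fun z => Gam z * I1 z.2)).
Proof.
pose ind (w : spacetime R * R) : R := \1_[set w | w.2 <= w.1.2] w.
have mind : measurable_fun setT ind.
  apply: measurable_indic; rewrite -[X in measurable X]setTI.
  rewrite (_ : [set _ | _] = (fun w : spacetime R * R => w.2 - w.1.2) @^-1` `]-oo, 0]); last first.
    by apply/seteqP; split => z /=; rewrite in_itv /= subr_le0.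
  have mB : measurable_fun setT (fun w : spacetime R * R => w.2 - w.1.2).
    apply: measurable_funB; first exact: measurable_snd.
    exact: (measurableT_comp measurable_snd measurable_fst).
  exact: mB.
have Ti : (leb4 \x leb1)%E.-integrable setT
    (EFin \o (fun w : spacetime R * R => g (w.1.1, w.2) * I1 w.1.2)).
  exact: (@integrable_tensor_mid _ _ _ _ _ _ _ leb3 leb1 leb4 leb1 g I1 (fun A => erefl _) gi (integrable_indic_oo a b)).
have Ti2 : (leb4 \x leb1)%E.-integrable setT
    (EFin \o (fun w : spacetime R * R => g (w.1.1, w.2) * I1 w.1.2 * ind w)).
  apply: (@integrable_bddM _ _ _ _ _ _ ind 1) => //.
  by move=> z _; rewrite /ind indicE; case: (_ \in _); rewrite ?normr1 ?normr0.
have := integrable_Rintegral_snd Ti2; congr (integrable _ _ (_ \o _)).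
apply/funext => z /=; rewrite /Gam Rintegral_mkcond.
have [I1z|I1z] : I1 z.2 = 1 \/ I1 z.2 = 0.
- by rewrite /I1 indicE; case: (_ \in _); [left|right].
- rewrite I1z mulr1; apply: eq_Rintegral => t _.
  rewrite mulr1 patchE /ind indicE; have [ts|ts] := leP t z.2.
    by rewrite !mem_set ?mulr1 //= in_itv.
  by rewrite !memNset ?mulr0 //= ?in_itv /=; apply/negP; rewrite -ltNge.
- rewrite I1z mulr0 -[RHS](mul0r (fine (leb1 [set: R]))) -Rintegral_cst //.
  by apply: eq_Rintegral => t _; rewrite mulr0 mul0r.
Qed.

(** The aim is that this difference depends on the line only, not on the position on it. *)
Let kf (z : spacetime R) : R := f z * I1 z.2 - Gam z * I1 z.2.

Let fIi : leb4.-integrable setT (EFin \o (fun z => f z * I1 z.2)).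
Proof. exact: (@integrable_bddM _ _ _ _ _ f (fun z => I1 z.2) 1). Qed.

Let kfi : leb4.-integrable setT (EFin \o kf).
Proof.
have := integrableB measurableT fIi GamIi; exact: eq_integrable.
Qed.

Let tensor_bdd (beta : space3 R -> R) (rho : R -> R) (C D : R) : measurable_fun setT beta ->
  measurable_fun setT rho -> (forall x, `|beta x| <= C) -> (forall s, `|rho s| <= D) ->
  measurable_fun setT (fun z : spacetime R => beta z.1 * rho z.2) /\
  forall z : spacetime R, `|beta z.1 * rho z.2| <= C * D.
Proof.
move=> mb mr bC rD; split; last by move=> z; rewrite normrM ler_pM.
apply: measurable_funM; first exact: (measurableT_comp mb measurable_fst).
exact: (measurableT_comp mr measurable_snd).
Qed.

(** A [chi] of zero integral is the derivative of a test function [alpha]. The weak formulation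
    turns the pairing of [f] with [chi] into one of [g] with [alpha], and integration by parts on
    each line cancels it against the pairing of the primitive. *)
Let kf_orth beta chi (c d : R) : Phi beta -> a < c -> c < d -> d < b -> smooth1 chi ->
  (forall s, ~ (c < s < d) -> chi s = 0) -> \int[leb1]_s chi s = 0 ->
  \int[leb4]_z (kf z * (beta z.1 * chi z.2)) = 0.
Proof.
move=> Pb ac cd db schi chi0 chii0; have [mbeta [C bC]] := bPhi Pb.
have chii := continuous_supp_integrable c d (smooth1_continuous schi) chi0.
have [D D0 chiD] := smooth1_supp_bounded c d schi chi0.
have mchi := smooth1_measurable schi.
pose alpha s := \int[leb1]_(t in `]-oo, s]) chi t.
have [alphaD alphac alphad] := primitive_supp c d (ltW cd) (smooth1_continuous schi) chi0.
have salpha : smooth1 alpha by exact: smooth1_primitive alphaD schi.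
have alpha0 s : ~ (c < s < d) -> alpha s = 0.
  move/negP; rewrite negb_and -!leNgt => /orP[|] h; first exact: alphac.
  by rewrite /alpha alphad.
have [E E0 alphaE] := smooth1_supp_bounded c d salpha alpha0.
have alpha' : derive1 alpha = chi.
  by apply/funext => s; rewrite derive1E; exact: (@derive_val _ _ _ _ _ _ _ (alphaD s)).
have [mbc bcb] := tensor_bdd _ _ mbeta mchi bC chiD.
have [mba bab] := tensor_bdd _ _ mbeta (smooth1_measurable salpha) bC alphaE.
have fbi : leb4.-integrable setT (EFin \o (fun z => f z * (beta z.1 * chi z.2))).
  by apply: integrable_bddM => //; exact: bcb.
have Gbi : leb4.-integrable setT (EFin \o (fun z => (Gam z * I1 z.2) * (beta z.1 * chi z.2))).
  by apply: integrable_bddM => //; exact: bcb.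
have gbi : leb4.-integrable setT (EFin \o (fun z => g z * (beta z.1 * alpha z.2))).
  by apply: integrable_bddM => //; exact: bab.
transitivity (\int[leb4]_z (f z * (beta z.1 * chi z.2) -
    (Gam z * I1 z.2) * (beta z.1 * chi z.2))).
  apply: eq_Rintegral => z _; rewrite /kf mulrBl; congr (_ - _).
  by rewrite -mulrA; congr (_ * _); rewrite mulrCA (@I1E _ c d chi chi0).
rewrite RintegralB // -{1}alpha' (weak_fg Pb salpha); last by exists c, d.
apply/eqP; rewrite subr_eq0 eq_sym; apply/eqP.
rewrite (Rintegral_prod1 Gbi) (Rintegral_prod1 gbi) -mulN1r -RintegralZl //; last first.
  exact: (integrable_Rintegral_snd gbi).
apply: ae_eq_Rintegral => //.
- by case/integrableP : (integrable_Rintegral_snd Gbi) => /measurable_EFinP.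
- apply: measurable_funM => //.
  by case/integrableP : (integrable_Rintegral_snd gbi) => /measurable_EFinP.
apply: filterS2 (ae_integrable_fst gi) (ae_integrable_fst GamIi) => y giy Giy _ /=.
have := Rintegral_primitive_parts giy chii; rewrite chii0 mulr0 sub0r.
set lhs := Rintegral _ _ _; set rhs := Rintegral _ _ _ => parts.
have -> : \int[leb1]_s (Gam (y, s) * I1 s * (beta y * chi s)) = beta y * lhs.
  rewrite -RintegralZl //; last first.
    have := @integrable_bddM _ _ _ leb1 _ (fun s => Gam (y, s) * I1 s) chi D measurableT Giy
      mchi (fun s _ => chiD s).
    apply: eq_integrable => // s _ /=.
    by rewrite -mulrA (@I1E _ c d chi chi0).
  apply: eq_Rintegral => s _; rewrite -mulrA (mulrCA (I1 s)) (@I1E _ c d chi chi0) //.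
  by rewrite mulrCA.
have -> : \int[leb1]_s (g (y, s) * (beta y * alpha s)) = beta y * rhs.
  rewrite -RintegralZl //; last first.
    apply: (@integrable_bddM _ _ _ leb1 _ (fun s => g (y, s)) alpha E) => //.
    exact: smooth1_measurable.
  by apply: eq_Rintegral => s _; rewrite mulrCA.
by rewrite parts mulrN mulN1r.
Qed.

(** The argument of du Bois-Reymond: every bump differs from a multiple of the fixed bump [k0] by a
    function of zero integral, to which [kf] is orthogonal. So [kf] acts like a function [C] of the
    line alone, and the separating family identifies the two. *)
Lemma weak_deriv_acl : {ae leb3, forall y, B3 y ->
  acl a b (fun s => f (y, s)) (fun s => g (y, s))}.
Proof.
have [k0 m0] := @bumps_mass a b ab.
pose m k : R := \int[leb1]_s bumps a b k s.
pose C (y : space3 R) : R := (m k0)^-1 * \int[leb1]_s (kf (y, s) * bumps a b k0 s).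
have mbumps k := @measurable_bumps R a b k.
have bbumps k := @bumps_norm R a b k.
have ki k : leb1.-integrable setT (EFin \o bumps a b k).
  have [c [d [_ _ _ z]]] := @bumps_supp R a b ab k.
  apply: (continuous_supp_integrable c d) => //.
  exact/smooth1_continuous/smooth1_bumps.
have kfk : leb4.-integrable setT (EFin \o (fun z => kf z * bumps a b k0 z.2)).
  apply: (@integrable_bddM _ _ _ _ _ kf (fun z => bumps a b k0 z.2) 1) => //.
  exact: (measurableT_comp (mbumps k0) measurable_snd).
have Ci : leb3.-integrable setT (EFin \o C).
  have := integrableZl measurableT (m k0)^-1 (integrable_Rintegral_snd kfk).
  exact: eq_integrable.
have CIi : leb4.-integrable setT (EFin \o (fun z => C z.1 * I1 z.2)).
  exact: (@integrable_tensor _ _ _ _ _ leb3 leb1 C I1 Ci (integrable_indic_oo a b)).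
pose h z := kf z - C z.1 * I1 z.2.
have hi : leb4.-integrable setT (EFin \o h).
  by have := integrableB measurableT kfi CIi; exact: eq_integrable.
have S := separates_prod (bumps a b) mB3 (measurable_itv `]a, b[) bPhi
  (fun n => conj (mbumps n) (ex_intro _ 1 (bbumps n))) sPhi (@bumps_separate R a b).
have {S} : {ae leb4, forall z, (B3 `*` `]a, b[%classic) z -> h z = 0}.
  apply: S => // _ [beta [n [Pb ->]]].
  have [mbeta [D bD]] := bPhi Pb.
  have [mb bb] := tensor_bdd _ _ mbeta (mbumps n) bD (bbumps n).
  have [mb0 bb0] := tensor_bdd _ _ mbeta (mbumps k0) bD (bbumps k0).
  have kbi k : leb4.-integrable setT (EFin \o (fun z => kf z * (beta z.1 * bumps a b k z.2))).
    have [mbk bbk] := tensor_bdd _ _ mbeta (mbumps k) bD (bbumps k).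
    by apply: integrable_bddM => //; exact: bbk.
  have cbi : leb4.-integrable setT (EFin \o (fun z => C z.1 * I1 z.2 * (beta z.1 * bumps a b n z.2))).
    by apply: integrable_bddM => //; exact: bb.
  transitivity (\int[leb4]_z (kf z * (beta z.1 * bumps a b n z.2) -
      C z.1 * I1 z.2 * (beta z.1 * bumps a b n z.2))).
    by apply: eq_Rintegral => z _; rewrite /h mulrBl.
  rewrite RintegralB //.
  have -> : \int[leb4]_z (C z.1 * I1 z.2 * (beta z.1 * bumps a b n z.2)) =
      \int[leb4]_z (kf z * (beta z.1 * bumps a b k0 z.2)) * ((m k0)^-1 * m n).
    rewrite (Rintegral_prod1 cbi) (Rintegral_prod1 (kbi k0)) -RintegralZr //; last first.
      exact: (integrable_Rintegral_snd (kbi k0)).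
    apply: ae_eq_Rintegral => //.
    - by case/integrableP : (integrable_Rintegral_snd cbi) => /measurable_EFinP.
    - apply: measurable_funM => //.
      by case/integrableP : (integrable_Rintegral_snd (kbi k0)) => /measurable_EFinP.
    apply: filterS (ae_integrable_fst kfk) => y kfy _ /=.
    have [c [d [ac _ db z]]] := @bumps_supp R a b ab n.
    transitivity (C y * beta y * m n).
      rewrite -RintegralZl //; apply: eq_Rintegral => s _.
      by rewrite -mulrA (mulrCA (I1 s)) (@I1E _ c d (bumps a b n) z) // mulrA.
    have -> : \int[leb1]_s (kf (y, s) * (beta y * bumps a b k0 s)) =
        beta y * \int[leb1]_s (kf (y, s) * bumps a b k0 s).
      by rewrite -RintegralZl //; apply: eq_Rintegral => s _; rewrite mulrCA.
    by rewrite /C; ring.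
  have [c [d [ac cd db z]]] := @bumps_supp R a b ab n.
  have [c0 [d0 [ac0 cd0 db0 z0]]] := @bumps_supp R a b ab k0.
  (* The multiple of the normalising bump is chosen so that [chi] has zero integral. *)
  pose chi s := bumps a b n s + (- ((m k0)^-1 * m n)) * bumps a b k0 s.
  have schi : smooth1 chi.
    apply: (smooth1D (@smooth1_bumps R a b n)).
    by apply: (@smooth1M R (cst (- ((m k0)^-1 * m n)))); [exact: smooth1_cst|exact: smooth1_bumps].
  have chi0 s : ~ (Num.min c c0 < s < Num.max d d0) -> chi s = 0.
    move=> ns; rewrite /chi z ?z0 ?mulr0 ?addr0 // => /andP[h1 h2]; apply: ns.
      by rewrite gt_min lt_max h1 h2 !orbT.
    by rewrite gt_min lt_max h1 h2.
  have chii0 : \int[leb1]_s chi s = 0.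
    rewrite /chi RintegralD //; last by have := integrableZl measurableT (- ((m k0)^-1 * m n)) (ki k0); exact: eq_integrable.
    by rewrite RintegralZl // -/(m n) -/(m k0); field.
  have := @kf_orth beta chi _ _ Pb _ _ _ schi chi0 chii0.
  rewrite lt_min ac ac0 gt_max db db0 lt_max gt_min cd /= => /(_ isT isT isT).
  rewrite (_ : (fun z => _) = (fun z => kf z * (beta z.1 * bumps a b n z.2) -
     kf z * (beta z.1 * bumps a b k0 z.2) * ((m k0)^-1 * m n))); last first.
    by apply/funext => w; rewrite /chi; ring.
  rewrite RintegralB //; last by have := integrableZr measurableT ((m k0)^-1 * m n) (kbi k0); exact: eq_integrable.
  by rewrite RintegralZr.
move=> /ae_prod_fst; apply: filterS2 (ae_integrable_fst gi) => y giy hy B3y.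
split => //; exists (C y); apply: filterS hy => s hs sab.
have : h (y, s) = 0 by apply: hs; split => //=; rewrite in_itv.
rewrite /h /kf /I1 indicE mem_set /= ?in_itv //= !mulr1 /Gam /= => /eqP.
by rewrite subr_eq0 subr_eq => /eqP ->.
Qed.

End weak_to_acl.

End absolutely_continuous_lines.

Arguments acl {R} a b f g.

Unset Strict Implicit.

Lemma measurable_Rintegral_snd d1 d2 (T1 : measurableType d1) (T2 : measurableType d2)
    (R : realType) (m2 : {sigma_finite_measure set T2 -> \bar R}) (G : T1 * T2 -> R) :
  measurable_fun setT G -> measurable_fun setT (fun x => \int[m2]_y G (x, y)).
Proof.
move=> /measurable_EFinP mG.
rewrite /Rintegral; apply: (measurableT_comp (f := fine)) => //.
have E : (fun x => \int[m2]_y (G (x, y))%:E)%E = (fun x => \int[m2]_y ((EFin \o G)^\+ (x, y)) -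
    \int[m2]_y ((EFin \o G)^\- (x, y)))%E.
  apply/funext => x; rewrite [LHS]integralE; congr (_ - _)%E; apply: eq_integral => y _.
    by rewrite !funeposE.
  by rewrite !funenegE.
rewrite E; apply: emeasurable_funB.
  apply: (measurable_fun_fubini_tonelli_F (funepos (EFin \o G))) => //.
  exact: measurable_funepos.
apply: (measurable_fun_fubini_tonelli_F (funeneg (EFin \o G))) => //.
exact: measurable_funeneg.
Qed.

Lemma leb1_oo (R : realType) (a b : R) : a < b -> leb1 `]a, b[%classic = (b - a)%:E.
Proof. by move=> ab; rewrite /leb1 lebesgue_measure_itv /= lte_fin ab. Qed.

(** * Calculus of absolutely continuous functions on an interval *)

Section acl_lemmas.
Variable R : realType.
Implicit Types (a b s t : R) (f g : R -> R).

Let m1 (A : set R) : measurable A -> measurable_fun setT (\1_A : R -> R).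
Proof. exact: measurable_indic. Qed.

Let n1 (A : set R) s : `|\1_A s : R| <= 1.
Proof. by rewrite indicE; case: (_ \in _); rewrite ?normr1 ?normr0. Qed.

Lemma Rintegral_indic (D : set R) f : measurable D ->
  \int[leb1]_(t in D) f t = \int[leb1]_t (f t * \1_D t).
Proof.
move=> mD; rewrite Rintegral_mkcond; apply: eq_Rintegral => t _.
by rewrite patchE indicE; case: (t \in D); rewrite ?mulr1 ?mulr0.
Qed.

Lemma le_Rintegral_ae (f h : R -> R) : leb1.-integrable setT (EFin \o f) ->
  leb1.-integrable setT (EFin \o h) -> {ae leb1, forall t, f t <= h t} ->
  \int[leb1]_t f t <= \int[leb1]_t h t.
Proof.
move=> fi hi fh.
have mf : measurable_fun setT f by case/integrableP : fi => /measurable_EFinP.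
have mh : measurable_fun setT h by case/integrableP : hi => /measurable_EFinP.
(* Replacing [h] by the maximum turns the inequality almost everywhere into one everywhere. *)
have -> : \int[leb1]_t h t = \int[leb1]_t Num.max (f t) (h t).
  apply: ae_eq_Rintegral => //; first exact: measurable_maxr.
  by apply: filterS fh => t ft _; rewrite max_r.
apply: le_Rintegral => //; last by move=> t _; rewrite le_max lexx.
apply: (le_integrable measurableT _ _ (integrableD measurableT (integrable_abse fi) (integrable_abse hi))).
  by apply/measurable_EFinP; exact: measurable_maxr.
move=> t _ /=; rewrite lee_fin [leRHS]ger0_norm ?addr_ge0 //.
by have [_|_] := leP (f t) (h t); rewrite ?lerDr ?lerDl normr_ge0.
Qed.

Lemma normr_primitive_le g s : leb1.-integrable setT (EFin \o g) ->
  `|\int[leb1]_(t in `]-oo, s]) g t| <= \int[leb1]_t `|g t|.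
Proof.
move=> gi; rewrite Rintegral_indic //.
have gsi : leb1.-integrable setT (EFin \o (fun t => g t * \1_`]-oo, s]%classic t)).
  by apply: (@integrable_bddM _ _ _ leb1 _ g (\1_`]-oo, s]%classic) 1) => //; exact: m1.
apply: le_trans (le_normr_Rintegral measurableT gsi) _.
apply: le_Rintegral => //; [exact: integrable_norm|exact: integrable_norm|].
by move=> t _; rewrite normrM ler_piMr.
Qed.

Lemma primitive_diff_le g s t : leb1.-integrable setT (EFin \o g) ->
  `|\int[leb1]_(x in `]-oo, s]) g x - \int[leb1]_(x in `]-oo, t]) g x| <=
  \int[leb1]_x `|g x|.
Proof.
move=> gi.
have RI u : \int[leb1]_(x in `]-oo, u]) g x = \int[leb1]_x (g x * \1_`]-oo, u]%classic x).
  exact: Rintegral_indic.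
rewrite !RI; have gsi u : leb1.-integrable setT (EFin \o (fun t => g t * \1_`]-oo, u]%classic t)).
  by apply: (@integrable_bddM _ _ _ leb1 _ g (\1_`]-oo, u]%classic) 1) => //; exact: m1.
rewrite -RintegralB //.
have di : leb1.-integrable setT (EFin \o (fun x => g x * \1_`]-oo, s]%classic x - g x * \1_`]-oo, t]%classic x)).
  by have := integrableB measurableT (gsi s) (gsi t); exact: eq_integrable.
apply: le_trans (le_normr_Rintegral measurableT di) _.
apply: le_Rintegral => //; [exact: integrable_norm|exact: integrable_norm|].
move=> x _; rewrite -mulrBr normrM ler_piMr // !indicE.
by case: (_ \in _); case: (_ \in _); rewrite ?subrr ?subr0 ?sub0r ?normrN ?normr1 ?normr0.
Qed.

Lemma measurable_primitive g : measurable_fun setT g ->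
  measurable_fun setT (fun t => \int[leb1]_(x in `]-oo, t]) g x).
Proof.
move=> mg; pose G (z : R * R) := g z.2 * \1_[set w : R * R | w.2 <= w.1] z.
have -> : (fun t => \int[leb1]_(x in `]-oo, t]) g x) = (fun t => \int[leb1]_x G (t, x)).
  have RI t : \int[leb1]_(x in `]-oo, t]) g x = \int[leb1]_x (g x * \1_`]-oo, t]%classic x).
    exact: Rintegral_indic.
  apply/funext => t; rewrite RI; apply: eq_Rintegral => x _.
  rewrite /G !indicE; have [xt|xt] := leP x t.
    by rewrite !mem_set //= in_itv.
  by rewrite !memNset //= ?in_itv /=; apply/negP; rewrite -ltNge.
apply: measurable_Rintegral_snd; apply: measurable_funM.
  exact: (measurableT_comp mg measurable_snd).
apply: measurable_indic; rewrite -[X in measurable X]setTI.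
rewrite (_ : [set _ | _] = (fun z : R * R => z.2 - z.1) @^-1` `]-oo, 0]); last first.
  by apply/seteqP; split => z /=; rewrite in_itv /= subr_le0.
have mB : measurable_fun setT (fun z : R * R => z.2 - z.1).
  by apply: measurable_funB; [exact: measurable_snd|exact: measurable_fst].
exact: mB.
Qed.

Lemma acl_ae_bounded a b f g : acl a b f g ->
  exists K, {ae leb1, forall s, a < s < b -> `|f s| <= K}.
Proof.
move=> [gi [C fC]]; exists (`|C| + \int[leb1]_t `|g t|).
apply: filterS fC => s /[apply] ->; apply: le_trans (ler_normD _ _) _.
by rewrite lerD2l normr_primitive_le.
Qed.

(** The bound is asked only where [g] does not vanish, because [acl] says nothing about [f] outside
    its interval. *)
Lemma integrable_ae_bdd f g (K : R) : measurable_fun setT f ->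
  leb1.-integrable setT (EFin \o g) ->
  {ae leb1, forall s, g s != 0 -> `|f s| <= K} ->
  leb1.-integrable setT (EFin \o (fun s => f s * g s)).
Proof.
move=> mf gi fK.
have mg : measurable_fun setT g by case/integrableP : gi => /measurable_EFinP.
have mfg : measurable_fun setT (fun s => f s * g s) by exact: measurable_funM.
apply/integrableP; split; first exact/measurable_EFinP.
have Kgi := integrableZl measurableT `|K| gi.
have /integrableP[_] := Kgi; apply: le_lt_trans.
apply: ae_ge0_le_integral => //.
- by apply: measurableT_comp => //; exact/measurable_EFinP.
- apply: measurableT_comp => //; exact: (measurable_int _ Kgi).
apply: filterS fK => s fK _ /=; rewrite lee_fin !normrM normr_id.
have [->|gs] := eqVneq (g s) 0; first by rewrite normr0 !mulr0.
by rewrite ler_wpM2r // (le_trans (fK gs)) // ler_norm.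
Qed.

(** For [g] cut off at [s], integration by parts against its own primitive gives half the square of
    its integral; together with the constant [C] this is the square of [f s]. It lets the Sobolev
    inequality be applied to [f ^ 2]. *)
Lemma acl_sqr a b f g : measurable_fun setT f ->
  (forall s, ~ (a < s < b) -> g s = 0) -> acl a b f g ->
  acl a b (fun s => f s ^+ 2) (fun s => 2 * (f s * g s)).
Proof.
move=> mf g0 aclfg; have [K fK] := acl_ae_bounded aclfg.
have [gi [C fC]] := aclfg.
have mg : measurable_fun setT g by case/integrableP : gi => /measurable_EFinP.
have fgi : leb1.-integrable setT (EFin \o (fun s => f s * g s)).
  apply: (integrable_ae_bdd (K := K)) => //; apply: filterS fK => s fK gs; apply: fK.
  by apply: contrapT => /g0 /eqP; rewrite (negbTE gs).
split; first by have := integrableZl measurableT 2 fgi; exact: eq_integrable.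
exists (C ^+ 2); apply: filterS (fC) => s /[apply] fs.
pose G t := \int[leb1]_(x in `]-oo, t]) g x.
pose gs t := g t * \1_`]-oo, s]%classic t.
have gsi : leb1.-integrable setT (EFin \o gs).
  by apply: (@integrable_bddM _ _ _ leb1 _ g (\1_`]-oo, s]%classic) 1) => //; exact: m1.
have Gs : \int[leb1]_t gs t = G s by rewrite /G; apply/esym/Rintegral_indic.
pose Gg t := \int[leb1]_(x in `]-oo, t]) gs x.
have parts := Rintegral_primitive_parts gsi gsi.
have symm : \int[leb1]_t (gs t * Gg t) = G s ^+ 2 / 2.
  have E : \int[leb1]_t (Gg t * gs t) = \int[leb1]_t (gs t * Gg t).
    by apply: eq_Rintegral => t _; rewrite mulrC.
  by move: parts; rewrite -/(Gg) E Gs; lra.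
have fgsi : leb1.-integrable setT (EFin \o (fun t => (f t * g t) * \1_`]-oo, s]%classic t)).
  by apply: (@integrable_bddM _ _ _ leb1 _ _ (\1_`]-oo, s]%classic) 1) => //; exact: m1.
have fgs2i : leb1.-integrable setT (EFin \o (fun t => 2 * (f t * g t) * \1_`]-oo, s]%classic t)).
  by have := integrableZl measurableT 2 fgsi; apply: eq_integrable => // t _; rewrite /= -EFinM; congr EFin; ring.
have mGg : measurable_fun setT (fun t => gs t * Gg t).
  have mgs : measurable_fun setT gs by case/integrableP : gsi => /measurable_EFinP.
  by apply: measurable_funM => //; exact: measurable_primitive.
have key : \int[leb1]_t ((f t * g t) * \1_`]-oo, s]%classic t) =
    \int[leb1]_t (C * gs t + gs t * Gg t).
  apply: ae_eq_Rintegral => //.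
  - by case/integrableP : fgsi => /measurable_EFinP.
  - apply: measurable_funD => //; apply: measurable_funM => //.
    by case/integrableP : gsi => /measurable_EFinP.
  apply: filterS fC => t ft _; have [tab|/g0 gt0] := pselect (a < t < b); last first.
    by rewrite /gs gt0 !(mulr0, mul0r) addr0.
  rewrite ft // -/(G t) /gs indicE; have [ts|ts] := leP t s; last first.
    rewrite memNset ?mulr0 ?mul0r ?addr0 //= in_itv /=; apply/negP; by rewrite -ltNge.
  rewrite mem_set ?mulr1 /= ?in_itv //; have -> : Gg t = G t.
    rewrite /Gg /G; apply: eq_Rintegral => x; rewrite inE /= in_itv /= => xt.
    by rewrite /gs indicE mem_set ?mulr1 //= in_itv /= (le_trans xt).
  by ring.
rewrite fs -/(G s) (_ : \int[leb1]_(t in `]-oo, s]) _ = 2 * \int[leb1]_t (f t * g t * \1_`]-oo, s]%classic t)); last first.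
  rewrite -RintegralZl // [LHS](@Rintegral_indic _ (fun t => 2 * (f t * g t))) //.
  by apply: eq_Rintegral => t _; rewrite !mulrA.
have Ggi : leb1.-integrable setT (EFin \o (fun t => gs t * Gg t)).
  apply: (le_integrable measurableT _ _ (integrableZl measurableT (\int[leb1]_x `|gs x|) gsi)).
    exact/measurable_EFinP.
  move=> t _ /=; rewrite lee_fin !normrM mulrC ler_wpM2r //.
  by apply: le_trans (normr_primitive_le t gsi) (ler_norm _).
rewrite key RintegralD //; last by have := integrableZl measurableT C gsi; exact: eq_integrable.
by rewrite RintegralZl // Gs symm; field.
Qed.

Lemma acl_integrable a b f g : measurable_fun setT f ->
  (forall s, ~ (a < s < b) -> f s = 0) -> acl a b f g -> leb1.-integrable setT (EFin \o f).
Proof.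
move=> mf f0 aclfg; have [K fK] := acl_ae_bounded aclfg.
have -> : f = (fun s => f s * \1_`]a, b[%classic s).
  apply/funext => s; rewrite indicE; have [|ns] := boolP (s \in _); first by rewrite mulr1.
  by rewrite mulr0 f0 // => sab; move: ns; rewrite notin_setE /= in_itv.
apply: (integrable_ae_bdd (K := K)) => //; first exact: integrable_indic_oo.
apply: filterS fK => s fK; rewrite indicE pnatr_eq0 eqb0 negbK inE /= in_itv /=.
exact: fK.
Qed.

(** Subtracting the mean averages the differences [f s - f t], each of which is at most the integral
    of [|g|]. Both the Sobolev and the Poincare inequality on boxes start from this bound. *)
Lemma acl_osc a b f g : a < b -> measurable_fun setT f ->
  (forall s, ~ (a < s < b) -> f s = 0) -> acl a b f g ->
  {ae leb1, forall s, a < s < b ->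
    `|f s - (b - a)^-1 * \int[leb1]_t f t| <= \int[leb1]_t `|g t|}.
Proof.
move=> ab mf f0 aclfg; have fi := acl_integrable mf f0 aclfg.
have [gi [C fC]] := aclfg; set M := \int[leb1]_t `|g t|.
pose I1 : R -> R := \1_`]a, b[%classic.
have I1i : leb1.-integrable setT (EFin \o I1) by exact: integrable_indic_oo.
have IE : \int[leb1]_t I1 t = b - a.
  transitivity (1 * fine (leb1 `]a, b[%classic)); last by rewrite leb1_oo //= mul1r.
  transitivity (\int[leb1]_(t in `]a, b[%classic) (cst 1 t : R)); last exact: Rintegral_cst.
  rewrite [RHS](@Rintegral_indic _ (cst 1)) //.
  by apply: eq_Rintegral => t _; rewrite mul1r.
have ba : 0 < b - a by rewrite subr_gt0.
apply: filterS (fC) => s hs sab.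
have -> : f s - (b - a)^-1 * \int[leb1]_t f t =
    (b - a)^-1 * \int[leb1]_t (f s * I1 t - f t).
  have fIi : leb1.-integrable setT (EFin \o (fun t => f s * I1 t)).
    by have := integrableZl measurableT (f s) I1i; exact: eq_integrable.
  rewrite RintegralB // RintegralZl // IE; field.
  by rewrite gt_eqF.
rewrite normrM gtr0_norm ?invr_gt0 // ler_pdivrMl //.
have di : leb1.-integrable setT (EFin \o (fun t => f s * I1 t - f t)).
  have := integrableB measurableT (integrableZl measurableT (f s) I1i) fi.
  exact: eq_integrable.
apply: le_trans (le_normr_Rintegral measurableT di) _.
rewrite -IE -RintegralZr //; apply: le_Rintegral_ae.
- exact: integrable_norm.
- by have := integrableZr measurableT M I1i; exact: eq_integrable.
apply: filterS fC => t ht; rewrite /I1 indicE; have [tab|ntab] := boolP (t \in _).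
  have tab' : a < t < b by move: tab; rewrite inE /= in_itv.
  rewrite mulr1 mul1r (hs sab) (ht tab') opprD addrACA subrr add0r.
  exact: primitive_diff_le.
rewrite mulr0 mul0r f0 ?subrr ?normr0 // => tab.
by move: ntab; rewrite notin_setE /= in_itv.
Qed.

End acl_lemmas.

(** * Hoelder and Loomis-Whitney inequalities *)

Section young.
Variable R : realType.
Implicit Types (x y a b al be : R).

Lemma weighted_young x y al be : 0 <= x -> 0 <= y -> 0 < al -> 0 < be ->
  al + be = 1 -> x `^ al * y `^ be <= al * x + be * y.
Proof.
move=> x0 y0 al0 be0 ab.
have := @conjugate_powR R (x `^ al) (y `^ be) al^-1 be^-1 (powR_ge0 _ _) (powR_ge0 _ _).
rewrite !invr_gt0 !invrK => /(_ al0 be0 ab).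
by rewrite -!powRrM !mulfV ?gt_eqF // !powRr1 // [al * x]mulrC [be * y]mulrC.
Qed.

(** Scaled so that, for [a] and [b] the integrals of two functions, integrating the inequality gives
    Hoelder's. *)
Lemma poweR_weighted_young (X Y : \bar R) a b al be : (0 <= X)%E -> (0 <= Y)%E ->
  0 < a -> 0 < b -> 0 < al -> 0 < be -> al + be = 1 ->
  (X `^ al * Y `^ be <= (a `^ al * b `^ be)%:E * ((al / a)%:E * X + (be / b)%:E * Y))%E.
Proof.
move=> X0 Y0 a0 b0 al0 be0 ab.
have k0 : 0 < a `^ al * b `^ be by rewrite mulr_gt0 ?powR_gt0.
have aa0 : (0 < (al / a)%:E)%E by rewrite lte_fin divr_gt0.
have bb0 : (0 < (be / b)%:E)%E by rewrite lte_fin divr_gt0.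
case: X X0 => [x| |//] X0; last first.
  by rewrite gt0_muley // addye ?gt0_muley ?leey ?lte_fin // -ltNye (lt_le_trans (ltNyr 0)) // mule_ge0 // ltW.
case: Y Y0 => [y| |//] Y0; last first.
  by rewrite (gt0_muley bb0) -EFinM addey // gt0_muley ?leey ?lte_fin.
rewrite !poweR_EFin -!EFinM lee_fin.
rewrite lee_fin in X0; rewrite lee_fin in Y0.
have := @weighted_young (x / a) (y / b) al be (divr_ge0 X0 (ltW a0)) (divr_ge0 Y0 (ltW b0)) al0 be0 ab.
have xE : x `^ al = a `^ al * (x / a) `^ al.
  by rewrite -powRM ?(ltW a0) ?divr_ge0 ?(ltW a0) // mulrCA divff ?mulr1 // gt_eqF.
have yE : y `^ be = b `^ be * (y / b) `^ be.
  by rewrite -powRM ?(ltW b0) ?divr_ge0 ?(ltW b0) // mulrCA divff ?mulr1 // gt_eqF.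
rewrite xE yE mulrACA ler_pM2l //.
by rewrite mulrA mulrAC [be * _]mulrA [be * y / b]mulrAC.
Qed.

End young.

Section hoelder_nonneg.
Context d (T : measurableType d) (R : realType) (mu : {measure set T -> \bar R}).
Implicit Types (F G H : T -> \bar R).
Local Open Scope ereal_scope.

Lemma measurable_poweR F (r : R) : measurable_fun setT F ->
  measurable_fun setT (fun x => F x `^ r).
Proof. exact: (measurableT_comp (measurable_poweR r)). Qed.

Lemma ae_eq0_integral F : measurable_fun setT F -> (forall x, 0 <= F x) ->
  \int[mu]_x F x = 0 -> {ae mu, forall x, F x = 0}.
Proof.
move=> mF F0 F0'; have : ae_eq mu setT F (cst 0).
  apply/ae_eq_integral_abs => //; rewrite -F0'.
  by apply: eq_integral => x _; rewrite gee0_abs.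
by apply: filterS => x /(_ I).
Qed.

Lemma integral_ae_eq0 F : measurable_fun setT F -> {ae mu, forall x, F x = 0} ->
  \int[mu]_x F x = 0.
Proof.
move=> mF F0; rewrite -[RHS](integral0 mu setT); apply: ae_eq_integral => //.
by apply: filterS F0 => x -> .
Qed.

(** Zero and infinite integrals are treated first; in the remaining case the scaled Young inequality
    is integrated. The form with exponents on the integrals avoids roots of powers in the later
    bookkeeping. *)
Lemma hoelder_ge0 F G (al be : R) : measurable_fun setT F -> measurable_fun setT G ->
  (forall x, 0 <= F x) -> (forall x, 0 <= G x) -> (0 < al)%R -> (0 < be)%R ->
  (al + be = 1)%R ->
  \int[mu]_x (F x `^ al * G x `^ be) <= (\int[mu]_x F x) `^ al * (\int[mu]_x G x) `^ be.
Proof.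
move=> mF mG F0 G0 al0 be0 ab.
have mFG : measurable_fun setT (fun x => F x `^ al * G x `^ be).
  by apply: emeasurable_funM; exact: measurable_poweR.
have alN : al != 0%R by rewrite gt_eqF.
have beN : be != 0%R by rewrite gt_eqF.
have [A0|A0] := eqVneq (\int[mu]_x F x) 0.
  rewrite A0 poweR0r // mul0e integral_ae_eq0 //.
  by apply: filterS (ae_eq0_integral mF F0 A0) => x ->; rewrite poweR0r // mul0e.
have [B0|B0] := eqVneq (\int[mu]_x G x) 0.
  rewrite B0 poweR0r // mule0 integral_ae_eq0 //.
  by apply: filterS (ae_eq0_integral mG G0 B0) => x ->; rewrite poweR0r // mule0.
have Ap : 0 < \int[mu]_x F x by rewrite lt0e A0 integral_ge0.
have Bp : 0 < \int[mu]_x G x by rewrite lt0e B0 integral_ge0.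
have [Ay|Ay] := eqVneq (\int[mu]_x F x) +oo.
  by rewrite Ay poweRyr // gt0_mulye ?leey // poweR_gt0.
have [By|By] := eqVneq (\int[mu]_x G x) +oo.
  by rewrite By poweRyr // gt0_muley ?leey // poweR_gt0.
pose a := fine (\int[mu]_x F x); pose b := fine (\int[mu]_x G x).
have AE : \int[mu]_x F x = a%:E by rewrite fineK // fin_numE Ay andbT -ltNye (lt_trans _ Ap).
have BE : \int[mu]_x G x = b%:E by rewrite fineK // fin_numE By andbT -ltNye (lt_trans _ Bp).
have a0 : (0 < a)%R by rewrite -lte_fin -AE.
have b0 : (0 < b)%R by rewrite -lte_fin -BE.
have aa0 : (0 <= al / a)%R by rewrite divr_ge0 // ltW.
have bb0 : (0 <= be / b)%R by rewrite divr_ge0 // ltW.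
have mS : measurable_fun setT (fun x => (al / a)%:E * F x + (be / b)%:E * G x).
  exact: (emeasurable_funD (measurable_funeM _ mF) (measurable_funeM _ mG)).
apply: (@le_trans _ _ (\int[mu]_x ((a `^ al * b `^ be)%:E * ((al / a)%:E * F x + (be / b)%:E * G x)))).
  apply: ge0_le_integral => //.
  - by move=> x _; rewrite mule_ge0 ?poweR_ge0.
  - apply: emeasurable_funM; first exact: measurable_cst.
    exact: mS.
  - by move=> x _; exact: poweR_weighted_young.
rewrite ge0_integralZl //; last 2 first.
- by move=> x _; rewrite adde_ge0 // mule_ge0.
- by rewrite lee_fin mulr_ge0 // powR_ge0.
rewrite ge0_integralD //; last 4 first.
- by move=> x _; rewrite mule_ge0.
- exact: measurable_funeM.
- by move=> x _; rewrite mule_ge0.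
- exact: measurable_funeM.
rewrite !ge0_integralZl // ?lee_fin // AE BE !poweR_EFin -!EFinM lee_fin.
by rewrite !divfK ?gt_eqF // ab mulr1.
Qed.

Lemma hoelder3_ge0 F G H (al be ga : R) : measurable_fun setT F ->
  measurable_fun setT G -> measurable_fun setT H ->
  (forall x, 0 <= F x) -> (forall x, 0 <= G x) -> (forall x, 0 <= H x) ->
  (0 < al)%R -> (0 < be)%R -> (0 < ga)%R -> (al + be + ga = 1)%R ->
  \int[mu]_x (F x `^ al * G x `^ be * H x `^ ga) <=
  (\int[mu]_x F x) `^ al * (\int[mu]_x G x) `^ be * (\int[mu]_x H x) `^ ga.
Proof.
move=> mF mG mH F0 G0 H0 al0 be0 ga0 abg.
have bg0 : (0 < be + ga)%R by rewrite addr_gt0.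
have bgN : (be + ga != 0)%R by rewrite gt_eqF.
pose K x := G x `^ (be / (be + ga)) * H x `^ (ga / (be + ga)).
have mK : measurable_fun setT K by apply: emeasurable_funM; exact: measurable_poweR.
have K0 x : 0 <= K x by rewrite mule_ge0 ?poweR_ge0.
rewrite (eq_integral (fun x => F x `^ al * K x `^ (be + ga))); last first.
  move=> x _; rewrite /K poweRM ?poweR_ge0 // -!poweRrM !divfK // muleA //.
apply: le_trans (hoelder_ge0 mF mK F0 K0 al0 bg0 _) _; first by rewrite addrA.
rewrite -muleA lee_wpmul2l ?poweR_ge0 //.
apply: (@le_trans _ _ (((\int[mu]_x G x) `^ (be / (be + ga)) * (\int[mu]_x H x) `^ (ga / (be + ga))) `^ (be + ga))).
  apply: gt0_ler_poweR; rewrite ?(ltW bg0) //.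
  - by rewrite in_itv /= leey andbT integral_ge0.
  - by rewrite in_itv /= leey andbT mule_ge0 ?poweR_ge0.
  - apply: hoelder_ge0 => //; rewrite ?divr_gt0 //.
    by rewrite -mulrDl divff.
by rewrite poweRM ?poweR_ge0 // -!poweRrM !divfK.
Qed.

(** Jensen's inequality, obtained as Hoelder's inequality against the indicator function of [D]. *)
Lemma poweR_integral_le F (D : set T) (l m : R) : measurable D -> mu D <= l%:E ->
  measurable_fun setT F -> (forall x, 0 <= F x) -> (forall x, ~ D x -> F x = 0) ->
  (1 < m)%R ->
  (\int[mu]_x F x) `^ m <= (l `^ (m - 1))%:E * \int[mu]_x (F x `^ m).
Proof.
move=> mD Dl mF F0 FD m1.
have m0 : (0 < m)%R by rewrite (lt_trans ltr01).
have mN : (m != 0)%R by rewrite gt_eqF.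
have m10 : (0 < 1 - m^-1)%R by rewrite subr_gt0 invf_lt1.
pose ind x : \bar R := (\1_D x)%:E.
have mind : measurable_fun setT ind by apply/measurable_EFinP; exact: measurable_indic.
have ind0 x : 0 <= ind x by rewrite lee_fin indicE.
have indE : \int[mu]_x ind x = mu D by rewrite integral_indic // setIT.
have l0 : (0 <= l)%R by rewrite -lee_fin (le_trans _ Dl).
have FE x : F x = (F x `^ m) `^ m^-1 * ind x `^ (1 - m^-1).
  rewrite -poweRrM mulfV // poweRe1 // /ind indicE.
  have [xD|xD] := boolP (x \in D); first by rewrite poweR1r mule1.
  by rewrite FD ?mul0e //; move: xD; rewrite notin_setE.
rewrite [X in X `^ m <= _](_ : _ = \int[mu]_x ((F x `^ m) `^ m^-1 * ind x `^ (1 - m^-1))); last first.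
  by apply: eq_integral => x _; exact: FE.
have H := hoelder_ge0 (measurable_poweR m mF) mind (fun x => poweR_ge0 _ _) ind0 (_ : 0 < m^-1)%R m10 _.
apply: (@le_trans _ _ (((\int[mu]_x (F x `^ m)) `^ m^-1 * (\int[mu]_x ind x) `^ (1 - m^-1)) `^ m)).
  apply: gt0_ler_poweR; rewrite ?(ltW m0) //.
  - by rewrite in_itv /= leey andbT integral_ge0 // => x _; rewrite mule_ge0 ?poweR_ge0.
  - by rewrite in_itv /= leey andbT mule_ge0 ?poweR_ge0.
  - by apply: H; rewrite ?invr_gt0 // addrC subrK.
rewrite poweRM ?poweR_ge0 // -!poweRrM mulVf // poweRe1; last first.
  by apply: integral_ge0 => x _; exact: poweR_ge0.
rewrite muleC mulrBl mul1r mulVf // indE lee_wpmul2r //.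
  by apply: integral_ge0 => x _; exact: poweR_ge0.
rewrite -poweR_EFin; apply: gt0_ler_poweR => //; first by rewrite subr_ge0 ltW.
- by rewrite in_itv /= leey andbT.
- by rewrite in_itv /= leey andbT lee_fin.
Qed.

End hoelder_nonneg.

Section tonelli.
Variable R : realType.
Local Open Scope ereal_scope.

Lemma measurable_section1 d1 d2 d3 (T1 : measurableType d1) (T2 : measurableType d2)
    (T3 : measurableType d3) (F : T1 * T2 -> T3) y :
  measurable_fun setT F -> measurable_fun setT (fun x => F (x, y)).
Proof. by move=> mF; exact: (measurableT_comp mF (measurable_pair2 y)). Qed.

Lemma measurable_section2 d1 d2 d3 (T1 : measurableType d1) (T2 : measurableType d2)
    (T3 : measurableType d3) (F : T1 * T2 -> T3) x :
  measurable_fun setT F -> measurable_fun setT (fun y => F (x, y)).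
Proof. by move=> mF; exact: (measurableT_comp mF (measurable_pair1 x)). Qed.

Variable F : space3 R -> \bar R.
Hypotheses (mF : measurable_fun setT F) (F0 : forall x, 0 <= F x).

Lemma leb3_tonelli_cba :
  \int[leb3]_x F x = \int[leb1]_c \int[leb1]_b \int[leb1]_a F (a, b, c).
Proof.
transitivity (\int[leb1]_c \int[leb2]_x F (x, c)).
  exact: (@fubini_tonelli2 _ _ _ _ R leb2 leb1 F).
apply: eq_integral => c _.
apply: (@fubini_tonelli2 _ _ _ _ R leb1 leb1 (fun x => F (x, c))) => //.
exact: measurable_section1.
Qed.

Lemma leb3_tonelli_cab :
  \int[leb3]_x F x = \int[leb1]_c \int[leb1]_a \int[leb1]_b F (a, b, c).
Proof.
transitivity (\int[leb1]_c \int[leb2]_x F (x, c)).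
  exact: (@fubini_tonelli2 _ _ _ _ R leb2 leb1 F).
apply: eq_integral => c _.
apply: (@fubini_tonelli1 _ _ _ _ R leb1 leb1 (fun x => F (x, c))) => //.
exact: measurable_section1.
Qed.

Lemma leb3_tonelli_bac :
  \int[leb3]_x F x = \int[leb1]_b \int[leb1]_a \int[leb1]_c F (a, b, c).
Proof.
transitivity (\int[leb2]_x \int[leb1]_c F (x, c)).
  exact: (@fubini_tonelli1 _ _ _ _ R leb2 leb1 F).
apply: (@fubini_tonelli2 _ _ _ _ R leb1 leb1 (fun x => \int[leb1]_c F (x, c))) => //.
  exact: (measurable_fun_fubini_tonelli_F F).
by move=> x; exact: integral_ge0.
Qed.

End tonelli.

Section loomis_whitney.
Variable R : realType.
Variables F1 F2 F3 : R * R -> \bar R.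
Hypotheses (m1 : measurable_fun setT F1) (m2 : measurable_fun setT F2) (m3 : measurable_fun setT F3).
Local Open Scope ereal_scope.
Hypotheses (p1 : forall z, 0 <= F1 z) (p2 : forall z, 0 <= F2 z) (p3 : forall z, 0 <= F3 z).

Let h : (0 < 2^-1 :> R)%R. Proof. by []. Qed.
Let hh : (2^-1 + 2^-1 = 1 :> R)%R. Proof. by rewrite [RHS](splitr 1) !div1r. Qed.

(** In each variable one of the three factors is constant, and Cauchy-Schwarz applies to the other
    two; doing this for [a], [b] and [c] in turn produces the three double integrals. *)
Lemma loomis_whitney :
  \int[leb1]_c \int[leb1]_b \int[leb1]_a
    (F1 (b, c) `^ 2^-1 * (F2 (a, c) `^ 2^-1 * F3 (a, b) `^ 2^-1)) <=
  (\int[leb1]_c \int[leb1]_b F1 (b, c)) `^ 2^-1 *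
  ((\int[leb1]_c \int[leb1]_a F2 (a, c)) `^ 2^-1 *
   (\int[leb1]_b \int[leb1]_a F3 (a, b)) `^ 2^-1).
Proof.
pose A2 c := \int[leb1]_a F2 (a, c); pose A3 b := \int[leb1]_a F3 (a, b).
pose B1 c := \int[leb1]_b F1 (b, c); pose K := \int[leb1]_b A3 b.
have mA2 : measurable_fun setT A2 by exact: (measurable_fun_fubini_tonelli_G F2).
have mA3 : measurable_fun setT A3 by exact: (measurable_fun_fubini_tonelli_G F3).
have mB1 : measurable_fun setT B1 by exact: (measurable_fun_fubini_tonelli_G F1).
have A20 c : 0 <= A2 c by exact: integral_ge0.
have A30 c : 0 <= A3 c by exact: integral_ge0.
have B10 c : 0 <= B1 c by exact: integral_ge0.
have K0 : 0 <= K by exact: integral_ge0.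
pose G (z : space3 R) := F1 (z.1.2, z.2) `^ 2^-1 *
  (F2 (z.1.1, z.2) `^ 2^-1 * F3 z.1 `^ 2^-1).
have mG : measurable_fun setT G.
  apply: emeasurable_funM; last apply: emeasurable_funM; apply: measurable_poweR.
  - apply: (measurableT_comp m1); apply: measurable_fun_pair => /=; last exact: measurable_snd.
    exact: (measurableT_comp measurable_snd measurable_fst).
  - apply: (measurableT_comp m2); apply: measurable_fun_pair => /=; last exact: measurable_snd.
    exact: (measurableT_comp measurable_fst measurable_fst).
  - exact: (measurableT_comp m3 measurable_fst).
have G0 z : 0 <= G z by rewrite !mule_ge0 ?poweR_ge0.
have sa b c : \int[leb1]_a (F1 (b, c) `^ 2^-1 * (F2 (a, c) `^ 2^-1 * F3 (a, b) `^ 2^-1)) <=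
    F1 (b, c) `^ 2^-1 * A3 b `^ 2^-1 * A2 c `^ 2^-1.
  rewrite ge0_integralZl ?poweR_ge0 //; last first.
    by move=> a _; rewrite mule_ge0 ?poweR_ge0.
    apply: emeasurable_funM; apply: measurable_poweR; exact: measurable_section1.
  rewrite -muleA lee_wpmul2l ?poweR_ge0 // muleC.
  rewrite [leRHS]muleC; under eq_integral do rewrite muleC.
  apply: (@hoelder_ge0 _ _ _ leb1 (fun x => F3 (x, b)) (fun x => F2 (x, c))) => //; exact: measurable_section1.
have sb c : \int[leb1]_b (F1 (b, c) `^ 2^-1 * A3 b `^ 2^-1 * A2 c `^ 2^-1) <=
    A2 c `^ 2^-1 * B1 c `^ 2^-1 * K `^ 2^-1.
  rewrite ge0_integralZr ?poweR_ge0 //; last 2 first.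
  - apply: emeasurable_funM; apply: measurable_poweR => //; exact: measurable_section1.
  - by move=> b _; rewrite mule_ge0 ?poweR_ge0.
  rewrite muleC -muleA lee_wpmul2l ?poweR_ge0 //.
  apply: hoelder_ge0 => //; exact: measurable_section1.
apply: (@le_trans _ _ (\int[leb1]_c (A2 c `^ 2^-1 * B1 c `^ 2^-1 * K `^ 2^-1))); last first.
  rewrite ge0_integralZr ?poweR_ge0 //; last 2 first.
  - by apply: emeasurable_funM; exact: measurable_poweR.
  - by move=> b _; rewrite mule_ge0 ?poweR_ge0.
  rewrite muleA lee_wpmul2r ?poweR_ge0 // [leRHS]muleC.
  exact: hoelder_ge0.
have mGa : measurable_fun setT (fun z : R * R => \int[leb1]_a G (a, z.1, z.2)).
  pose G' (w : space3 R) := G (w.2, w.1.1, w.1.2).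
  apply: (measurable_fun_fubini_tonelli_F G'); last by move=> w; exact: G0.
  apply: (measurableT_comp mG); apply: measurable_fun_pair => /=.
    apply: measurable_fun_pair => /=; first exact: measurable_snd.
    exact: (measurableT_comp measurable_fst measurable_fst).
  exact: (measurableT_comp measurable_snd measurable_fst).
apply: ge0_le_integral => //.
- by move=> c _; apply: integral_ge0 => b _; apply: integral_ge0 => a _; exact: (G0 (a, b, c)).
- apply: (measurable_fun_fubini_tonelli_G (fun z : R * R => \int[leb1]_a G (a, z.1, z.2))) => // z.
  by apply: integral_ge0 => a _; exact: G0.
- by apply: emeasurable_funM; [apply: emeasurable_funM|]; apply: measurable_poweR.
- move=> c _; apply: le_trans (sb c); apply: ge0_le_integral => //.
  + by move=> b _; apply: integral_ge0 => a _; exact: (G0 (a, b, c)).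
  + exact: (@measurable_section1 _ _ _ _ _ _ (fun z : R * R => \int[leb1]_a G (a, z.1, z.2)) c mGa).
  + apply: emeasurable_funM; last exact: measurable_cst.
    by apply: emeasurable_funM; apply: measurable_poweR => //; exact: measurable_section1.
Qed.

End loomis_whitney.

Lemma le_iterated_integral (R : realType) (f g : R -> R -> \bar R) (k : R) : (0 <= k)%R ->
  (forall s t, 0 <= f s t)%E -> (forall s t, 0 <= g s t)%E ->
  measurable_fun setT (fun z : R * R => f z.1 z.2) ->
  measurable_fun setT (fun z : R * R => g z.1 z.2) ->
  (forall s t, f s t <= k%:E * g s t)%E ->
  (\int[leb1]_s \int[leb1]_t f s t <= k%:E * \int[leb1]_s \int[leb1]_t g s t)%E.
Proof.
move=> k0 f0 g0 mf mg fg.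
have mf2 s : measurable_fun setT (f s).
  exact: (@measurable_section2 _ _ _ _ _ _ (fun z : R * R => f z.1 z.2) s mf).
have mg2 s : measurable_fun setT (g s).
  exact: (@measurable_section2 _ _ _ _ _ _ (fun z : R * R => g z.1 z.2) s mg).
have mfi : measurable_fun setT (fun s => \int[leb1]_t f s t)%E.
  exact: (@measurable_fun_fubini_tonelli_F _ _ _ _ R leb1 (fun z : R * R => f z.1 z.2) mf (fun z => f0 _ _)).
have mgi : measurable_fun setT (fun s => \int[leb1]_t g s t)%E.
  exact: (@measurable_fun_fubini_tonelli_F _ _ _ _ R leb1 (fun z : R * R => g z.1 z.2) mg (fun z => g0 _ _)).
rewrite -ge0_integralZl //; last by move=> s _; exact: integral_ge0.
apply: ge0_le_integral => //.
- by move=> s _; exact: integral_ge0.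
- exact: measurable_funeM.
- move=> s _; rewrite -ge0_integralZl //; apply: ge0_le_integral => //.
  exact: measurable_funeM.
Qed.

(** * Gagliardo-Nirenberg inequality for functions dominated by line integrals *)

Section gagliardo.
Variable R : realType.
Implicit Types (h w : space3 R -> R).
Local Open Scope ereal_scope.

Definition line_dominated h w : Prop :=
  {ae leb3, forall x, [/\ (h x)%:E <= \int[leb1]_s (w (s, x.1.2, x.2))%:E,
    (h x)%:E <= \int[leb1]_s (w (x.1.1, s, x.2))%:E &
    (h x)%:E <= \int[leb1]_s (w (x.1.1, x.1.2, s))%:E]}.

(** Each of the three line integrals of [w] dominates [h], so [h ^ (3 q / 2)] is at most the product
    of the square roots of their [q]-th powers. Loomis-Whitney applies to this product, and Jensen's
    inequality on lines of length at most [l] gives the factor [l ^ (q - 1)]. *)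
Lemma gagliardo h w (I1 I2 I3 : set R) (l q : R) :
  measurable_fun setT h -> measurable_fun setT w -> (forall x, 0 <= h x)%R ->
  (forall x, 0 <= w x)%R -> measurable I1 -> measurable I2 -> measurable I3 ->
  leb1 I1 <= l%:E -> leb1 I2 <= l%:E -> leb1 I3 <= l%:E ->
  (forall x, ~ (I1 x.1.1 /\ I2 x.1.2 /\ I3 x.2) -> w x = 0%R) -> (1 < q)%R ->
  line_dominated h w ->
  \int[leb3]_x ((h x `^ (3 * q / 2))%R)%:E <=
  ((l `^ (q - 1))%:E * \int[leb3]_x ((w x `^ q)%R)%:E) `^ (3 / 2).
Proof.
move=> mh mw h0 w0 mI1 mI2 mI3 lI1 lI2 lI3 wI q1 hw.
have q0 : (0 < q)%R by rewrite (lt_trans ltr01).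
pose W (x : space3 R) := (w x)%:E.
have mW : measurable_fun setT W by exact/measurable_EFinP.
have W0 x : 0 <= W x by rewrite lee_fin.
pose Wq (x : space3 R) := W x `^ q.
have mWq : measurable_fun setT Wq by exact: measurable_poweR.
have Wq0 x : 0 <= Wq x by exact: poweR_ge0.
pose J := \int[leb3]_x ((w x `^ q)%R)%:E.
pose k := (l `^ (q - 1))%:E.
have J_E : \int[leb3]_x Wq x = J by apply: eq_integral.
pose P1 (x : space3 R) := W (x.2, x.1.1, x.1.2).
pose P2 (x : space3 R) := W (x.1.1, x.2, x.1.2).
have mp1 : measurable_fun setT P1.
  apply: (measurableT_comp mW); apply: measurable_fun_pair => /=.
    apply: measurable_fun_pair => /=; first exact: measurable_snd.
    exact: (measurableT_comp measurable_fst measurable_fst).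
  exact: (measurableT_comp measurable_snd measurable_fst).
have mp2 : measurable_fun setT P2.
  apply: (measurableT_comp mW); apply: measurable_fun_pair => /=.
    apply: measurable_fun_pair => /=; last exact: measurable_snd.
    exact: (measurableT_comp measurable_fst measurable_fst).
  exact: (measurableT_comp measurable_snd measurable_fst).
pose F1 (z : R * R) := (\int[leb1]_s W (s, z.1, z.2)) `^ q.
pose F2 (z : R * R) := (\int[leb1]_s W (z.1, s, z.2)) `^ q.
pose F3 (z : R * R) := (\int[leb1]_s W (z.1, z.2, s)) `^ q.
have mF1 : measurable_fun setT F1.
  apply: measurable_poweR.
  by apply: (measurable_fun_fubini_tonelli_F P1) => // z; exact: W0.
have mF2 : measurable_fun setT F2.
  apply: measurable_poweR.
  by apply: (measurable_fun_fubini_tonelli_F P2) => // z; exact: W0.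
have mF3 : measurable_fun setT F3.
  apply: measurable_poweR.
  have -> : (fun z : R * R => \int[leb1]_s W (z.1, z.2, s)) = fubini_F leb1 W.
    by apply/funext => -[].
  exact: (measurable_fun_fubini_tonelli_F W).
have F10 z : 0 <= F1 z by exact: poweR_ge0.
have F20 z : 0 <= F2 z by exact: poweR_ge0.
have F30 z : 0 <= F3 z by exact: poweR_ge0.
have mW1 b c : measurable_fun setT (fun s => W (s, b, c)).
  exact: (measurableT_comp (@measurable_section1 _ _ _ _ _ _ W c mW) (measurable_pair2 b)).
have mW2 a c : measurable_fun setT (fun s => W (a, s, c)).
  exact: (measurableT_comp (@measurable_section1 _ _ _ _ _ _ W c mW) (measurable_pair1 a)).
have mW3 a b : measurable_fun setT (fun s => W (a, b, s)) by exact: measurable_section2.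
have jensen1 b c : F1 (b, c) <= k * \int[leb1]_s Wq (s, b, c).
  apply: (poweR_integral_le mI1 lI1) => // s ns.
  by rewrite /W wI // => -[].
have jensen2 a c : F2 (a, c) <= k * \int[leb1]_s Wq (a, s, c).
  apply: (poweR_integral_le mI2 lI2) => // s ns.
  by rewrite /W wI // => -[_ []].
have jensen3 a b : F3 (a, b) <= k * \int[leb1]_s Wq (a, b, s).
  apply: (poweR_integral_le mI3 lI3) => // s ns.
  by rewrite /W wI // => -[_ []].
have le_poweR (X Y : \bar R) (r : R) : (0 <= r)%R -> 0 <= X -> X <= Y -> X `^ r <= Y `^ r.
  move=> r0 X0 XY; apply: gt0_ler_poweR => //; rewrite in_itv /= leey andbT //.
  exact: le_trans XY.
have k0 : 0 <= k by rewrite lee_fin powR_ge0.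
have mswap : measurable_fun setT (fun z : R * R => (z.2, z.1)).
  by apply: measurable_fun_pair; [exact: measurable_snd|exact: measurable_fst].
have mQ1 : measurable_fun setT (fun z : R * R => \int[leb1]_s Wq (s, z.1, z.2)).
  apply: (measurable_fun_fubini_tonelli_F (fun x => P1 x `^ q)) => //; first exact: measurable_poweR.
  by move=> z; exact: poweR_ge0.
have mQ2 : measurable_fun setT (fun z : R * R => \int[leb1]_s Wq (z.1, s, z.2)).
  apply: (measurable_fun_fubini_tonelli_F (fun x => P2 x `^ q)) => //; first exact: measurable_poweR.
  by move=> z; exact: poweR_ge0.
have mQ3 : measurable_fun setT (fun z : R * R => \int[leb1]_s Wq (z.1, z.2, s)).
  have -> : (fun z : R * R => \int[leb1]_s Wq (z.1, z.2, s)) = fubini_F leb1 Wq.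
    by apply/funext => -[].
  exact: (measurable_fun_fubini_tonelli_F Wq).
have kZ1 : \int[leb1]_c \int[leb1]_b F1 (b, c) <= k * J.
  rewrite -J_E leb3_tonelli_cba //.
  exact: (@le_iterated_integral R (fun c b => F1 (b, c)) (fun c b => \int[leb1]_s Wq (s, b, c))
    (l `^ (q - 1))%R (powR_ge0 _ _) (fun _ _ => F10 _)
    (fun _ _ => integral_ge0 _ (fun _ _ => Wq0 _))
    (measurableT_comp mF1 mswap) (measurableT_comp mQ1 mswap) (fun c b => jensen1 b c)).
have kZ2 : \int[leb1]_c \int[leb1]_a F2 (a, c) <= k * J.
  rewrite -J_E leb3_tonelli_cab //.
  exact: (@le_iterated_integral R (fun c a => F2 (a, c)) (fun c a => \int[leb1]_s Wq (a, s, c))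
    (l `^ (q - 1))%R (powR_ge0 _ _) (fun _ _ => F20 _)
    (fun _ _ => integral_ge0 _ (fun _ _ => Wq0 _))
    (measurableT_comp mF2 mswap) (measurableT_comp mQ2 mswap) (fun c a => jensen2 a c)).
have kZ3 : \int[leb1]_b \int[leb1]_a F3 (a, b) <= k * J.
  rewrite -J_E leb3_tonelli_bac //.
  exact: (@le_iterated_integral R (fun b a => F3 (a, b)) (fun b a => \int[leb1]_s Wq (a, b, s))
    (l `^ (q - 1))%R (powR_ge0 _ _) (fun _ _ => F30 _)
    (fun _ _ => integral_ge0 _ (fun _ _ => Wq0 _))
    (measurableT_comp mF3 mswap) (measurableT_comp mQ3 mswap) (fun b a => jensen3 a b)).
pose L (x : space3 R) := F1 (x.1.2, x.2) `^ 2^-1 *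
  (F2 (x.1.1, x.2) `^ 2^-1 * F3 x.1 `^ 2^-1).
have mL : measurable_fun setT L.
  apply: emeasurable_funM; last apply: emeasurable_funM; apply: measurable_poweR.
  - apply: (measurableT_comp mF1); apply: measurable_fun_pair => /=; last exact: measurable_snd.
    exact: (measurableT_comp measurable_snd measurable_fst).
  - apply: (measurableT_comp mF2); apply: measurable_fun_pair => /=; last exact: measurable_snd.
    exact: (measurableT_comp measurable_fst measurable_fst).
  - exact: (measurableT_comp mF3 measurable_fst).
have L0 x : 0 <= L x by rewrite !mule_ge0 ?poweR_ge0.
have h2 : (0 <= 2^-1 :> R)%R by [].
have split3 (X : \bar R) : X `^ (3 * q / 2) = (X `^ q) `^ 2^-1 * ((X `^ q) `^ 2^-1 * (X `^ q) `^ 2^-1).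
  rewrite -!poweRrM -!poweRD; first by congr (_ `^ _); lra.
  - by apply: add_neq0_poweRD_def; rewrite gt_eqF //; lra.
  - by apply: add_neq0_poweRD_def; rewrite gt_eqF //; lra.
apply: (@le_trans _ _ (\int[leb3]_x L x)).
  apply: ae_ge0_le_integral => //.
  - by move=> x _; rewrite lee_fin powR_ge0.
  - apply/measurable_EFinP; exact: (measurableT_comp (measurable_powR _) mh).
  - apply: filterS hw => x [h1 h2' h3] _; rewrite -poweR_EFin split3.
    have hx : 0 <= (h x)%:E by rewrite lee_fin.
    apply: lee_pmul; rewrite ?mule_ge0 ?poweR_ge0 //.
      by apply: (le_poweR); rewrite ?poweR_ge0 //; apply: (le_poweR) => //; exact: ltW.
    apply: lee_pmul; rewrite ?poweR_ge0 //.
      by apply: (le_poweR); rewrite ?poweR_ge0 //; apply: (le_poweR) => //; exact: ltW.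
    apply: (le_poweR); rewrite ?poweR_ge0 //; apply: (le_poweR) => //; first exact: ltW.
rewrite leb3_tonelli_cba //; apply: le_trans (loomis_whitney mF1 mF2 mF3 F10 F20 F30) _.
have -> : (k * J) `^ (3 / 2) = (k * J) `^ 2^-1 * ((k * J) `^ 2^-1 * (k * J) `^ 2^-1).
  rewrite -!poweRD; first by congr (_ `^ _); lra.
  - by apply: add_neq0_poweRD_def; rewrite gt_eqF //; lra.
  - by apply: add_neq0_poweRD_def; rewrite gt_eqF //; lra.
have i0 (f : R -> R -> \bar R) : (forall s t, 0 <= f s t) -> 0 <= \int[leb1]_s \int[leb1]_t f s t.
  by move=> f0; apply: integral_ge0 => s _; exact: integral_ge0.
apply: lee_pmul; [exact: poweR_ge0|by rewrite mule_ge0 ?poweR_ge0| |].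
  exact: (le_poweR _ _ _ h2 (i0 _ (fun _ _ => F10 _)) kZ1).
apply: lee_pmul; [exact: poweR_ge0|exact: poweR_ge0| |].
  exact: (le_poweR _ _ _ h2 (i0 _ (fun _ _ => F20 _)) kZ2).
exact: (le_poweR _ _ _ h2 (i0 _ (fun _ _ => F30 _)) kZ3).
Qed.

End gagliardo.

(** * Poincare inequality on boxes *)

Section insertion.
Variable R : realType.

(** [ins] and [del] allow the three coordinate directions to be treated alike; [y] holds the other
    two coordinates in increasing order. *)
Definition ins (i : 'I_3) (y : R * R) (s : R) : space3 R :=
  if i == 0%N :> nat then (s, y.1, y.2)
  else if i == 1%N :> nat then (y.1, s, y.2) else (y.1, y.2, s).

Definition del (i : 'I_3) (x : space3 R) : R * R :=
  if i == 0%N :> nat then (x.1.2, x.2)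
  else if i == 1%N :> nat then (x.1.1, x.2) else x.1.

Lemma coordsE (x : space3 R) (i : 'I_3) : coords x i =
  if i == 0%N :> nat then x.1.1 else if i == 1%N :> nat then x.1.2 else x.2.
Proof. by case: i => -[|[|[|//]]] ?; rewrite /coords (tnth_nth 0). Qed.

Lemma coords_ins i y s : coords (ins i y s) i = s.
Proof. by rewrite coordsE /ins; case: i => -[|[|[|//]]] ?. Qed.

Lemma del_ins i y s : del i (ins i y s) = y.
Proof. by case: y => y1 y2; rewrite /ins /del; case: i => -[|[|[|//]]] ?. Qed.

Lemma ins_del i x : ins i (del i x) (coords x i) = x.
Proof.
by case: x => -[a b] c; rewrite coordsE /ins /del; case: i => -[|[|[|//]]] ?.
Qed.

Let m11 : measurable_fun setT (fun z : space3 R => z.1.1).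
Proof. exact: (measurableT_comp measurable_fst measurable_fst). Qed.
Let m12 : measurable_fun setT (fun z : space3 R => z.1.2).
Proof. exact: (measurableT_comp measurable_snd measurable_fst). Qed.
Let m2 : measurable_fun setT (fun z : space3 R => z.2).
Proof. exact: measurable_snd. Qed.

Lemma measurable_coords i : measurable_fun setT (fun x : space3 R => coords x i).
Proof.
rewrite (_ : (fun x => _) = fun x : space3 R =>
  if i == 0%N :> nat then x.1.1 else if i == 1%N :> nat then x.1.2 else x.2).
  by case: i => -[|[|[|//]]] ?.
by apply/funext => x; rewrite coordsE.
Qed.

Lemma measurable_ins i : measurable_fun setT (fun z : space3 R => ins i z.1 z.2).
Proof.
by case: i => -[|[|[|//]]] ?; rewrite /ins /=;
  do 2 ?[apply: measurable_fun_pair => //=].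
Qed.

Lemma measurable_del i : measurable_fun setT (@del i).
Proof.
case: i => -[|[|[|//]]] ?; rewrite /del /=; last exact: measurable_fst.
all: exact: measurable_fun_pair.
Qed.

Lemma leb3_tonelli_ins i (F : space3 R -> \bar R) : measurable_fun setT F ->
  (forall x, 0 <= F x)%E ->
  (\int[leb3]_x F x = \int[leb2]_y \int[leb1]_s F (ins i y s))%E.
Proof.
move=> mF F0; have mFi : measurable_fun setT (fun z : R * R => \int[leb1]_s F (ins i z s))%E.
  apply: (measurable_fun_fubini_tonelli_F (fun z : space3 R => F (ins i z.1 z.2))) => //.
  exact: (measurableT_comp mF (measurable_ins i)).
have F0i z : (0 <= \int[leb1]_s F (ins i z s))%E by exact: integral_ge0.
case: i mFi F0i => -[|[|[|//]]] ? mFi F0i; rewrite /ins /= in mFi F0i *.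
- rewrite leb3_tonelli_cba //; apply/esym.
  exact: (@fubini_tonelli2 _ _ _ _ R leb1 leb1 (fun y => \int[leb1]_s F (s, y.1, y.2))%E).
- rewrite leb3_tonelli_cab //; apply/esym.
  exact: (@fubini_tonelli2 _ _ _ _ R leb1 leb1 (fun y => \int[leb1]_s F (y.1, s, y.2))%E).
- have -> : (\int[leb3]_x F x = \int[leb2]_y \int[leb1]_s F (y, s))%E.
    exact: (@fubini_tonelli1 _ _ _ _ R leb2 leb1 F mF F0).
  by apply: eq_integral => -[a b] _.
Qed.

Let ind (T : Type) (N : set T) (x : T) : \bar R := (\1_N x)%:E.
Let mind d (T : measurableType d) (N : set T) : measurable N -> measurable_fun setT (ind N).
Proof. by move=> mN; apply/measurable_EFinP; exact: measurable_indic. Qed.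
Let ind0 T (N : set T) x : (0 <= ind N x)%E.
Proof. by rewrite lee_fin indicE. Qed.
Let ind_eq0 T (N : set T) x : ind N x = 0%E -> ~ N x.
Proof. by move=> + Nx; rewrite /ind indicE mem_set // => -[] /eqP; rewrite oner_eq0. Qed.
Let int_ind d (T : measurableType d) (mu : {measure set T -> \bar R}) (N : set T) :
  measurable N -> (\int[mu]_x ind N x = mu N)%E.
Proof. by move=> mN; rewrite integral_indic // setIT. Qed.

Lemma ae_ins i (P : space3 R -> Prop) : {ae leb3, forall x, P x} ->
  {ae leb2, forall y, {ae leb1, forall s, P (ins i y s)}}.
Proof.
move=> [N [mN N0 sub]].
have mI : measurable_fun setT (fun z : space3 R => ind N (ins i z.1 z.2)).
  exact: (measurableT_comp (mind mN) (measurable_ins i)).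
have : (\int[leb2]_y \int[leb1]_s ind N (ins i y s) = 0)%E.
  by rewrite -leb3_tonelli_ins ?int_ind //; exact: mind.
move=> /ae_eq0_integral h.
have {h} := h (measurable_fun_fubini_tonelli_F _ mI (fun _ => ind0 _ _))
  (fun _ => integral_ge0 _ (fun _ _ => ind0 _ _)).
apply: filterS => y /ae_eq0_integral h.
have {h} := h (measurable_section2 y mI) (fun _ => ind0 _ _).
by apply: filterS => s h; apply: contrapT => nP; apply: (ind_eq0 h); exact: sub.
Qed.

(** A converse of [ae_ins]. Tonelli needs a measurable exceptional set, and for an inequality
    between measurable functions the set where it fails is one. *)
Lemma ae_ins_le i (F G : space3 R -> \bar R) : measurable_fun setT F ->
  measurable_fun setT G ->
  {ae leb2, forall y, {ae leb1, forall s, (F (ins i y s) <= G (ins i y s))%E}} ->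
  {ae leb3, forall x, (F x <= G x)%E}.
Proof.
move=> mF mG h; pose N := [set x | (G x < F x)%E].
have mN : measurable N by rewrite /N -(setTI [set x | _]); exact: measurable_lte.
exists N; split=> //; last by move=> x /negP; rewrite -ltNge.
have mI : measurable_fun setT (fun z : space3 R => ind N (ins i z.1 z.2)).
  exact: (measurableT_comp (mind mN) (measurable_ins i)).
rewrite -int_ind // (leb3_tonelli_ins i (mind mN) (fun _ => ind0 _ _)).
apply: integral_ae_eq0; first exact: (measurable_fun_fubini_tonelli_F _ mI (fun _ => ind0 _ _)).
apply: filterS h => y h; apply: integral_ae_eq0; first exact: (measurable_section2 y mI).
apply: filterS h => s h; rewrite /ind indicE memNset //=.
by apply/negP; rewrite -leNgt.
Qed.

Lemma ae_del i (P : R * R -> Prop) : {ae leb2, forall y, P y} ->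
  {ae leb3, forall x, P (del i x)}.
Proof.
move=> [N [mN N0 sub]]; exists (del i @^-1` N); split.
- by rewrite -(setTI (_ @^-1` _)); exact: (measurable_del i).
- have mI : measurable_fun setT (fun x : space3 R => ind N (del i x)).
    exact: (measurableT_comp (mind mN) (@measurable_del i)).
  transitivity (\int[leb3]_x ind N (del i x))%E.
    rewrite -int_ind //; last by rewrite -(setTI (_ @^-1` _)); exact: (measurable_del i).
  rewrite (leb3_tonelli_ins i mI (fun _ => ind0 _ _)).
  under eq_integral do under eq_integral do rewrite del_ins.
  apply: integral_ae_eq0.
    apply: (measurable_fun_fubini_tonelli_F (fun z : space3 R => ind N z.1)) => //.
    exact: (measurableT_comp (mind mN) measurable_fst).
  exists N; split=> // y /= h; apply: contrapT => Ny; apply: h.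
  by rewrite integral0_eq // => s _; rewrite /ind indicE memNset.
- by move=> x /= h; apply: sub.
Qed.

Lemma ae_third (P : R -> Prop) : {ae leb1, forall c, P c} ->
  {ae leb3, forall x : space3 R, P x.2}.
Proof.
move=> [N [mN N0 sub]]; exists (setT `*` N); split.
- exact: measurableX.
- by rewrite /leb3 product_measure1E //= N0 mule0.
- by move=> x /= h; split=> //; exact: sub.
Qed.

End insertion.

Lemma ae_and d (T : measurableType d) (R : realType) (mu : {measure set T -> \bar R})
    (P Q : T -> Prop) : {ae mu, forall x, P x} -> {ae mu, forall x, Q x} ->
  {ae mu, forall x, P x /\ Q x}.
Proof. by move=> hP hQ; apply: filterS2 hP hQ => x. Qed.

Section power_sums.
Variable R : realType.
Local Open Scope ereal_scope.

Lemma le_poweR (X Y : \bar R) (r : R) : (0 <= r)%R -> 0 <= X -> X <= Y -> X `^ r <= Y `^ r.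
Proof.
move=> r0 X0 XY; apply: gt0_ler_poweR => //; rewrite in_itv /= leey andbT //.
exact: le_trans XY.
Qed.

Lemma poweRD_le (X Y : \bar R) (m : R) : (0 <= m)%R -> 0 <= X -> 0 <= Y ->
  (X + Y) `^ m <= (2 `^ m)%:E * (X `^ m + Y `^ m).
Proof.
move=> m0.
have key (U V : \bar R) : 0 <= U -> 0 <= V -> U <= V ->
    (U + V) `^ m <= (2 `^ m)%:E * (U `^ m + V `^ m).
  move=> U0 V0 UV; have V2 : U + V <= 2%:E * V by rewrite mule_natl mule2n leeD2r.
  apply: le_trans (le_poweR m0 (adde_ge0 U0 V0) V2) _.
  rewrite poweRM // -poweR_EFin; apply: lee_pmul; rewrite ?poweR_ge0 //.
  by rewrite leeDr // poweR_ge0.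
move=> X0 Y0; case: (leP X Y) => [|/ltW] h; first exact: key.
by rewrite addeC [X `^ m + _]addeC; exact: key.
Qed.

Lemma poweRD3_le (X Y Z : \bar R) (m : R) : (0 <= m)%R -> 0 <= X -> 0 <= Y -> 0 <= Z ->
  (X + Y + Z) `^ m <= (4 `^ m)%:E * (X `^ m + Y `^ m + Z `^ m).
Proof.
move=> m0 X0 Y0 Z0.
have t1 : (1 <= 2 `^ m :> R)%R by have := @ler_powR R 2 (ler1n _ 2) _ _ m0; rewrite powRr0.
apply: le_trans (poweRD_le m0 (adde_ge0 X0 Y0) Z0) _.
have -> : (4 `^ m = 2 `^ m * 2 `^ m :> R)%R by rewrite -powRM //; congr (_ `^ _)%R; lra.
rewrite EFinM -muleA lee_wpmul2l ?lee_fin ?powR_ge0 // [leRHS]ge0_muleDr ?adde_ge0 ?poweR_ge0 //.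
apply: leeD; first exact: poweRD_le.
by rewrite -[leLHS]mul1e lee_wpmul2r ?poweR_ge0 // lee_fin.
Qed.

(** Jensen's inequality in the form needed when the average itself is then integrated as a constant
    over a set of measure at most [V]. *)
Lemma avg_power_le d (T : measurableType d) (mu : {measure set T -> \bar R}) (F : T -> \bar R)
    (D : set T) (k V m : R) : measurable D -> mu D <= V%:E -> (0 <= k)%R -> (0 <= V)%R ->
  measurable_fun setT F -> (forall x, 0 <= F x) -> (forall x, ~ D x -> F x = 0) ->
  (1 < m)%R ->
  V%:E * (k%:E * \int[mu]_x F x) `^ m <= ((k * V) `^ m)%:E * \int[mu]_x (F x `^ m).
Proof.
move=> mD DV k0 V0 mF F0 FD m1.
have m0 : (0 < m)%R by exact: lt_trans m1.
rewrite poweRM ?lee_fin ?integral_ge0 // powRM // EFinM muleCA -poweR_EFin -[leRHS]muleA.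
apply: lee_wpmul2l; first exact: poweR_ge0.
apply: le_trans (lee_wpmul2l _ (poweR_integral_le mD DV mF F0 FD m1)) _; first by rewrite lee_fin.
by rewrite muleA -EFinM -(mulr_powRB1 V0 m0).
Qed.

Lemma Rintegral_dist_le d (T : measurableType d) (mu : {measure set T -> \bar R})
    (F H : T -> R) (G : T -> \bar R) :
  mu.-integrable setT (EFin \o F) -> mu.-integrable setT (EFin \o H) ->
  measurable_fun setT G -> (forall x, 0 <= G x) ->
  {ae mu, forall x, (`|F x - H x|%:E <= G x)} ->
  `|\int[mu]_x F x - \int[mu]_x H x|%R%:E <= \int[mu]_x G x.
Proof.
move=> iF iH mG G0 h; rewrite -RintegralB //.
have iFH : mu.-integrable setT (EFin \o (fun x => F x - H x)%R).
  exact: (integrableB measurableT iF iH).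
rewrite EFin_normr_Rintegral //.
apply: le_trans (le_abse_integral _ measurableT (measurable_int _ iFH)) _.
apply: ae_ge0_le_integral => //.
- by apply/measurableT_comp => //; exact: (measurable_int _ iFH).
- by apply: filterS h => x h _.
Qed.

Lemma measurable_abse (d : measure_display) (T : measurableType d) (f : T -> R) :
  measurable_fun setT f -> measurable_fun setT (fun x => (`|f x|)%:E).
Proof. by move=> mf; apply/measurable_EFinP; exact: measurableT_comp. Qed.

End power_sums.

Lemma integral_indic_cst_le d (T : measurableType d) (R : realType)
    (mu : {measure set T -> \bar R}) (D : set T) (F : T -> R) (V : R) (H : \bar R) :
  measurable D -> (mu D <= V%:E)%E -> measurable_fun setT F ->
  (forall x, 0 <= F x <= \1_D x) -> (0 <= H)%E ->
  (\int[mu]_x ((F x)%:E * H) <= V%:E * H)%E.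
Proof.
move=> mD DV mF F1 H0.
have F0 x : (0 <= (F x)%:E)%E by rewrite lee_fin; case/andP: (F1 x).
have mFE : measurable_fun setT (EFin \o F) by exact/measurable_EFinP.
rewrite ge0_integralZr //; apply: lee_wpmul2r => //; apply: le_trans DV.
have -> : mu D = (\int[mu]_x (\1_D x)%:E)%E by rewrite integral_indic // setIT.
apply: ge0_le_integral => //.
  by apply/measurable_EFinP; exact: measurable_indic.
by move=> x _; rewrite lee_fin; case/andP: (F1 x).
Qed.

(** * Functions absolutely continuous on the lines of a box *)

Section boxes.
Variable R : realType.
Variables a b : 'I_3 -> R.

Definition sides (i : 'I_3) : set R := `]a i, b i[%classic.

Definition box : set (space3 R) := [set x | forall i, a i < coords x i < b i].

Definition i0 : 'I_3 := @Ordinal 3 0 isT.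
Definition i1 : 'I_3 := @Ordinal 3 1 isT.
Definition i2 : 'I_3 := @Ordinal 3 2 isT.

Lemma boxE : box = (sides i0 `*` sides i1) `*` sides i2.
Proof.
apply/seteqP; split=> [x h|x [[h0 h1] h2] i].
  have := (h i0, h i1, h i2); rewrite !coordsE /= => -[[h0 h1] h2].
  by split; [split|]; rewrite /sides /= in_itv.
rewrite coordsE; move: h0 h1 h2; rewrite /sides /= !in_itv /=.
case: i => -[|[|[|//]]] hi h0 h1 h2 /=.
- by rewrite (_ : Ordinal hi = i0) //; exact: val_inj.
- by rewrite (_ : Ordinal hi = i1) //; exact: val_inj.
- by rewrite (_ : Ordinal hi = i2) //; exact: val_inj.
Qed.

Lemma measurable_sides i : measurable (sides i).
Proof. exact: measurable_itv. Qed.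

Lemma measurable_box : measurable box.
Proof.
rewrite boxE; apply: measurableX; last exact: measurable_sides.
by apply: measurableX; exact: measurable_sides.
Qed.

Definition line_acl (f : space3 R -> R) (g : 'I_3 -> space3 R -> R) : Prop :=
  forall i, {ae leb2, forall y,
    acl (a i) (b i) (fun s => f (ins i y s)) (fun s => g i (ins i y s))}.

Definition supported (f : space3 R -> R) : Prop := forall x, ~ box x -> f x = 0.

Lemma supported_line f i y s : supported f -> ~ (a i < s < b i) -> f (ins i y s) = 0.
Proof. by move=> sf ns; apply: sf => /(_ i); rewrite coords_ins. Qed.

Variable l : R.
Hypothesis l0 : 0 < l.
(** Admits half cubes, whose sides are [l], [l] and [l / 2]. *)
Hypothesis side_le : forall i, l / 2 <= b i - a i <= l.

Let ab i : a i < b i.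
Proof. by rewrite -subr_gt0; case/andP: (side_le i) => h _; apply: lt_le_trans h; rewrite divr_gt0. Qed.

Let sidesV i : (b i - a i)^-1 <= 2 / l.
Proof.
case/andP: (side_le i) => h _; rewrite -[leRHS]invrK lef_pV2 ?posrE ?invr_gt0 ?divr_gt0 //.
  by rewrite invfM invrK mulrC.
by rewrite subr_gt0.
Qed.

Let leb1_sides i : (leb1 (sides i) <= l%:E)%E.
Proof. by rewrite leb1_oo // lee_fin; case/andP: (side_le i). Qed.

Let leb2_sides : (leb2 (sides i0 `*` sides i1) <= (l * l)%:E)%E.
Proof.
rewrite /leb2 product_measure1E; [|exact: measurable_sides|exact: measurable_sides].
by rewrite EFinM; apply: lee_pmul; [exact: measure_ge0|exact: measure_ge0|exact: leb1_sides..].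
Qed.

Lemma leb3_box_le : (leb3 box <= (l * l * l)%:E)%E.
Proof.
rewrite boxE /leb3 product_measure1E;
  [|by apply: measurableX; exact: measurable_sides|exact: measurable_sides].
by rewrite EFinM; apply: lee_pmul;
  [exact: measure_ge0|exact: measure_ge0|exact: leb2_sides|exact: leb1_sides].
Qed.

Lemma line_acl_sqr f g : measurable_fun setT f -> (forall i, supported (g i)) ->
  line_acl f g -> line_acl (fun x => f x ^+ 2) (fun i x => 2 * (f x * g i x)).
Proof.
move=> mf sg h i; apply: filterS (h i) => y; apply: acl_sqr.
  by apply: (measurableT_comp mf); exact: (measurable_section2 y (@measurable_ins R i)).
by move=> s; exact: supported_line.
Qed.

Lemma coords_ins_neq (i j : 'I_3) y s t : j != i -> coords (ins i y s : space3 R) j = coords (ins i y t) j.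
Proof.
by rewrite !coordsE /ins; case: i => -[|[|[|//]]] ?; case: j => -[|[|[|//]]] ?.
Qed.

Lemma box_line i y s t : box (ins i y s) -> a i < t < b i -> box (ins i y t).
Proof.
move=> h tab j; have [->|ji] := eqVneq j i; first by rewrite coords_ins.
by rewrite (coords_ins_neq y t s ji).
Qed.

Lemma line_outside f i y : supported f -> ~ (exists s, box (ins i y s)) ->
  forall s, f (ins i y s) = 0.
Proof. by move=> sf nb s; apply: sf => h; apply: nb; exists s. Qed.

(** Cutting off again after subtracting [c] restores the support in the box and leaves the
    derivative unchanged, since [acl] looks only at the part of a line inside the box. *)
Lemma line_acl_shift f g (c : R) : (forall i, supported (g i)) -> line_acl f g ->
  line_acl (fun x => \1_box x * (f x - c)) g.
Proof.
move=> sg h i; apply: filterS (h i) => y [ig [C hC]]; split=> //.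
have [[s0 bs0]|nB] := pselect (exists s, box (ins i y s)).
  exists (C - c); apply: filterS hC => s hs abs.
  by rewrite indicE mem_set ?mul1r ?hs //; [ring|exact: box_line bs0 abs].
exists 0; apply: aeW => s _; rewrite indicE memNset ?mul0r; last by move=> ?; apply: nB; exists s.
by rewrite add0r /Rintegral integral0_eq // => t _; rewrite (line_outside (sg i)).
Qed.

Lemma EFin_Rintegral_norm (g : R -> R) : leb1.-integrable setT (EFin \o g) ->
  (\int[leb1]_s `|g s|)%:E = (\int[leb1]_s (`|g s|)%:E)%E.
Proof.
move=> ig; rewrite fineK //; apply: integrable_fin_num => //.
exact: (integrable_abse ig).
Qed.

(** On each line [f] is at most its mean plus its oscillation. As [f] may be nonzero at the ends of
    the line, the mean contributes the term in [2 / l]; the line has length at least [l / 2]. *)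
Lemma line_dominates f g i : measurable_fun setT f -> supported f ->
  measurable_fun setT (g i) -> line_acl f g ->
  {ae leb3, forall x, ((`|f x|)%:E <= \int[leb1]_s
    (2 / l * `|f (ins i (del i x) s)| + `|g i (ins i (del i x) s)|)%:E)%E}.
Proof.
move=> mf sf mg h.
have mw : measurable_fun setT (fun x => (2 / l * `|f x| + `|g i x|)%:E).
  apply/measurable_EFinP; apply: measurable_funD; last exact: measurableT_comp.
  by apply: measurable_funM => //; exact: measurableT_comp.
have mwi := measurableT_comp mw (@measurable_ins R i).
have w0 x : (0 <= (2 / l * `|f x| + `|g i x|)%:E)%E.
  by rewrite lee_fin addr_ge0 // mulr_ge0 // divr_ge0 // ltW.
apply: (@ae_ins_le R i (fun x => (`|f x|)%:E)
  (fun x => \int[leb1]_s (2 / l * `|f (ins i (del i x) s)| + `|g i (ins i (del i x) s)|)%:E)%E).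
- exact: measurable_abse.
- exact: (measurableT_comp (measurable_fun_fubini_tonelli_F _ mwi (fun _ => w0 _))
    (@measurable_del R i)).
apply: filterS (h i) => y hy.
have mfy : measurable_fun setT (fun s => f (ins i y s)).
  by apply: (measurableT_comp mf); exact: (measurable_section2 y (@measurable_ins R i)).
have sfy s : ~ (a i < s < b i) -> f (ins i y s) = 0 by exact: supported_line.
have ify := acl_integrable mfy sfy hy.
have ig : leb1.-integrable setT (EFin \o (fun s => g i (ins i y s))) by case: hy.
have E : (\int[leb1]_s (2 / l * `|f (ins i y s)| + `|g i (ins i y s)|)%:E)%E =
    (2 / l * \int[leb1]_s `|f (ins i y s)| + \int[leb1]_s `|g i (ins i y s)|)%:E.
  under eq_integral do rewrite EFinD EFinM.
  rewrite ge0_integralD //; last 3 first.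
  - by move=> s _; rewrite -EFinM lee_fin mulr_ge0 // divr_ge0 // ltW.
  - apply/measurable_EFinP; apply: measurable_funM => //; exact: measurableT_comp.
  - apply/measurable_EFinP; apply: measurableT_comp => //.
    by apply: (measurableT_comp mg); exact: (measurable_section2 y (@measurable_ins R i)).
  rewrite ge0_integralZl //; [|exact: (measurable_abse mfy)|by rewrite lee_fin divr_ge0 // ltW].
  have /= <- := EFin_Rintegral_norm ify; have /= <- := EFin_Rintegral_norm ig.
  by rewrite EFinD EFinM.
have := acl_osc (ab i) mfy sfy hy; apply: filterS => s hs; rewrite del_ins E lee_fin.
have [sab|nab] := pselect (a i < s < b i); last first.
  rewrite sfy // normr0; apply: addr_ge0; last exact: Rintegral_ge0.
  by apply: mulr_ge0; [rewrite divr_ge0 // ltW|exact: Rintegral_ge0].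
have := hs sab; set A := \int[leb1]_t f _ => osc.
rewrite -(subrK ((b i - a i)^-1 * A) (f _)); apply: le_trans (ler_normD _ _) _.
rewrite addrC lerD // normrM ger0_norm ?invr_ge0 ?subr_ge0; last by rewrite ltW.
apply: ler_pM => //; first by rewrite invr_ge0 subr_ge0 ltW.
exact: le_normr_Rintegral.
Qed.

Section poincare.
Variables (f : space3 R -> R) (g : 'I_3 -> space3 R -> R) (m : R).
Hypotheses (mf : measurable_fun setT f) (sf : supported f)
  (mg : forall i, measurable_fun setT (g i)) (sg : forall i, supported (g i))
  (fi : leb3.-integrable setT (EFin \o f)) (h : line_acl f g) (m1 : 1 < m).

Let avg i x := (b i - a i)^-1 * \1_(sides i) (coords x i) *
  \int[leb1]_s f (ins i (del i x) s).

Let G i y := (\int[leb1]_s (`|g i (ins i y s)|)%:E)%E.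

Let G0 i y : (0 <= G i y)%E. Proof. by apply: integral_ge0 => s _; rewrite lee_fin. Qed.

Let mG i : measurable_fun setT (G i).
Proof.
apply: (measurable_fun_fubini_tonelli_F (fun z : space3 R => (`|g i (ins i z.1 z.2)|)%:E)).
  apply: measurable_abse; exact: (measurableT_comp (mg i) (@measurable_ins R i)).
by move=> z; rewrite lee_fin.
Qed.

Let mavg i : measurable_fun setT (avg i).
Proof.
apply: measurable_funM; first apply: measurable_funM => //.
  exact: (measurableT_comp (measurable_indic (measurable_sides i)) (@measurable_coords R i)).
have M : measurable_fun setT (fun z => \int[leb1]_s f (ins i z s)).
  apply: (@measurable_Rintegral_snd _ _ _ _ R leb1 (fun z => f (ins i z.1 z.2))).
  exact: (measurableT_comp mf (@measurable_ins R i)).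
exact: (measurableT_comp M (@measurable_del R i)).
Qed.

Let osc i : {ae leb3, forall x, ((`|f x - avg i x|)%:E <= G i (del i x))%E}.
Proof.
apply: (@ae_ins_le R i (fun x => (`|f x - avg i x|)%:E) (fun x => G i (del i x))).
- by apply: (@measurable_abse R _ _ (fun x => f x - avg i x)); exact: (measurable_funB mf (mavg i)).
- exact: (measurableT_comp (mG i) (@measurable_del R i)).
apply: filterS (h i) => y hy.
have mfy : measurable_fun setT (fun s => f (ins i y s)).
  by apply: (measurableT_comp mf); exact: (measurable_section2 y (@measurable_ins R i)).
have sfy s : ~ (a i < s < b i) -> f (ins i y s) = 0 by exact: supported_line.
have ig : leb1.-integrable setT (EFin \o (fun s => g i (ins i y s))) by case: hy.
have := acl_osc (ab i) mfy sfy hy; apply: filterS => s hs; rewrite del_ins /avg coords_ins del_ins.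
have /= := EFin_Rintegral_norm ig; rewrite /G => <-; rewrite lee_fin.
have [sab|nab] := pselect (a i < s < b i).
  by rewrite indicE mem_set ?mulr1 ?hs //= in_itv.
by rewrite sfy // indicE memNset ?mulr0 ?mul0r ?subr0 ?normr0 ?Rintegral_ge0 //= in_itv.
Qed.

Let c0 := ((b i0 - a i0) * (b i1 - a i1) * (b i2 - a i2))^-1 *
  \int[leb2]_z \int[leb1]_c f (z, c).

Let E1 c := (\int[leb2]_z (`|g i1 (z, c)|)%:E)%E.
Let E2 := (\int[leb3]_z (`|g i2 z|)%:E)%E.

(** The coordinates are averaged one at a time: [f] is compared with its mean in the first
    coordinate, this with the mean in two coordinates, and that with the full mean [c0]. Each
    comparison is [osc] for the new coordinate, integrated over those already averaged. *)
Let osc_mean : {ae leb3, forall x, box x ->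
  ((`|f x - c0|)%:E <= G i0 (del i0 x) + (2 / l)%:E * E1 x.2 + (4 / (l * l))%:E * E2)%E}.
Proof.
have H2 := ae_del i0 (ae_ins i0 (osc i1)).
have H3 := ae_third (@ae_integrable_snd _ _ _ _ R leb2 leb1 f fi).
have H4 : {ae leb2, forall y, leb1.-integrable setT (EFin \o (fun s => f (ins i0 y s)))}.
  apply: filterS (h i0) => y hy; apply: acl_integrable hy.
    by apply: (measurableT_comp mf); exact: (measurable_section2 y (@measurable_ins R i0)).
  by move=> s; exact: supported_line.
have H5 := ae_third (@ae_prod_snd _ _ _ _ R leb2 leb1 _ (osc i2)).
have H := ae_and (ae_and (osc i0) H2) (ae_and (ae_and H3 H5) (ae_del i0 H4)).
apply: filterS H => -[[x1 x2] c] [[h1 h2] [[h3 h5] h4]] bx; rewrite /= in h1 h2 h3 h4 h5 *.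
have [k0 k1 k2] : [/\ sides i0 x1, sides i1 x2 & sides i2 c].
  by move: bx; rewrite boxE => -[[? ?] ?].
have E (i : 'I_3) s : sides i s -> \1_(sides i) s = 1 :> R by move=> ?; rewrite indicE mem_set.
set y := del i0 (x1, x2, c) in h1 h2 h4 *.
pose A := \int[leb1]_s f (ins i0 y s).
pose I := \int[leb2]_z f (z, c).
pose J := \int[leb2]_z \int[leb1]_c f (z, c).
pose L i := (b i - a i)^-1.
have L0 i : 0 <= L i by rewrite invr_ge0 subr_ge0 ltW.
have e0 : avg i0 (x1, x2, c) = L i0 * A by rewrite /avg coordsE /= E // mulr1.
have iB : leb1.-integrable setT (EFin \o (fun s => \int[leb1]_u f (s, u, c))).
  exact: (@integrable_Rintegral_snd _ _ _ _ R leb1 leb1 (fun z => f (z, c)) h3).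
have IB : I = \int[leb1]_s \int[leb1]_u f (s, u, c).
  exact: (@Rintegral_prod1 _ _ _ _ R leb1 leb1 (fun z => f (z, c)) h3).
have K1 : ((`|A - L i1 * I|)%:E <= E1 c)%E.
  have -> : E1 c = (\int[leb1]_s G i1 (s, c))%E.
    apply: (@fubini_tonelli1 _ _ _ _ R leb1 leb1 (fun z => (`|g i1 (z, c)|)%:E)).
      by apply: measurable_abse; exact: measurable_section1.
    by move=> z; rewrite lee_fin.
  rewrite IB -RintegralZl //.
  apply: (@Rintegral_dist_le R _ _ leb1 (fun s => f (ins i0 y s))
    (fun s => L i1 * \int[leb1]_u f (s, u, c)) (fun s => G i1 (s, c))) => //.
  - exact: (integrableZl measurableT _ iB).
  - exact: (measurable_section1 c (mG i1)).
  - by apply: filterS h2 => s; rewrite /avg coordsE /= E // mulr1.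
have K2 : ((`|I - L i2 * J|)%:E <= E2)%E.
  have -> : E2 = (\int[leb2]_z G i2 z)%E.
    by rewrite /E2 (leb3_tonelli_ins i2) //; apply: measurable_abse; exact: mg.
  have iJ := @integrable_Rintegral_snd _ _ _ _ R leb2 leb1 f fi.
  rewrite -RintegralZl //.
  apply: (@Rintegral_dist_le R _ _ leb2 (fun z => f (z, c))
    (fun z => L i2 * \int[leb1]_c f (z, c)) (fun z => G i2 z)) => //.
  - exact: (integrableZl measurableT _ iJ).
  - apply: filterS h5 => z; rewrite /avg coordsE /= E // mulr1 /del /ins /=.
    by rewrite -surjective_pairing.
have tri : `|f (x1, x2, c) - c0| <= `|f (x1, x2, c) - L i0 * A| +
    L i0 * `|A - L i1 * I| + L i0 * L i1 * `|I - L i2 * J|.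
  have -> : f (x1, x2, c) - c0 = (f (x1, x2, c) - L i0 * A) + L i0 * (A - L i1 * I) +
      L i0 * L i1 * (I - L i2 * J).
    by rewrite /c0 -/J !invfM -/(L i0) -/(L i1) -/(L i2); ring.
  apply: le_trans (ler_normD _ _) _; apply: lerD; last by rewrite normrM ger0_norm ?mulr_ge0.
  by apply: le_trans (ler_normD _ _) _; rewrite lerD // normrM ger0_norm.
have L2 : L i0 * L i1 <= 4 / (l * l).
  apply: le_trans (ler_pM (L0 _) (L0 _) (sidesV _) (sidesV _)) _.
  by rewrite le_eqVlt; apply/orP; left; apply/eqP; field; rewrite gt_eqF.
apply: le_trans (_ : _ <= (`|f (x1, x2, c) - L i0 * A|)%:E +
  (L i0 * `|A - L i1 * I|)%:E + (L i0 * L i1 * `|I - L i2 * J|)%:E)%E _.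
  by rewrite -!EFinD lee_fin.
apply: leeD; first apply: leeD; first by rewrite -e0.
- by rewrite EFinM; apply: lee_pmul => //; rewrite lee_fin ?L0 ?sidesV.
- by rewrite EFinM; apply: lee_pmul => //; rewrite lee_fin // mulr_ge0.
Qed.

Let mbox : measurable_fun setT (\1_box : space3 R -> R).
Proof. exact: (measurable_indic measurable_box). Qed.

Let indic_le (x : space3 R) i : 0 <= (\1_box x : R) <= \1_(sides i) (coords x i).
Proof.
rewrite !indicE; have [bx|nbx] := pselect (box x).
  by rewrite !mem_set //= ?lexx ?ler01 //=; exact: bx.
by rewrite (memNset nbx) lexx /= ler0n.
Qed.

Let int_g i := (\int[leb3]_x (`|g i x|%:E `^ m))%E.

Let mgm i : measurable_fun setT (fun x => (`|g i x|%:E `^ m)%E).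
Proof. by apply: measurable_poweR; apply: measurable_abse; exact: mg. Qed.

Let m0 : 0 <= m. Proof. by rewrite (le_trans _ (ltW m1)). Qed.

(** [T0], [T1] and [T2] treat the three terms of [osc_mean], which are constant on lines, on planes
    and on the whole box, so that [avg_power_le] applies with sets of dimension 1, 2 and 3. *)
Let T0 : (\int[leb3]_x ((\1_box x)%:E * G i0 (del i0 x) `^ m) <= ((1 * l) `^ m)%:E * int_g i0)%E.
Proof.
rewrite (leb3_tonelli_ins i0); last first.
- by move=> x; rewrite mule_ge0 ?poweR_ge0.
- apply: emeasurable_funM; first by apply/measurable_EFinP; exact: mbox.
  apply: measurable_poweR; exact: (measurableT_comp (mG i0) (@measurable_del R i0)).
rewrite /int_g (leb3_tonelli_ins i0) //; last by move=> x; rewrite poweR_ge0.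
have mins := @measurable_ins R i0.
have mgi := measurableT_comp (mgm i0) mins.
rewrite -ge0_integralZl //; last 3 first.
- by apply: (measurable_fun_fubini_tonelli_F _ mgi) => z; exact: poweR_ge0.
- by move=> y _; apply: integral_ge0 => s _; exact: poweR_ge0.
- by rewrite lee_fin powR_ge0.
apply: ge0_le_integral => //.
- by move=> y _; apply: integral_ge0 => s _; rewrite mule_ge0 ?poweR_ge0.
- apply: (@measurable_fun_fubini_tonelli_F _ _ _ _ R leb1
    (fun z : space3 R => (\1_box (ins i0 z.1 z.2))%:E * G i0 (del i0 (ins i0 z.1 z.2)) `^ m)%E).
    apply: emeasurable_funM.
      by apply/measurable_EFinP; exact: (measurableT_comp mbox mins).
    apply: measurable_poweR; apply: (measurableT_comp (mG i0)).
    exact: (measurableT_comp (@measurable_del R i0) mins).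
  by move=> z; rewrite mule_ge0 ?poweR_ge0.
- apply: emeasurable_funM => //.
  by apply: (measurable_fun_fubini_tonelli_F _ mgi) => z; exact: poweR_ge0.
move=> y _; under eq_integral do rewrite del_ins.
have mgy : measurable_fun setT (fun s => (`|g i0 (ins i0 y s)|)%:E).
  by apply: measurable_abse; apply: (measurableT_comp (mg i0)); exact: (measurable_section2 y mins).
apply: le_trans (integral_indic_cst_le (measurable_sides i0) (leb1_sides i0) _ _ (poweR_ge0 _ _)) _.
- by apply: (measurableT_comp mbox); exact: (measurable_section2 y mins).
- by move=> s; have := indic_le (ins i0 y s) i0; rewrite coords_ins.
rewrite -[G i0 y]mul1e.
apply: (avg_power_le (measurable_sides i0) (leb1_sides i0) _ (ltW l0) mgy) => // s ns.
by rewrite supported_line ?normr0 // => h'; apply: ns; rewrite /sides /= in_itv.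
Qed.

Let T1 : (\int[leb3]_x ((\1_box x)%:E * ((2 / l)%:E * E1 x.2) `^ m) <=
  ((2 / l * (l * l)) `^ m)%:E * int_g i1)%E.
Proof.
have E10 c : (0 <= E1 c)%E by apply: integral_ge0 => s _; rewrite lee_fin.
have mE1 : measurable_fun setT E1.
  apply: (@measurable_fun_fubini_tonelli_G _ _ _ _ R leb2 (fun z : space3 R => (`|g i1 z|)%:E)).
    by apply: measurable_abse; exact: mg.
  by move=> z; rewrite lee_fin.
have mF : measurable_fun setT (fun x : space3 R => (\1_box x)%:E * ((2 / l)%:E * E1 x.2) `^ m)%E.
  apply: emeasurable_funM; first by apply/measurable_EFinP; exact: mbox.
  apply: measurable_poweR; apply: emeasurable_funM => //.
  exact: (measurableT_comp mE1 measurable_snd).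
have F0 x : (0 <= (\1_box x)%:E * ((2 / l)%:E * E1 x.2) `^ m)%E by rewrite mule_ge0 ?poweR_ge0.
have g0 x : (0 <= `|g i1 x|%:E `^ m)%E by exact: poweR_ge0.
have -> := @fubini_tonelli2 _ _ _ _ R leb2 leb1 _ mF F0.
rewrite /int_g; have -> := @fubini_tonelli2 _ _ _ _ R leb2 leb1 _ (mgm i1) g0.
have mg2 := measurable_fun_fubini_tonelli_G (m1 := leb2) _ (mgm i1) g0.
rewrite -ge0_integralZl //; last 2 first.
- by move=> y _; apply: integral_ge0 => s _; exact: poweR_ge0.
- by rewrite lee_fin powR_ge0.
apply: ge0_le_integral => //.
- by move=> y _; apply: integral_ge0 => s _; exact: F0.
- exact: (measurable_fun_fubini_tonelli_G (m1 := leb2) _ mF F0).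
- exact: emeasurable_funM.
move=> c _.
suff key : (\int[leb2]_z ((\1_box (z, c))%:E * ((2 / l)%:E * E1 c) `^ m) <=
  ((2 / l * (l * l)) `^ m)%:E * \int[leb2]_z (`|g i1 (z, c)|%:E `^ m))%E by exact: key.
have mD : measurable (sides i0 `*` sides i1) by apply: measurableX; exact: measurable_sides.
have mgc : measurable_fun setT (fun z : R * R => (`|g i1 (z, c)|)%:E).
  by apply: measurable_abse; exact: (measurable_section1 c (mg i1)).
apply: le_trans (integral_indic_cst_le mD leb2_sides _ _ (poweR_ge0 _ _)) _.
- exact: (measurable_section1 c mbox).
- move=> z; rewrite !indicE; have [bx|nbx] := pselect (box (z, c)).
    by rewrite !mem_set //= ?lexx ?ler01 //; move: bx; rewrite boxE => -[].
  by rewrite (memNset nbx) lexx /= ler0n.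
apply: (avg_power_le mD leb2_sides _ _ mgc) => //.
- by rewrite divr_ge0 // ltW.
- by rewrite mulr_ge0 // ltW.
- move=> z nz; rewrite sg ?normr0 // boxE => -[h' _]; exact: nz.
Qed.

Let T2 : (\int[leb3]_x ((\1_box x)%:E * ((4 / (l * l))%:E * E2) `^ m) <=
  ((4 / (l * l) * (l * l * l)) `^ m)%:E * int_g i2)%E.
Proof.
have ll : 0 <= l * l by rewrite mulr_ge0 // ltW.
apply: le_trans (integral_indic_cst_le measurable_box leb3_box_le mbox _ (poweR_ge0 _ _)) _.
  by move=> x; rewrite lexx andbT indicE ler0n.
apply: (avg_power_le measurable_box leb3_box_le) => //.
- by rewrite divr_ge0.
- by rewrite mulr_ge0 // ltW.
- by apply: measurable_abse; exact: mg.
- by move=> x nx; rewrite sg // normr0.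
Qed.

(** [16 l] is [4] times [4 l]: the first factor comes from the power of a sum of three terms, the
    second is the largest of the coefficients [l], [2 l] and [4 l] of the three averages. *)
Lemma poincare : exists c, (\int[leb3]_x ((\1_box x * `|f x - c|)%:E `^ m) <=
  ((16 * l) `^ m)%:E * (int_g i0 + int_g i1 + int_g i2))%E.
Proof.
exists c0; have l0' := ltW l0.
have E10 c : (0 <= E1 c)%E by apply: integral_ge0 => s _; rewrite lee_fin.
have E20 : (0 <= E2)%E by apply: integral_ge0 => s _; rewrite lee_fin.
have mE1 : measurable_fun setT E1.
  apply: (@measurable_fun_fubini_tonelli_G _ _ _ _ R leb2 (fun z : space3 R => (`|g i1 z|)%:E)).
    by apply: measurable_abse; exact: mg.
  by move=> z; rewrite lee_fin.
pose A x := ((\1_box x)%:E * G i0 (del i0 x) `^ m)%E.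
pose B (x : space3 R) := ((\1_box x)%:E * ((2 / l)%:E * E1 x.2) `^ m)%E.
pose C (x : space3 R) := ((\1_box x)%:E * ((4 / (l * l))%:E * E2) `^ m)%E.
have mA : measurable_fun setT A.
  apply: emeasurable_funM; first by apply/measurable_EFinP; exact: mbox.
  apply: measurable_poweR; exact: (measurableT_comp (mG i0) (@measurable_del R i0)).
have mB : measurable_fun setT B.
  apply: emeasurable_funM; first by apply/measurable_EFinP; exact: mbox.
  apply: measurable_poweR; apply: emeasurable_funM => //.
  exact: (measurableT_comp mE1 measurable_snd).
have mC : measurable_fun setT C by apply: emeasurable_funM => //; by apply/measurable_EFinP; exact: mbox.
have A0 x : (0 <= A x)%E by rewrite mule_ge0 ?poweR_ge0.
have B0 x : (0 <= B x)%E by rewrite mule_ge0 ?poweR_ge0.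
have C0 x : (0 <= C x)%E by rewrite mule_ge0 ?poweR_ge0.
have pt : {ae leb3, forall x, ((\1_box x * `|f x - c0|)%:E `^ m <=
    (4 `^ m)%:E * (A x + B x + C x))%E}.
  apply: filterS osc_mean => x hx; rewrite /A /B /C indicE.
  have [bx|nbx] := pselect (box x); last first.
    rewrite memNset //= mul0r !mul0e !adde0 mule0 ?poweR_EFin powR0 //.
    by rewrite gt_eqF // (lt_trans _ m1).
  rewrite mem_set //= !mul1e mul1r; apply: le_trans (le_poweR m0 _ (hx bx)) _ => //.
  apply: poweRD3_le => //; apply: mule_ge0 => //; rewrite lee_fin divr_ge0 //.
  by rewrite mulr_ge0.
have mX : measurable_fun setT (fun x => (\1_box x * `|f x - c0|)%:E `^ m)%E.
  apply: measurable_poweR; apply/measurable_EFinP; apply: measurable_funM => //.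
  by apply: measurableT_comp => //; exact: measurable_funB.
have mABC : measurable_fun setT (fun x => A x + B x + C x)%E.
  by apply: emeasurable_funD => //; exact: emeasurable_funD.
apply: (@le_trans _ _ (\int[leb3]_x ((4 `^ m)%:E * (A x + B x + C x)))%E).
  apply: ae_ge0_le_integral => //.
  - by move=> x _; exact: poweR_ge0.
  - by move=> x _; rewrite mule_ge0 ?lee_fin ?powR_ge0 ?adde_ge0.
  - exact: emeasurable_funM.
  - by apply: filterS pt => x hx _.
rewrite ge0_integralZl //; last by move=> x _; rewrite !adde_ge0.
rewrite ge0_integralD //; last by exact: emeasurable_funD.
rewrite ge0_integralD //.
have int0 i : (0 <= int_g i)%E by apply: integral_ge0 => x _; exact: poweR_ge0.
have step (k : R) (X Y : \bar R) : 0 <= k <= 4 * l -> (0 <= Y)%E ->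
    (X <= (k `^ m)%:E * Y)%E -> (X <= ((4 * l) `^ m)%:E * Y)%E.
  move=> /andP[k0 kl] Y0 h1; apply: (le_trans h1); apply: lee_wpmul2r => //.
  by rewrite lee_fin ge0_ler_powR // nnegrE mulr_ge0.
have -> : (16 * l) `^ m = 4 `^ m * (4 * l) `^ m.
  by rewrite -powRM ?mulr_ge0 //; congr (_ `^ _); ring.
rewrite EFinM -muleA; apply: lee_wpmul2l; first by rewrite lee_fin powR_ge0.
rewrite (ge0_muleDr _ (adde_ge0 (int0 _) (int0 _)) (int0 _)) (ge0_muleDr _ (int0 _) (int0 _)).
apply: leeD; first apply: leeD.
- by apply: step T0 => //; lra.
- apply: step T1 => //; rewrite (_ : 2 / l * (l * l) = 2 * l); first lra.
  by field; rewrite gt_eqF.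
- apply: step T2 => //; rewrite (_ : 4 / (l * l) * (l * l * l) = 4 * l); first lra.
  by field; rewrite gt_eqF.
- by move=> x _; rewrite adde_ge0.
Qed.

End poincare.

End boxes.

(** * Interpolation with the weak norm on a time slice *)

(** [gagliardo] wants one dominating function for all directions; the three bounds of
    [line_dominates] are merged by summing the derivatives. *)
Lemma sobolev_box (R : realType) (a b : 'I_3 -> R) (l : R) (f : space3 R -> R)
    (g : 'I_3 -> space3 R -> R) (q : R) : 0 < l ->
  (forall i, l / 2 <= b i - a i <= l) -> measurable_fun setT f -> supported a b f ->
  (forall i, measurable_fun setT (g i)) -> (forall i, supported a b (g i)) ->
  line_acl a b f g -> 1 < q ->
  (\int[leb3]_x ((`|f x| `^ (3 * q / 2))%R)%:E <= ((l `^ (q - 1))%:E *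
    \int[leb3]_x (((2 / l * `|f x| + \sum_(i < 3) `|g i x|) `^ q)%R)%:E) `^ (3 / 2))%E.
Proof.
move=> l0 side_le mf sf mg sg h q1.
have sle i : (leb1 (sides a b i) <= l%:E)%E.
  case/andP: (side_le i) => h1 h2; rewrite leb1_oo ?lee_fin // -subr_gt0.
  by apply: lt_le_trans h1; rewrite divr_gt0.
have l2 : 0 <= 2 / l by rewrite divr_ge0 // ltW.
have mw : measurable_fun setT (fun x => 2 / l * `|f x| + \sum_(i < 3) `|g i x|).
  apply: measurable_funD; first by apply: measurable_funM => //; exact: measurableT_comp.
  by apply: measurable_sum => i; exact: measurableT_comp.
apply: (@gagliardo R (fun x => `|f x|) _ (sides a b i0) (sides a b i1) (sides a b i2) l q) => //.
- exact: measurableT_comp.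
- by move=> x; apply: addr_ge0; [exact: mulr_ge0|exact: sumr_ge0].
- exact: measurable_sides.
- exact: measurable_sides.
- exact: measurable_sides.
- move=> x nx; have nb : ~ box a b x by rewrite boxE => -[[? ?] ?]; apply: nx.
  by rewrite sf // normr0 mulr0 add0r big1 // => i _; rewrite sg // normr0.
have H i := line_dominates l0 side_le mf sf (mg i) h.
have mono i x : (\int[leb1]_s (2 / l * `|f (ins i (del i x) s)| + `|g i (ins i (del i x) s)|)%:E <=
    \int[leb1]_s (2 / l * `|f (ins i (del i x) s)| + \sum_(j < 3) `|g j (ins i (del i x) s)|)%:E)%E.
  have mi := @measurable_section2 _ _ _ _ _ _ _ (del i x) (@measurable_ins R i).
  apply: ge0_le_integral => //.
  - by move=> s _; rewrite lee_fin; apply: addr_ge0 => //; exact: mulr_ge0.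
  - apply/measurable_EFinP; apply: measurable_funD.
      by apply: measurable_funM => //; apply: measurableT_comp => //; exact: (measurableT_comp mf mi).
    by apply: measurableT_comp => //; exact: (measurableT_comp (mg i) mi).
  - by apply/measurable_EFinP; exact: (measurableT_comp mw mi).
  - by move=> s _; rewrite lee_fin lerD2l (bigD1 i) //= lerDl sumr_ge0.
have := ae_and (H i0) (ae_and (H i1) (H i2)).
apply: filterS => x [h0 [h1 h2]].
split; [apply: le_trans h0 (mono i0 x)|apply: le_trans h1 (mono i1 x)|].
apply: (le_trans h2); apply: (le_trans (mono i2 x)).
by case: x {h0 h1 h2} => -[].
Qed.

Section weak_lebesgue.
Context d (T : measurableType d) (R : realType) (mu : {measure set T -> \bar R}).
Variables (f : T -> R).
Hypotheses (mf : measurable_fun setT f) (f0 : forall x, 0 <= f x).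

Definition upper (c : R) : set T := [set x | c < f x].

Let mset (c : R) : measurable (upper c).
Proof. by rewrite -(setTI (upper c)); exact: (measurable_fun_ltr _ mf). Qed.

(** Comes from the geometric series of ratio [2 ^ (m - 3)] over the dyadic layers in [weak_tail]; it
    converges for [m < 3]. *)
Definition tail_cst (m : R) : R := 2 `^ m / (1 - 2 `^ (m - 3)).

Let pow2_lt1 (m : R) : m < 3 -> 2 `^ (m - 3) < 1 :> R.
Proof.
by move=> m3; rewrite /powR gt_eqF // expR_lt1 pmulr_llt0 ?subr_lt0 // ln_gt0 // ltr1n.
Qed.

Lemma tail_cst_ge0 m : m < 3 -> 0 <= tail_cst m.
Proof. by move=> m3; rewrite /tail_cst divr_ge0 ?powR_ge0 // subr_ge0 ltW // pow2_lt1. Qed.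

Let powRB3 (x m : R) : 0 < x -> x `^ (m - 3) = x `^ m / x ^+ 3.
Proof.
move=> x0; have x3 : x ^+ 3 != 0 by rewrite expf_neq0 // gt_eqF.
apply: (mulIf x3); rewrite mulfVK // -(powR_mulrn 3 (ltW x0)) -powRD ?subrK //.
by rewrite (gt_eqF x0) implybT.
Qed.

(** On the dyadic layer between [2 ^ k lam] and [2 ^ (k+1) lam] the function is at most its upper
    end, and the weak bound controls the measure of the layer by its lower end. The contributions
    form a geometric series of ratio [2 ^ (m - 3)]. *)
Lemma weak_tail (N lam m : R) :
  (forall c, 0 < c -> (mu (upper c) <= (N ^+ 3 / c ^+ 3)%:E)%E) ->
  0 <= m < 3 -> 0 < lam -> 0 <= N ->
  (\int[mu]_x (\1_(upper lam) x * f x `^ m)%R%:E <=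
   (tail_cst m * lam `^ (m - 3) * N ^+ 3)%:E)%E.
Proof.
move=> wk /andP[m0 m3] lam0 N0.
pose A k := upper (2 ^+ k * lam).
pose u k x := ((2 ^+ k.+1 * lam) `^ m * \1_(A k) x)%:E.
have u0 k x : (0 <= u k x)%E by rewrite lee_fin mulr_ge0 ?powR_ge0.
have mA k : measurable (A k) by exact: mset.
have mu_ k : measurable_fun setT (u k).
  by apply/measurable_EFinP; apply: measurable_funM => //; exact: measurable_indic.
have pt x : ((\1_(upper lam) x * f x `^ m)%:E <= \sum_(k <oo) u k x)%E.
  have [lf|fl] := ltP lam (f x); last first.
    rewrite indicE memNset ?mul0r; first exact: nneseries_ge0.
    by apply/negP; rewrite -leNgt.
  rewrite indicE mem_set // mul1r.
  have ex : exists n, f x <= 2 ^+ n.+1 * lam.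
    have := archi_boundP (divr_ge0 (f0 x) (ltW lam0)).
    set n := Num.bound _ => hn; exists n; rewrite -ler_pdivrMr //; apply: (le_trans (ltW hn)).
    by rewrite -natrX ler_nat (leq_trans (ltnW (ltn_expl n (ltnSn 1)))) // leq_exp2l.
  (* The least such [k] identifies the dyadic layer that contains [f x]. *)
  case: (ex_minnP ex) => k fk kmin.
  have Ak : A k x.
    rewrite /A /upper /=; case: k fk kmin => [|k] _ kmin; first by rewrite expr0 mul1r.
    by rewrite ltNge; apply/negP => /kmin; rewrite ltnn.
  apply: le_trans (nneseries_lim_ge k.+1 _) => //.
  rewrite big_nat_recr //= /u indicE mem_set // mulr1.
  apply: (@le_trans _ _ ((2 ^+ k.+1 * lam) `^ m)%:E).
    by rewrite lee_fin ge0_ler_powR ?nnegrE // mulr_ge0 ?exprn_ge0 // ltW.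
  by rewrite -[leLHS]add0e; apply: leeD => //; apply: sume_ge0 => i _; exact: u0.
have mS : measurable_fun setT (fun x => \sum_(k <oo) u k x)%E.
  by apply: ge0_emeasurable_sum => //; exact: u0.
apply: (@le_trans _ _ (\int[mu]_x \sum_(k <oo) u k x)%E).
  apply: ge0_le_integral => //.
  - by move=> x _; rewrite lee_fin mulr_ge0 ?powR_ge0.
  - apply/measurable_EFinP; apply: measurable_funM; first exact: measurable_indic.
    exact: (measurableT_comp (measurable_powR m) mf).
rewrite integral_nneseries //.
pose z : R := 2 `^ (m - 3).
pose al := 2 `^ m * lam `^ (m - 3) * N ^+ 3.
have z1 : z < 1 by exact: pow2_lt1.
have z0 : 0 <= z by exact: powR_ge0.
have al0 : 0 <= al by rewrite !mulr_ge0 ?powR_ge0 // exprn_ge0.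
have term k : (\int[mu]_x u k x <= (al * z ^+ k)%:E)%E.
  rewrite /u; under eq_integral do rewrite EFinM.
  rewrite ge0_integralZl //; last 2 first.
  - by apply/measurable_EFinP; exact: measurable_indic.
  - by rewrite lee_fin powR_ge0.
  rewrite integral_indic // setIT.
  have t0 : 0 < 2 ^+ k :> R by rewrite exprn_gt0.
  have l2 : 0 < 2 ^+ k * lam by rewrite mulr_gt0.
  apply: le_trans (lee_wpmul2l _ (wk _ l2)) _; first by rewrite lee_fin powR_ge0.
  rewrite -EFinM lee_fin le_eqVlt; apply/orP; left; apply/eqP.
  have -> : z ^+ k = (2 ^+ k) `^ (m - 3).
    by rewrite /z -powR_mulrn ?powR_ge0 // -powRrM -[in RHS]powR_mulrn // -powRrM mulrC.
  rewrite /al !powRB3 // exprS -mulrA !powRM ?ltW //.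
  move: (2 `^ m) ((2 ^+ k) `^ m) (lam `^ m) => p1 p2 p3.
  by field; rewrite !gt_eqF.
apply: lime_le; first by apply: is_cvg_nneseries => n _ _; exact: integral_ge0.
apply: nearW => n; apply: le_trans (lee_sum _ (fun k _ => term k)) _.
rewrite sumEFin lee_fin.
have -> : \sum_(0 <= k < n) al * z ^+ k = al * (1 - z ^+ n) / (1 - z).
  by have := @geometric_seriesE R al z (negbT (lt_eqF z1)); move/(congr1 (fun h => h n)).
have -> : tail_cst m * lam `^ (m - 3) * N ^+ 3 = al / (1 - z).
  by rewrite /tail_cst /al -/z; ring.
apply: ler_wpM2r; first by rewrite invr_ge0 subr_ge0 ltW.
by rewrite ler_piMr // gerBl exprn_ge0.
Qed.

Let mpow (m : R) : measurable_fun setT (fun x => (f x `^ m)%:E).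
Proof. by apply/measurable_EFinP; exact: (measurableT_comp (measurable_powR m) mf). Qed.

Let pow0 (m : R) x : (0 <= (f x `^ m)%:E)%E. Proof. by rewrite lee_fin powR_ge0. Qed.

Let int_pow_eq0 (m : R) : 0 < m -> {ae mu, forall x, f x = 0} -> (\int[mu]_x (f x `^ m)%:E = 0)%E.
Proof.
move=> m0 h; apply: integral_ae_eq0; first exact: mpow.
by apply: filterS h => x ->; rewrite powR0 // gt_eqF.
Qed.

(** A bound for the weak norm rather than the norm itself, so that a majorant measurable in time can
    be inserted; it may be infinite. *)
Variable N : \bar R.
Hypotheses (N0 : (0 <= N)%E)
  (wk : forall c, 0 < c -> ((c ^+ 3)%:E * mu (upper c) <= N `^ 3)%E).

Let weak_eq0 : N = 0%E -> {ae mu, forall x, f x = 0}.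
Proof.
move=> Nz; have up0 c : 0 < c -> mu (upper c) = 0%E.
  move=> c0; have := wk c0; rewrite Nz poweR0r ?pnatr_eq0 // => h.
  have c3 : (0 < (c ^+ 3)%:E)%E by rewrite lte_fin exprn_gt0.
  apply/eqP; rewrite eq_le measure_ge0 andbT leNgt; apply/negP => h2.
  by have := mule_gt0 c3 h2; rewrite ltNge h.
have : mu.-negligible (\bigcup_n upper n.+1%:R^-1).
  apply: negligible_bigcup => n; exists (upper n.+1%:R^-1); split => //; exact: up0.
apply: negligibleS => x /= /eqP fx; have {}fx : 0 < f x by rewrite lt0r fx f0.
have := archi_boundP (ltW (y := (f x)^-1) _); rewrite invr_gt0 => /(_ fx).
set n := Num.bound _ => hn; exists n => //; rewrite /upper /=.
rewrite -[ltRHS]invrK ltf_pV2 ?posrE ?invr_gt0 //; apply: lt_trans hn _.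
by rewrite ltr_nat.
Qed.

Let wk_fin (n : R) : N = n%:E -> 0 <= n ->
  forall c, 0 < c -> (mu (upper c) <= (n ^+ 3 / c ^+ 3)%:E)%E.
Proof.
move=> Nn n0 c c0; have := wk c0; rewrite Nn poweR_EFin (powR_mulrn 3 n0).
have c3 : 0 < c ^+ 3 by rewrite exprn_gt0.
by rewrite -lee_pdivlMl // -EFinM [(_^-1 * _)%R]mulrC.
Qed.

(** The level [lam] at which [f] is split stays free: [weak_power] balances it with the measure of
    the support, [weak_interpolation] with the L^2 norm. *)
Let split_le (n lam m : R) (G : T -> R) : N = n%:E -> 0 < n -> 0 < lam -> 0 <= m < 3 ->
  measurable_fun setT G -> (forall x, 0 <= G x) -> (forall x, f x <= lam -> f x `^ m <= G x) ->
  (\int[mu]_x (f x `^ m)%:E <= \int[mu]_x (G x)%:E + (tail_cst m * lam `^ (m - 3) * n ^+ 3)%:E)%E.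
Proof.
move=> Nn n0 lam0 m3 mG G0 hG.
have mI : measurable_fun setT (fun x => (\1_(upper lam) x * f x `^ m)%:E).
  apply/measurable_EFinP; apply: measurable_funM; first exact: measurable_indic.
  exact: (measurableT_comp (measurable_powR m) mf).
have mGE : measurable_fun setT (fun x => (G x)%:E) by exact/measurable_EFinP.
have I0 x : (0 <= (\1_(upper lam) x * f x `^ m)%:E)%E by rewrite lee_fin mulr_ge0 ?powR_ge0.
apply: le_trans (leeD (lexx _) (weak_tail (wk_fin Nn (ltW n0)) m3 lam0 (ltW n0))).
rewrite -ge0_integralD //; last by move=> x _; rewrite lee_fin.
apply: ge0_le_integral => //.
  exact: (emeasurable_funD mGE mI).
move=> x _; rewrite -EFinD lee_fin; have [fl|lf] := leP (f x) lam.
  by rewrite (le_trans (hG _ fl)) // lerDl mulr_ge0 ?powR_ge0.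
by rewrite indicE mem_set // mul1r lerDr.
Qed.

Lemma weak_power (D : set T) (l m : R) : measurable D -> 0 < l -> (mu D <= (l ^+ 3)%:E)%E ->
  (forall x, ~ D x -> f x = 0) -> 0 < m < 3 ->
  (\int[mu]_x (f x `^ m)%:E <= ((1 + tail_cst m) * l `^ (3 - m))%:E * N `^ m)%E.
Proof.
move=> mD l0 Dl fD /andP[m0 m3].
have C0 : 0 < (1 + tail_cst m) * l `^ (3 - m).
  by rewrite mulr_gt0 ?powR_gt0 // ltr_pwDl // tail_cst_ge0.
have [/weak_eq0/(int_pow_eq0 m0) ->|Nn0] := eqVneq N 0%E.
  by rewrite mule_ge0 ?poweR_ge0 // lee_fin ltW.
case: N N0 Nn0 wk_fin split_le => [n| |//] n0 Nn0 wkf spl; last first.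
  by rewrite poweRyr ?gt_eqF // gt0_muley ?leey // lte_fin.
have {}n0 : 0 < n by rewrite lt0r -lee_fin n0 andbT; move: Nn0; rewrite eqe.
(* This level makes [lam ^ m * l ^ 3] and [lam ^ (m - 3) * n ^ 3] equal. *)
pose lam := n / l; have lam0 : 0 < lam by rewrite divr_gt0.
apply: le_trans (spl n lam m (fun x => lam `^ m * \1_D x) erefl n0 lam0 _ _ _ _) _.
- by rewrite (ltW m0).
- by apply: measurable_funM => //; exact: measurable_indic.
- by move=> x; rewrite mulr_ge0 ?powR_ge0.
- move=> x fl; rewrite indicE; have [Dx|nDx] := pselect (D x).
    by rewrite mem_set // mulr1 ge0_ler_powR ?nnegrE // ltW.
  by rewrite fD // powR0 ?gt_eqF // mulr_ge0 ?powR_ge0.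
under eq_integral do rewrite EFinM.
rewrite ge0_integralZl //; last 2 first.
- by apply/measurable_EFinP; exact: measurable_indic.
- by rewrite lee_fin powR_ge0.
rewrite integral_indic // setIT.
apply: (@le_trans _ _ ((lam `^ m * l ^+ 3)%:E + (tail_cst m * lam `^ (m - 3) * n ^+ 3)%:E)%E).
  by rewrite leeD2r // EFinM lee_wpmul2l // lee_fin powR_ge0.
rewrite poweR_EFin -EFinD -EFinM lee_fin le_eqVlt; apply/orP; left; apply/eqP.
have -> : l `^ (3 - m) = (l `^ (m - 3))^-1 by rewrite -powRN opprB.
have e : lam `^ m = n `^ m * (l `^ m)^-1 by rewrite /lam powRM ?invr_ge0 ?ltW // -(powR_inv1 (ltW l0)) powRAC powR_inv1 ?powR_ge0.
rewrite !powRB3 // e /lam.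
have lm : 0 < l `^ m by rewrite powR_gt0.
move: (l `^ m) lm (n `^ m) (tail_cst m) => p1 p10 p2 p3.
by field; rewrite !gt_eqF.
Qed.

Lemma weak_interpolation (m : R) : 2 < m < 3 ->
  (\int[mu]_x (f x `^ m)%:E <= (1 + tail_cst m)%:E *
    (N `^ (3 * (m - 2)) * (\int[mu]_x (f x `^ 2)%:E) `^ (3 - m)))%E.
Proof.
move=> /andP[m2 m3]; set Z := (\int[mu]_x (f x `^ 2)%:E)%E.
have m0 : 0 < m by rewrite (lt_trans _ m2).
have C0 : 0 < 1 + tail_cst m by rewrite ltr_pwDl // tail_cst_ge0.
have Z0 : (0 <= Z)%E by apply: integral_ge0 => x _; exact: pow0.
have R0 : (0 <= (1 + tail_cst m)%:E * (N `^ (3 * (m - 2)) * Z `^ (3 - m)))%E.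
  by rewrite !mule_ge0 ?poweR_ge0 // lee_fin ltW.
have [/weak_eq0/(int_pow_eq0 m0) -> //|Nn0] := eqVneq N 0%E.
have [Zz|Zn0] := eqVneq Z 0%E.
  rewrite int_pow_eq0 //; have := ae_eq0_integral (mpow 2) (pow0 2) Zz.
  by apply: filterS => x [] /eqP; rewrite powR_eq0 => /andP[/eqP].
have m31 : 0 < 3 - m by rewrite subr_gt0.
have m21 : 0 < 3 * (m - 2) by rewrite mulr_gt0 // subr_gt0.
have Zp : (0 < Z)%E by rewrite lt0e Zn0.
have Np : (0 < N)%E by rewrite lt0e Nn0.
case: N N0 Nn0 Np wk_fin split_le {R0} => [n| |//] n0 Nn0 Np wkf spl; last first.
  by rewrite poweRyr ?gt_eqF // gt0_mulye ?poweR_gt0 // gt0_muley ?leey // lte_fin.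
have {}n0 : 0 < n by [].
case EZ : Z Z0 Zp => [zz| |//] Z0 Zp; last first.
  by rewrite poweRyr ?gt_eqF // gt0_muley ?poweR_gt0 // gt0_muley ?leey // lte_fin.
have {}z0 : 0 < zz by [].
(* This level makes [lam ^ (m - 2) * zz] and [lam ^ (m - 3) * n ^ 3] equal. *)
pose lam := n ^+ 3 / zz; have lam0 : 0 < lam by rewrite divr_gt0 // exprn_gt0.
apply: le_trans (spl n lam m (fun x => lam `^ (m - 2) * f x `^ 2) erefl n0 lam0 _ _ _ _) _.
- by rewrite (ltW m0).
- by apply: measurable_funM => //; exact: (measurableT_comp (measurable_powR 2) mf).
- by move=> x; rewrite mulr_ge0 ?powR_ge0.
- move=> x fl; have [fx0|fx0] := eqVneq (f x) 0.
    by rewrite fx0 powR0 ?gt_eqF // mulr_ge0 ?powR_ge0.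
  have -> : f x `^ m = f x `^ (m - 2) * f x `^ 2 by rewrite -powRD ?subrK // fx0 implybT.
  apply: ler_wpM2r; first exact: powR_ge0.
  by rewrite ge0_ler_powR ?nnegrE ?subr_ge0 // ltW.
under eq_integral do rewrite EFinM.
rewrite ge0_integralZl //; last by rewrite lee_fin powR_ge0.
rewrite -/Z EZ !poweR_EFin -!EFinM -EFinD lee_fin le_eqVlt; apply/orP; left; apply/eqP.
have nx x : (n ^+ 3) `^ x = n `^ (3 * x) by rewrite powRrM powR_mulrn // ltW.
have zV x : (zz^-1) `^ x = zz `^ (- x).
  by rewrite -(powR_inv1 (ltW z0)) -powRrM mulN1r.
have lx x : lam `^ x = n `^ (3 * x) * zz `^ (- x).
  by rewrite /lam powRM ?invr_ge0 ?exprn_ge0 ?ltW // nx zV.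
have e1 : zz `^ (- (m - 2)) * zz = zz `^ (3 - m).
  rewrite -[X in _ * X](powRr1 (ltW z0)) -powRD; first by congr (_ `^ _); ring.
  by rewrite (gt_eqF z0) implybT.
have e2 : n `^ (3 * (m - 3)) * n ^+ 3 = n `^ (3 * (m - 2)).
  rewrite -(powR_mulrn 3 (ltW n0)) -powRD; first by congr (_ `^ _); ring.
  by rewrite (gt_eqF n0) implybT.
have e3 : zz `^ (- (m - 3)) = zz `^ (3 - m) by rewrite opprB.
rewrite !lx e3 -e1 -e2; ring.
Qed.

End weak_lebesgue.

(** * Slice estimates for the cube of the velocity and for the pressure term *)

Section slices.
Variable R : realType.
Variables (a b : 'I_3 -> R) (l : R).
Hypotheses (l0 : 0 < l) (side_le : forall i, l / 2 <= b i - a i <= l).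

Let mpow (f : space3 R -> R) (m : R) : measurable_fun setT f ->
  measurable_fun setT (fun x => (`|f x| `^ m)%:E).
Proof.
move=> mf; apply/measurable_EFinP; apply: (measurableT_comp (measurable_powR m)).
exact: measurableT_comp.
Qed.

Let pow0 (f : space3 R -> R) (m : R) x : (0 <= (`|f x| `^ m)%:E)%E.
Proof. by rewrite lee_fin powR_ge0. Qed.

Let poweRD2 (X : \bar R) (r s : R) : 0 < r -> 0 < s -> (X `^ (r + s) = X `^ r * X `^ s)%E.
Proof.
move=> r0 s0; apply: poweRD; apply: add_neq0_poweRD_def; rewrite gt_eqF //.
exact: addr_gt0.
Qed.

Variables (f : space3 R -> R) (N : \bar R).
Hypotheses (mf : measurable_fun setT f) (sf : supported a b f).
Hypotheses (N0 : (0 <= N)%E) (wk : forall c, 0 < c ->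
  ((c ^+ 3)%:E * leb3 (upper (fun x => `|f x|%R) c) <= N `^ 3)%E).

Let maf : measurable_fun setT (fun x => `|f x|). Proof. exact: measurableT_comp. Qed.

Lemma slice_weak_power (m : R) : 0 < m < 3 ->
  (\int[leb3]_x (`|f x| `^ m)%:E <= ((1 + tail_cst m) * l `^ (3 - m))%:E * N `^ m)%E.
Proof.
apply: (@weak_power _ _ _ leb3 (fun x => `|f x|) maf _ N N0 wk (box a b) l m) => //.
- exact: measurable_box.
- by have := leb3_box_le l0 side_le; rewrite !exprS expr0 mulr1 mulrA.
- by move=> x nx; rewrite sf ?normr0.
Qed.

Section cube.
Variable g : 'I_3 -> space3 R -> R.
Hypotheses (mg : forall i, measurable_fun setT (g i))
  (sg : forall i, supported a b (g i)) (h : line_acl a b f g).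

Let H x := 2 / l * `|f x| + \sum_(i < 3) `|g i x|.
Let G2 := (\int[leb3]_x ((2 / l * `|f x|) ^+ 2 + \sum_(i < 3) g i x ^+ 2)%:E)%E.
Let Z := (\int[leb3]_x (`|f x| `^ 2)%:E)%E.
Let W := (\int[leb3]_x (`|f x| `^ (14 / 5))%:E)%E.

Let l20 : 0 <= 2 / l. Proof. by rewrite divr_ge0 // ltW. Qed.
Let H0 x : 0 <= H x.
Proof. by apply: addr_ge0; [exact: mulr_ge0|exact: sumr_ge0]. Qed.
Let mH : measurable_fun setT H.
Proof.
apply: measurable_funD; first by apply: measurable_funM => //; exact: measurableT_comp.
by apply: measurable_sum => i; exact: measurableT_comp.
Qed.

Let HG : (\int[leb3]_x (H x `^ 2)%:E <= 4%:E * G2)%E.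
Proof.
have mG : measurable_fun setT
    (fun x => ((2 / l * `|f x|) ^+ 2 + \sum_(i < 3) g i x ^+ 2)%:E).
  apply/measurable_EFinP; apply: measurable_funD.
    by apply: measurable_funX; apply: measurable_funM => //; exact: measurableT_comp.
  by apply: measurable_sum => i; exact: measurable_funX.
have G0 x : 0 <= (2 / l * `|f x|) ^+ 2 + \sum_(i < 3) g i x ^+ 2.
  by apply: addr_ge0; [exact: sqr_ge0|apply: sumr_ge0 => i _; exact: sqr_ge0].
rewrite /G2 -ge0_integralZl //; last by move=> x _; rewrite lee_fin.
apply: ge0_le_integral => //.
- by move=> x _; rewrite lee_fin powR_ge0.
- by apply/measurable_EFinP; exact: (measurableT_comp (measurable_powR 2) mH).
- exact: emeasurable_funM.
move=> x _; rewrite -EFinM lee_fin powR_mulrn // /H !big_ord_recl !big_ord0.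
rewrite -[g ord0 x ^+ 2]real_normK ?num_real // -[g (lift ord0 ord0) x ^+ 2]real_normK ?num_real //.
rewrite -[g (lift ord0 (lift ord0 ord0)) x ^+ 2]real_normK ?num_real //.
move: (2 / l * `|f x|) (`|g ord0 x|) (`|g (lift ord0 ord0) x|)
  (`|g (lift ord0 (lift ord0 ord0)) x|) => A B C D.
have := sqr_ge0 (A - B); have := sqr_ge0 (A - C); have := sqr_ge0 (A - D).
have := sqr_ge0 (B - C); have := sqr_ge0 (B - D); have := sqr_ge0 (C - D).
rewrite !expr2; lra.
Qed.

(** The Sobolev inequality for [f ^ 2] with [q = 7/6]. The gradient of the square is [2 f g], and
    Hoelder with weights 5/12 and 7/12 returns the 14/5-integral of [f], because 7/6 = 5/12 * 14/5,
    and the square integral of [H], because 7/6 = 7/12 * 2. *)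
Let X_le : (\int[leb3]_x (`|f x| `^ (7 / 2))%:E <=
  ((l `^ 6^-1 * 2 `^ (7 / 6))%:E * (W `^ (5 / 12) * (4%:E * G2) `^ (7 / 12))) `^ (3 / 2))%E.
Proof.
have mf2 : measurable_fun setT (fun x => f x ^+ 2) by exact: measurable_funX.
have sf2 : supported a b (fun x => f x ^+ 2) by move=> x nx; rewrite sf // expr0n.
have mg2 i : measurable_fun setT (fun x => 2 * (f x * g i x)).
  by apply: measurable_funM => //; exact: measurable_funM.
have sg2 i : supported a b (fun x => 2 * (f x * g i x)) by move=> x nx; rewrite sf // mul0r mulr0.
have q1 : 1 < 7 / 6 :> R by lra.
have := sobolev_box l0 side_le mf2 sf2 mg2 sg2 (line_acl_sqr mf sg h) q1.
under eq_integral => x _.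
  have -> : `|f x ^+ 2| `^ (3 * (7 / 6) / 2) = `|f x| `^ (7 / 2).
    rewrite normrX -powR_mulrn // -powRrM; congr (_ `^ _); lra.
  over.
move/le_trans; apply; apply: le_poweR; first lra.
  rewrite mule_ge0 ?lee_fin ?powR_ge0 // integral_ge0 // => x _.
  by rewrite lee_fin powR_ge0.
have -> : (7 / 6 - 1 = 6^-1 :> R) by lra.
rewrite EFinM -muleA; apply: lee_wpmul2l; first by rewrite lee_fin powR_ge0.
have mHE : measurable_fun setT (fun x => (H x `^ 2)%:E).
  by apply/measurable_EFinP; exact: (measurableT_comp (measurable_powR 2) mH).
have HE0 x : (0 <= (H x `^ 2)%:E)%E by rewrite lee_fin powR_ge0.
have hh : (0 < 5 / 12 :> R) by lra.
have hh' : (0 < 7 / 12 :> R) by lra.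
have hs : (5 / 12 + 7 / 12 = 1 :> R) by lra.
have := @hoelder_ge0 _ _ R leb3 _ _ _ _ (mpow (14 / 5) mf) mHE (pow0 f (14 / 5)) HE0 hh hh' hs.
move=> hoel; apply: (@le_trans _ _ ((2 `^ (7 / 6))%:E * (W `^ (5 / 12) *
    (\int[leb3]_x (H x `^ 2)%:E) `^ (7 / 12)))%E); last first.
  apply: lee_wpmul2l; first by rewrite lee_fin powR_ge0.
  apply: lee_wpmul2l; first exact: poweR_ge0.
  apply: le_poweR HG; first lra.
  by apply: integral_ge0 => x _.
apply: le_trans (lee_wpmul2l _ hoel); last by rewrite lee_fin powR_ge0.
have mF := emeasurable_funM (@measurable_poweR _ _ R _ (5 / 12) (mpow (14 / 5) mf))
  (@measurable_poweR _ _ R _ (7 / 12) mHE).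
rewrite -ge0_integralZl //; last by move=> x _; rewrite mule_ge0 ?poweR_ge0.
apply: ge0_le_integral => //.
- by move=> x _; rewrite lee_fin powR_ge0.
- apply/measurable_EFinP; apply: (measurableT_comp (measurable_powR _)).
  apply: measurable_funD; first by apply: measurable_funM => //; exact: measurableT_comp.
  by apply: measurable_sum => i; apply: measurableT_comp.
- exact: (emeasurable_funM (measurable_cst _) mF).
move=> x _; rewrite !poweR_EFin -!EFinM lee_fin -!powRrM.
have -> : 14 / 5 * (5 / 12) = 7 / 6 :> R by lra.
have -> : 2 * (7 / 12) = 7 / 6 :> R by lra.
rewrite -!powRM ?mulr_ge0 //; apply: ge0_ler_powR; first lra.
- by rewrite nnegrE; apply: addr_ge0; [exact: mulr_ge0|exact: sumr_ge0].
- by rewrite nnegrE !mulr_ge0.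
rewrite normrX /H mulrDr mulrDr; apply: lerD.
  have -> : 2 * (`|f x| * (2 / l * `|f x|)) = 2 * (2 / l * `|f x| ^+ 2) by rewrite expr2; ring.
  by rewrite ler_peMl ?ler1n // mulr_ge0 // sqr_ge0.
rewrite !mulr_sumr; apply: ler_sum => i _.
by rewrite !normrM (ger0_norm (ler0n _ 2)).
Qed.

(** Since 3 = 5/7 * 14/5 + 2/7 * 7/2, Hoelder and [X_le] leave [W ^ (25/28)] and [G2 ^ (1/4)]; then
    [W] is interpolated between the weak norm and L^2. *)
Lemma slice_cube :
  (\int[leb3]_x (`|f x| `^ 3)%:E <=
   ((1 + tail_cst (14 / 5)) `^ (25 / 28) * (l `^ 14^-1 * 2 `^ 2^-1 * 4 `^ 4^-1))%:E *
   (N `^ (15 / 7) * (Z `^ (5 / 28) * G2 `^ 4^-1)))%E.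
Proof.
have hh : (0 < 5 / 7 :> R) by lra.
have hh' : (0 < 2 / 7 :> R) by lra.
have hs : (5 / 7 + 2 / 7 = 1 :> R) by lra.
have := @hoelder_ge0 _ _ R leb3 _ _ _ _ (mpow (14 / 5) mf) (mpow (7 / 2) mf) (pow0 f (14 / 5))
  (pow0 f (7 / 2)) hh hh' hs.
under eq_integral => x _.
  rewrite !poweR_EFin -EFinM -!powRrM -powRD; last first.
    by apply/implyP => /eqP; lra.
  have -> : 14 / 5 * (5 / 7) + 7 / 2 * (2 / 7) = 3 :> R by lra.
  over.
move/le_trans; apply; rewrite -/W.
have W0 : (0 <= W)%E by apply: integral_ge0.
have Z0 : (0 <= Z)%E by apply: integral_ge0.
have G20 : (0 <= G2)%E.
  apply: integral_ge0 => x _; rewrite lee_fin.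
  by apply: addr_ge0; [exact: sqr_ge0|apply: sumr_ge0 => i _; exact: sqr_ge0].
have Wle : (W <= (1 + tail_cst (14 / 5))%:E * (N `^ (12 / 5) * Z `^ 5^-1))%E.
  have m23 : (2 < 14 / 5 :> R) && (14 / 5 < 3 :> R) by apply/andP; split; lra.
  have := weak_interpolation maf (fun x => normr_ge0 _) N0 wk m23.
  have -> : 3 * (14 / 5 - 2) = 12 / 5 :> R by lra.
  by have -> : 3 - 14 / 5 = 5^-1 :> R by lra.
have t0 : 0 <= 1 + tail_cst (14 / 5) :> R by rewrite addr_ge0 // tail_cst_ge0 //; lra.
have X2 := le_poweR (r := 2 / 7) _ (integral_ge0 _ (fun x _ => pow0 f (7 / 2) x)) X_le.
apply: le_trans (lee_wpmul2l (poweR_ge0 _ _) (X2 _)) _; first lra.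
have -> : ((((l `^ 6^-1 * 2 `^ (7 / 6))%:E * (W `^ (5 / 12) * (4%:E * G2) `^ (7 / 12))) `^ (3 / 2)) `^ (2 / 7)
   = (l `^ 14^-1 * 2 `^ 2^-1 * 4 `^ 4^-1)%:E * (W `^ (5 / 28) * G2 `^ 4^-1))%E.
  have c0 : (0 <= (l `^ 6^-1 * 2 `^ (7 / 6))%:E)%E by rewrite lee_fin mulr_ge0 ?powR_ge0.
  rewrite -poweRrM (poweRM _ c0) ?mule_ge0 ?poweR_ge0 // poweRM ?poweR_ge0 // -!poweRrM.
  rewrite [((4%:E * G2) `^ _)%E]poweRM // poweR_EFin powRM ?powR_ge0 // -!powRrM.
  have -> : 6^-1 * (3 / 2 * (2 / 7)) = 14^-1 :> R by lra.
  have -> : 7 / 6 * (3 / 2 * (2 / 7)) = 2^-1 :> R by lra.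
  have -> : 5 / 12 * (3 / 2 * (2 / 7)) = 5 / 28 :> R by lra.
  have -> : 7 / 12 * (3 / 2 * (2 / 7)) = 4^-1 :> R by lra.
  rewrite [X in _ = (X * _)%E]EFinM -muleA; congr (_ * _)%E.
  by rewrite muleCA.
apply: (@le_trans _ _ ((l `^ 14^-1 * 2 `^ 2^-1 * 4 `^ 4^-1)%:E * (W `^ (25 / 28) * G2 `^ 4^-1))%E).
  have -> : 25 / 28 = 5 / 7 + 5 / 28 :> R by lra.
  by rewrite poweRD2 ?divr_gt0 // muleCA !muleA.
have K0 : 0 <= l `^ 14^-1 * 2 `^ 2^-1 * 4 `^ 4^-1 by rewrite !mulr_ge0 ?powR_ge0.
move: (l `^ 14^-1 * 2 `^ 2^-1 * 4 `^ 4^-1) K0 => K K0.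
rewrite [X in (_ <= X%:E * _)%E]mulrC EFinM -muleA; apply: lee_wpmul2l; first by rewrite lee_fin.
rewrite !muleA; apply: lee_wpmul2r; first exact: poweR_ge0.
have := le_poweR (r := 25 / 28) _ W0 Wle; rewrite poweRM ?lee_fin ?mule_ge0 ?poweR_ge0 //.
rewrite poweRM ?poweR_ge0 // -!poweRrM poweR_EFin.
have -> : 12 / 5 * (25 / 28) = 15 / 7 :> R by lra.
have -> : 5^-1 * (25 / 28) = 5 / 28 :> R by lra.
rewrite muleA; apply; lra.
Qed.

End cube.

Section pressure.
Variables (p : space3 R -> R) (g : 'I_3 -> space3 R -> R).
Hypotheses (mp : measurable_fun setT p) (sp : supported a b p)
  (mg : forall i, measurable_fun setT (g i)) (sg : forall i, supported a b (g i))
  (hp : line_acl a b p g).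

Let m : R := 9 / 8.
Let m1 : 1 < m. Proof. rewrite /m; lra. Qed.
Let m0 : 0 <= m. Proof. rewrite /m; lra. Qed.
Let intg i := (\int[leb3]_x (`|g i x|%:E `^ m))%E.
Let Y := (intg i0 + intg i1 + intg i2)%E.
Let intg0 i : (0 <= intg i)%E. Proof. by apply: integral_ge0 => x _; exact: poweR_ge0. Qed.
Let Y0 : (0 <= Y)%E. Proof. by apply: adde_ge0 => //; exact: adde_ge0. Qed.

(** [32 ^ m] is [(2 / l) ^ m * (16 l) ^ m], the zero order term after the Poincare inequality;
    [4 ^ m] is the cost of the power of a sum of three derivatives. *)
Let cst1 : R := 2 `^ m * (32 `^ m + 4 `^ m).

Let cst1_ge0 : 0 <= cst1.
Proof. by rewrite mulr_ge0 ?addr_ge0 ?powR_ge0. Qed.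

(** The Sobolev exponent for a gradient in L^(9/8) is 27/16. Its conjugate exponent 27/11 is below
    3, so on a bounded box the weak norm controls the velocity factor. *)
Lemma slice_pressure c :
  (\int[leb3]_x ((\1_(box a b) x * `|p x - c|)%:E `^ m) <= ((16 * l) `^ m)%:E * Y)%E ->
  (\int[leb3]_x (`|f x| * (\1_(box a b) x * `|p x - c|))%:E <=
   ((1 + tail_cst (27 / 11)) `^ (11 / 27) * cst1 `^ (8 / 9) * l `^ 3^-1)%:E *
   (N * Y `^ (8 / 9)))%E.
Proof.
move=> hc.
pose h x := \1_(box a b) x * (p x - c).
have mB : measurable_fun setT (\1_(box a b) : space3 R -> R).
  by apply: measurable_indic; exact: measurable_box.
have mh : measurable_fun setT h.
  by apply: measurable_funM => //; exact: measurable_funB.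
have sh : supported a b h by move=> x nx; rewrite /h indicE memNset // mul0r.
have hE x : `|h x| = \1_(box a b) x * `|p x - c|.
  by rewrite /h normrM ger0_norm // indicE ler0n.
have lah : line_acl a b h g := line_acl_shift c sg hp.
have l20 : 0 <= 2 / l by rewrite divr_ge0 // ltW.
pose w x := 2 / l * `|h x| + \sum_(i < 3) `|g i x|.
have w0 x : 0 <= w x by apply: addr_ge0; [exact: mulr_ge0|exact: sumr_ge0].
have mag i : measurable_fun setT (fun x => `|g i x|%:E `^ m)%E.
  by apply: measurable_poweR; apply: measurable_abse; exact: mg.
have wle : (\int[leb3]_x ((w x `^ m)%R)%:E <= cst1%:E * Y)%E.
  have pt x : ((w x `^ m)%:E <= (2 `^ m)%:E * (((2 / l) `^ m)%:E * (`|h x|%:E `^ m) +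
      (4 `^ m)%:E * (`|g i0 x|%:E `^ m + `|g i1 x|%:E `^ m + `|g i2 x|%:E `^ m)))%E.
    have -> : ((w x `^ m)%:E = ((2 / l * `|h x|)%:E + (`|g i0 x| + `|g i1 x| + `|g i2 x|)%:E) `^ m)%E.
      have e1 : lift ord0 ord0 = i1 by exact: val_inj.
      have e2 : lift ord0 (lift ord0 ord0) = i2 by exact: val_inj.
      have e0 : ord0 = i0 by exact: val_inj.
      by rewrite -EFinD poweR_EFin /w !big_ord_recl big_ord0 addr0 e2 e1 e0 !addrA.
    apply: le_trans (poweRD_le m0 _ _) _; [by rewrite lee_fin mulr_ge0|by rewrite lee_fin !addr_ge0|].
    apply: lee_wpmul2l; first by rewrite lee_fin powR_ge0.
    apply: leeD; first by rewrite EFinM poweRM ?lee_fin // poweR_EFin.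
    by rewrite !EFinD; apply: poweRD3_le; rewrite ?lee_fin.
  have mh' : measurable_fun setT (fun x => `|h x|%:E `^ m)%E.
    by apply: measurable_poweR; exact: measurable_abse.
  have mS : measurable_fun setT (fun x => `|g i0 x|%:E `^ m + `|g i1 x|%:E `^ m + `|g i2 x|%:E `^ m)%E.
    exact: (emeasurable_funD (emeasurable_funD (mag i0) (mag i1)) (mag i2)).
  have S0 x : (0 <= `|g i0 x|%:E `^ m + `|g i1 x|%:E `^ m + `|g i2 x|%:E `^ m)%E.
    by rewrite !adde_ge0 ?poweR_ge0.
  have mL : measurable_fun setT (fun x => ((2 / l) `^ m)%:E * (`|h x|%:E `^ m))%E.
    exact: (emeasurable_funM (measurable_cst _) mh').
  have mR : measurable_fun setT (fun x => (4 `^ m)%:E *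
      (`|g i0 x|%:E `^ m + `|g i1 x|%:E `^ m + `|g i2 x|%:E `^ m))%E.
    exact: (emeasurable_funM (measurable_cst _) mS).
  have L0 x : (0 <= ((2 / l) `^ m)%:E * (`|h x|%:E `^ m))%E.
    by rewrite mule_ge0 ?poweR_ge0 // lee_fin powR_ge0.
  have R0 x : (0 <= (4 `^ m)%:E * (`|g i0 x|%:E `^ m + `|g i1 x|%:E `^ m + `|g i2 x|%:E `^ m))%E.
    by rewrite mule_ge0 // lee_fin powR_ge0.
  apply: (@le_trans _ _ (\int[leb3]_x ((2 `^ m)%:E * (((2 / l) `^ m)%:E * (`|h x|%:E `^ m) +
      (4 `^ m)%:E * (`|g i0 x|%:E `^ m + `|g i1 x|%:E `^ m + `|g i2 x|%:E `^ m))))%E).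
    apply: ge0_le_integral => //.
    - by move=> x _; rewrite lee_fin powR_ge0.
    - apply/measurable_EFinP; apply: (measurableT_comp (measurable_powR _)).
      apply: measurable_funD; first by apply: measurable_funM => //; exact: measurableT_comp.
      by apply: measurable_sum => i; apply: measurableT_comp.
    - exact: (emeasurable_funM (measurable_cst _) (emeasurable_funD mL mR)).
  rewrite (ge0_integralZl _ _ (emeasurable_funD mL mR)) //; last by move=> x _; rewrite adde_ge0.
  rewrite /cst1 EFinM -muleA; apply: lee_wpmul2l; first by rewrite lee_fin powR_ge0.
  have k0 (z : R) : (0 <= (z `^ m)%:E)%E by rewrite lee_fin powR_ge0.
  rewrite (ge0_integralD _ measurableT (fun x _ => L0 x) mL (fun x _ => R0 x) mR).
  rewrite (ge0_integralZl _ measurableT mh' (fun x _ => poweR_ge0 _ _) (k0 (2 / l))).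
  rewrite (ge0_integralZl _ measurableT mS (fun x _ => S0 x) (k0 4)).
  have -> : (\int[leb3]_x (`|g i0 x|%:E `^ m + `|g i1 x|%:E `^ m + `|g i2 x|%:E `^ m) = Y)%E.
    have q0 i x : [set: space3 R] x -> (0 <= `|g i x|%:E `^ m)%E by move=> _; exact: poweR_ge0.
    rewrite (ge0_integralD _ measurableT (fun x h => adde_ge0 (q0 i0 x h) (q0 i1 x h))
      (emeasurable_funD (mag i0) (mag i1)) (q0 i2) (mag i2)).
    by rewrite (ge0_integralD _ measurableT (q0 i0) (mag i0) (q0 i1) (mag i1)).
  rewrite EFinD ge0_muleDl ?lee_fin ?powR_ge0 //; apply: leeD => //.
  have -> : 32 `^ m = (2 / l) `^ m * (16 * l) `^ m.
    have -> : 32 = 2 / l * (16 * l) by field; rewrite gt_eqF.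
    have l16 : 0 <= 16 * l by rewrite mulr_ge0 // ltW.
    exact: powRM.
  rewrite EFinM -muleA; apply: lee_wpmul2l; first by rewrite lee_fin powR_ge0.
  by apply: le_trans hc; under eq_integral do rewrite hE.
have X_le := sobolev_box l0 side_le mh sh mg sg lah m1.
have e1 : 3 * m / 2 = 27 / 16 by rewrite /m; lra.
have e2 : m - 1 = 8^-1 by rewrite /m; lra.
rewrite e1 e2 -/w in X_le.
have {}X_le : ((\int[leb3]_x (`|h x| `^ (27 / 16))%:E) `^ (16 / 27) <=
    (cst1 `^ (8 / 9) * l `^ 9^-1)%:E * Y `^ (8 / 9))%E.
  have := le_poweR (r := 16 / 27) _ (integral_ge0 _ (fun x _ => pow0 h (27 / 16) x)) X_le.
  move/(_ (ltac:(lra)))/le_trans; apply.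
  rewrite -poweRrM; have -> : 3 / 2 * (16 / 27) = 8 / 9 :> R by lra.
  apply: (@le_trans _ _ (((l `^ 8^-1)%:E * (cst1%:E * Y)) `^ (8 / 9))%E).
    apply: le_poweR; first lra.
      by rewrite mule_ge0 ?lee_fin ?powR_ge0 // integral_ge0 // => x _; rewrite lee_fin powR_ge0.
    by apply: lee_wpmul2l; [rewrite lee_fin powR_ge0|exact: wle].
  rewrite poweRM ?mule_ge0 ?lee_fin ?powR_ge0 // poweRM ?lee_fin // !poweR_EFin -powRrM.
  have -> : 8^-1 * (8 / 9) = 9^-1 :> R by lra.
  by rewrite muleA -EFinM mulrC.
have F_le : ((\int[leb3]_x (`|f x| `^ (27 / 11))%:E) `^ (11 / 27) <=
    ((1 + tail_cst (27 / 11)) `^ (11 / 27) * l `^ (2 / 9))%:E * N)%E.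
  have t0 : 0 <= 1 + tail_cst (27 / 11) :> R by rewrite addr_ge0 // tail_cst_ge0 //; lra.
  have m23 : (0 < 27 / 11 :> R) && (27 / 11 < 3 :> R) by apply/andP; split; lra.
  have := le_poweR (r := 11 / 27) _ (integral_ge0 _ (fun x _ => pow0 f (27 / 11) x)) (slice_weak_power m23).
  move/(_ (ltac:(lra)))/le_trans; apply.
  rewrite poweRM ?poweR_ge0 ?lee_fin ?mulr_ge0 ?powR_ge0 // -poweRrM poweR_EFin powRM ?powR_ge0 // -powRrM.
  have -> : (3 - 27 / 11) * (11 / 27) = 2 / 9 :> R by lra.
  have -> : 27 / 11 * (11 / 27) = 1 :> R by lra.
  by rewrite poweRe1.
have hh : (0 < 11 / 27 :> R) by lra.
have hh' : (0 < 16 / 27 :> R) by lra.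
have hs : (11 / 27 + 16 / 27 = 1 :> R) by lra.
have := @hoelder_ge0 _ _ R leb3 _ _ _ _ (mpow (27 / 11) mf) (mpow (27 / 16) mh) (pow0 f (27 / 11))
  (pow0 h (27 / 16)) hh hh' hs.
under eq_integral => x _.
  rewrite !poweR_EFin -EFinM -!powRrM.
  have -> : 27 / 11 * (11 / 27) = 1 :> R by lra.
  have -> : 27 / 16 * (16 / 27) = 1 :> R by lra.
  rewrite !powRr1 // hE.
  over.
move/le_trans; apply.
apply: le_trans (lee_pmul (poweR_ge0 _ _) (poweR_ge0 _ _) F_le X_le) _.
have -> : 3^-1 = 2 / 9 + 9^-1 :> R by lra.
rewrite [l `^ (_ + _)]powRD; last by rewrite (gt_eqF l0) implybT.
move: (_ `^ (11 / 27)) (cst1 `^ _) (l `^ _) (l `^ _) (Y `^ _)%E => q1 q2 q3 q4 y.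
by rewrite muleACA -!EFinM (_ : q1 * q4 * (q2 * q3) = q1 * q2 * (q4 * q3)) //; ring.
Qed.

End pressure.

End slices.

(** * Time slices of the weak formulation *)

Section permutation.
Variable R : realType.

(** The argument is read as [((y, t), s)], with the [i]-th space coordinate [s] in the last place,
    since [weak_deriv_acl] treats the last variable. Time becomes one of the transverse
    variables. *)
Definition perm (i : 'I_3) (z : spacetime R) : spacetime R := (ins i z.1.1 z.2, z.1.2).

Lemma measurable_perm i : measurable_fun setT (perm i).
Proof.
have m11 : measurable_fun setT (fun z : spacetime R => (z.1.1, z.2)).
  apply: measurable_fun_pair => //; first exact: (measurableT_comp measurable_fst measurable_fst).
apply: measurable_fun_pair; first exact: (measurableT_comp (@measurable_ins R i) m11).
exact: (measurableT_comp measurable_snd measurable_fst).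
Qed.

Lemma leb4_tonelli_perm i (F : spacetime R -> \bar R) : measurable_fun setT F ->
  (forall z, 0 <= F z)%E -> (\int[leb4]_z F (perm i z) = \int[leb4]_z F z)%E.
Proof.
move=> mF F0.
have mFp := measurableT_comp mF (@measurable_perm i).
have Fp0 z : (0 <= F (perm i z))%E by [].
have -> : (\int[leb4]_z F z = \int[leb1]_t \int[leb3]_x F (x, t))%E.
  exact: (@fubini_tonelli2 _ _ _ _ R leb3 leb1 F mF F0).
have -> : (\int[leb4]_z F (perm i z) = \int[leb3]_w \int[leb1]_s F (perm i (w, s)))%E.
  exact: (@fubini_tonelli1 _ _ _ _ R leb3 leb1 _ mFp Fp0).
have mG := @measurable_fun_fubini_tonelli_F _ _ _ _ R leb1 _ mFp Fp0.
have G0 w : (0 <= \int[leb1]_s F (perm i (w, s)))%E by exact: integral_ge0.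
have -> : (\int[leb3]_w \int[leb1]_s F (perm i (w, s)) =
    \int[leb1]_t \int[leb2]_y \int[leb1]_s F (perm i ((y, t), s)))%E.
  exact: (@fubini_tonelli2 _ _ _ _ R leb2 leb1 _ mG G0).
apply: eq_integral => t _; rewrite (leb3_tonelli_ins i) //.
exact: (measurable_section1 t mF).
Qed.

Lemma integral_perm i (F : spacetime R -> \bar R) : measurable_fun setT F ->
  (\int[leb4]_z F (perm i z) = \int[leb4]_z F z)%E.
Proof.
move=> mF; rewrite [LHS]integralE [RHS]integralE; congr (_ - _)%E.
  rewrite -(leb4_tonelli_perm i (measurable_funepos mF) (funepos_ge0 F)).
  by apply: eq_integral => z _; rewrite !funeposE.
rewrite -(leb4_tonelli_perm i (measurable_funeneg mF) (funeneg_ge0 F)).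
by apply: eq_integral => z _; rewrite !funenegE.
Qed.

Lemma Rintegral_perm i (F : spacetime R -> R) : measurable_fun setT F ->
  \int[leb4]_z F (perm i z) = \int[leb4]_z F z.
Proof.
by move=> mF; rewrite /Rintegral (integral_perm i (F := EFin \o F)) //; exact/measurable_EFinP.
Qed.

Lemma integrable_perm i (F : spacetime R -> R) : leb4.-integrable setT (EFin \o F) ->
  leb4.-integrable setT (EFin \o (fun z => F (perm i z))).
Proof.
move=> /integrableP[mF Foo]; apply/integrableP; split.
  exact: (measurableT_comp mF (@measurable_perm i)).
rewrite (leb4_tonelli_perm i (F := fun z => `|(EFin \o F) z|%E)) //.
exact: measurableT_comp.
Qed.

Definition tensi (i : 'I_3) (al p1 p2 chi : R -> R) : spacetime R -> R :=
  if i == 0%N :> nat then tens al p1 p2 chi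
  else if i == 1%N :> nat then tens p1 al p2 chi else tens p1 p2 al chi.

Lemma tensi_perm i al p1 p2 chi z :
  tensi i al p1 p2 chi (perm i z) = p1 z.1.1.1 * p2 z.1.1.2 * chi z.1.2 * al z.2.
Proof.
case: z => -[[y1 y2] t] s.
by case: i => -[|[|[|//]]] ?; rewrite /tensi /tens /perm /ins /=; ring.
Qed.

Lemma derive_tensi i al p1 p2 chi : smooth1 al -> smooth1 p1 -> smooth1 p2 -> smooth1 chi ->
  'D_(dirx i) (tensi i al p1 p2 chi) = tensi i (derive1 al) p1 p2 chi.
Proof.
by move=> s0 s1 s2 s3; case: i => -[|[|[|//]]] ?; rewrite /tensi /= derive_dirx_tens.
Qed.

Lemma measurable_tensi i al p1 p2 chi : measurable_fun setT al -> measurable_fun setT p1 ->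
  measurable_fun setT p2 -> measurable_fun setT chi -> measurable_fun setT (tensi i al p1 p2 chi).
Proof.
have m3 : measurable_fun setT (fun z : spacetime R => z.1.2).
  exact: (measurableT_comp measurable_snd measurable_fst).
have m12 : measurable_fun setT (fun z : spacetime R => z.1.1).
  exact: (measurableT_comp measurable_fst measurable_fst).
have m1 := measurableT_comp (@measurable_fst _ _ R R) m12.
have m2 := measurableT_comp (@measurable_snd _ _ R R) m12.
have key (f1 f2 f3 f4 : R -> R) : measurable_fun setT f1 -> measurable_fun setT f2 ->
    measurable_fun setT f3 -> measurable_fun setT f4 -> measurable_fun setT (tens f1 f2 f3 f4).
  move=> h1 h2 h3 h4; apply: measurable_funM; last exact: (measurableT_comp h4 measurable_snd).
  apply: measurable_funM; last exact: (measurableT_comp h3 m3).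
  by apply: measurable_funM; [exact: (measurableT_comp h1 m1)|exact: (measurableT_comp h2 m2)].
by move=> h0 h1 h2 h3; case: i => -[|[|[|//]]] ?; rewrite /tensi /=; exact: key.
Qed.

(** The interval grows so that every point outside it has a neighbourhood on which [al] vanishes. *)
Lemma derive1_out (al : R -> R) (c d c' d' : R) : (forall s, ~ (c < s < d) -> al s = 0) ->
  c' < c -> d < d' -> forall s, ~ (c' < s < d') -> derive1 al s = 0.
Proof.
move=> al0 cc dd s ns; rewrite derive1E.
have e0 : 0 < Num.min (c - c') (d' - d) by rewrite lt_min !subr_gt0 cc.
have e : \forall y \near s, 0 = al y.
  near=> y; rewrite al0 // => /andP[cy yd]; apply: ns.
  have : `|s - y| < Num.min (c - c') (d' - d) by near: y; exact: (nbhsx_ballx s _ e0).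
  by rewrite lt_min !ltr_norml => /andP[/andP[? ?] /andP[? ?]]; apply/andP; split; lra.
by rewrite -(near_eq_derive _ e) derive_cst.
Unshelve. all: by end_near.
Qed.

Definition other1 (i : 'I_3) : 'I_3 := if i == 0%N :> nat then i1 else i0.
Definition other2 (i : 'I_3) : 'I_3 := if i == 2%N :> nat then i1 else i2.

Lemma coords_other1 i y s : coords (ins i y s : space3 R) (other1 i) = y.1.
Proof. by rewrite coordsE; case: i => -[|[|[|//]]] ?. Qed.

Lemma coords_other2 i y s : coords (ins i y s : space3 R) (other2 i) = y.2.
Proof. by rewrite coordsE; case: i => -[|[|[|//]]] ?. Qed.

Lemma box_ins (a b : 'I_3 -> R) i y s : box a b (ins i y s) <->
  [/\ a i < s < b i, a (other1 i) < y.1 < b (other1 i) & a (other2 i) < y.2 < b (other2 i)].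
Proof.
split=> [h|[h0 h1 h2]].
  by have := (h i, h (other1 i), h (other2 i)); rewrite coords_ins coords_other1 coords_other2 => -[[]].
move=> j; have [->|ji] := eqVneq j i; first by rewrite coords_ins.
have [->|j1] := eqVneq j (other1 i); first by rewrite coords_other1.
suff -> : j = other2 i by rewrite coords_other2.
apply/val_inj; move: ji j1; rewrite -!val_eqE /= /other1 /other2.
by case: i {h0 h1 h2} => -[|[|[|//]]] ?; case: j => -[|[|[|//]]] ?.
Qed.

Lemma test_fun_tensi (D : set (spacetime R)) (a b : 'I_3 -> R) (T0 T1 : R) i al p1 p2 chi
    (c d c1 d1 c2 d2 c3 d3 : R) :
  smooth1 al -> smooth1 p1 -> smooth1 p2 -> smooth1 chi ->
  a i < c -> d < b i -> (forall s, ~ (c < s < d) -> al s = 0) ->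
  a (other1 i) < c1 -> d1 < b (other1 i) -> (forall s, ~ (c1 < s < d1) -> p1 s = 0) ->
  a (other2 i) < c2 -> d2 < b (other2 i) -> (forall s, ~ (c2 < s < d2) -> p2 s = 0) ->
  T0 < c3 -> d3 < T1 -> (forall s, ~ (c3 < s < d3) -> chi s = 0) ->
  (forall x t, box a b x -> T0 < t < T1 -> D (x, t)) ->
  test_fun D (tensi i al p1 p2 chi).
Proof.
move=> s0 s1 s2 s3 ac db h0 ac1 db1 h1 ac2 db2 h2 ac3 db3 h3 bD.
have strict (u v w x y : R) : u < v -> x < y -> v <= w <= x -> u < w < y.
  by move=> h h' /andP[h4 h5]; rewrite (lt_le_trans h h4) (le_lt_trans h5 h').
case: i ac db ac1 db1 ac2 db2 => -[|[|[|//]]] hi ac db ac1 db1 ac2 db2; rewrite /tensi /=.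
- apply: (@test_fun_tens R D _ _ _ _ _ _ _ _ _ _ _ _ s0 s1 s2 s3 h0 h1 h2 h3) => -[[[x1 x2] x3] t] /= k0 k1 k2 k3.
  apply: bD; last exact: strict k3.
  apply/(box_ins a b (Ordinal hi) (x2, x3) x1); split; [exact: strict k0|exact: strict k1|exact: strict k2].
- apply: (@test_fun_tens R D _ _ _ _ _ _ _ _ _ _ _ _ s1 s0 s2 s3 h1 h0 h2 h3) => -[[[x1 x2] x3] t] /= k0 k1 k2 k3.
  apply: bD; last exact: strict k3.
  apply/(box_ins a b (Ordinal hi) (x1, x3) x2); split; [exact: strict k1|exact: strict k0|exact: strict k2].
- apply: (@test_fun_tens R D _ _ _ _ _ _ _ _ _ _ _ _ s1 s2 s0 s3 h1 h2 h0 h3) => -[[[x1 x2] x3] t] /= k0 k1 k2 k3.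
  apply: bD; last exact: strict k3.
  apply/(box_ins a b (Ordinal hi) (x1, x2) x3); split; [exact: strict k2|exact: strict k0|exact: strict k1].
Qed.

Lemma acl_zero (a b : R) (f g : R -> R) : (forall s, f s = 0) -> (forall s, g s = 0) -> acl a b f g.
Proof.
move=> f0 g0; split.
  by rewrite (_ : EFin \o g = cst 0%E) ?integrable0 //; apply/funext => s /=; rewrite g0.
exists 0; apply: aeW => s _; rewrite f0 add0r /Rintegral integral0_eq // => t _.
by rewrite g0.
Qed.

Lemma Rintegral_restrict (D Q : set (spacetime R)) (f h : spacetime R -> R) :
  measurable D -> Q `<=` D -> (forall z, ~ Q z -> h z = 0) ->
  \int[leb4]_(z in D) (f z * h z) = \int[leb4]_z ((f \_ Q) z * h z).
Proof.
move=> mD QD hQ; rewrite [LHS]Rintegral_mkcond; congr Rintegral; apply/funext => z.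
rewrite !patchE; case: ifPn => [_|/negP nD]; case: ifPn => [//|/negP nQ].
- by rewrite (hQ z) ?mulr0 ?mul0r // => Qz; apply: nQ; rewrite inE.
- by move=> Qz; case: nD; move: Qz; rewrite !inE; exact: QD.
- by rewrite mul0r.
Qed.

Section slices.
Variables (D : set (spacetime R)) (a b : 'I_3 -> R) (T0 T1 : R).
Hypotheses (mD : measurable D) (ab : forall i, a i < b i) (T01 : T0 < T1).
Hypothesis (bD : forall x t, box a b x -> T0 < t < T1 -> D (x, t)).

Definition cylbox : set (spacetime R) := box a b `*` `]T0, T1[%classic.

Lemma cylbox_sub : cylbox `<=` D.
Proof. by move=> [x t] [/= bx]; rewrite in_itv /=; exact: bD. Qed.

(** For each direction, [weak_deriv_acl] with time among the transverse variables gives absolute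
    continuity on almost every line in space-time; Fubini turns this into almost every line of
    almost every slice. The transverse test functions are products of bumps. *)
Lemma weak_deriv_line_acl f (g : 'I_3 -> spacetime R -> R) :
  leb4.-integrable setT (EFin \o (f \_ cylbox)) ->
  (forall i, leb4.-integrable setT (EFin \o (g i \_ cylbox))) ->
  (forall i, weak_deriv D (dirx i) f (g i)) ->
  {ae leb1, forall t, T0 < t < T1 ->
    line_acl a b (fun x => (f \_ cylbox) (x, t)) (fun i x => (g i \_ cylbox) (x, t))}.
Proof.
move=> fi gi wd.
suff key (i : 'I_3) : {ae leb1, forall t, T0 < t < T1 -> {ae leb2, forall y,
    acl (a i) (b i) (fun s => (f \_ cylbox) (ins i y s, t)) (fun s => (g i \_ cylbox) (ins i y s, t))}}.
  have := ae_and (key i0) (ae_and (key i1) (key i2)).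
  apply: filterS => t [h0 [h1 h2]] tT i.
  have := h0 tT; have := h1 tT; have := h2 tT.
  case: i => -[|[|[|//]]] hi k2 k1 k0.
  - by rewrite (_ : Ordinal hi = i0) //; exact: val_inj.
  - by rewrite (_ : Ordinal hi = i1) //; exact: val_inj.
  - by rewrite (_ : Ordinal hi = i2) //; exact: val_inj.
pose S1 := sides a b (other1 i); pose S2 := sides a b (other2 i).
pose bu1 := bumps (a (other1 i)) (b (other1 i)).
pose bu2 := bumps (a (other2 i)) (b (other2 i)).
pose bu3 := bumps T0 T1.
have bnd (c d : R) n : measurable_fun setT (bumps c d n) /\ exists C, forall x, `|bumps c d n x| <= C.
  by split; [exact: measurable_bumps|exists 1; exact: bumps_norm].
pose Phi2 := [set w : R * R -> R | exists phi n, range bu1 phi /\ w = fun z => phi z.1 * bu2 n z.2].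
have sep2 : separates leb2 (S1 `*` S2) Phi2.
  apply: (@separates_prod R _ _ _ _ leb1 leb1) => //.
  - exact: measurable_sides.
  - exact: measurable_sides.
  - by move=> _ [n _ <-]; exact: bnd.
  - by move=> n; exact: bnd.
  - exact: bumps_separate.
  - exact: bumps_separate.
have bPhi2 phi : Phi2 phi -> measurable_fun setT phi /\ exists C, forall x, `|phi x| <= C.
  move=> [_ [n [[k _ <-] ->]]]; split.
    apply: measurable_funM.
      exact: (measurableT_comp (measurable_bumps _ _ _) measurable_fst).
    exact: (measurableT_comp (measurable_bumps _ _ _) measurable_snd).
  by exists 1 => x; rewrite normrM mulr_ile1 // bumps_norm.
pose Phi := [set w : space3 R -> R | exists phi n, Phi2 phi /\ w = fun z => phi z.1 * bu3 n z.2].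
have sep3 : separates leb3 ((S1 `*` S2) `*` `]T0, T1[%classic) Phi.
  apply: (@separates_prod R _ _ _ _ leb2 leb1) => //.
  - by apply: measurableX; exact: measurable_sides.
  - by move=> n; exact: bnd.
  - exact: bumps_separate.
have bPhi phi : Phi phi -> measurable_fun setT phi /\ exists C, forall x, `|phi x| <= C.
  move=> [phi2 [n [P2 ->]]]; have [m2 [C hC]] := bPhi2 _ P2; split.
    apply: measurable_funM; first exact: (measurableT_comp m2 measurable_fst).
    exact: (measurableT_comp (measurable_bumps _ _ _) measurable_snd).
  exists C => x; rewrite normrM -[C]mulr1; apply: ler_pM => //; exact: bumps_norm.
have mfQ : measurable_fun setT (f \_ cylbox) by apply/measurable_EFinP; exact: (measurable_int _ fi).
have mgQ : measurable_fun setT (g i \_ cylbox) by apply/measurable_EFinP; exact: (measurable_int _ (gi i)).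
have weak be al : Phi be -> smooth1 al ->
    (exists c d, [/\ a i < c, d < b i & forall s, ~ (c < s < d) -> al s = 0]) ->
    \int[leb4]_z ((f \_ cylbox) (perm i z) * (be z.1 * derive1 al z.2)) =
    - \int[leb4]_z ((g i \_ cylbox) (perm i z) * (be z.1 * al z.2)).
  move=> [_ [n3 [[_ [n2 [[n1 _ <-] ->]]] ->]]] sal [c [d [ac db al0]]].
  have [s1 s2 s3] : [/\ smooth1 (bu1 n1), smooth1 (bu2 n2) & smooth1 (bu3 n3)].
    by split; exact: smooth1_bumps.
  have [c1 [d1 [h1 _ h1' h1'']]] := @bumps_supp R _ _ (ab (other1 i)) n1.
  have [c2 [d2 [h2 _ h2' h2'']]] := @bumps_supp R _ _ (ab (other2 i)) n2.
  have [c3 [d3 [h3 _ h3' h3'']]] := @bumps_supp R _ _ T01 n3.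
  have tf := test_fun_tensi (i := i) sal s1 s2 s3 ac db al0 h1 h1' h1'' h2 h2' h2'' h3 h3' h3'' bD.
  have [_ _ /(_ _ tf)] := wd i.
  have E z : 'D_(dirx i) (tensi i al (bu1 n1) (bu2 n2) (bu3 n3)) z =
      tensi i (derive1 al) (bu1 n1) (bu2 n2) (bu3 n3) z.
    by rewrite -(derive_tensi i sal s1 s2 s3).
  under eq_Rintegral do rewrite E.
  (* The derivative of [al] is known to vanish only off a slightly larger interval, which still fits
     into []a i, b i[]. *)
  pose c' := (a i + c) / 2; pose d' := (d + b i) / 2.
  have [ac' cc' dd' db'] : [/\ a i < c', c' < c, d < d' & d' < b i].
    by rewrite /c' /d'; split; lra.
  have dal0 := derive1_out al0 cc' dd'.
  have al0' s : ~ (c' < s < d') -> al s = 0.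
    move=> ns; apply: al0 => /andP[cs sd]; apply: ns.
    by rewrite (lt_trans cc' cs) (lt_trans sd dd').
  have out al' z : (forall s, ~ (c' < s < d') -> al' s = 0) -> ~ cylbox z ->
      tensi i al' (bu1 n1) (bu2 n2) (bu3 n3) z = 0.
    case: z => x t h nQ; rewrite -(ins_del i x).
    have -> : (ins i (del i x) (coords x i), t) = perm i ((del i x, t), coords x i) by [].
    rewrite tensi_perm /=.
    have [k1|k1] := pselect (c1 < (del i x).1 < d1); last by rewrite [bu1 _ _]h1'' ?mul0r.
    have [k2|k2] := pselect (c2 < (del i x).2 < d2); last by rewrite [bu2 _ _]h2'' ?mulr0 ?mul0r.
    have [k3|k3] := pselect (c3 < t < d3); last by rewrite [bu3 _ _]h3'' ?mulr0 ?mul0r.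
    have [k4|k4] := pselect (c' < coords x i < d'); last by rewrite h ?mulr0.
    have strict (u v w x' y : R) : u < v -> x' < y -> v < w < x' -> u < w < y.
      by move=> l1 l2 /andP[l3 l4]; rewrite (lt_trans l1 l3) (lt_trans l4 l2).
    case: nQ; split; last by rewrite /= in_itv; exact: strict k3.
    rewrite /= -(ins_del i x); apply/box_ins; split;
      [exact: strict k4|exact: strict k1|exact: strict k2].
  have mt al' : measurable_fun setT al' ->
      measurable_fun setT (tensi i al' (bu1 n1) (bu2 n2) (bu3 n3)).
    by move=> mal; apply: measurable_tensi => //; exact: measurable_bumps.
  rewrite (Rintegral_restrict _ mD cylbox_sub (fun z => out _ z dal0)).
  rewrite (Rintegral_restrict _ mD cylbox_sub (fun z => out _ z al0')).
  have mL := measurable_funM mfQ (mt _ (smooth1_measurable (smooth1_deriv sal))).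
  have mRr := measurable_funM mgQ (mt _ (smooth1_measurable sal)).
  rewrite -(Rintegral_perm i mL) -(Rintegral_perm i mRr).
  have L (al' : R -> R) (f' : spacetime R -> R) :
      \int[leb4]_z (f' \* tensi i al' (bu1 n1) (bu2 n2) (bu3 n3)) (perm i z) =
      \int[leb4]_z (f' (perm i z) *
        (bu1 n1 z.1.1.1 * bu2 n2 z.1.1.2 * bu3 n3 z.1.2 * al' z.2)).
    by apply: eq_Rintegral => z _; rewrite -(tensi_perm i).
  by rewrite !L.
have abi := ab i.
have mB3 : measurable ((S1 `*` S2) `*` `]T0, T1[%classic).
  by apply: measurableX => //; apply: measurableX; exact: measurable_sides.
have := @weak_deriv_acl R _ _ _ _ _ _ abi mB3 bPhi sep3 (integrable_perm i fi) (integrable_perm i (gi i)) weak.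
move=> /(@ae_prod_snd _ _ _ _ R leb2 leb1); apply: filterS => t ht tT.
apply: filterS ht => y; rewrite /perm /= => hy.
have [B|nB] := pselect ((S1 `*` S2) y).
  by apply: hy; split=> //=; rewrite in_itv.
have nin s : ~ cylbox (ins i y s, t).
  move=> [/= /(box_ins a b i y s)[_ k1 k2] _]; apply: nB; rewrite /S1 /S2 /sides; split=> /=; by rewrite in_itv.
by apply: acl_zero => s; rewrite patchE memNset.
Qed.

End slices.

End permutation.

(** * Solenoidal slices with zero normal trace *)

Section solenoidal.
Variable R : realType.

Definition tens3 (f : 'I_3 -> R -> R) (x : space3 R) : R := f i0 x.1.1 * f i1 x.1.2 * f i2 x.2.

(** With this list of factors, [tens3 (derf f i)] is the [i]-th partial derivative of [tens3 f]. *)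
Definition derf (f : 'I_3 -> R -> R) (i : 'I_3) : 'I_3 -> R -> R :=
  fun j => if j == i then derive1 (f j) else f j.

Lemma dirx_tens f psi (i : 'I_3) z : (forall j, smooth1 (f j)) -> smooth1 psi ->
  'D_(dirx i) (tens (f i0) (f i1) (f i2) psi) z = tens3 (derf f i) z.1 * psi z.2.
Proof.
move=> sf sp; have := derive_dirx_tens i (sf i0) (sf i1) (sf i2) sp.
move/(congr1 (fun h => h z)) => ->; rewrite /tens /tens3 /derf.
by case: i => -[|[|[|//]]] ?.
Qed.

Lemma measurable_tens3 f : (forall j, measurable_fun setT (f j)) -> measurable_fun setT (tens3 f).
Proof.
move=> mf; have m11 : measurable_fun setT (fun z : space3 R => z.1.1).
  exact: (measurableT_comp measurable_fst measurable_fst).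
have m12 : measurable_fun setT (fun z : space3 R => z.1.2).
  exact: (measurableT_comp measurable_snd measurable_fst).
apply: measurable_funM; last exact: (measurableT_comp (mf i2) measurable_snd).
by apply: measurable_funM; [exact: (measurableT_comp (mf i0) m11)|exact: (measurableT_comp (mf i1) m12)].
Qed.

Lemma smooth1_derf f i : (forall j, smooth1 (f j)) -> forall j, smooth1 (derf f i j).
Proof. by move=> sf j; rewrite /derf; case: ifP => _ //; exact: smooth1_deriv. Qed.

Lemma tens3_out f (c d : 'I_3 -> R) x : (forall j s, ~ (c j < s < d j) -> f j s = 0) ->
  ~ (forall j, c j < coords x j < d j) -> tens3 f x = 0.
Proof.
move=> h nx; have [j nj] : exists j, ~ (c j < coords x j < d j) by apply/existsNP.
have := h j _ nj; rewrite coordsE /tens3; case: j {nj} => -[|[|[|//]]] hj /=.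
- by rewrite (_ : Ordinal hj = i0) ?[f i0 _]/id => [->|]; [rewrite !mul0r|exact: val_inj].
- by rewrite (_ : Ordinal hj = i1) => [->|]; [rewrite mulr0 mul0r|exact: val_inj].
- by rewrite (_ : Ordinal hj = i2) => [->|]; [rewrite mulr0|exact: val_inj].
Qed.

Lemma tens3_bounded f (c d : 'I_3 -> R) : (forall j, smooth1 (f j)) ->
  (forall j s, ~ (c j < s < d j) -> f j s = 0) -> exists C, forall x, `|tens3 f x| <= C.
Proof.
move=> sf h.
have [C0 C00 h0] := smooth1_supp_bounded _ _ (sf i0) (h i0).
have [C1 C10 h1] := smooth1_supp_bounded _ _ (sf i1) (h i1).
have [C2 C20 h2] := smooth1_supp_bounded _ _ (sf i2) (h i2).
exists (C0 * C1 * C2) => x; rewrite /tens3 !normrM; apply: ler_pM => //.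
exact: ler_pM.
Qed.

Variables (z0 : spacetime R) (u : 'I_3 -> spacetime R -> R) (Du : 'I_3 -> 'I_3 -> spacetime R -> R).
Let D := halfcyl z0 1.
Let T0 := tstart z0 1.
Let T1 := z0.2.
Let x3 := z0.1.2.
Variables (f : 'I_3 -> R -> R) (c d : 'I_3 -> R).
Hypotheses (mD : measurable D) (sf : forall j, smooth1 (f j)).
Hypothesis f0 : forall j s, ~ (c j < s < d j) -> f j s = 0.
Hypothesis df0 : forall j s, ~ (c j < s < d j) -> derive1 (f j) s = 0.
Hypothesis cB : forall x, (forall j, c j <= coords x j <= d j) -> eball z0.1 1 x.
Hypothesis c3 : c i2 <= x3.

(** The third lower face is moved up to the flat boundary, while the support of the test function
    may reach below it. *)
Definition lower (j : 'I_3) : R := if j == i2 then x3 else c j.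
Let Q := cylbox lower d T0 T1.

Hypothesis iu : forall i, leb4.-integrable setT (EFin \o (u i \_ Q)).
Hypothesis iDu : forall i, leb4.-integrable setT (EFin \o (Du i i \_ Q)).
Hypothesis wd : forall i, weak_deriv D (dirx i) (u i) (Du i i).
Hypothesis fl : flat_trace z0 1 (u ord_max) (Du ord_max ord_max) (fun=> 0).
Hypothesis dv : {ae leb4, forall z, D z -> \sum_(i < 3) Du i i z = 0}.

Let boxlow x : box lower d x <-> (forall j, c j < coords x j < d j) /\ x3 < coords x i2.
Proof.
split=> [h|[h k] j].
  split; last by have /andP[] := h i2.
  move=> j; have := h j; rewrite /lower; case: eqP => [->|//] /andP[h1 h2].
  by rewrite (le_lt_trans c3 h1).
by rewrite /lower; case: eqP => [->|//]; rewrite k; case/andP: (h i2).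
Qed.

Let QD : Q `<=` D.
Proof.
move=> [x t] [/= /boxlow[bx x3x] ht]; split=> //=; split.
  by apply: cB => j; case/andP: (bx j) => h1 h2; rewrite !ltW.
by move: x3x; rewrite coordsE.
Qed.

Let derf0 i j s : ~ (c j < s < d j) -> derf f i j s = 0.
Proof. by rewrite /derf; case: ifP => _ h; [exact: df0|exact: f0]. Qed.

Let out (h : 'I_3 -> R -> R) psi z : (forall j s, ~ (c j < s < d j) -> h j s = 0) ->
  (forall s, ~ (T0 < s < T1) -> psi s = 0) -> D z -> ~ Q z -> tens3 h z.1 * psi z.2 = 0.
Proof.
move=> h0 psi0 Dz nQ; have [tT|ntT] := pselect (T0 < z.2 < T1); last by rewrite psi0 ?mulr0.
rewrite (tens3_out (c := c) (d := d) h0) ?mul0r // => bx; apply: nQ; split; last by rewrite /= in_itv.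
by apply/boxlow; split=> //; case: Dz => -[_ /=]; rewrite coordsE.
Qed.

(** The spatial product rule for [u_i] times the test function, without summation over [i]. Against
    functions of time it integrates to zero: [flat_claim] for the normal direction, [side_claim] for
    the tangential ones. *)
Let E i z := (u i \_ Q) z * tens3 (derf f i) z.1 + (Du i i \_ Q) z * tens3 f z.1.

Let restrictE i psi : (forall s, ~ (T0 < s < T1) -> psi s = 0) ->
  \int[leb4]_(z in D) (u i z * (tens3 (derf f i) z.1 * psi z.2) + Du i i z * (tens3 f z.1 * psi z.2)) =
  \int[leb4]_z (E i z * psi z.2).
Proof.
move=> psi0; rewrite [LHS]Rintegral_mkcond; congr Rintegral; apply/funext => z.
rewrite /E !patchE; case: ifPn => [Dz|/negP nD]; case: ifPn => [Qz|/negP nQ].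
- ring.
- have Dz' : D z by rewrite inE in Dz.
  have nQ' : ~ Q z by move=> Qz; apply: nQ; rewrite inE.
  by rewrite (out (@derf0 i) psi0 Dz' nQ') (out f0 psi0 Dz' nQ') !mulr0 !mul0r addr0 mul0r.
- by case: nD; move: Qz; rewrite !inE; exact: QD.
- by rewrite !mul0r addr0 mul0r.
Qed.

Let Em i : leb4.-integrable setT (EFin \o E i).
Proof.
have key g h : (forall j, smooth1 (h j)) -> (forall j s, ~ (c j < s < d j) -> h j s = 0) ->
    leb4.-integrable setT (EFin \o (g \_ Q)) ->
    leb4.-integrable setT (EFin \o (fun z => (g \_ Q) z * tens3 h z.1)).
  move=> sh h0 ig; have [C hC] := tens3_bounded sh h0.
  apply: (@integrable_bddM _ _ R leb4 setT _ (fun z : spacetime R => tens3 h z.1) (C) measurableT ig).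
    apply: (measurableT_comp (@measurable_tens3 h _) measurable_fst) => j.
    exact: smooth1_measurable.
  by move=> z _; exact: hC.
apply: (integrableD measurableT (key _ _ _ _ (iu i)) (key _ _ _ _ (iDu i))) => //.
- exact: smooth1_derf.
- exact: derf0.
Qed.

Let Emeas i : measurable_fun setT (E i).
Proof. by apply/measurable_EFinP; exact: (measurable_int _ (Em i)). Qed.

Let psi_data (psi : R -> R) := smooth1 psi /\ exists a b, [/\ T0 < a, b < T1 &
  forall s, ~ (a < s < b) -> psi s = 0].

Let psi_out psi : psi_data psi -> forall s, ~ (T0 < s < T1) -> psi s = 0.
Proof.
move=> [_ [a [b [h1 h2 h]]]] s ns; apply: h => /andP[h3 h4]; apply: ns.
by rewrite (lt_trans h1 h3) (lt_trans h4 h2).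
Qed.

(** In the normal direction the Green formula of the trace applies, whose boundary term is zero; its
    test functions may be nonzero on the flat boundary. *)
Let flat_claim psi : psi_data psi -> \int[leb4]_z (E i2 z * psi z.2) = 0.
Proof.
move=> pd; have [sp [a [b [h1 h2 h]]]] := pd.
rewrite -(restrictE i2 (psi_out pd)).
have tf : test_fun (cyl z0 1) (tens (f i0) (f i1) (f i2) psi).
  apply: (@test_fun_tens R (cyl z0 1) _ _ _ _ _ _ _ _ _ _ _ _ (sf i0) (sf i1) (sf i2) sp
    (f0 (j := i0)) (f0 (j := i1)) (f0 (j := i2)) h).
  move=> [[[x1 x2] y3] t] /= k0 k1 k2 /andP[k3 k4]; split=> /=.
    apply: cB => j; rewrite coordsE; case: j => -[|[|[|//]]] hj /=.
    - by rewrite (_ : Ordinal hj = i0) //; exact: val_inj.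
    - by rewrite (_ : Ordinal hj = i1) //; exact: val_inj.
    - by rewrite (_ : Ordinal hj = i2) //; exact: val_inj.
  by rewrite in_itv /= (lt_le_trans h1 k3) (le_lt_trans k4 h2).
have [_] := fl tf.
have -> : (ord_max : 'I_3) = i2 by exact: val_inj.
under [X in _ = - X -> _]eq_Rintegral do rewrite mul0r.
rewrite [X in _ = - X -> _](_ : _ = 0); last by rewrite /Rintegral integral0.
rewrite oppr0 => <-; apply: eq_Rintegral => z _.
by rewrite dirx_tens.
Qed.

(** A cutoff that is zero up to height [1 / (n + 1)] above the flat boundary and one from height
    [2 / (n + 1)] on. *)
Let step n (s : R) := stepf (n.+1%:R * s + (- (n.+1%:R * x3) - 1)).

Let step_smooth n : smooth1 (step n).
Proof. exact: smooth1_affine (@smooth1_stepf R). Qed.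

Let step_le n s : s <= x3 + n.+1%:R^-1 -> step n s = 0.
Proof.
move=> h; apply: stepf_le0; have n0 : 0 < n.+1%:R :> R by [].
have : n.+1%:R * s <= n.+1%:R * (x3 + n.+1%:R^-1) by rewrite ler_pM2l.
rewrite mulrDr mulfV ?gt_eqF //; lra.
Qed.

Let step_cvg s : step n s @[n --> \oo] --> (\1_[set s : R | x3 < s] s : R).
Proof.
have [xs|sx] := ltP x3 s.
  rewrite indicE mem_set //; apply: cvg_near_cst.
  have sx0 : 0 < s - x3 by rewrite subr_gt0.
  pose k := Num.bound (2 / (s - x3)).
  have hk : 2 / (s - x3) < k%:R by apply: archi_boundP; rewrite divr_ge0 // ltW.
  exists k => // n /= kn; rewrite /step stepf_ge1 //.
  have : 2 / (s - x3) <= n.+1%:R.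
    by rewrite (le_trans (ltW hk)) // ler_nat (leq_trans kn).
  rewrite ler_pdivrMr // mulrBr; lra.
rewrite indicE memNset; last by apply/negP; rewrite -leNgt.
apply: cvg_near_cst; apply: nearW => n; apply: step_le.
by rewrite (le_trans sx) // lerDl.
Qed.

(** In a tangential direction only the interior weak derivative is at hand, so the test function is
    cut off near the flat boundary. The cutoff depends on the third coordinate alone, hence commutes
    with the [i]-th derivative, and is removed by dominated convergence. *)
Let side_claim i psi : i != i2 -> psi_data psi -> \int[leb4]_z (E i z * psi z.2) = 0.
Proof.
move=> ii2 pd; have [sp [a [b [h1 h2 h]]]] := pd.
have mpsi := smooth1_measurable sp.
have [Cp Cp0 hCp] := smooth1_supp_bounded _ _ sp h.
have iEp : leb4.-integrable setT (EFin \o (fun z => E i z * psi z.2)).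
  apply: (@integrable_bddM _ _ R leb4 setT _ (fun z : spacetime R => psi z.2) (Cp) measurableT (Em i)).
    exact: (measurableT_comp mpsi measurable_snd).
  by move=> z _; exact: hCp.
have m12 : measurable_fun setT (fun z : spacetime R => z.1.2).
  exact: (measurableT_comp measurable_snd measurable_fst).
have mstep n : measurable_fun setT (fun z : spacetime R => step n z.1.2).
  exact: (measurableT_comp (smooth1_measurable (step_smooth n)) m12).
have mI : measurable_fun setT (fun z : spacetime R => \1_[set s : R | x3 < s] z.1.2 : R).
  have mS : measurable [set s : R | x3 < s].
    by rewrite (_ : [set s | _] = `]x3, +oo[%classic) //; apply/seteqP; split=> s /=; rewrite in_itv /= andbT.
  exact: (measurableT_comp (measurable_indic mS) m12).
have bstep n (z : spacetime R) : `|step n z.1.2| <= 1.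
  by rewrite ger0_norm ?stepf_ge0 // stepf_le1.
have cvgs (z : spacetime R) : step n z.1.2 @[n --> \oo] --> (\1_[set s : R | x3 < s] z.1.2 : R).
  exact: step_cvg.
suff zero n : \int[leb4]_z (E i z * psi z.2 * step n z.1.2) = 0.
  have := @Rintegral_zero_lim _ _ R leb4 _ _ _ 1 iEp mstep mI bstep cvgs zero.
  move=> <-; apply: eq_Rintegral => z _.
  have [Qz|nQ] := pselect (Q z).
    by rewrite indicE mem_set ?mulr1 //; case: Qz => /boxlow[_]; rewrite coordsE.
  by rewrite /E !patchE !memNset // !mul0r addr0 !mul0r.
pose g j := if j == i2 then (fun s => f j s * step n s) else f j.
have sg j : smooth1 (g j).
  by rewrite /g; case: ifP => _ //; exact: (smooth1M (sf j) (step_smooth n)).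
have tE (x : space3 R) : tens3 g x = tens3 f x * step n x.2.
  by rewrite /tens3 /g /= mulrA.
have dtE (x : space3 R) : tens3 (derf g i) x = tens3 (derf f i) x * step n x.2.
  rewrite /tens3 /derf /g /=; have -> : (i2 == i) = false by rewrite eq_sym (negbTE ii2).
  by rewrite mulrA.
have tf : test_fun D (tens (g i0) (g i1) (g i2) psi).
  have g2 s : ~ (x3 + n.+1%:R^-1 < s < d i2) -> g i2 s = 0.
    move=> ns; rewrite /g eqxx; have [sl|ls] := leP s (x3 + n.+1%:R^-1).
      by rewrite step_le ?mulr0.
    rewrite f0 ?mul0r // => /andP[_ sd]; apply: ns; by rewrite ls sd.
  apply: (@test_fun_tens R D _ _ _ _ _ _ _ _ _ _ _ _ (sg i0) (sg i1) (sg i2) sp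
    (f0 (j := i0)) (f0 (j := i1)) g2 h).
  move=> [[[x1 x2] y3] t] /= k0 k1 /andP[k2 k2'] /andP[k3 k4].
  have xy : x3 < y3 by apply: lt_le_trans k2; rewrite ltrDl invr_gt0.
  split=> /=; last by rewrite in_itv /= (lt_le_trans h1 k3) (le_lt_trans k4 h2).
  split => //; apply: cB => j; rewrite coordsE; case: j => -[|[|[|//]]] hj /=.
  - by rewrite (_ : Ordinal hj = i0) //; exact: val_inj.
  - by rewrite (_ : Ordinal hj = i1) //; exact: val_inj.
  - rewrite (_ : Ordinal hj = i2) //; last exact: val_inj.
    by rewrite k2' andbT (le_trans c3) // ltW.
have [_ _ /(_ _ tf)] := wd i.
have psi0 := psi_out pd.
have gf0 j s : ~ (c j < s < d j) -> g j s = 0.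
  by move=> ns; rewrite /g; case: ifP => _; rewrite f0 ?mul0r.
have dout z : ~ Q z -> D z -> tens3 (derf g i) z.1 * psi z.2 = 0.
  by move=> nQ Dz; rewrite dtE mulrAC (out (@derf0 i) psi0 Dz nQ) mul0r.
have gout z : ~ Q z -> D z -> tens3 g z.1 * psi z.2 = 0.
  by move=> nQ Dz; rewrite (out gf0 psi0 Dz nQ).
have conv (w : spacetime R -> R) (k : space3 R -> R) (k' : space3 R -> R) :
    (forall x, k' x = k x * step n x.2) -> (forall z, ~ Q z -> D z -> k' z.1 * psi z.2 = 0) ->
    \int[leb4]_(z in D) (w z * (k' z.1 * psi z.2)) =
    \int[leb4]_z ((w \_ Q) z * (k z.1 * psi z.2 * step n z.1.2)).
  move=> kk k0; rewrite [LHS]Rintegral_mkcond; congr Rintegral; apply/funext => z.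
  rewrite !patchE; case: ifPn => [Dz|/negP nD]; case: ifPn => [Qz|/negP nQ].
  - by rewrite kk; ring.
  - by rewrite k0 ?mulr0 ?mul0r // ?inE //; [move=> Qz; apply: nQ; rewrite inE|rewrite inE in Dz].
  - by case: nD; move: Qz; rewrite !inE; exact: QD.
  - by rewrite !mul0r.
under eq_Rintegral do rewrite (dirx_tens _ _ sg sp).
have LHS_E : \int[leb4]_(z in D) (u i z * (tens3 (derf g i) z.1 * psi z.2)) = _ :=
  conv (u i) _ _ dtE dout.
have RHS_E : \int[leb4]_(z in D) (Du i i z * tens (g i0) (g i1) (g i2) psi z) = _ :=
  conv (Du i i) _ _ tE gout.
rewrite LHS_E RHS_E => e.
pose M k (z : spacetime R) := tens3 k z.1 * psi z.2 * step n z.1.2.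
have iM w k : (forall j, smooth1 (k j)) -> (forall j s, ~ (c j < s < d j) -> k j s = 0) ->
    leb4.-integrable setT (EFin \o (w \_ Q)) ->
    leb4.-integrable setT (EFin \o (fun z => (w \_ Q) z * M k z)).
  move=> sk k0 iw; have [C hC] := tens3_bounded sk k0.
  apply: (@integrable_bddM _ _ R leb4 setT _ (M k) (C * Cp * 1) measurableT iw).
    apply: measurable_funM => //; apply: measurable_funM.
      apply: (measurableT_comp (@measurable_tens3 k _) measurable_fst) => j.
      exact: smooth1_measurable.
    exact: (measurableT_comp mpsi measurable_snd).
  move=> z _; rewrite /M normrM normrM.
  apply: (ler_pM (mulr_ge0 (normr_ge0 _) (normr_ge0 _)) (normr_ge0 _) _ (bstep n z)).
  exact: (ler_pM (normr_ge0 _) (normr_ge0 _) (hC _) (hCp _)).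
transitivity (\int[leb4]_z ((u i \_ Q) z * M (derf f i) z + (Du i i \_ Q) z * M f z)).
  by apply: eq_Rintegral => z _; rewrite /E /M !mulrDl !mulrA.
rewrite (RintegralD measurableT (iM _ _ (smooth1_derf i sf) (@derf0 i) (iu i)) (iM _ _ sf f0 (iDu i))).
by rewrite e addNr.
Qed.

(** Summed over the directions, the terms with derivatives of [u] cancel almost everywhere by the
    divergence condition. What remains, as a function of time, is orthogonal to all bumps and so
    vanishes almost everywhere. *)
Lemma solenoidal_slices : {ae leb1, forall t, T0 < t < T1 ->
  \int[leb3]_x (\sum_(i < 3) (u i \_ Q) (x, t) * tens3 (derf f i) x) = 0}.
Proof.
have claim i psi : psi_data psi -> \int[leb4]_z (E i z * psi z.2) = 0.
  by have [->|] := eqVneq i i2; [exact: flat_claim|exact: side_claim].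
pose F (z : spacetime R) := \sum_(i < 3) (u i \_ Q) z * tens3 (derf f i) z.1.
pose G z := E i0 z + E i1 z + E i2 z.
have iG : leb4.-integrable setT (EFin \o G).
  exact: (integrableD measurableT (integrableD measurableT (Em i0) (Em i1)) (Em i2)).
have o1 : lift ord0 ord0 = i1 by exact: val_inj.
have o2 : lift ord0 (lift ord0 ord0) = i2 by exact: val_inj.
have o0 : ord0 = i0 by exact: val_inj.
have mG : measurable_fun setT G.
  by apply: measurable_funD => //; exact: measurable_funD.
have GF : {ae leb4, forall z, G z = F z}.
  apply: filterS dv => z hz; rewrite /G /F /E !big_ord_recl big_ord0 o2 o1 o0 addr0.
  have [Qz|nQ] := pselect (Q z); last by rewrite !patchE !memNset // !mul0r !addr0.
  have := hz (QD Qz); rewrite !big_ord_recl big_ord0 o2 o1 o0 addr0 !patchE !mem_set // => e.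
  have -> : Du i0 i0 z = - (Du i1 i1 z + Du i2 i2 z) by apply/eqP; rewrite -subr_eq0 opprK e.
  ring.
have iEt i psi : smooth1 psi -> (exists C, forall s, `|psi s| <= C) ->
    leb4.-integrable setT (EFin \o (fun z => E i z * psi z.2)).
  move=> sp [C hC].
  apply: (@integrable_bddM _ _ R leb4 setT _ (fun z : spacetime R => psi z.2) (C) measurableT (Em i)).
    exact: (measurableT_comp (smooth1_measurable sp) measurable_snd).
  by move=> z _; exact: hC.
have T01 : T0 < T1 by rewrite /T0 /T1 /tstart expr1n ltrBlDr ltrDl.
have bump0 n : \int[leb4]_z (G z * bumps T0 T1 n z.2) = 0.
  have sp : smooth1 (bumps T0 T1 n) by exact: smooth1_bumps.
  have pd : psi_data (bumps T0 T1 n).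
    split=> //; have [a [b [h1 _ h2 h]]] := @bumps_supp R _ _ T01 n.
    by exists a, b.
  have bd : exists C, forall s, `|bumps T0 T1 n s| <= C by exists 1; exact: bumps_norm.
  transitivity (\int[leb4]_z (E i0 z * bumps T0 T1 n z.2 + E i1 z * bumps T0 T1 n z.2 +
      E i2 z * bumps T0 T1 n z.2)).
    by apply: eq_Rintegral => z _; rewrite /G; ring.
  rewrite (RintegralD measurableT (integrableD measurableT (iEt i0 _ sp bd) (iEt i1 _ sp bd)) (iEt i2 _ sp bd)).
  by rewrite (RintegralD measurableT (iEt i0 _ sp bd) (iEt i1 _ sp bd)) !claim // !addr0.
have iH := @integrable_Rintegral_fst _ _ _ _ R leb3 leb1 G iG.
have sep := @bumps_separate R T0 T1 _ iH.
have {}sep : {ae leb1, forall t, `]T0, T1[%classic t -> \int[leb3]_x G (x, t) = 0}.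
  apply: sep => _ [n _ <-]; rewrite -(bump0 n).
  have iGb : leb4.-integrable setT (EFin \o (fun z => G z * bumps T0 T1 n z.2)).
    apply: (@integrable_bddM _ _ R leb4 setT _ (fun z : spacetime R => bumps T0 T1 n z.2) (1) measurableT iG).
      exact: (measurableT_comp (measurable_bumps _ _ _) measurable_snd).
    by move=> z _; exact: bumps_norm.
  rewrite (@Rintegral_prod2 _ _ _ _ R leb3 leb1 _ iGb).
  apply: ae_eq_Rintegral => //.
  - apply: measurable_funM; last exact: measurable_bumps.
    by apply/measurable_EFinP; exact: (measurable_int _ iH).
  - apply/measurable_EFinP.
    exact: (measurable_int _ (@integrable_Rintegral_fst _ _ _ _ R leb3 leb1 _ iGb)).
  - apply: filterS (@ae_integrable_snd _ _ _ _ R leb3 leb1 G iG) => t it _.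
    by rewrite /= -RintegralZr.
have := ae_and sep (@ae_prod_snd _ _ _ _ R leb3 leb1 _ GF).
apply: filterS => t [ht eqt] tT.
have mF : measurable_fun setT F.
  apply: measurable_sum => i; apply: measurable_funM.
    by apply/measurable_EFinP; exact: (measurable_int _ (iu i)).
  apply: (measurableT_comp (@measurable_tens3 _ _) measurable_fst) => j.
  by apply: smooth1_measurable; exact: smooth1_derf.
transitivity (\int[leb3]_x G (x, t)); last by apply: ht; rewrite /= in_itv.
apply: ae_eq_Rintegral => //.
- exact: (measurable_section1 t mF).
- exact: (measurable_section1 t mG).
- by apply: filterS eqt => x -> _.
Qed.

End solenoidal.

(** * The energy balance on a slice and its time integral *)

Section young_absorption.
Variable R : realType.

Let powD (x s t : R) : 0 < x -> x `^ (s + t) = x `^ s * x `^ t.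
Proof. by move=> x0; rewrite powRD // (gt_eqF x0) implybT. Qed.

Let ler_pow (x y s : R) : 0 <= s -> 0 <= x -> x <= y -> x `^ s <= y `^ s.
Proof. by move=> s0 x0 xy; rewrite ge0_ler_powR ?nnegrE // (le_trans x0). Qed.

(** In the three absorption lemmas [r ^ 2 * al] bounds the time integral of the cubed weak norm,
    [h ^ 2] is the length of the time interval, [2 * h] the longest side of the half cube and [w]
    the width of the cutoff. *)
Lemma absorb_lower_order (r w h al cE : R) : 0 < w <= r -> 0 < h <= r -> 0 <= al ->
  0 <= cE ->
  cE / w ^+ 2 * (2 * h) * ((r ^+ 2 * al) `^ (2 / 3) * (h ^+ 2) `^ (1 / 3)) <=
  2 * cE * (r / w) ^+ 2 * (r * al `^ (2 / 3)).
Proof.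
move=> /andP[w0 wr] /andP[h0 hr] al0 cE0; have r0 : 0 < r := lt_le_trans w0 wr.
have r2 : 0 < r ^+ 2 by rewrite exprn_gt0.
rewrite powRM ?(ltW r2) //.
have e : (r ^+ 2) `^ (2 / 3) * (r ^+ 2) `^ (1 / 3) = r ^+ 2.
  rewrite -powD // (_ : 2 / 3 + 1 / 3 = 1 :> R); last by field.
  by rewrite powRr1 // ltW.
have hh : (h ^+ 2) `^ (1 / 3) <= (r ^+ 2) `^ (1 / 3).
  apply: ler_pow; [by rewrite divr_ge0|exact: sqr_ge0|].
  by rewrite ler_pXn2r // nnegrE ltW.
apply: (@le_trans _ _ (cE / w ^+ 2 * (2 * r) *
    ((r ^+ 2) `^ (2 / 3) * al `^ (2 / 3) * (r ^+ 2) `^ (1 / 3)))).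
  apply: ler_pM.
  - by rewrite !mulr_ge0 ?invr_ge0 ?exprn_ge0 // ltW.
  - by rewrite !mulr_ge0 ?powR_ge0.
  - by rewrite ler_wpM2l ?ler_wpM2l // divr_ge0 // exprn_ge0 // ltW.
  - by rewrite ler_wpM2l // mulr_ge0 ?powR_ge0.
have -> : cE / w ^+ 2 * (2 * r) *
    ((r ^+ 2) `^ (2 / 3) * al `^ (2 / 3) * (r ^+ 2) `^ (1 / 3)) =
  cE / w ^+ 2 * (2 * r) * al `^ (2 / 3) * ((r ^+ 2) `^ (2 / 3) * (r ^+ 2) `^ (1 / 3)) by ring.
rewrite e le_eqVlt; apply/orP; left; apply/eqP.
by field; rewrite gt_eqF.
Qed.

(** The energy bound [M] enters to the power 5/28 + 1/4 = 3/7, so Young's inequality with weights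
    4/7 and 3/7 leaves at most [M / 2]. The data then enter to the power 5/7 * 7/4 = 5/4, which lies
    between 2/3 and 4/3, and [r / w] to the power 7/4, rounded up to 2. *)
Lemma absorb_cubic (r w h al M K : R) : 0 < w <= r -> 0 < h <= r -> 0 <= al -> 0 <= M -> 0 <= K ->
  K / w * (2 * h) `^ 14^-1 *
    ((r ^+ 2 * al) `^ (5 / 7) * (M `^ (5 / 28) * (2 * M) `^ 4^-1) * (h ^+ 2) `^ 28^-1) <=
  M / 2 + (4 * K) `^ (7 / 4) * (r / w) ^+ 2 * (r * (al `^ (4 / 3) + al `^ (2 / 3))).
Proof.
move=> /andP[w0 wr] /andP[h0 hr] al0 M0 K0; have r0 : 0 < r := lt_le_trans w0 wr.
have r2 : 0 <= r ^+ 2 by rewrite exprn_ge0 // ltW.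
have rw1 : 1 <= r / w by rewrite ler_pdivlMr // mul1r.
have rw0 : 0 < r / w by rewrite divr_gt0.
have [M_0|M_n0] := eqVneq M 0.
  rewrite M_0 mulr0 !powR0 ?invr_neq0 ?pnatr_eq0 ?mulf_neq0 ?invr_neq0 ?pnatr_eq0 //.
  rewrite !(mul0r, mulr0) add0r; apply: mulr_ge0.
    by apply: mulr_ge0; [exact: powR_ge0|exact: sqr_ge0].
  by apply: mulr_ge0; [exact: ltW|rewrite addr_ge0 ?powR_ge0].
have Mp : 0 < M by rewrite lt0r M_n0.
have le2 (s : R) : 0 <= s <= 1 -> 2 `^ s <= 2 :> R.
  by move=> /andP[s0 s1]; have := ler_powR (ler1n R 2) s1; rewrite powRr1.
(* The factor 4 collects the powers of 2 in [2 * h] and [2 * M], each estimated by 2. *)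
apply: (@le_trans _ _ (4 * K * (r / w) * ((r * al `^ (5 / 4)) `^ (4 / 7) * M `^ (3 / 7)))).
  have e1 : (r * al `^ (5 / 4)) `^ (4 / 7) = r `^ (4 / 7) * al `^ (5 / 7).
    rewrite powRM ?powR_ge0 ?(ltW r0) // -powRrM (_ : 5 / 4 * (4 / 7) = 5 / 7 :> R) //; by field.
  have e2 : M `^ (3 / 7) = M `^ (5 / 28) * M `^ 4^-1.
    by rewrite -powD // (_ : 5 / 28 + 4^-1 = 3 / 7 :> R) //; field.
  have e3 : r `^ (4 / 7) * r = r `^ 14^-1 * (r ^+ 2) `^ (5 / 7) * (r ^+ 2) `^ 28^-1.
    rewrite -(powR_mulrn 2 (ltW r0)) -!powRrM -[X in _ * X = _](powRr1 (ltW r0)) -!powD //.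
    by congr (_ `^ _); field.
  have h1 : (2 * h) `^ 14^-1 <= 2 * r `^ 14^-1.
    rewrite powRM ?(ltW h0) //; apply: ler_pM; rewrite ?powR_ge0 //.
      by apply: le2; apply/andP; split; lra.
    by apply: ler_pow => //; exact: ltW.
  have h2 : (2 * M) `^ 4^-1 <= 2 * M `^ 4^-1.
    rewrite powRM //; apply: ler_pM; rewrite ?powR_ge0 //.
    by apply: le2; apply/andP; split; lra.
  have h3 : (h ^+ 2) `^ 28^-1 <= (r ^+ 2) `^ 28^-1.
    apply: ler_pow; [lra|exact: sqr_ge0|].
    by rewrite ler_pXn2r // nnegrE ltW.
  have -> : 4 * K * (r / w) * ((r * al `^ (5 / 4)) `^ (4 / 7) * M `^ (3 / 7)) =
     K / w * (2 * r `^ 14^-1) * ((r ^+ 2) `^ (5 / 7) * al `^ (5 / 7) *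
       (M `^ (5 / 28) * (2 * M `^ 4^-1)) * (r ^+ 2) `^ 28^-1).
    rewrite e1 e2.
    transitivity (4 * K / w * (r `^ (4 / 7) * r) * al `^ (5 / 7) * M `^ (5 / 28) * M `^ 4^-1); first by ring.
    by rewrite e3; ring.
  have Kw : 0 <= K / w by rewrite divr_ge0 // ltW.
  apply: ler_pM; [exact: (mulr_ge0 Kw (powR_ge0 _ _))|by rewrite !mulr_ge0 ?powR_ge0|exact: ler_wpM2l|].
  apply: ler_pM; rewrite ?mulr_ge0 ?powR_ge0 //.
  apply: ler_pM; rewrite ?mulr_ge0 ?powR_ge0 //; first by rewrite powRM.
  by apply: ler_wpM2l => //; exact: powR_ge0.
have K4 : 0 <= 4 * K by rewrite mulr_ge0.
have -> : 4 * K * (r / w) * ((r * al `^ (5 / 4)) `^ (4 / 7) * M `^ (3 / 7)) =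
    ((4 * K) `^ (7 / 4) * (r / w) `^ (7 / 4) * (r * al `^ (5 / 4))) `^ (4 / 7) * M `^ (3 / 7).
  rewrite mulrA; congr (_ * _).
  rewrite [RHS]powRM ?mulr_ge0 ?powR_ge0 ?(ltW r0) //; congr (_ * _).
  rewrite powRM ?powR_ge0 // -!powRrM (_ : 7 / 4 * (4 / 7) = 1 :> R); last by field.
  by rewrite !powRr1 // ltW.
have X0 : 0 <= (4 * K) `^ (7 / 4) * (r / w) `^ (7 / 4) * (r * al `^ (5 / 4)).
  by rewrite !mulr_ge0 ?powR_ge0 // ltW.
apply: le_trans (weighted_young X0 M0 _ _ _) _; [lra|lra|lra|].
have al54 : al `^ (5 / 4) <= al `^ (4 / 3) + al `^ (2 / 3).
  have [a1|a1] := leP 1 al.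
    by rewrite ler_wpDr ?powR_ge0 // ler_powR //; lra.
  rewrite ler_wpDl ?powR_ge0 //.
  have [->|an0] := eqVneq al 0; first by rewrite !powR0 //; lra.
  rewrite /powR (negbTE an0) ler_expR; apply: ler_wnM2r; last lra.
  by rewrite ln_le0 // ltW.
have q2 : (r / w) `^ (7 / 4) <= (r / w) ^+ 2.
  by rewrite -(powR_mulrn 2 (ltW rw0)) ler_powR //; lra.
set X := (_ * _) in X0 *.
have XY : X <= (4 * K) `^ (7 / 4) * (r / w) ^+ 2 * (r * (al `^ (4 / 3) + al `^ (2 / 3))).
  apply: ler_pM; rewrite ?mulr_ge0 ?powR_ge0 ?(ltW r0) //.
    by apply: ler_wpM2l => //; exact: powR_ge0.
  by apply: ler_wpM2l => //; exact: ltW.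
lra.
Qed.

Lemma absorb_pressure (r w h p K : R) : 0 < w <= r -> 0 < h <= r -> 0 <= p -> 0 <= K ->
  K / w * (2 * h) `^ 3^-1 * (r `^ (5 / 3) * p) <= 2 * K * (r / w) ^+ 2 * (r * p).
Proof.
move=> /andP[w0 wr] /andP[h0 hr] p0 K0; have r0 : 0 < r := lt_le_trans w0 wr.
have rw1 : 1 <= r / w by rewrite ler_pdivlMr // mul1r.
have h1 : (2 * h) `^ 3^-1 <= 2 * r `^ 3^-1.
  rewrite powRM ?(ltW h0) //; apply: ler_pM; rewrite ?powR_ge0 //.
    by have := @ler_powR _ 2 (ler1n R 2) 3^-1 1; rewrite powRr1 //; apply; lra.
  by apply: ler_pow => //; exact: ltW.
have e : r `^ 3^-1 * r `^ (5 / 3) = r ^+ 2.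
  by rewrite -powD // -(powR_mulrn 2 (ltW r0)); congr (_ `^ _); field.
have Kw : 0 <= K / w by rewrite divr_ge0 // ltW.
apply: (@le_trans _ _ (K / w * (2 * r `^ 3^-1) * (r `^ (5 / 3) * p))).
  apply: ler_wpM2r; first by rewrite mulr_ge0 ?powR_ge0.
  exact: ler_wpM2l.
have -> : K / w * (2 * r `^ 3^-1) * (r `^ (5 / 3) * p) = 2 * K * (r / w) * (r * p).
  transitivity (K / w * 2 * (r `^ 3^-1 * r `^ (5 / 3)) * p); first by ring.
  by rewrite e; ring.
apply: ler_wpM2r; first by rewrite mulr_ge0 // ltW.
by rewrite ler_wpM2l ?mulr_ge0 // expr2 ler_peMr // divr_ge0 ?ltW.
Qed.

End young_absorption.

(** * The flux of the energy inequality on one slice *)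

Section energy_slice.
Variable R : realType.

Definition energy_cst : R := 1 + tail_cst 2.
Definition cube_cst : R := (1 + tail_cst (14 / 5)) `^ (25 / 28) * (2 `^ 2^-1 * 4 `^ 4^-1).
Definition pressure_cst : R := (1 + tail_cst (27 / 11)) `^ (11 / 27) *
  (2 `^ (9 / 8) * (32 `^ (9 / 8) + 4 `^ (9 / 8))) `^ (8 / 9).

Lemma energy_cst_ge0 : 0 <= energy_cst.
Proof. by rewrite addr_ge0 // tail_cst_ge0 //; lra. Qed.

Lemma cube_cst_ge0 : 0 <= cube_cst. Proof. by rewrite !mulr_ge0 ?powR_ge0. Qed.

Lemma pressure_cst_ge0 : 0 <= pressure_cst. Proof. by rewrite !mulr_ge0 ?powR_ge0. Qed.

(* The powers make the three time integrals estimable by Hoelder: the exponents of [N ^ 3] and [H] sum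
   to 2/3, 5/7 + 1/4 and, together with that of [Y ^ (4/3)], to 1. *)
Definition slice_bound (Kt Kx l : R) (N Z H Y : \bar R) : \bar R :=
  (Kt%:E * ((energy_cst * l)%:E * N `^ 2) +
   (3 * Kx)%:E * ((cube_cst * l `^ 14^-1)%:E * (N `^ (15 / 7) * (Z `^ (5 / 28) * H `^ 4^-1))) +
   (2 * Kx)%:E * ((pressure_cst * l `^ 3^-1)%:E * (N * Y `^ (8 / 9))))%E.

Variables (a b : 'I_3 -> R) (l : R).
Hypotheses (l0 : 0 < l) (side_le : forall i, l / 2 <= b i - a i <= l).
Variables (v : 'I_3 -> space3 R -> R) (g : 'I_3 -> 'I_3 -> space3 R -> R).
Variables (q : space3 R -> R) (gq : 'I_3 -> space3 R -> R) (N : \bar R).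
Hypotheses (mv : forall j, measurable_fun setT (v j)) (sv : forall j, supported a b (v j)).
Hypotheses (mg : forall j i, measurable_fun setT (g j i)) (sg : forall j i, supported a b (g j i)).
Hypotheses (mq : measurable_fun setT q) (sq : supported a b q).
Hypotheses (mgq : forall i, measurable_fun setT (gq i)) (sgq : forall i, supported a b (gq i)).
Hypotheses (lv : forall j, line_acl a b (v j) (g j)) (lq : line_acl a b q gq).
Hypotheses (iv : forall j, leb3.-integrable setT (EFin \o v j)).
Hypothesis (iq : leb3.-integrable setT (EFin \o q)).
Hypotheses (N0 : (0 <= N)%E) (wk : forall j c, 0 < c ->
  ((c ^+ 3)%:E * leb3 (upper (fun x => `|v j x|%R) c) <= N `^ 3)%E).

Let V2 x := \sum_(j < 3) v j x ^+ 2.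
Let Z := (\int[leb3]_x (\sum_(j < 3) v j x ^+ 2)%:E)%E.
Let G := (\int[leb3]_x (\sum_(j < 3) \sum_(i < 3) g j i x ^+ 2)%:E)%E.
Let Y := (\int[leb3]_x (`|gq i0 x|%:E `^ (9 / 8)) + \int[leb3]_x (`|gq i1 x|%:E `^ (9 / 8)) +
  \int[leb3]_x (`|gq i2 x|%:E `^ (9 / 8)))%E.
Let H := ((4 / l ^+ 2)%:E * Z + G)%E.

(** On a slice, [A] stands for the time derivative plus Laplacian of the cutoff and [B] for its
    gradient. *)
Variables (A : space3 R -> R) (B : 'I_3 -> space3 R -> R) (Kt Kx : R).
Hypotheses (mA : measurable_fun setT A) (mB : forall i, measurable_fun setT (B i)).
Hypotheses (hA : forall x, `|A x| <= Kt) (hB : forall i x, `|B i x| <= Kx).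
Hypothesis div0 : \int[leb3]_x (\sum_(i < 3) v i x * B i x) = 0.

Let E x := V2 x * A x + (\sum_(i < 3) v i x * B i x) * (V2 x + 2 * q x).
Hypothesis iE : leb3.-integrable setT (EFin \o E).

Let mV2 : measurable_fun setT V2.
Proof. by apply: measurable_sum => j; exact: measurable_funX. Qed.

Let Kt0 : 0 <= Kt. Proof. exact: le_trans (normr_ge0 _) (hA 0). Qed.
Let Kx0 : 0 <= Kx. Proof. exact: le_trans (normr_ge0 _) (hB i0 0). Qed.

Let mpw j (s : R) : measurable_fun setT (fun x => (`|v j x| `^ s)%:E).
Proof.
apply/measurable_EFinP; apply: (measurableT_comp (measurable_powR s)).
exact: measurableT_comp.
Qed.

Let pow2 (x : R) : `|x| `^ 2 = x ^+ 2.
Proof. by rewrite powR_mulrn // real_normK ?num_real. Qed.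

Let Zj j : (\int[leb3]_x (`|v j x| `^ 2)%:E <= Z)%E.
Proof.
apply: ge0_le_integral => //.
- by apply/measurable_EFinP; exact: mV2.
- by move=> x _; rewrite lee_fin pow2 (bigD1 j) //= lerDl sumr_ge0 // => i _; exact: sqr_ge0.
Qed.

Let Gj j : (\int[leb3]_x ((2 / l * `|v j x|) ^+ 2 + \sum_(i < 3) g j i x ^+ 2)%:E <= H)%E.
Proof.
have l2 : 0 <= 4 / l ^+ 2 by rewrite divr_ge0 // sqr_ge0.
have mGG : measurable_fun setT (fun x => (\sum_(j < 3) \sum_(i < 3) g j i x ^+ 2)%:E).
  apply/measurable_EFinP; apply: measurable_sum => k; apply: measurable_sum => i.
  exact: measurable_funX.
have G0 x : (0 <= (\sum_(j < 3) \sum_(i < 3) g j i x ^+ 2)%:E)%E.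
  by rewrite lee_fin sumr_ge0 // => k _; rewrite sumr_ge0 // => i _; exact: sqr_ge0.
have mZ : measurable_fun setT (fun x => (V2 x)%:E) by exact/measurable_EFinP.
have Z0 x : (0 <= (V2 x)%:E)%E by rewrite lee_fin sumr_ge0 // => i _; exact: sqr_ge0.
rewrite /H /Z /G -(ge0_integralZl _ measurableT mZ (fun x _ => Z0 x)) //.
have mZ4 := emeasurable_funM (measurable_cst (4 / l ^+ 2)%:E) mZ.
have Z40 x : [set: space3 R] x -> (0 <= (4 / l ^+ 2)%:E * (V2 x)%:E)%E.
  by move=> _; rewrite mule_ge0.
rewrite -(ge0_integralD _ measurableT Z40 mZ4 (fun x _ => G0 x) mGG).
apply: ge0_le_integral => //.
- move=> x _; rewrite lee_fin addr_ge0 ?sqr_ge0 // sumr_ge0 // => i _; exact: sqr_ge0.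
- apply/measurable_EFinP; apply: measurable_funD.
    by apply: measurable_funX; apply: measurable_funM => //; exact: measurableT_comp.
  by apply: measurable_sum => i; exact: measurable_funX.
- exact: (emeasurable_funD mZ4 mGG).
move=> x _; rewrite -EFinM -EFinD lee_fin; apply: lerD.
  rewrite exprMn real_normK ?num_real // (_ : (2 / l) ^+ 2 = 4 / l ^+ 2); last by field; rewrite gt_eqF.
  by rewrite ler_wpM2l // /V2 (bigD1 j) //= lerDl sumr_ge0 // => i _; exact: sqr_ge0.
rewrite [leRHS](bigD1 j) //= lerDl sumr_ge0 // => k _.
by rewrite sumr_ge0 // => i _; exact: sqr_ge0.
Qed.

(** By [div0] the constant of the Poincare inequality can be subtracted from the pressure without
    changing the integral. The new integrand is bounded pointwise by powers of the components of the
    velocity, and each component contributes one [slice_bound]. *)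
Lemma energy_slice_le : ((\int[leb3]_x E x)%:E <=
  slice_bound Kt Kx l N Z H Y + slice_bound Kt Kx l N Z H Y + slice_bound Kt Kx l N Z H Y)%E.
Proof.
have m1 : 1 < 9 / 8 :> R by lra.
have [c hc] := poincare l0 side_le mq sq mgq sgq iq lq m1.
have e0 : ord0 = i0 by exact: val_inj.
have e1 : lift ord0 ord0 = i1 by exact: val_inj.
have e2 : lift ord0 (lift ord0 ord0) = i2 by exact: val_inj.
have iVB i : leb3.-integrable setT (EFin \o (fun x => v i x * B i x)).
  by apply: (@integrable_bddM _ _ R leb3 setT (v i) (B i) Kx measurableT (iv i) (mB i)) => x _.
pose VB x := \sum_(i < 3) v i x * B i x.
have iVBs : leb3.-integrable setT (EFin \o VB).
  rewrite (_ : EFin \o VB = fun x => (\sum_(i < 3) (v i x * B i x)%:E)%E); last first.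
    by apply/funext => x; rewrite /= sumEFin.
  by apply: integrable_sum => // i _; exact: iVB.
pose E' x := V2 x * A x + VB x * (V2 x + 2 * (q x - c)).
have EE' x : E' x = E x - 2 * c * VB x by rewrite /E' /E -/(VB x); ring.
have icVB : leb3.-integrable setT (EFin \o (fun x => 2 * c * VB x)).
  exact: (integrableZl measurableT _ iVBs).
have IE : \int[leb3]_x E' x = \int[leb3]_x E x.
  under eq_Rintegral do rewrite EE'.
  by rewrite RintegralB // RintegralZl // div0 mulr0 subr0.
have iE' : leb3.-integrable setT (EFin \o E').
  rewrite (_ : E' = fun x => E x - 2 * c * VB x); last exact/funext.
  exact: (integrableB measurableT iE icVB).
pose T j x := (Kt * `|v j x| `^ 2 + 3 * Kx * `|v j x| `^ 3 +
  2 * Kx * (`|v j x| * (\1_(box a b) x * `|q x - c|))).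
have pt x : `|E' x| <= T i0 x + T i1 x + T i2 x.
  have [bx|nbx] := pselect (box a b x); last first.
    rewrite /E' /V2 /VB !big_ord_recl !big_ord0 !sv // !expr0n /= !mul0r !addr0 !mul0r addr0 normr0.
    by rewrite /T !addr_ge0 ?mulr_ge0 ?powR_ge0 // indicE ler0n.
  rewrite /T indicE mem_set // mul1r !pow2 !(powR_mulrn 3) // /E' /VB /V2 !big_ord_recl !big_ord0 e2 e1 e0 !addr0.
  rewrite -![v _ x ^+ 2](real_normK (num_real _)).
  set W2 := `|v i0 x| ^+ 2 + _.
  apply: le_trans (ler_normD _ _) _; rewrite !normrM.
  have hV : `|W2| = W2 by rewrite ger0_norm // !addr_ge0 // sqr_ge0.
  have hVB : `|v i0 x * B i0 x + (v i1 x * B i1 x + v i2 x * B i2 x)| <=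
      Kx * (`|v i0 x| + `|v i1 x| + `|v i2 x|).
    apply: le_trans (ler_normD _ _) _; rewrite !mulrDr -addrA; apply: lerD.
      by rewrite normrM mulrC ler_wpM2r.
    apply: le_trans (ler_normD _ _) _; apply: lerD; by rewrite normrM mulrC ler_wpM2r.
  have hq : `|W2 + 2 * (q x - c)| <= W2 + 2 * `|q x - c|.
    by apply: le_trans (ler_normD _ _) _; rewrite hV normrM ger0_norm.
  have hP := ler_pM (normr_ge0 _) (normr_ge0 _) hVB hq.
  rewrite hV; apply: le_trans (lerD (ler_wpM2l _ (hA x)) hP) _.
    by rewrite !addr_ge0 // sqr_ge0.
  rewrite /W2; have := normr_ge0 (v i0 x); have := normr_ge0 (v i1 x); have := normr_ge0 (v i2 x).
  move: (`|v i0 x|) (`|v i1 x|) (`|v i2 x|) (`|q x - c|) => y0 y1 y2 d p2 p1 p0.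
  (* Chebyshev's sum inequality: the difference of the sides is the sum over pairs of
     [(y - y') ^ 2 * (y + y')]. *)
  have cheb : (y0 + y1 + y2) * (y0 ^+ 2 + (y1 ^+ 2 + y2 ^+ 2)) <= 3 * (y0 ^+ 3 + y1 ^+ 3 + y2 ^+ 3).
    rewrite -subr_ge0.
    have -> : 3 * (y0 ^+ 3 + y1 ^+ 3 + y2 ^+ 3) - (y0 + y1 + y2) * (y0 ^+ 2 + (y1 ^+ 2 + y2 ^+ 2)) =
      (y0 - y1) ^+ 2 * (y0 + y1) + (y0 - y2) ^+ 2 * (y0 + y2) + (y1 - y2) ^+ 2 * (y1 + y2) by ring.
    by rewrite !addr_ge0 // mulr_ge0 ?sqr_ge0 ?addr_ge0.
  have := ler_wpM2l Kx0 cheb.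
  rewrite -subr_ge0 => k1; rewrite -subr_ge0; apply: le_trans k1 _.
  by rewrite le_eqVlt; apply/orP; left; apply/eqP; ring.
have mT1 j : measurable_fun setT (fun x => (`|v j x| * (\1_(box a b) x * `|q x - c|))%:E).
  apply/measurable_EFinP; apply: measurable_funM; first exact: measurableT_comp.
  apply: measurable_funM; first exact: (measurable_indic (measurable_box _ _)).
  by apply: measurableT_comp => //; exact: measurable_funB.
have T10 j x : [set: space3 R] x -> (0 <= (`|v j x| * (\1_(box a b) x * `|q x - c|))%:E)%E.
  by move=> _; rewrite lee_fin !mulr_ge0 // indicE ler0n.
have p0 j s x : [set: space3 R] x -> (0 <= (`|v j x| `^ s)%:E)%E by move=> _; rewrite lee_fin powR_ge0.
pose T' j x := (Kt%:E * (`|v j x| `^ 2)%:E + (3 * Kx)%:E * (`|v j x| `^ 3)%:E +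
  (2 * Kx)%:E * (`|v j x| * (\1_(box a b) x * `|q x - c|))%:E)%E.
have k3 : (0 <= (3 * Kx)%:E)%E by rewrite lee_fin mulr_ge0.
have k2 : (0 <= (2 * Kx)%:E)%E by rewrite lee_fin mulr_ge0.
have kt : (0 <= Kt%:E)%E by rewrite lee_fin.
have mA1 j := emeasurable_funM (measurable_cst Kt%:E) (mpw j 2).
have mA2 j := emeasurable_funM (measurable_cst (3 * Kx)%:E) (mpw j 3).
have mA3 j := emeasurable_funM (measurable_cst (2 * Kx)%:E) (mT1 j).
have n1 j x : [set: space3 R] x -> (0 <= Kt%:E * (`|v j x| `^ 2)%:E)%E.
  by move=> Tx; rewrite mule_ge0 // p0.
have n2 j x : [set: space3 R] x -> (0 <= (3 * Kx)%:E * (`|v j x| `^ 3)%:E)%E.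
  by move=> Tx; rewrite mule_ge0 // p0.
have n3 j x : [set: space3 R] x -> (0 <= (2 * Kx)%:E * (`|v j x| * (\1_(box a b) x * `|q x - c|))%:E)%E.
  by move=> Tx; rewrite mule_ge0 // T10.
have n12 j x (h : [set: space3 R] x) := adde_ge0 (n1 j x h) (n2 j x h).
have mT' j : measurable_fun setT (T' j) := emeasurable_funD (emeasurable_funD (mA1 j) (mA2 j)) (mA3 j).
have T'0 j x (h : [set: space3 R] x) : (0 <= T' j x)%E := adde_ge0 (n12 j x h) (n3 j x h).
have T'le j : (\int[leb3]_x T' j x <= slice_bound Kt Kx l N Z H Y)%E.
  rewrite /T' (ge0_integralD _ measurableT (n12 j) (emeasurable_funD (mA1 j) (mA2 j)) (n3 j) (mA3 j)).
  rewrite (ge0_integralD _ measurableT (n1 j) (mA1 j) (n2 j) (mA2 j)).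
  rewrite (ge0_integralZl _ measurableT (mpw j 2) (p0 j 2) kt).
  rewrite (ge0_integralZl _ measurableT (mpw j 3) (p0 j 3) k3).
  rewrite (ge0_integralZl _ measurableT (mT1 j) (T10 j) k2).
  apply: leeD; first apply: leeD.
  - apply: lee_wpmul2l => //.
    have m2 : (0 < 2 :> R) && (2 < 3 :> R) by apply/andP; split; lra.
    have := slice_weak_power l0 side_le (mv j) (sv j) N0 (@wk j) m2.
    have -> : 3 - 2 = 1 :> R by ring.
    by rewrite powRr1 // ltW.
  - apply: lee_wpmul2l => //.
    have := slice_cube l0 side_le (mv j) (sv j) N0 (@wk j) (mg j) (sg j) (lv j).
    have -> : (1 + tail_cst (14 / 5)) `^ (25 / 28) * (l `^ 14^-1 * 2 `^ 2^-1 * 4 `^ 4^-1) =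
        cube_cst * l `^ 14^-1 by rewrite /cube_cst; ring.
    move/le_trans; apply; apply: lee_wpmul2l.
      by rewrite lee_fin mulr_ge0 ?powR_ge0 // cube_cst_ge0.
    apply: lee_wpmul2l; first exact: poweR_ge0.
    apply: lee_pmul; rewrite ?poweR_ge0 //; apply: le_poweR => //.
    - by apply: integral_ge0 => x _; rewrite lee_fin powR_ge0.
    - apply: integral_ge0 => x _; rewrite lee_fin addr_ge0 ?sqr_ge0 // sumr_ge0 // => i _.
      exact: sqr_ge0.
  - apply: lee_wpmul2l => //.
    have := slice_pressure l0 side_le (mv j) (sv j) N0 (@wk j) mq mgq sgq lq hc.
    by [].
apply: (@le_trans _ _ (\int[leb3]_x (T' i0 x + T' i1 x + T' i2 x))%E); last first.
  rewrite (ge0_integralD _ measurableT (fun x h => adde_ge0 (T'0 i0 x h) (T'0 i1 x h))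
    (emeasurable_funD (mT' i0) (mT' i1)) (T'0 i2) (mT' i2)).
  rewrite (ge0_integralD _ measurableT (T'0 i0) (mT' i0) (T'0 i1) (mT' i1)).
  by apply: leeD => //; exact: leeD.
rewrite -IE; apply: (@le_trans _ _ `|\int[leb3]_x E' x|%:E); first by rewrite lee_fin ler_norm.
rewrite EFin_normr_Rintegral //.
apply: le_trans (le_abse_integral _ measurableT (measurable_int _ iE')) _.
apply: ge0_le_integral => //.
- by apply: measurableT_comp => //; exact: (measurable_int _ iE').
- exact: (emeasurable_funD (emeasurable_funD (mT' i0) (mT' i1)) (mT' i2)).
- by move=> x _; have := pt x; rewrite -lee_fin.
Qed.

End energy_slice.

(** * Time integral of the slice bound *)

Section energy_time.
Variable R : realType.
Variables (C r w h M al p : R) (N Z H Y : R -> \bar R) (I : set R).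
Hypotheses (C0 : 0 <= C) (w0r : 0 < w <= r) (h0r : 0 < h <= r) (M0 : 0 <= M) (al0 : 0 <= al) (p0 : 0 <= p).
Hypotheses (mN : measurable_fun setT N) (mZ : measurable_fun setT Z)
  (mH : measurable_fun setT H) (mY : measurable_fun setT Y).
Hypotheses (N0 : forall t, (0 <= N t)%E) (Z0 : forall t, (0 <= Z t)%E)
  (H0 : forall t, (0 <= H t)%E) (Y0 : forall t, (0 <= Y t)%E).
Hypotheses (mI : measurable I) (hI : (leb1 I <= (h ^+ 2)%:E)%E).
Hypothesis hZ : {ae leb1, forall t, (Z t <= M%:E)%E}.
Hypothesis hN : (\int[leb1]_t (N t `^ 3) <= (r ^+ 2 * al)%:E)%E.
Hypothesis hH : (\int[leb1]_t H t <= (2 * M)%:E)%E.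
(** The product is bounded as a whole: when the first factor is zero, the pressure factor may be
    infinite. *)
Hypothesis hP : ((\int[leb1]_t (N t `^ 3)) `^ (1 / 3) * (\int[leb1]_t (Y t `^ (4 / 3))) `^ (2 / 3) <=
  (r `^ (5 / 3) * p)%:E)%E.

(** One term for each absorption lemma. The factors 3, 9 and 6 are the coefficients 1, 3 and 2 in
    [slice_bound] times the three components. *)
Definition step_cst (c : R) : R := 2 * (3 * c * energy_cst R) +
  (4 * (9 * c * cube_cst R)) `^ (7 / 4) + 2 * (6 * c * pressure_cst R).

Let sb t := slice_bound (C / w ^+ 2) (C / w) (2 * h) (N t) (Z t) (H t) (Y t).

Let r0 : 0 < r. Proof. by case/andP: w0r => w0 wr; exact: lt_le_trans wr. Qed.
Let w0 : 0 < w. Proof. by case/andP: w0r. Qed.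
Let h0 : 0 < h. Proof. by case/andP: h0r. Qed.
(** The indicator of the time interval serves as a further factor in Hoelder's inequality and takes
    the exponents 1/3 and 1/28 that are missing to 1. *)
Let J t : \bar R := (\1_I t)%:E.
Let N3 t := (N t `^ 3)%E.
Let Y4 t := (Y t `^ (4 / 3))%E.
Let mJ : measurable_fun setT J.
Proof. by apply/measurable_EFinP; exact: measurable_indic. Qed.
Let J0 t : (0 <= J t)%E. Proof. by rewrite lee_fin indicE ler0n. Qed.
Let mN3 : measurable_fun setT N3. Proof. exact: measurable_poweR. Qed.
Let N30 t : (0 <= N3 t)%E. Proof. exact: poweR_ge0. Qed.
Let mY4 : measurable_fun setT Y4. Proof. exact: measurable_poweR. Qed.
Let Y40 t : (0 <= Y4 t)%E. Proof. exact: poweR_ge0. Qed.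
Let IJ : (\int[leb1]_t J t <= (h ^+ 2)%:E)%E.
Proof. by rewrite integral_indic // setIT. Qed.
Let IN0 : (0 <= \int[leb1]_t N3 t)%E. Proof. by apply: integral_ge0 => t _. Qed.
Let IH0 : (0 <= \int[leb1]_t H t)%E. Proof. by apply: integral_ge0 => t _. Qed.
Let IJ0 : (0 <= \int[leb1]_t J t)%E. Proof. by apply: integral_ge0 => t _. Qed.

Let k1 := 3 * (C / w ^+ 2) * (energy_cst R * (2 * h)).
Let k2 := 9 * (C / w) * (cube_cst R * (2 * h) `^ 14^-1) * M `^ (5 / 28).
Let k3 := 6 * (C / w) * (pressure_cst R * (2 * h) `^ 3^-1).

Let Cw : 0 <= C / w. Proof. by rewrite divr_ge0 // ltW. Qed.
Let k10 : 0 <= k1.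
Proof. by rewrite !mulr_ge0 ?energy_cst_ge0 ?invr_ge0 ?sqr_ge0 // ltW. Qed.
Let k20 : 0 <= k2. Proof. by rewrite !mulr_ge0 ?cube_cst_ge0 ?powR_ge0 ?invr_ge0 // ltW. Qed.
Let k30 : 0 <= k3. Proof. by rewrite !mulr_ge0 ?pressure_cst_ge0 ?powR_ge0 ?invr_ge0 // ltW. Qed.

Let T1 t := (N3 t `^ (2 / 3) * J t `^ (1 / 3))%E.
Let T2 t := (N3 t `^ (5 / 7) * H t `^ 4^-1 * J t `^ 28^-1)%E.
Let T3 t := (N3 t `^ (1 / 3) * Y4 t `^ (2 / 3))%E.

Let mT1 : measurable_fun setT T1.
Proof. by rewrite /T1; apply: emeasurable_funM; apply: measurable_poweR. Qed.
Let mT2 : measurable_fun setT T2.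
Proof.
rewrite /T2; apply: emeasurable_funM; last exact: measurable_poweR.
by apply: emeasurable_funM; apply: measurable_poweR.
Qed.
Let mT3 : measurable_fun setT T3.
Proof. by rewrite /T3; apply: emeasurable_funM; apply: measurable_poweR. Qed.
Let T10 t : (0 <= T1 t)%E. Proof. by rewrite mule_ge0 ?poweR_ge0. Qed.
Let T20 t : (0 <= T2 t)%E. Proof. by rewrite !mule_ge0 ?poweR_ge0. Qed.
Let T30 t : (0 <= T3 t)%E. Proof. by rewrite mule_ge0 ?poweR_ge0. Qed.

Let sum3 (x : \bar R) : (0 <= x)%E -> (x + x + x = 3%:E * x)%E.
Proof.
move=> x0; have -> : 3%:E = (1 + 1 + 1)%E :> \bar R by rewrite -!EFinD; congr EFin; ring.
by rewrite !ge0_muleDl ?adde_ge0 // !mul1e.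
Qed.

Let e1 := (C / w ^+ 2)%:E. Let f1 := (energy_cst R * (2 * h))%:E.
Let e2 := (3 * (C / w))%:E. Let f2 := (cube_cst R * (2 * h) `^ 14^-1)%:E.
Let e3 := (2 * (C / w))%:E. Let f3 := (pressure_cst R * (2 * h) `^ 3^-1)%:E.
Let e10 : (0 <= e1)%E. Proof. by rewrite lee_fin divr_ge0 // sqr_ge0. Qed.
Let e20 : (0 <= e2)%E. Proof. by rewrite lee_fin mulr_ge0. Qed.
Let e30 : (0 <= e3)%E. Proof. by rewrite lee_fin mulr_ge0. Qed.
Let f10 : (0 <= f1)%E.
Proof. by rewrite lee_fin !mulr_ge0 ?energy_cst_ge0 // ltW. Qed.
Let f20 : (0 <= f2)%E.
Proof. by rewrite lee_fin mulr_ge0 ?cube_cst_ge0 ?powR_ge0. Qed.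
Let f30 : (0 <= f3)%E.
Proof. by rewrite lee_fin mulr_ge0 ?pressure_cst_ge0 ?powR_ge0. Qed.

Let s1 t := (e1 * (f1 * N t `^ 2))%E.
Let s2 t := (e2 * (f2 * (N t `^ (15 / 7) * (Z t `^ (5 / 28) * H t `^ 4^-1))))%E.
Let s3 t := (e3 * (f3 * (N t * Y t `^ (8 / 9))))%E.
Let s10 t : (0 <= s1 t)%E. Proof. by rewrite !mule_ge0 ?poweR_ge0. Qed.
Let s20 t : (0 <= s2 t)%E. Proof. by rewrite !mule_ge0 ?poweR_ge0. Qed.
Let s30 t : (0 <= s3 t)%E. Proof. by rewrite !mule_ge0 ?poweR_ge0. Qed.

Let sbE t : sb t = (s1 t + s2 t + s3 t)%E. Proof. by []. Qed.

Lemma slice_bound_time_ge0 t : (0 <= sb t)%E. Proof. by rewrite sbE !adde_ge0. Qed.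

Let sb0 := slice_bound_time_ge0.

Lemma measurable_slice_bound_time : measurable_fun setT sb.
Proof.
rewrite (_ : sb = fun t => s1 t + s2 t + s3 t)%E; last exact/funext.
have mc (c : \bar R) (F : R -> \bar R) : measurable_fun setT F -> measurable_fun setT (fun t => c * F t)%E.
  by move=> mF; apply: emeasurable_funM.
apply: emeasurable_funD; first apply: emeasurable_funD.
- by apply: (mc e1); apply: (mc f1); exact: measurable_poweR.
- apply: (mc e2); apply: (mc f2); apply: emeasurable_funM; first exact: measurable_poweR.
  by apply: emeasurable_funM; exact: measurable_poweR.
- by apply: (mc e3); apply: (mc f3); apply: emeasurable_funM => //; exact: measurable_poweR.
Qed.

Let pt t : I t -> (Z t <= M%:E)%E ->
  (sb t + sb t + sb t <= k1%:E * T1 t + k2%:E * T2 t + k3%:E * T3 t)%E.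
Proof.
move=> It ZM; rewrite sum3 // sbE.
have Jt : J t = 1%E by rewrite /J indicE mem_set.
rewrite (ge0_muleDr _ (adde_ge0 (s10 t) (s20 t)) (s30 t)) (ge0_muleDr _ (s10 t) (s20 t)).
apply: leeD; first apply: leeD.
- rewrite /T1 Jt poweR1r mule1 /N3 -poweRrM (_ : 3 * (2 / 3) = 2 :> R); last by field.
  have -> : k1 = 3 * (C / w ^+ 2) * (energy_cst R * (2 * h)) by [].
  by rewrite /s1 !muleA -!EFinM.
- rewrite /T2 Jt poweR1r mule1 /N3 -poweRrM (_ : 3 * (5 / 7) = 15 / 7 :> R); last by field.
  have ZMp : (Z t `^ (5 / 28) <= (M `^ (5 / 28))%:E)%E.
    by rewrite -poweR_EFin; apply: le_poweR.
  have -> : k2%:E = (3%:E * (e2 * (f2 * (M `^ (5 / 28))%:E)))%E.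
    by rewrite -!EFinM; congr EFin; rewrite /k2; ring.
  rewrite -!muleA; apply: lee_wpmul2l => //; apply: lee_wpmul2l => //; apply: lee_wpmul2l => //.
  rewrite muleCA; apply: lee_wpmul2r => //; by rewrite mule_ge0 ?poweR_ge0.
- rewrite /T3 /N3 /Y4 -!poweRrM (_ : 3 * (1 / 3) = 1 :> R); last by field.
  rewrite poweRe1 // (_ : 4 / 3 * (2 / 3) = 8 / 9 :> R); last by field.
  have -> : k3%:E = (3%:E * (e3 * f3))%E by rewrite -!EFinM; congr EFin; rewrite /k3; ring.
  by rewrite -!muleA.
Qed.

Lemma energy_time_le : (\int[leb1]_(t in I) (sb t + sb t + sb t) <=
  (M / 2 + step_cst C * (r / w) ^+ 2 * (r * (al `^ (4 / 3) + al `^ (2 / 3) + p)))%:E)%E.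
Proof.
have k1E : (0 <= k1%:E)%E by rewrite lee_fin.
have k2E : (0 <= k2%:E)%E by rewrite lee_fin.
have k3E : (0 <= k3%:E)%E by rewrite lee_fin.
have m1 := emeasurable_funM (measurable_cst k1%:E) mT1.
have m2 := emeasurable_funM (measurable_cst k2%:E) mT2.
have m3 := emeasurable_funM (measurable_cst k3%:E) mT3.
have n1 t : [set: R] t -> (0 <= k1%:E * T1 t)%E by move=> _; rewrite mule_ge0.
have n2 t : [set: R] t -> (0 <= k2%:E * T2 t)%E by move=> _; rewrite mule_ge0.
have n3 t : [set: R] t -> (0 <= k3%:E * T3 t)%E by move=> _; rewrite mule_ge0.
apply: (@le_trans _ _ (\int[leb1]_t (k1%:E * T1 t + k2%:E * T2 t + k3%:E * T3 t))%E).
  rewrite integral_mkcond; apply: ae_ge0_le_integral => //.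
  - move=> t *; rewrite patchE; case: ifP => _; last exact: lexx.
    by apply: adde_ge0 => //; exact: adde_ge0.
  - apply/(measurable_restrictT _ mI); apply: measurable_funTS.
    exact: (emeasurable_funD (emeasurable_funD measurable_slice_bound_time measurable_slice_bound_time) measurable_slice_bound_time).
  - move=> t *; exact: (adde_ge0 (adde_ge0 (n1 _ _) (n2 _ _)) (n3 _ _)).
  - exact: (emeasurable_funD (emeasurable_funD m1 m2) m3).
  - apply: filterS hZ => t Zt _; rewrite patchE; case: ifPn => [|_].
      by rewrite inE => It; exact: pt.
    exact: (adde_ge0 (adde_ge0 (n1 _ _) (n2 _ _)) (n3 _ _)).
rewrite (ge0_integralD _ measurableT (fun t h => adde_ge0 (n1 t h) (n2 t h)) (emeasurable_funD m1 m2) n3 m3).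
rewrite (ge0_integralD _ measurableT n1 m1 n2 m2).
rewrite (ge0_integralZl _ measurableT mT1 (fun t _ => T10 t) k1E).
rewrite (ge0_integralZl _ measurableT mT2 (fun t _ => T20 t) k2E).
rewrite (ge0_integralZl _ measurableT mT3 (fun t _ => T30 t) k3E).
have b1 : (\int[leb1]_t T1 t <= ((r ^+ 2 * al) `^ (2 / 3) * (h ^+ 2) `^ (1 / 3))%:E)%E.
  apply: le_trans (@hoelder_ge0 _ _ R leb1 N3 J (2 / 3) (1 / 3) mN3 mJ N30 J0 _ _ _) _; [lra|lra|lra|].
  rewrite EFinM -!poweR_EFin; apply: lee_pmul; rewrite ?poweR_ge0 //; apply: le_poweR => //; lra.
have b2 : (\int[leb1]_t T2 t <= ((r ^+ 2 * al) `^ (5 / 7) * (2 * M) `^ 4^-1 * (h ^+ 2) `^ 28^-1)%:E)%E.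
  apply: le_trans (@hoelder3_ge0 _ _ R leb1 N3 H J (5 / 7) 4^-1 28^-1 mN3 mH mJ N30 H0 J0 _ _ _ _) _; [lra|lra|lra|lra|].
  rewrite !EFinM -!poweR_EFin; apply: lee_pmul; rewrite ?mule_ge0 ?poweR_ge0 //.
    by apply: lee_pmul; rewrite ?poweR_ge0 //; apply: le_poweR => //; lra.
  by apply: le_poweR => //; lra.
have b3 : (\int[leb1]_t T3 t <= (r `^ (5 / 3) * p)%:E)%E.
  by apply: le_trans (@hoelder_ge0 _ _ R leb1 N3 Y4 (1 / 3) (2 / 3) mN3 mY4 N30 Y40 _ _ _) hP; lra.
apply: le_trans (leeD (leeD (lee_wpmul2l k1E b1) (lee_wpmul2l k2E b2)) (lee_wpmul2l k3E b3)) _.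
rewrite -!EFinM -!EFinD lee_fin.
have c1 : 0 <= 3 * C * energy_cst R by rewrite !mulr_ge0 // energy_cst_ge0.
have c2 : 0 <= 9 * C * cube_cst R by apply: mulr_ge0; [exact: mulr_ge0|exact: cube_cst_ge0].
have c3 : 0 <= 6 * C * pressure_cst R by apply: mulr_ge0; [exact: mulr_ge0|exact: pressure_cst_ge0].
have a1 := absorb_lower_order w0r h0r al0 c1.
have a2 := absorb_cubic w0r h0r al0 M0 c2.
have a3 := absorb_pressure w0r h0r p0 c3.
set U := (r / w) ^+ 2 in a1 a2 a3 *; have U0 : 0 <= U by exact: sqr_ge0.
set S := r * (_ + p).
have rr := ltW r0.
have S1 : r * al `^ (2 / 3) <= S by rewrite ler_wpM2l // -addrA addrC -addrA lerDl addr_ge0 ?powR_ge0.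
have S2 : r * (al `^ (4 / 3) + al `^ (2 / 3)) <= S by rewrite ler_wpM2l // lerDl.
have S3 : r * p <= S by rewrite ler_wpM2l // lerDr addr_ge0 ?powR_ge0.
have q1 : 2 * (3 * C * energy_cst R) * U * (r * al `^ (2 / 3)) <= 2 * (3 * C * energy_cst R) * U * S.
  by rewrite ler_wpM2l // mulr_ge0 // mulr_ge0.
have q2 : (4 * (9 * C * cube_cst R)) `^ (7 / 4) * U * (r * (al `^ (4 / 3) + al `^ (2 / 3))) <=
    (4 * (9 * C * cube_cst R)) `^ (7 / 4) * U * S by rewrite ler_wpM2l // mulr_ge0 ?powR_ge0.
have q3 : 2 * (6 * C * pressure_cst R) * U * (r * p) <= 2 * (6 * C * pressure_cst R) * U * S.
  by rewrite ler_wpM2l // mulr_ge0 // mulr_ge0.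
have l1 := le_trans a1 q1.
have l2 := le_trans a2 (lerD (lexx _) q2).
have l3 := le_trans a3 q3.
have -> : M / 2 + step_cst C * U * S = 2 * (3 * C * energy_cst R) * U * S +
    (M / 2 + (4 * (9 * C * cube_cst R)) `^ (7 / 4) * U * S) +
    2 * (6 * C * pressure_cst R) * U * S by rewrite /step_cst; ring.
have x1 : k1 * ((r ^+ 2 * al) `^ (2 / 3) * (h ^+ 2) `^ (1 / 3)) =
    3 * C * energy_cst R / w ^+ 2 * (2 * h) * ((r ^+ 2 * al) `^ (2 / 3) * (h ^+ 2) `^ (1 / 3)).
  by rewrite /k1; ring.
have x2 : k2 * ((r ^+ 2 * al) `^ (5 / 7) * (2 * M) `^ 4^-1 * (h ^+ 2) `^ 28^-1) =
    9 * C * cube_cst R / w * (2 * h) `^ 14^-1 *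
    ((r ^+ 2 * al) `^ (5 / 7) * (M `^ (5 / 28) * (2 * M) `^ 4^-1) * (h ^+ 2) `^ 28^-1).
  by rewrite /k2; ring.
have x3 : k3 * (r `^ (5 / 3) * p) =
    6 * C * pressure_cst R / w * (2 * h) `^ 3^-1 * (r `^ (5 / 3) * p) by rewrite /k3; ring.
by rewrite x1 x2 x3; apply: lerD l3; apply: lerD l1 l2.
Qed.

End energy_time.

(** * Mixed norms and the geometry of half cylinders *)

Section mixed_lebesgue.
Variable R : realType.
Variables (Om : set (space3 R)) (a b : R) (f : spacetime R -> R).
Hypothesis mOm : measurable Om.
Let W := Om `*` `]a, b[%classic.
Let F := f \_ W.

Let mW : measurable W. Proof. by apply: measurableX => //; exact: measurable_itv. Qed.

Lemma measurable_Lmn m n : Lmn m n Om a b f -> measurable_fun setT F.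
Proof. by move=> [mf _]; apply/(measurable_restrictT _ mW). Qed.

Let mpw (s : R) : measurable_fun setT F -> measurable_fun setT (fun z => (`|F z| `^ s)%:E).
Proof.
move=> mF; apply/measurable_EFinP; apply: (measurableT_comp (measurable_powR s)).
exact: measurableT_comp.
Qed.

Definition slice_power (s : R) (g : spacetime R -> R) t := (\int[leb3]_x (`|g (x, t)| `^ s)%:E)%E.

Let inner t x : `]a, b[%classic t -> (((fun x => (f (x, t))%:E) \_ Om) x = (F (x, t))%:E)%E.
Proof.
move=> tab; rewrite /F !patchE; case: ifPn => Ox; case: ifPn => Wx //.
- by case/negP: Wx; rewrite inE; split => //; rewrite inE in Ox.
- by case/negP: Ox; rewrite inE in Wx; rewrite inE; case: Wx.
Qed.

Let Fout t x : ~ `]a, b[%classic t -> F (x, t) = 0.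
Proof. by move=> nt; rewrite /F patchE memNset // => -[]. Qed.

Let slice_out (s : R) t : 0 < s -> ~ `]a, b[%classic t -> slice_power s F t = 0%E.
Proof.
move=> s0 nt; apply: integral0_eq => x _; rewrite Fout // normr0 powR0 // gt_eqF //.
Qed.

Lemma Lmn_fin (m n : R) : 0 < m -> 0 < n -> Lmn m%:E n%:E Om a b f ->
  (\int[leb1]_t (slice_power m F t `^ (n / m)) < +oo)%E.
Proof.
move=> m0 n0 [_]; rewrite /mixed_norm unlock /= => h.
suff <- : (\int[leb1]_t (`|((fun t => (\int[leb3]_x `|((fun x => (f (x, t))%:E) \_ Om) x| `^ m) `^ m^-1) \_ `]a, b[%classic) t| `^ n)
    = \int[leb1]_t (slice_power m F t `^ (n / m)))%E.
  rewrite ltey; apply/eqP => e; move: h; rewrite e poweRyr ?ltxx //.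
  by rewrite invr_neq0 // gt_eqF.
apply: eq_integral => t _; rewrite patchE; case: ifPn => [|/negP tab].
  rewrite inE => tab; rewrite gee0_abs ?poweR_ge0 // -poweRrM mulrC; congr (_ `^ _)%E.
  by apply: eq_integral => x _; rewrite inner.
rewrite slice_out ?normr0 //; last by move=> tt; apply: tab; rewrite inE.
by rewrite abse0 !poweR0r // ?gt_eqF // divr_gt0.
Qed.

Lemma Lmn_sqr_fin : Lmn 2%:E 2%:E Om a b f -> (\int[leb1]_t slice_power 2 F t < +oo)%E.
Proof.
move=> h; have t0 : 0 < 2 :> R by [].
have := Lmn_fin t0 t0 h; rewrite divff ?gt_eqF //.
rewrite (_ : (fun t => slice_power 2 F t `^ 1)%E = slice_power 2 F) //.
apply/funext => t; rewrite poweRe1 //; apply: integral_ge0 => x _.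
by rewrite lee_fin powR_ge0.
Qed.

Lemma Lmn_sup : Lmn 2%:E +oo%E Om a b f ->
  exists M : R, {ae leb1, forall t, (slice_power 2 F t <= M%:E)%E}.
Proof.
(* At the exponent [+oo] the norm is the essential supremum only when the whole line has positive
   measure. *)
have lT : (0 < leb1 [set: R])%E.
  apply: (@lt_le_trans _ _ (leb1 `]0 : R, 1[%classic)); first by rewrite leb1_oo // subr0 lte_fin.
  by apply: le_measure; rewrite ?inE.
move=> [_]; rewrite /mixed_norm unlock /= lT.
set g := (fun t : R => _) \_ _; set S := ess_sup _ _ => S1.
have S0 : (0 <= S)%E by apply: (ess_sup_gee lT); apply/nearW => t /=.
exists (fine (S `^ 2)).
have fS : (S `^ 2)%E \is a fin_num by rewrite ge0_fin_numE ?poweR_ge0 // poweR_lty.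
rewrite fineK //; apply: filterS (ess_sup_ge leb1 (abse \o g)) => t /= ht.
have [tab|ntab] := pselect (`]a, b[%classic t); last by rewrite slice_out ?poweR_ge0.
move: ht; rewrite -/S /g patchE mem_set // gee0_abs ?poweR_ge0 // => ht.
have := le_poweR (r := 2) _ (poweR_ge0 _ _) ht; rewrite -poweRrM mulVf // poweRe1; last first.
  by apply: integral_ge0 => x _; exact: poweR_ge0.
move=> /(_ (ler0n _ _)); apply: le_trans.
rewrite le_eqVlt; apply/orP; left; apply/eqP.
by apply: eq_integral => x _; rewrite inner.
Qed.

Variables (K : set (space3 R)) (I : set R) (k i : R).
Hypotheses (mK : measurable K) (mI : measurable I) (kK : (leb3 K <= k%:E)%E)
  (iI : (leb1 I <= i%:E)%E) (KI : K `*` I `<=` W).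

(** Jensen's inequality in space on slices of [K], then in time on [I], bounds a power of the
    integral of [|f|] by a finite multiple of the mixed norm to a power. *)
Lemma integrable_Lmn (m n : R) : 1 < m -> 1 < n -> Lmn m%:E n%:E Om a b f ->
  leb4.-integrable setT (EFin \o (f \_ (K `*` I))).
Proof.
move=> m1 n1 h; have mF := measurable_Lmn h.
have m0 : 0 < m by exact: lt_trans m1. have n0 : 0 < n by exact: lt_trans n1.
pose g := f \_ (K `*` I).
have mKI : measurable (K `*` I) by exact: measurableX.
have gE : g = F \_ (K `*` I).
  apply/funext => z; rewrite /g /F !patchE; case: ifPn => // /[!inE] /KI Wz.
  by rewrite mem_set.
have mg : measurable_fun setT g.
  by rewrite gE; apply/(measurable_restrictT _ mKI); exact: measurable_funTS.
have gF z : `|g z| <= `|F z| by rewrite gE patchE; case: ifP => // _; rewrite normr0.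
apply/integrableP; split; first exact/measurable_EFinP.
have mag : measurable_fun setT (fun z => (`|g z|)%:E).
  by apply/measurable_EFinP; exact: measurableT_comp.
have ag0 z : (0 <= (`|g z|)%:E)%E by rewrite lee_fin.
pose X t := (\int[leb3]_x (`|g (x, t)|)%:E)%E.
have X0 t : (0 <= X t)%E by exact: integral_ge0.
have mX : measurable_fun setT X := measurable_fun_fubini_tonelli_G (m1 := leb3) _ mag ag0.
have -> : (\int[leb4]_z `|(EFin \o g) z| = \int[leb1]_t X t)%E.
  exact: (@fubini_tonelli2 _ _ _ _ R leb3 leb1 _ mag ag0).
have gout x t : ~ (K x /\ I t) -> g (x, t) = 0.
  by move=> nk; rewrite /g patchE memNset // => -[].
have Xm t : (X t `^ m <= (k `^ (m - 1))%:E * slice_power m F t)%E.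
  apply: le_trans (poweR_integral_le mK kK (measurable_section1 t mag) _ _ m1) _ => //.
    by move=> x nx; rewrite gout ?normr0 // => -[].
  apply: lee_wpmul2l; first by rewrite lee_fin powR_ge0.
  apply: ge0_le_integral => //.
  - by move=> x _; exact: poweR_ge0.
  - by apply: measurable_poweR; exact: (measurable_section1 t mag).
  - exact: (measurable_section1 t (mpw m mF)).
  - by move=> x _; rewrite poweR_EFin lee_fin ge0_ler_powR ?nnegrE // ltW.
have Xn t : (X t `^ n <= ((k `^ (m - 1)) `^ (n / m))%:E * slice_power m F t `^ (n / m))%E.
  have -> : (X t `^ n = (X t `^ m) `^ (n / m))%E.
    by rewrite -poweRrM mulrCA divff ?gt_eqF // mulr1.
  apply: le_trans (le_poweR _ (poweR_ge0 _ _) (Xm t)) _; first by rewrite divr_ge0 // ltW.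
  rewrite poweRM ?lee_fin ?powR_ge0 //; apply: integral_ge0 => x _.
  by rewrite lee_fin powR_ge0.
have mS : measurable_fun setT (slice_power m F).
  apply: (measurable_fun_fubini_tonelli_G (m1 := leb3) _ (mpw m mF)) => z.
  by rewrite lee_fin powR_ge0.
have fin : ((\int[leb1]_t X t) `^ n < +oo)%E.
  apply: (le_lt_trans (poweR_integral_le mI iI mX X0 _ n1)).
    by move=> t nt; apply: integral0_eq => x _; rewrite gout ?normr0 // => -[].
  apply: (@le_lt_trans _ _ ((i `^ (n - 1))%:E * (((k `^ (m - 1)) `^ (n / m))%:E *
      \int[leb1]_t (slice_power m F t `^ (n / m))))%E).
    apply: lee_wpmul2l; first by rewrite lee_fin powR_ge0.
    rewrite -ge0_integralZl //; last 3 first.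
    - exact: measurable_poweR.
    - by move=> t _; exact: poweR_ge0.
    - by rewrite lee_fin powR_ge0.
    apply: ge0_le_integral => //.
    - by move=> t _; exact: poweR_ge0.
    - exact: measurable_poweR.
    - by apply: emeasurable_funM => //; exact: measurable_poweR.
  rewrite muleA -EFinM; apply: lte_mul_pinfty; rewrite ?lee_fin ?mulr_ge0 ?powR_ge0 //.
  exact: Lmn_fin.
rewrite ltey; apply/eqP => e; move: fin; rewrite e poweRyr ?ltxx // gt_eqF //.
Qed.

End mixed_lebesgue.

(** * Half cubes and half balls *)

Section geometry.
Variable R : realType.
Implicit Types (x : space3 R).

Lemma coordsB x y (j : 'I_3) : coords (x - y) j = coords x j - coords y j.
Proof. by rewrite !coordsE; case: j => -[|[|[|//]]] ?. Qed.

Lemma eballE (y : space3 R) (s : R) x : 0 < s ->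
  eball y s x <-> \sum_(j < 3) (coords x j - coords y j) ^+ 2 < s ^+ 2.
Proof.
move=> s0; rewrite /eball /euclid /=; under eq_bigr do rewrite coordsB.
set S := \sum_(j < 3) _; have S0 : 0 <= S by apply: sumr_ge0 => j _; exact: sqr_ge0.
split=> h; first by rewrite -(sqr_sqrtr S0) ltr_pXn2r // ?nnegrE ?sqrtr_ge0 // ltW.
by rewrite -[ltRHS](gtr0_norm s0) -sqrtr_sqr ltr_sqrt // exprn_gt0.
Qed.

Lemma measurable_euclid d (T : measurableType d) (w : T -> 'I_3 -> R) :
  (forall j, measurable_fun setT (fun y => w y j)) -> measurable_fun setT (fun y => euclid (w y)).
Proof.
move=> mw; rewrite /euclid; apply: (measurableT_comp (f := @Num.sqrt R)).
  by apply: continuous_measurable_fun; exact: sqrt_continuous.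
by apply: measurable_sum => j; exact: measurable_funX.
Qed.

Lemma measurable_halfball y (s : R) : measurable (halfball y s).
Proof.
apply: measurableI.
  rewrite (_ : eball y s = [set x | euclid (coords (x - y)) < s]) //.
  have m : measurable_fun setT (fun x => euclid (coords (x - y))).
    apply: measurable_euclid => j; under eq_fun do rewrite coordsB.
    by apply: measurable_funB => //; exact: measurable_coords.
  by rewrite -(setTI [set x | _]); apply: (measurable_fun_ltr m) => //; exact: measurable_cst.
by rewrite -(setTI [set x | _]); apply: (measurable_fun_ltr (measurable_cst _)).
Qed.

Lemma measurable_halfcyl (z0 : spacetime R) (s : R) : measurable (halfcyl z0 s).
Proof. by apply: measurableX; [exact: measurable_halfball|exact: measurable_itv]. Qed.

(** [3 * h ^ 2 < s ^ 2] says that the half-diagonal of the cube is shorter than the radius. *)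
Lemma cube_eball (y : space3 R) (h s : R) x : 0 <= h -> 0 < s -> 3 * h ^+ 2 < s ^+ 2 ->
  (forall j, coords y j - h <= coords x j <= coords y j + h) -> eball y s x.
Proof.
move=> h0 s0 hs bx; apply/eballE => //; apply: le_lt_trans hs.
have -> : 3 * h ^+ 2 = \sum_(j < 3) h ^+ 2 by rewrite sumr_const card_ord mulr_natl.
apply: ler_sum => j _; rewrite -[leLHS]real_normK ?num_real // ler_pXn2r ?nnegrE //.
by rewrite ler_norml; have /andP[] := bx j; lra.
Qed.

Lemma eball_coords (y : space3 R) (s : R) x j : 0 < s -> eball y s x ->
  coords y j - s < coords x j < coords y j + s.
Proof.
move=> s0 /eballE-/(_ s0) h.
have : (coords x j - coords y j) ^+ 2 < s ^+ 2.
  apply: le_lt_trans h; rewrite (bigD1 j) //= lerDl sumr_ge0 // => i _; exact: sqr_ge0.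
move=> h2; have : `|coords x j - coords y j| < s.
  by rewrite -(ltr_pXn2r (n := 2)) ?nnegrE ?(ltW s0) // real_normK ?num_real.
by rewrite ltr_norml => /andP[h3 h4]; apply/andP; split; lra.
Qed.

(** Built with [lower], so that the half cube is a box to which [solenoidal_slices] applies as it
    stands. *)
Definition cubea (z0 : spacetime R) (h : R) : 'I_3 -> R := lower z0 (fun j => coords z0.1 j - h).
Definition cubeb (z0 : spacetime R) (h : R) (j : 'I_3) : R := coords z0.1 j + h.
Definition cube (z0 : spacetime R) (h : R) := box (cubea z0 h) (cubeb z0 h).
Definition cubecyl (z0 : spacetime R) (h : R) := cylbox (cubea z0 h) (cubeb z0 h) (tstart z0 h) z0.2.

Lemma cubeP (z0 : spacetime R) (h : R) x : 0 < h -> cube z0 h x <->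
  (forall j, coords z0.1 j - h < coords x j < coords z0.1 j + h) /\ z0.1.2 < x.2.
Proof.
move=> h0; have c2 (y : space3 R) : coords y i2 = y.2 by rewrite coordsE.
split=> [bx|[bx x3] j].
  split; last by have := bx i2; rewrite c2 /cubea /lower eqxx => /andP[].
  move=> j; have := bx j; rewrite /cubea /lower /cubeb; case: eqP => [->|//].
  rewrite c2; case/andP=> h1 ->; rewrite andbT; apply: lt_trans h1; rewrite c2; lra.
rewrite /cubea /lower /cubeb; case: eqP => [->|_]; last exact: bx.
by rewrite c2 x3 /=; have := bx i2; rewrite c2 => /andP[].
Qed.

Lemma cube_halfball (z0 : spacetime R) (h s : R) : 0 < h -> 0 < s -> 3 * h ^+ 2 < s ^+ 2 ->
  cube z0 h `<=` halfball z0.1 s.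
Proof.
move=> h0 s0 hs x /(cubeP _ _ h0)[bx x3]; split=> //.
by apply: (cube_eball (ltW h0) s0 hs) => j; case/andP: (bx j) => h1 h2; rewrite !ltW.
Qed.

Lemma halfball_cube (z0 : spacetime R) (s : R) : 0 < s -> halfball z0.1 s `<=` cube z0 s.
Proof.
move=> s0 x [ex x3]; apply/(cubeP _ _ s0); split=> // j; exact: eball_coords.
Qed.

Lemma tstart_le (z0 : spacetime R) (h s : R) : 0 <= h <= s -> tstart z0 s <= tstart z0 h.
Proof.
move=> /andP[h0 hs]; rewrite /tstart lerD2l lerN2 ler_pXn2r ?nnegrE //; exact: le_trans hs.
Qed.

Lemma cubecyl_halfcyl (z0 : spacetime R) (h s : R) : 0 < h <= s -> 3 * h ^+ 2 < s ^+ 2 ->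
  cubecyl z0 h `<=` halfcyl z0 s.
Proof.
move=> /andP[h0 hs] h3; have s0 := lt_le_trans h0 hs.
move=> [x t] [/= bx]; rewrite in_itv /= => /andP[t1 t2]; split => /=.
  exact: (cube_halfball h0 s0 h3).
rewrite in_itv /= t2 andbT (le_lt_trans _ t1) // tstart_le // (ltW h0) //.
Qed.

Lemma cube_sides (z0 : spacetime R) (h : R) j : 0 < h -> 2 * h / 2 <= cubeb z0 h j - cubea z0 h j <= 2 * h.
Proof.
move=> h0; rewrite /cubea /lower /cubeb; case: eqP => [->|_].
  by rewrite coordsE /=; apply/andP; split; lra.
by apply/andP; split; lra.
Qed.

End geometry.

(** Comparing the suprema over simple functions covers arbitrary nonnegative functions, such as the
    weak norm in time, whose measurability is unclear. *)
Lemma le_integral_ge0 d (T : measurableType d) (R : realType) (mu : {measure set T -> \bar R})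
    (D : set T) (f1 f2 : T -> \bar R) : (forall x, D x -> (0 <= f1 x)%E) ->
  (forall x, D x -> (f1 x <= f2 x)%E) ->
  (\int[mu]_(x in D) f1 x <= \int[mu]_(x in D) f2 x)%E.
Proof.
move=> f10 f12; have f20 x : D x -> (0 <= f2 x)%E by move=> Dx; exact: le_trans (f10 _ Dx) (f12 _ Dx).
rewrite !ge0_integralE //; apply: ereal_sup_le => _ [h hf <-] /=.
exists h => // x; apply: (le_trans (hf x)).
by rewrite !patchE; case: ifPn => // /[!inE]; exact: f12.
Qed.

Lemma poweR3 (R : realType) (x : \bar R) : (0 <= x)%E -> (x `^ 3 = x ^+ 3)%E.
Proof.
case: x => [x| |//] x0; first by rewrite poweR_EFin powR_mulrn // EFin_expe.
by rewrite poweRyr ?pnatr_eq0 // !expeS expe0 mule1 !mulyy.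
Qed.

(** * A measurable substitute for the weak norm *)

Section weak_norm_bound.
Variable R : realType.
Variables (z0 : spacetime R) (r : R) (u : 'I_3 -> spacetime R -> R).
Hypothesis r0 : 0 < r.
Let U j := u j \_ (halfcyl z0 r).
Hypothesis mU : forall j, measurable_fun setT (U j).

(** Enumerates the positive rationals; codes of anything else give the default value 1. *)
Definition rat_pos (k : nat) : R :=
  let q := odflt 1%Q (unpickle k) in if 0 < q then ratr q else 1.

Lemma rat_pos_gt0 k : 0 < rat_pos k.
Proof. by rewrite /rat_pos; case: ifP => // q0; rewrite ltr0q. Qed.

Let spd t x := euclid (fun j => U j (x, t)).

Let level (q t : R) : \bar R := leb3 [set x | q < spd t x].

Let wn (t : R) : \bar R :=
  ereal_sup (range (fun k => (rat_pos k)%:E * level (rat_pos k) t `^ 3^-1))%E.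

(* The weak norm is a supremum over uncountably many levels, hence not clearly measurable in time;
   rational levels give a measurable function equivalent to it up to a factor 2. *)
Definition wnorm (t : R) : \bar R := (2%:E * wn t)%E.

Let mspd : measurable_fun setT (fun z : spacetime R => spd z.2 z.1).
Proof.
apply: (@measurable_euclid R _ _ (fun z : spacetime R => fun j => U j (z.1, z.2))) => j.
by rewrite (_ : (fun y => _) = U j) //; apply/funext => -[].
Qed.

Let mset q t : measurable [set x | q < spd t x].
Proof.
rewrite -(setTI [set x | _]); apply: (measurable_fun_ltr (measurable_cst _)) => //.
exact: (measurable_section1 t mspd).
Qed.

Let mlevel q : measurable_fun setT (level q).
Proof.
pose S := [set z : spacetime R | q < spd z.2 z.1].
have mS : measurable S.
  by rewrite -(setTI S); exact: (measurable_fun_ltr (measurable_cst _) mspd).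
rewrite (_ : level q = fun t => \int[leb3]_x (\1_S (x, t))%:E)%E.
  apply: (measurable_fun_fubini_tonelli_G (m1 := leb3) (fun z => (\1_S z)%:E)).
    by apply/measurable_EFinP; exact: measurable_indic.
  by move=> z; rewrite lee_fin indicE ler0n.
apply/funext => t; have -> : level q t = (\int[leb3]_x (\1_[set x | (q < spd t x)%R] x)%:E)%E.
  by rewrite integral_indic // setIT.
by apply: eq_integral => x _; rewrite !indicE; congr (_%:R%:E); apply/idP/idP; rewrite !inE.
Qed.

Let wn0 t : (0 <= wn t)%E.
Proof.
apply: (@ereal_sup_ge _ _ _).
exists ((rat_pos 0)%:E * level (rat_pos 0) t `^ 3^-1)%E; first by exists 0%N.
by rewrite mule_ge0 ?poweR_ge0 // lee_fin ltW // rat_pos_gt0.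
Qed.

Lemma wnorm_ge0 t : (0 <= wnorm t)%E. Proof. by rewrite mule_ge0. Qed.

Let mwn : measurable_fun setT wn.
Proof.
have := @measurable_fun_esups _ _ R setT (fun k t => (rat_pos k)%:E * level (rat_pos k) t `^ 3^-1)%E _ 0%N.
rewrite (_ : (fun t => esups _ 0) = wn); last first.
  apply/funext => t; rewrite /esups /sdrop; congr ereal_sup.
  by apply/seteqP; split=> _ [k _ <-]; exists k.
apply=> k; apply: emeasurable_funM => //; apply: measurable_poweR; exact: mlevel.
Qed.

Lemma measurable_wnorm : measurable_fun setT wnorm.
Proof. exact: emeasurable_funM. Qed.

Lemma wnorm_weak t (v : space3 R -> R) : measurable_fun setT v -> (forall x, `|v x| <= euclid (fun j => U j (x, t))) ->
  forall c, 0 < c -> ((c ^+ 3)%:E * leb3 (upper (fun x => `|v x|%R) c) <= wnorm t `^ 3)%E.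
Proof.
move=> mv hv c c0.
have c2 : c / 2 < c by lra.
(* A rational level between [c / 2] and [c] costs at most the factor 2 built into [wnorm]. *)
have [q] := rat_in_itvoo c2; rewrite in_itv /= => /andP[q1 q2].
have q0 : 0 < q by rewrite -(ltr0q R) (lt_trans _ q1) // divr_gt0.
pose k := pickle q.
have kq : rat_pos k = ratr q by rewrite /rat_pos pickleK /= q0.
have l0 : (0 <= level (ratr q) t)%E by exact: measure_ge0.
have lw : (c%:E * level (ratr q) t `^ 3^-1 <= wnorm t)%E.
  apply: (@le_trans _ _ (2%:E * ((rat_pos k)%:E * level (rat_pos k) t `^ 3^-1))%E).
    rewrite kq muleA -EFinM; apply: lee_wpmul2r; first exact: poweR_ge0.
    by rewrite lee_fin; lra.
  by apply: lee_wpmul2l => //; apply: ereal_sup_ubound; exists k.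
have := le_poweR (r := 3) _ _ lw; rewrite mule_ge0 ?poweR_ge0 ?lee_fin ?(ltW c0) //.
move=> /(_ (ler0n _ _) isT); apply: le_trans.
rewrite poweRM ?poweR_ge0 ?lee_fin ?(ltW c0) // -poweRrM mulVf ?pnatr_eq0 // poweRe1 //.
rewrite poweR_EFin powR_mulrn ?(ltW c0) //; apply: lee_wpmul2l; first by rewrite lee_fin exprn_ge0 // ltW.
apply: le_measure; rewrite ?inE.
- rewrite -(setTI (upper _ _)); apply: (measurable_fun_ltr (measurable_cst _)) => //.
  exact: measurableT_comp.
- exact: mset.
- move=> x; rewrite /upper /= => cv; apply: lt_le_trans (hv x).
  exact: lt_trans cv.
Qed.

Let wn_le t : tstart z0 r < t < z0.2 ->
  (wn t <= weak_norm 3 (halfball z0.1 r) (fun x => euclid (fun i => u i (x, t))))%E.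
Proof.
move=> tI; apply: ge_ereal_sup => _ [k _ <-].
apply: ereal_sup_ubound; exists (rat_pos k); first exact: rat_pos_gt0.
congr (_ * _ `^ _)%E; congr (leb3 _).
have q0 := rat_pos_gt0 k.
apply/seteqP; split=> [x [ox]|x] /=.
  rewrite ger0_norm ?sqrtr_ge0 //; congr (_ < _); rewrite /spd /euclid; congr Num.sqrt.
  by apply: eq_bigr => j _; rewrite /U patchE mem_set //; split => //=; rewrite in_itv.
have [ox|nox] := pselect (halfball z0.1 r x).
  move=> h; split=> //; rewrite ger0_norm ?sqrtr_ge0 //; move: h; congr (_ < _).
  rewrite /spd /euclid; congr Num.sqrt.
  by apply: eq_bigr => j _; rewrite /U patchE mem_set //; split => //=; rewrite in_itv.
rewrite /spd /euclid big1 ?sqrtr0; first by move/(lt_trans q0); rewrite ltxx.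
by move=> j _; rewrite /U patchE memNset ?expr0n // => -[].
Qed.

Lemma wnorm_out t : ~ (tstart z0 r < t < z0.2) -> wnorm t = 0%E.
Proof.
move=> nt.
have lv k : level (rat_pos k) t = 0%E.
  rewrite /level (_ : [set x | _] = set0) ?measure0 // -subset0 => x /=.
  rewrite /spd /euclid big1 ?sqrtr0; first by move/(lt_trans (rat_pos_gt0 k)); rewrite ltxx.
  by move=> j _; rewrite /U patchE memNset ?expr0n // => -[_ /=]; rewrite in_itv.
apply/eqP; rewrite eq_le wnorm_ge0 andbT -[leRHS](mule0 2%:E); apply: lee_wpmul2l => //.
apply: ge_ereal_sup => _ [k _ <-].
by rewrite lv poweR0r ?mule0 // invr_neq0 // pnatr_eq0.
Qed.

(** [wn] is at most the weak norm on each slice, and the factor 8 is the cube of the 2 in [wnorm].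
    It is taken out while the integrand is still the measurable [wn], before the comparison with the
    weak norm. *)
Lemma integral_wnorm : (\int[leb1]_t (wnorm t `^ 3) <= (8 * r ^+ 2)%:E * Cinfplus z0 r u)%E.
Proof.
rewrite /Cinfplus muleA -EFinM mulfK; last by rewrite expf_neq0 // gt_eqF.
set J := `]tstart z0 r, z0.2[%classic.
have -> : (\int[leb1]_t (wnorm t `^ 3) = \int[leb1]_(t in J) (wnorm t `^ 3))%E.
  rewrite [RHS]integral_mkcond; apply: eq_integral => t _; rewrite patchE; case: ifPn => // /negP nt.
  by rewrite wnorm_out ?poweR0r // => tI; apply: nt; rewrite inE /J /= in_itv.
have wk0 t : (0 <= weak_norm 3 (halfball z0.1 r) (fun x => euclid (fun i => u i (x, t))))%E.
  apply: (@ereal_sup_ge _ _ _); eexists; first by exists 1 => //=.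
  by rewrite mule_ge0 ?poweR_ge0.
have w8 t : (wnorm t `^ 3 = 8%:E * wn t `^ 3)%E.
  rewrite poweRM // poweR_EFin powR_mulrn // (_ : 2 ^+ 3 = 8 :> R) //; ring.
under eq_integral do rewrite w8.
have mwn3 : measurable_fun J (fun t => wn t `^ 3)%E.
  by apply: measurable_funTS; exact: measurable_poweR.
rewrite (ge0_integralZl _ (measurable_itv _) mwn3 (fun t _ => poweR_ge0 _ _)) //.
apply: lee_wpmul2l => //; apply: le_integral_ge0 => [t _|t]; first exact: poweR_ge0.
rewrite /J /= in_itv /= => tI; rewrite -[leRHS]poweR3 //.
by apply: le_poweR => //; exact: wn_le.
Qed.

End weak_norm_bound.

(** * The pressure gradient on half cubes against the scale-invariant quantity *)

Section pressure_bound.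
Variable R : realType.
Variables (z0 : spacetime R) (r h : R) (Dp : 'I_3 -> spacetime R -> R).
Hypotheses (h0r : 0 < h <= r) (h3 : 3 * h ^+ 2 < r ^+ 2).
Let g i := Dp i \_ (cubecyl z0 h).
Hypothesis mg : forall j, measurable_fun setT (g j).

Definition slice_gradp t : \bar R := (\int[leb3]_x (`|g i0 (x, t)|%:E `^ (9 / 8)) +
  \int[leb3]_x (`|g i1 (x, t)|%:E `^ (9 / 8)) + \int[leb3]_x (`|g i2 (x, t)|%:E `^ (9 / 8)))%E.

Let h0 : 0 < h. Proof. by case/andP: h0r. Qed.
Let r0 : 0 < r. Proof. by case/andP: h0r => ?; exact: lt_le_trans. Qed.

Let S i t := (\int[leb3]_x (`|g i (x, t)|%:E `^ (9 / 8)))%E.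
Let S0 i t : (0 <= S i t)%E. Proof. by apply: integral_ge0 => x _; exact: poweR_ge0. Qed.
Let mS i : measurable_fun setT (S i).
Proof.
apply: (measurable_fun_fubini_tonelli_G (m1 := leb3) (fun z => `|g i z|%:E `^ (9 / 8))%E).
  by apply: measurable_poweR; apply: measurable_abse; exact: mg.
by move=> z; exact: poweR_ge0.
Qed.

Lemma slice_gradp_ge0 t : (0 <= slice_gradp t)%E.
Proof. exact: (adde_ge0 (adde_ge0 (S0 _ _) (S0 _ _)) (S0 _ _)). Qed.

Lemma measurable_slice_gradp : measurable_fun setT slice_gradp.
Proof. exact: (emeasurable_funD (emeasurable_funD (mS i0) (mS i1)) (mS i2)). Qed.

Let T t := (\int[leb3]_(x in halfball z0.1 r) (euclid (fun i => Dp i (x, t)) `^ (9 / 8))%:E)%E.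

Let S_le i t : (S i t <= T t)%E.
Proof.
rewrite /T integral_mkcond; apply: le_integral_ge0 => [x _|x _]; first exact: poweR_ge0.
rewrite patchE /g patchE; case: ifPn => [/[!inE] Qx|_]; last first.
  rewrite (_ : (point : R) = 0) // normr0 poweR0r; last by rewrite gt_eqF // divr_gt0.
  by case: ifPn => // _; rewrite lee_fin powR_ge0.
have [hx _] := cubecyl_halfcyl h0r h3 Qx; rewrite mem_set // poweR_EFin lee_fin.
apply: ge0_ler_powR; rewrite ?nnegrE ?sqrtr_ge0 //.
rewrite -sqrtr_sqr /euclid ler_sqrt; last by apply: sumr_ge0 => j _; exact: sqr_ge0.
by rewrite (bigD1 i) //= lerDl sumr_ge0 // => j _; exact: sqr_ge0.
Qed.

Let S_out i t : ~ (tstart z0 r < t < z0.2) -> S i t = 0%E.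
Proof.
move=> nt; apply: integral0_eq => x _; rewrite /g patchE memNset.
  by rewrite normr0 poweR0r //; lra.
by move=> /(cubecyl_halfcyl h0r h3)[_ /=]; rewrite in_itv.
Qed.

(** Each of the three component integrals is at most that of the Euclidean norm of the gradient,
    whence [3 ^ (4 / 3)]. *)
Lemma integral_slice_gradp : (\int[leb1]_t (slice_gradp t `^ (4 / 3)) <=
  (3 `^ (4 / 3) * r `^ (3 / 2))%:E * D1plus z0 r Dp)%E.
Proof.
rewrite /D1plus muleA -EFinM -mulrA powRN mulfV ?mulr1; last by rewrite gt_eqF // powR_gt0.
set J := `]tstart z0 r, z0.2[%classic.
have c0 : (0 <= (3 `^ (4 / 3) : R)%:E)%E by rewrite lee_fin powR_ge0.
(* The factor 3 is split off on this side, where the integrand is measurable; for the integrand of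
   [D1plus] no measurability has been assumed here. *)
pose Y t := (3^-1%:E * slice_gradp t)%E.
have Y0 t : (0 <= Y t)%E by rewrite mule_ge0 // slice_gradp_ge0.
have mY : measurable_fun J (fun t => Y t `^ (4 / 3))%E.
  apply: measurable_funTS; apply: measurable_poweR.
  by apply: emeasurable_funM => //; exact: measurable_slice_gradp.
have YE t : slice_gradp t = (3%:E * Y t)%E by rewrite /Y muleA -EFinM mulfV ?mul1e // pnatr_eq0.
have -> : (\int[leb1]_t (slice_gradp t `^ (4 / 3)) = \int[leb1]_(t in J) ((3 `^ (4 / 3))%:E * Y t `^ (4 / 3)))%E.
  rewrite [RHS]integral_mkcond; apply: eq_integral => t _; rewrite patchE; case: ifPn => [_|/negP nt].
    by rewrite YE poweRM.
  have nt' : ~ (tstart z0 r < t < z0.2) by move=> tI; apply: nt; rewrite inE /J /= in_itv.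
  have := S_out i0 nt'; have := S_out i1 nt'; have := S_out i2 nt'; rewrite /S => e2 e1 e0.
  rewrite /slice_gradp e0 e1 e2 !adde0 poweR0r //; lra.
rewrite (ge0_integralZl _ (measurable_itv _) mY (fun t _ => poweR_ge0 _ _)) //.
apply: lee_wpmul2l => //; apply: le_integral_ge0 => [t _|t _]; first exact: poweR_ge0.
have TE : ((3^-1)%:E * (3%:E * T t) = T t)%E by rewrite muleA -EFinM mulVf ?mul1e // pnatr_eq0.
apply: le_poweR => //; rewrite -/(T t) -TE /Y.
apply: lee_wpmul2l => //; rewrite (_ : 3%:E = (1 + 1 + 1)%E); last by rewrite -!EFinD; congr EFin; ring.
have T0 : (0 <= T t)%E by exact: le_trans (S0 i0 t) (S_le _ _).
rewrite !ge0_muleDl ?adde_ge0 // !mul1e; apply: leeD; first apply: leeD; exact: S_le.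
Qed.

End pressure_bound.

(** The [6] is [8 ^ (1/3) = 2] times 3, which bounds [3 ^ (4/3 * 2/3)]. The powers of [r] add up to
    2/3 + 1 = 5/3. *)
Lemma product_bound (R : realType) (r : R) (A B Cc Dd : \bar R) (p : R) : 0 < r ->
  (0 <= A)%E -> (0 <= B)%E -> (0 <= Cc)%E -> (0 <= Dd)%E ->
  (A <= (8 * r ^+ 2)%:E * Cc)%E -> (B <= (3 `^ (4 / 3) * r `^ (3 / 2))%:E * Dd)%E ->
  (Dd `^ (2 / 3) * Cc `^ (1 / 3) <= p%:E)%E ->
  (A `^ (1 / 3) * B `^ (2 / 3) <= (r `^ (5 / 3) * (6 * p))%:E)%E.
Proof.
move=> r0 A0 B0 C0 D0 hA hB hp.
have q1 : (A `^ (1 / 3) <= (2 * r `^ (2 / 3))%:E * Cc `^ (1 / 3))%E.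
  apply: le_trans (le_poweR _ A0 hA) _; first lra.
  have r8 : 0 <= 8 * r ^+ 2 by rewrite mulr_ge0 // exprn_ge0 // ltW.
  rewrite poweRM ?lee_fin // poweR_EFin.
  rewrite (_ : (8 * r ^+ 2) `^ (1 / 3) = 2 * r `^ (2 / 3)) //.
  rewrite powRM ?exprn_ge0 ?(ltW r0) // -(powR_mulrn 2 (ltW r0)) -powRrM.
  rewrite (_ : 8 = 2 `^ 3 :> R); last by rewrite powR_mulrn //; ring.
  rewrite -powRrM (_ : 3 * (1 / 3) = 1 :> R); last by field.
  by rewrite powRr1 // (_ : 2 * (1 / 3) = 2 / 3 :> R) //; field.
have q2 : (B `^ (2 / 3) <= (3 * r)%:E * Dd `^ (2 / 3))%E.
  apply: le_trans (le_poweR _ B0 hB) _; first lra.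
  have r3 : 0 <= 3 `^ (4 / 3) * r `^ (3 / 2) by rewrite mulr_ge0 ?powR_ge0.
  rewrite poweRM ?lee_fin // poweR_EFin; apply: lee_wpmul2r; first exact: poweR_ge0.
  rewrite lee_fin powRM ?powR_ge0 // -!powRrM (_ : 3 / 2 * (2 / 3) = 1 :> R); last by field.
  rewrite powRr1 ?(ltW r0) //; apply: ler_wpM2r; first exact: ltW.
  have := @ler_powR R 3 (ler1n _ 3) (4 / 3 * (2 / 3)) 1; rewrite powRr1 //; apply; lra.
apply: le_trans (lee_pmul (poweR_ge0 _ _) (poweR_ge0 _ _) q1 q2) _.
rewrite muleACA -EFinM [X in (_ * X)%E]muleC.
have k0 : 0 <= 2 * r `^ (2 / 3) * (3 * r) by rewrite !mulr_ge0 ?powR_ge0 // ltW.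
apply: le_trans (lee_wpmul2l _ hp) _; first by rewrite lee_fin.
rewrite -EFinM lee_fin le_eqVlt; apply/orP; left; apply/eqP.
have -> : r `^ (5 / 3) = r `^ (2 / 3) * r.
  have -> : 5 / 3 = 2 / 3 + 1 :> R by field.
  by rewrite powRD ?(gt_eqF r0) ?implybT // powRr1 // ltW.
ring.
Qed.

(** * One step of the local energy inequality *)

Section cutoff.
Variable R : realType.
Variables (z0 : spacetime R) (h w : R).

(** Equal to one up to distance [h - 2 w] from the centre and to zero from distance [h - w] on; the
    layer up to [h] is room for the derivatives, which are shown to vanish only on slightly larger
    sets. Centred at the flat boundary in the normal direction, it is one there. *)
Definition cutx (j : 'I_3) : R -> R := plateau (coords z0.1 j - (h - w)) (coords z0.1 j + (h - w)) w.

(* The time width (h^2 - (h - 2w)^2) / 2 lets the cutoff rise inside the larger cylinder. *)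
Definition cutw : R := 2 * w * (h - w).

(** The plateau is prolonged beyond the final time, so that within the cylinder the cutoff only
    rises. *)
Definition cutt : R -> R := plateau (z0.2 - (h - 2 * w) ^+ 2 - cutw) (z0.2 + cutw) cutw.

Definition cutoff : spacetime R -> R := tens (cutx i0) (cutx i1) (cutx i2) cutt.

Definition cutheat (z : spacetime R) : R := 'D_dirt cutoff z + laplacian cutoff z.

Lemma smooth1_cutx j : smooth1 (cutx j). Proof. exact: smooth1_plateau. Qed.

Lemma smooth1_cutt : smooth1 cutt. Proof. exact: smooth1_plateau. Qed.

Hypotheses (w0 : 0 < w) (wh : 2 * w < h).

Let near0 z := (forall j, coords z0.1 j - h < coords z.1 j < coords z0.1 j + h) /\ z0.2 - h ^+ 2 < z.2.

Let cutw0 : 0 < cutw. Proof. by apply: mulr_gt0; [exact: mulr_gt0|rewrite subr_gt0; move: w0 wh; lra]. Qed.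

Let axw j : coords z0.1 j - (h - w) + w <= coords z0.1 j + (h - w).
Proof. by move: w0 wh; lra. Qed.

Let atw : z0.2 - (h - 2 * w) ^+ 2 - cutw + cutw <= z0.2 + cutw.
Proof. by have := sqr_ge0 (h - 2 * w); have := cutw0; lra. Qed.

Let cutx_out' j s : ~ (coords z0.1 j - (h - w) < s < coords z0.1 j + (h - w)) -> cutx j s = 0.
Proof. exact: (@plateau_out R _ _ w w0 (axw j)). Qed.

Lemma cutx_out j s : ~ (coords z0.1 j - h < s < coords z0.1 j + h) -> cutx j s = 0.
Proof. by move=> ns; apply: cutx_out' => /andP[s1 s2]; apply: ns; apply/andP; split; move: w0; lra. Qed.

Let derive1_cutx_out' j s : ~ (coords z0.1 j - (h - w / 2) < s < coords z0.1 j + (h - w / 2)) ->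
  derive1 (cutx j) s = 0.
Proof. by apply: (derive1_out (@cutx_out' j)); move: w0; lra. Qed.

Lemma derive1_cutx_out j s : ~ (coords z0.1 j - h < s < coords z0.1 j + h) -> derive1 (cutx j) s = 0.
Proof. by apply: (derive1_out (@cutx_out' j)); move: w0; lra. Qed.

Let derive2_cutx_out j s : ~ (coords z0.1 j - h < s < coords z0.1 j + h) ->
  derive1 (derive1 (cutx j)) s = 0.
Proof. by apply: (derive1_out (@derive1_cutx_out' j)); move: w0; lra. Qed.

Let cutt_out' s : ~ (z0.2 - (h - 2 * w) ^+ 2 - cutw < s < z0.2 + cutw) -> cutt s = 0.
Proof. exact: (@plateau_out R _ _ _ cutw0 atw). Qed.

Let cutwE : h ^+ 2 = (h - 2 * w) ^+ 2 + 2 * cutw.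
Proof. by rewrite /cutw; ring. Qed.

Let cutt_out s : s <= z0.2 - h ^+ 2 -> cutt s = 0.
Proof. by move=> sh; apply: cutt_out' => /andP[h1 h2]; move: sh h1 cutw0; rewrite cutwE; lra. Qed.

Let derive1_cutt_out s : s <= z0.2 - h ^+ 2 -> derive1 cutt s = 0.
Proof.
move=> sh; apply: (@derive1_out _ _ _ _ (z0.2 - h ^+ 2) (z0.2 + 2 * cutw) cutt_out').
- by rewrite cutwE; move: cutw0; lra.
- by move: cutw0; lra.
- by case/andP => h1 _; move: (lt_le_trans h1 sh); rewrite ltxx.
Qed.

Let tens_out (f : 'I_3 -> R -> R) (psi : R -> R) z :
  (forall j s, ~ (coords z0.1 j - h < s < coords z0.1 j + h) -> f j s = 0) ->
  (forall s, s <= z0.2 - h ^+ 2 -> psi s = 0) -> ~ near0 z ->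
  tens (f i0) (f i1) (f i2) psi z = 0.
Proof.
move=> f0 p0 nz; rewrite (_ : tens _ _ _ _ _ = tens3 f z.1 * psi z.2) //.
have [ht|ht] := leP z.2 (z0.2 - h ^+ 2); first by rewrite p0 ?mulr0.
by rewrite (tens3_out (c := fun j => coords z0.1 j - h) (d := fun j => coords z0.1 j + h)) ?mul0r // => hx; apply: nz.
Qed.

Lemma cutoff_out z : ~ near0 z -> cutoff z = 0.
Proof. by apply: tens_out => [j s|s]; [exact: cutx_out|exact: cutt_out]. Qed.

Lemma cutoff_dirx i z : 'D_(dirx i) cutoff z = tens3 (derf cutx i) z.1 * cutt z.2.
Proof. by apply: dirx_tens => [j|]; [exact: smooth1_cutx|exact: smooth1_cutt]. Qed.

Lemma derf_cutx_out i j s : ~ (coords z0.1 j - h < s < coords z0.1 j + h) -> derf cutx i j s = 0.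
Proof. by rewrite /derf; case: ifP => _; [exact: derive1_cutx_out|exact: cutx_out]. Qed.

Lemma cutoff_dirx_out i z : ~ near0 z -> 'D_(dirx i) cutoff z = 0.
Proof.
rewrite cutoff_dirx => nz; apply: (tens_out (f := derf cutx i) (psi := cutt) _ cutt_out nz) => j s.
exact: derf_cutx_out.
Qed.

Lemma cutheat_out z : ~ near0 z -> cutheat z = 0.
Proof.
move=> nz; have sx := smooth1_cutx; have st := smooth1_cutt.
rewrite /cutheat /cutoff laplacian_tens //; try exact: smooth1_cutx; try exact: smooth1_cutt.
rewrite (congr1 (fun g => g z) (derive_dirt_tens (sx i0) (sx i1) (sx i2) st)).
rewrite (tens_out (psi := derive1 cutt) cutx_out derive1_cutt_out nz).
have E (i : 'I_3) : tens (if i0 == i then derive1 (derive1 (cutx i0)) else cutx i0)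
    (if i1 == i then derive1 (derive1 (cutx i1)) else cutx i1)
    (if i2 == i then derive1 (derive1 (cutx i2)) else cutx i2) cutt z = 0.
  apply: (tens_out (f := fun j => if j == i then derive1 (derive1 (cutx j)) else cutx j) _ cutt_out nz).
  by move=> j s; case: ifP => _; [exact: derive2_cutx_out|exact: cutx_out].
by rewrite add0r; have := E i0; have := E i1; have := E i2; rewrite /= => -> -> ->; rewrite !addr0.
Qed.

Let cutx01 j s : 0 <= cutx j s <= 1.
Proof. by rewrite (@plateau_ge0 R _ _ w w0 (axw j)) plateau_le1. Qed.

Let cutt01 s : 0 <= cutt s <= 1.
Proof. by rewrite (@plateau_ge0 R _ _ _ cutw0 atw) plateau_le1. Qed.

Lemma cutoff_ge0 z : 0 <= cutoff z.
Proof.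
have c j s := (andP (cutx01 j s)).1.
exact: mulr_ge0 (mulr_ge0 (mulr_ge0 (c _ _) (c _ _)) (c _ _)) (andP (cutt01 _)).1.
Qed.

Lemma cutoff_le1 z : cutoff z <= 1.
Proof.
have c j s := (andP (cutx01 j s)).1; have d j s := (andP (cutx01 j s)).2.
have m (x y : R) : 0 <= x -> 0 <= y -> x <= 1 -> y <= 1 -> x * y <= 1.
  by move=> ? ? ? ?; rewrite -[leRHS](mul1r 1); exact: ler_pM.
have /andP[t0 t1] := cutt01 z.2.
by rewrite /cutoff /tens !m ?mulr_ge0.
Qed.

Lemma cutoff_in z : (forall j, coords z0.1 j - (h - 2 * w) < coords z.1 j < coords z0.1 j + (h - 2 * w)) ->
  z0.2 - (h - 2 * w) ^+ 2 <= z.2 <= z0.2 -> cutoff z = 1.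
Proof.
move=> hx /andP[t1 t2].
have c j : cutx j (coords z.1 j) = 1.
  by apply: (@plateau_in R _ _ w w0); case/andP: (hx j) => h1 h2; apply/andP; split; lra.
have := c i0; have := c i1; have := c i2; rewrite !coordsE /= => c2 c1 c0.
rewrite /cutoff /tens c0 c1 c2 !mul1r; apply: (@plateau_in R _ _ _ cutw0).
by apply/andP; split; lra.
Qed.

Lemma test_fun_cutoff : test_fun setT cutoff.
Proof.
exact: (@test_fun_tens R setT _ _ _ _ _ _ _ _ _ _ _ _ (smooth1_cutx i0) (smooth1_cutx i1) (smooth1_cutx i2) smooth1_cutt
  (@cutx_out i0) (@cutx_out i1) (@cutx_out i2) cutt_out' (fun _ _ _ _ _ => I)).
Qed.

(** The open set is the complement of a compact box [K]. Its cross-section lies inside the unit ball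
    because [3 h ^ 2 < 1], so [K] misses the lateral boundary, and it starts after the initial time
    because [h < 1]. *)
Lemma cutoff_boundary : 3 * h ^+ 2 < 1 -> exists U : set (spacetime R),
  [/\ open U, parabolic_boundary z0 1 `<=` U & forall z, U z -> cutoff z = 0].
Proof.
move=> h3.
have h0 : 0 < h by move: w0 wh; lra.
pose I j := `[coords z0.1 j - h, coords z0.1 j + h]%classic.
pose K : set (spacetime R) := I i0 `*` I i1 `*` I i2 `*` `[z0.2 - h ^+ 2, z0.2 + cutw]%classic.
have KP z : K z <-> (forall j, coords z0.1 j - h <= coords z.1 j <= coords z0.1 j + h) /\
    z0.2 - h ^+ 2 <= z.2 <= z0.2 + cutw.
  split=> [[[[/= k0 k1] k2] k3]|[k k3]].
    split; last by move: k3; rewrite in_itv.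
    move: k0 k1 k2; rewrite /I /= !in_itv /= => k0 k1 k2 j.
    case: j => -[|[|[|//]]] hj.
    - by rewrite (_ : Ordinal hj = i0) ?(coordsE z.1) //; exact: val_inj.
    - by rewrite (_ : Ordinal hj = i1) ?(coordsE z.1) //; exact: val_inj.
    - by rewrite (_ : Ordinal hj = i2) ?(coordsE z.1) //; exact: val_inj.
  have := k i0; have := k i1; have := k i2; rewrite !(coordsE z.1) /= => c2 c1 c0.
  by do 3 (split=> /=; last by rewrite ?/I /= in_itv); rewrite /I /= in_itv.
have cK : closed K.
  apply: compact_closed; first exact: norm_hausdorff.
  by do 3 (apply: compact_setX; last exact: segment_compact); exact: segment_compact.
exists (~` K); split; first by rewrite openC.
  have x1 : h ^+ 2 < 1 by have := exprn_gt0 2 h0; lra.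
  move=> [x t] [[/= ex te]|[/= ex te]] /KP[/= kx kt].
    by move: kt; rewrite te /tstart expr1n; lra.
  have := @cube_eball R z0.1 h 1 x (ltW h0) ltr01; rewrite expr1n => /(_ h3 kx).
  by rewrite /eball /= ex ltxx.
move=> z nz; have [nr|/cutoff_out//] := pselect (near0 z).
have [tz|tz] := ltP z.2 (z0.2 + cutw).
  exfalso; apply: nz; apply/KP; case: nr => n1 n2; split.
    by move=> j; case/andP: (n1 j) => ? ?; rewrite !ltW.
  by rewrite !ltW.
rewrite /cutoff /tens cutt_out' ?mulr0 // => /andP[_ h2].
by move: (lt_le_trans h2 tz); rewrite ltxx.
Qed.

Let dbl (a b c d k : R) : 0 <= k -> `|a| <= 1 -> `|b| <= 1 -> `|c| <= 1 -> `|d| <= k -> `|a * b * c * d| <= k.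
Proof.
move=> k0 a1 b1 c1 dk; rewrite !normrM -[leRHS]mul1r; apply: ler_pM => //; rewrite ?mulr_ge0 //.
by rewrite -[leRHS](mul1r 1); apply: ler_pM => //; rewrite ?mulr_ge0 // -[leRHS](mul1r 1); exact: ler_pM.
Qed.

(** The factor 4 counts the time derivative and the three second derivatives; the gradient bound
    carries it too, so that one constant enters [slice_bound]. *)
Lemma cutoff_bounds (C : R) : 1 <= C -> (forall a b w, 0 < w ->
    forall s, `|derive1 (plateau a b w) s| <= C / w /\
              `|derive1 (derive1 (plateau a b w)) s| <= C / w ^+ 2) ->
  (forall i z, `|'D_(dirx i) cutoff z| <= 4 * C / w) /\ (forall z, `|cutheat z| <= 4 * C / w ^+ 2).
Proof.
move=> C1 hC; have C0 : 0 <= C by lra.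
have nx j s : `|cutx j s| <= 1 by case/andP: (cutx01 j s) => ? ?; rewrite ger0_norm.
have nt s : `|cutt s| <= 1 by case/andP: (cutt01 s) => ? ?; rewrite ger0_norm.
have k1 : 0 <= C / w by rewrite divr_ge0 // ltW.
have k2 : 0 <= C / w ^+ 2 by rewrite divr_ge0 // exprn_ge0 // ltW.
have d1 j s : `|derive1 (cutx j) s| <= C / w := (hC _ _ _ w0 s).1.
have d2 j s : `|derive1 (derive1 (cutx j)) s| <= C / w ^+ 2 := (hC _ _ _ w0 s).2.
(* [cutw] is at least [w ^ 2], so the time derivative obeys the bound of the second space
   derivatives. *)
have dt s : `|derive1 cutt s| <= C / w ^+ 2.
  apply: le_trans (hC _ _ _ cutw0 s).1 _; apply: ler_wpM2l => //.
  rewrite lef_pV2 ?posrE ?exprn_gt0 //; rewrite /cutw expr2.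
  by rewrite -mulrA mulrCA ler_pM2l //; move: w0 wh; lra.
split=> [i z|z].
  rewrite cutoff_dirx; apply: (@le_trans _ _ (C / w)); last by move: k1; rewrite -mulrA; lra.
  rewrite /tens3 /derf; case: i => -[|[|[|//]]] hj.
  - rewrite [X in `|X|](_ : _ = cutx i1 z.1.1.2 * cutx i2 z.1.2 * cutt z.2 * derive1 (cutx i0) z.1.1.1).
      exact: dbl.
    by rewrite /=; ring.
  - rewrite [X in `|X|](_ : _ = cutx i0 z.1.1.1 * cutx i2 z.1.2 * cutt z.2 * derive1 (cutx i1) z.1.1.2).
      exact: dbl.
    by rewrite /=; ring.
  - rewrite [X in `|X|](_ : _ = cutx i0 z.1.1.1 * cutx i1 z.1.1.2 * cutt z.2 * derive1 (cutx i2) z.1.2).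
      exact: dbl.
    by rewrite /=; ring.
have sx := smooth1_cutx; have st := smooth1_cutt.
rewrite /cutheat /cutoff laplacian_tens //; try exact: smooth1_cutx; try exact: smooth1_cutt.
rewrite (congr1 (fun g => g z) (derive_dirt_tens (sx i0) (sx i1) (sx i2) st)).
have -> : 4 * C / w ^+ 2 = C / w ^+ 2 + (C / w ^+ 2 + C / w ^+ 2 + C / w ^+ 2) by rewrite -!mulrA; ring.
apply: le_trans (ler_normD _ _) _; apply: lerD; first exact: dbl.
apply: le_trans (ler_normD _ _) _; apply: lerD.
  apply: le_trans (ler_normD _ _) _; apply: lerD.
    rewrite (_ : tens _ _ _ _ _ = cutx i1 z.1.1.2 * cutx i2 z.1.2 * cutt z.2 * derive1 (derive1 (cutx i0)) z.1.1.1).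
      exact: dbl.
    by rewrite /tens; ring.
  rewrite (_ : tens _ _ _ _ _ = cutx i0 z.1.1.1 * cutx i2 z.1.2 * cutt z.2 * derive1 (derive1 (cutx i1)) z.1.1.2).
    exact: dbl.
  by rewrite /tens; ring.
rewrite (_ : tens _ _ _ _ _ = cutx i0 z.1.1.1 * cutx i1 z.1.1.2 * cutt z.2 * derive1 (derive1 (cutx i2)) z.1.2).
  exact: dbl.
by rewrite /tens; ring.
Qed.

End cutoff.

Lemma ae_forall_ord d (T : measurableType d) (R : realType) (mu : {measure set T -> \bar R}) n
    (P : 'I_n -> T -> Prop) : (forall i, {ae mu, forall x, P i x}) ->
  {ae mu, forall x, forall i, P i x}.
Proof.
move=> h; have : {ae mu, forall x, forall k : nat, forall kn : (k < n)%N, P (Ordinal kn) x}.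
  apply: ae_foralln => k; have [kn|kn] := pselect (k < n)%N.
    by apply: filterS (h (Ordinal kn)) => x px kn'; rewrite (_ : Ordinal kn' = Ordinal kn) //; exact: val_inj.
  by apply: aeW => x kn'.
by apply: filterS => x hx [k kn]; exact: hx.
Qed.

Lemma Rintegral_le_ae d (T : measurableType d) (R : realType) (mu : {measure set T -> \bar R})
    (f : T -> R) (B : T -> \bar R) : mu.-integrable setT (EFin \o f) -> measurable_fun setT B ->
  (forall x, (0 <= B x)%E) -> {ae mu, forall x, ((f x)%:E <= B x)%E} ->
  ((\int[mu]_x f x)%:E <= \int[mu]_x B x)%E.
Proof.
move=> fi mB B0 fB; have mf := measurable_int mu fi.
rewrite /Rintegral fineK; last exact: integrable_fin_num.
apply: (@le_trans _ _ (\int[mu]_x (EFin \o f)^\+ x)%E).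
  by apply: le_integral => //; [exact: integrable_funepos|move=> x _; rewrite funeposE le_max lexx].
apply: ae_ge0_le_integral => //; first exact: measurable_funepos.
by apply: filterS fB => x fB _; rewrite funeposE ge_max fB B0.
Qed.

(** * Regularity and solenoidality of almost every slice of a suitable solution *)

Section slices.
Variable R : realType.
Variables (z0 : spacetime R) (u : 'I_3 -> spacetime R -> R) (Du : 'I_3 -> 'I_3 -> spacetime R -> R)
  (p : spacetime R -> R) (Dp : 'I_3 -> spacetime R -> R).
Let Om := halfball z0.1 1.
Let a := tstart z0 1.
Let b := z0.2.
Hypothesis Hu : forall i, W10 2%:E 2%:E Om a b (u i) (Du i).
Hypothesis Hp : W10 (9 / 8)%:E (3 / 2)%:E Om a b p Dp.
Hypothesis dv : {ae leb4, forall z, halfcyl z0 1 z -> \sum_(i < 3) Du i i z = 0}.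
Hypothesis fl : forall i, flat_trace z0 1 (u i) (Du i ord_max) (fun=> 0).

Section radius.
Variable h : R.
Hypotheses (h0 : 0 < h) (h3 : 3 * h ^+ 2 < 1).

Let h1 : h < 1.
Proof.
rewrite -(ltr_pXn2r (n := 2)) ?nnegrE ?(ltW h0) // expr1n.
by have := exprn_gt0 2 h0; move: h3; lra.
Qed.

Let h31 : 3 * h ^+ 2 < 1 ^+ 2. Proof. by rewrite expr1n. Qed.

Let cube_le : (leb3 (cube z0 h) <= ((2 * h) * (2 * h) * (2 * h))%:E)%E.
Proof. by apply: (@leb3_box_le R (cubea z0 h) (cubeb z0 h) (2 * h)) => [|j]; [move: h0; lra|exact: cube_sides]. Qed.

Let cube_Om : cube z0 h `<=` Om. Proof. exact: cube_halfball. Qed.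

Let tlt s : 0 < s -> tstart z0 s < z0.2.
Proof. by move=> s0; rewrite /tstart ltrBlDr ltrDl exprn_gt0. Qed.

Lemma leb1_time (s : R) : 0 < s -> leb1 `]tstart z0 s, z0.2[%classic = (s ^+ 2)%:E.
Proof. by move=> s0; rewrite leb1_oo ?tlt // /tstart opprB addrCA subrr addr0. Qed.

(** Separate parameters for space and time, since [solenoidal_slices] works on a half cube over the
    whole unit time interval. *)
Lemma integrable_cube s f (m n : R) : h <= s <= 1 -> 1 < m -> 1 < n -> Lmn m%:E n%:E Om a b f ->
  leb4.-integrable setT (EFin \o (f \_ (cylbox (cubea z0 h) (cubeb z0 h) (tstart z0 s) z0.2))).
Proof.
move=> /andP[hs s1] m1 n1 hf; have s0 := lt_le_trans h0 hs.
apply: (integrable_Lmn (Om := Om) (a := a) (b := b) _ _ _ cube_le _ _ m1 n1 hf) => //.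
- exact: measurable_halfball.
- exact: measurable_box.
- by rewrite leb1_time.
- move=> [x t] [/= bx]; rewrite in_itv /= => /andP[t1 t2]; split; first exact: cube_Om.
  rewrite /= in_itv /= t2 andbT (le_lt_trans _ t1) // /a tstart_le // (ltW s0) //.
Qed.

Lemma integrable_cubecyl f (m n : R) : 1 < m -> 1 < n -> Lmn m%:E n%:E Om a b f ->
  leb4.-integrable setT (EFin \o (f \_ (cubecyl z0 h))).
Proof. by apply: integrable_cube; rewrite lexx ltW. Qed.

Let two1 : (1 < 2 :> R). Proof. by lra. Qed.
Let p1 : (1 < 9 / 8 :> R). Proof. by lra. Qed.
Let p2 : (1 < 3 / 2 :> R). Proof. by lra. Qed.

Lemma integrable_u j : leb4.-integrable setT (EFin \o (u j \_ (cubecyl z0 h))).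
Proof. by apply: (integrable_cubecyl two1 two1); case: (Hu j). Qed.

Lemma integrable_Du j i : leb4.-integrable setT (EFin \o (Du j i \_ (cubecyl z0 h))).
Proof. by apply: (integrable_cubecyl two1 two1); case: (Hu j) => _ /(_ i)[]. Qed.

Lemma integrable_p : leb4.-integrable setT (EFin \o (p \_ (cubecyl z0 h))).
Proof. by apply: (integrable_cubecyl p1 p2); case: Hp. Qed.

Lemma integrable_Dp i : leb4.-integrable setT (EFin \o (Dp i \_ (cubecyl z0 h))).
Proof. by apply: (integrable_cubecyl p1 p2); case: Hp => _ /(_ i)[]. Qed.

Lemma measurable_cut (f : spacetime R -> R) : leb4.-integrable setT (EFin \o f) -> measurable_fun setT f.
Proof. by move=> fi; apply/measurable_EFinP; exact: measurable_int fi. Qed.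

Let sides_lt j : cubea z0 h j < cubeb z0 h j.
Proof. by have /andP[+ _] := cube_sides z0 j h0; move: h0; lra. Qed.

Let sub_halfcyl x t : box (cubea z0 h) (cubeb z0 h) x -> tstart z0 h < t < z0.2 -> halfcyl z0 1 (x, t).
Proof.
move=> bx tI; apply: (@cubecyl_halfcyl R z0 h 1); rewrite ?h0 ?(ltW h1) //.
Qed.

Lemma slices_acl : {ae leb1, forall t, tstart z0 h < t < z0.2 ->
  (forall j, line_acl (cubea z0 h) (cubeb z0 h) (fun x => (u j \_ (cubecyl z0 h)) (x, t))
     (fun i x => (Du j i \_ (cubecyl z0 h)) (x, t))) /\
  line_acl (cubea z0 h) (cubeb z0 h) (fun x => (p \_ (cubecyl z0 h)) (x, t))
     (fun i x => (Dp i \_ (cubecyl z0 h)) (x, t))}.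
Proof.
have mD := @measurable_halfcyl R z0 1.
have L f g (fi : leb4.-integrable setT (EFin \o (f \_ (cubecyl z0 h)))) :=
  @weak_deriv_line_acl R (halfcyl z0 1) _ _ _ _ mD sides_lt (tlt h0) sub_halfcyl f g fi.
have Lu j : {ae leb1, forall t, tstart z0 h < t < z0.2 ->
    line_acl (cubea z0 h) (cubeb z0 h) (fun x => (u j \_ (cubecyl z0 h)) (x, t))
     (fun i x => (Du j i \_ (cubecyl z0 h)) (x, t))}.
  by apply: L; [exact: integrable_u|exact: integrable_Du|move=> i; case: (Hu j) => _ /(_ i)[]].
have Lp : {ae leb1, forall t, tstart z0 h < t < z0.2 ->
    line_acl (cubea z0 h) (cubeb z0 h) (fun x => (p \_ (cubecyl z0 h)) (x, t))
     (fun i x => (Dp i \_ (cubecyl z0 h)) (x, t))}.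
  by apply: L; [exact: integrable_p|exact: integrable_Dp|move=> i; case: Hp => _ /(_ i)[]].
apply: filterS (ae_and (ae_forall_ord Lu) Lp) => t [lu lp] tI.
by split=> [j|]; [exact: lu|exact: lp].
Qed.

(** On a slice the time factor of the cutoff is a constant, so [solenoidal_slices] for the spatial
    factor suffices. *)
Lemma slices_solenoidal w : 0 < w -> 2 * w < h ->
  {ae leb1, forall t, tstart z0 h < t < z0.2 ->
    \int[leb3]_x (\sum_(i < 3) (u i \_ (cubecyl z0 h)) (x, t) * 'D_(dirx i) (cutoff z0 h w) (x, t)) = 0}.
Proof.
move=> w0 wh; have mD := @measurable_halfcyl R z0 1.
have hI : h <= 1 <= (1 : R) by rewrite lexx (ltW h1).
have cB x : (forall j, coords z0.1 j - h <= coords x j <= coords z0.1 j + h) -> eball z0.1 1 x.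
  by move=> bx; apply: (cube_eball (ltW h0) ltr01 h31).
have c3 : coords z0.1 i2 - h <= z0.1.2 by rewrite coordsE /=; move: h0; lra.
have iu i := integrable_cube hI two1 two1 (Hu i).1.
have iDu i := integrable_cube hI two1 two1 ((Hu i).2 i).1.
have := @solenoidal_slices R z0 u Du (cutx z0 h w) (fun j => coords z0.1 j - h) (fun j => coords z0.1 j + h)
  (smooth1_cutx z0 h w) (cutx_out w0 wh) (derive1_cutx_out w0 wh) cB c3 iu iDu (fun i => ((Hu i).2 i).2)
  (fl ord_max) dv.
have iut : {ae leb1, forall t, forall i, leb3.-integrable setT (EFin \o (fun x => (u i \_
    (cylbox (cubea z0 h) (cubeb z0 h) (tstart z0 1) z0.2)) (x, t)))}.
  by apply: ae_forall_ord => i; exact: (@ae_integrable_snd _ _ _ _ R leb3 leb1 _ (iu i)).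
move=> S; apply: filterS (ae_and S iut) => t [St it] tI; have t1I : tstart z0 1 < t < z0.2.
  by case/andP: tI => t1 t2; rewrite t2 andbT (le_lt_trans _ t1) // tstart_le // (ltW h0) ltW.
transitivity (cutt z0 h w t * \int[leb3]_x \sum_(i < 3) ((u i \_
    (cylbox (cubea z0 h) (cubeb z0 h) (tstart z0 1) z0.2)) (x, t) * tens3 (derf (cutx z0 h w) i) x));
  last by rewrite (St t1I) mulr0.
rewrite -RintegralZl //.
  apply: eq_Rintegral => x _; rewrite mulr_sumr; apply: eq_bigr => i _.
  rewrite cutoff_dirx // mulrA [RHS]mulrC; congr (_ * _ * _).
  rewrite !patchE; suff -> : ((x, t) \in cubecyl z0 h) = ((x, t) \in cylbox (cubea z0 h) (cubeb z0 h) (tstart z0 1) z0.2) by [].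
  by apply/idP/idP; rewrite !inE => -[/= bx tx]; split=> //=; rewrite in_itv.
apply: (eq_integrable _ (fun x => \sum_(i < 3) ((u i \_ (cylbox (cubea z0 h) (cubeb z0 h) (tstart z0 1) z0.2)) (x, t) *
    tens3 (derf (cutx z0 h w) i) x)%:E)%E) => //.
  by move=> x _; rewrite /= sumEFin.
apply: integrable_sum => // i _.
have [C hC] := tens3_bounded (smooth1_derf i (smooth1_cutx z0 h w)) (fun j s => @derf_cutx_out R z0 h w w0 wh i j s).
apply: (@integrable_bddM _ _ R leb3 setT _ _ C measurableT (it i)) => //.
by apply: measurable_tens3 => j; apply: smooth1_measurable; apply: smooth1_derf; exact: smooth1_cutx.
Qed.

End radius.
End slices.

Definition slice_mass (R : realType) (z0 : spacetime R) (u : 'I_3 -> spacetime R -> R) h t : \bar R :=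
  (\int[leb3]_x (\sum_(j < 3) (u j \_ (cubecyl z0 h)) (x, t) ^+ 2)%:E)%E.

Definition slice_dissipation (R : realType) (z0 : spacetime R) (Du : 'I_3 -> 'I_3 -> spacetime R -> R) h t : \bar R :=
  (\int[leb3]_x (\sum_(j < 3) \sum_(i < 3) (Du j i \_ (cubecyl z0 h)) (x, t) ^+ 2)%:E)%E.

(** One number bounds both the mass on almost every slice and the total dissipation, so that the
    iteration runs on a single quantity. *)
Definition bounded_energy (R : realType) (z0 : spacetime R) (u : 'I_3 -> spacetime R -> R)
    (Du : 'I_3 -> 'I_3 -> spacetime R -> R) (h M : R) : Prop :=
  {ae leb1, forall t, (slice_mass z0 u h t <= M%:E)%E} /\
  (\int[leb1]_t slice_dissipation z0 Du h t <= M%:E)%E.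

Lemma Rintegral_eq0 d (T : measurableType d) (R : realType) (mu : {measure set T -> \bar R})
    (f : T -> R) : (forall x, f x = 0) -> \int[mu]_x f x = 0.
Proof. by move=> f0; rewrite /Rintegral integral0_eq // => x _; rewrite f0. Qed.

(* The real-valued integral is the finite part of the extended one, hence 0 when the latter is infinite. *)
Lemma Rintegral_nonintegrable d (T : measurableType d) (R : realType) (mu : {measure set T -> \bar R})
    (f : T -> R) : measurable_fun setT f -> ~ mu.-integrable setT (EFin \o f) -> \int[mu]_x f x = 0.
Proof.
move=> mf nf; have mF : measurable_fun setT (EFin \o f) by exact/measurable_EFinP.
have : (\int[mu]_x `|(EFin \o f) x| = +oo)%E.
  apply/eqP; rewrite -leye_eq leNgt; apply/negP => lt; apply: nf; exact/integrableP.
have -> : (\int[mu]_x `|(EFin \o f) x| = \int[mu]_x ((EFin \o f)^\+ x + (EFin \o f)^\- x))%E.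
  by apply: eq_integral => x _; have := congr1 (fun g => g x) (fune_abse (EFin \o f)).
rewrite ge0_integralD //; last 2 first.
- exact: measurable_funepos.
- exact: measurable_funeneg.
rewrite /Rintegral [X in _ -> fine X = _]integralE.
set A := (\int[mu]_x _)%E; set B := (\int[mu]_x _)%E.
have A0 : (0 <= A)%E by exact: integral_ge0.
have B0 : (0 <= B)%E by exact: integral_ge0.
by clearbody A B; case: A A0 => [x| |] //; case: B B0 => [y| |] //.
Qed.

Lemma measurable_tens (R : realType) (f1 f2 f3 f4 : R -> R) : smooth1 f1 -> smooth1 f2 -> smooth1 f3 ->
  smooth1 f4 -> measurable_fun setT (tens f1 f2 f3 f4).
Proof.
move=> s1 s2 s3 s4; pose f (j : 'I_3) := if j == i0 then f1 else if j == i1 then f2 else f3.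
rewrite (_ : tens _ _ _ _ = fun z => tens3 f z.1 * f4 z.2) //.
apply: measurable_funM; last by apply: (measurableT_comp _ measurable_snd); exact: smooth1_measurable.
apply: (measurableT_comp _ measurable_fst); apply: measurable_tens3 => j.
by rewrite /f; case: ifP => _; [|case: ifP => _]; exact: smooth1_measurable.
Qed.

Lemma measurable_cutheat (R : realType) (z0 : spacetime R) h w : measurable_fun setT (cutheat z0 h w).
Proof.
have sx := smooth1_cutx z0 h w; have st := smooth1_cutt z0 h w.
rewrite (_ : cutheat z0 h w = fun z => tens (cutx z0 h w i0) (cutx z0 h w i1) (cutx z0 h w i2) (derive1 (cutt z0 h w)) z +
    (tens (derive1 (derive1 (cutx z0 h w i0))) (cutx z0 h w i1) (cutx z0 h w i2) (cutt z0 h w) z +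
     tens (cutx z0 h w i0) (derive1 (derive1 (cutx z0 h w i1))) (cutx z0 h w i2) (cutt z0 h w) z +
     tens (cutx z0 h w i0) (cutx z0 h w i1) (derive1 (derive1 (cutx z0 h w i2))) (cutt z0 h w) z)); last first.
  apply/funext => z; rewrite /cutheat /cutoff laplacian_tens //.
  by rewrite (congr1 (fun g => g z) (derive_dirt_tens (sx i0) (sx i1) (sx i2) st)).
apply: measurable_funD; first by apply: measurable_tens => //; exact: smooth1_deriv.
by apply: measurable_funD; [apply: measurable_funD|]; apply: measurable_tens => //; do 2 apply: smooth1_deriv.
Qed.

(** * Bound for the right-hand side of the energy inequality *)

Section energy_step.
Variable R : realType.
Variables (z0 : spacetime R) (u : 'I_3 -> spacetime R -> R) (Du : 'I_3 -> 'I_3 -> spacetime R -> R)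
  (p : spacetime R -> R) (Dp : 'I_3 -> spacetime R -> R).
Let Om := halfball z0.1 1.
Let a := tstart z0 1.
Let b := z0.2.
Hypothesis Hu : forall i, W10 2%:E 2%:E Om a b (u i) (Du i).
Hypothesis Hp : W10 (9 / 8)%:E (3 / 2)%:E Om a b p Dp.
Hypothesis dv : {ae leb4, forall z, halfcyl z0 1 z -> \sum_(i < 3) Du i i z = 0}.
Hypothesis fl : forall i, flat_trace z0 1 (u i) (Du i ord_max) (fun=> 0).
Variables (r h w C M al P : R).
Hypotheses (r01 : 0 < r < 1) (w0 : 0 < w) (wh : 2 * w < h) (hr : h <= 11 / 20 * r) (C1 : 1 <= C).
Hypothesis hC : forall a b w : R, 0 < w -> forall s, `|derive1 (plateau a b w) s| <= C / w /\
  `|derive1 (derive1 (plateau a b w)) s| <= C / w ^+ 2.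
Hypotheses (M0 : 0 <= M) (al0 : 0 <= al) (P0 : 0 <= P).
Hypothesis hN : (\int[leb1]_t (wnorm z0 r u t `^ 3) <= (r ^+ 2 * al)%:E)%E.
Hypothesis hP : ((\int[leb1]_t (wnorm z0 r u t `^ 3)) `^ (1 / 3) *
  (\int[leb1]_t (slice_gradp z0 h Dp t `^ (4 / 3))) `^ (2 / 3) <= (r `^ (5 / 3) * P)%:E)%E.
Hypothesis bM : bounded_energy z0 u Du h M.

Definition energy_rhs : R := M / 2 + step_cst (4 * C) * (r / w) ^+ 2 *
  (r * (al `^ (4 / 3) + al `^ (2 / 3) + P)).

Let r0 : 0 < r. Proof. by case/andP: r01. Qed.
Let r1 : r < 1. Proof. by case/andP: r01. Qed.
Let h0 : 0 < h. Proof. by move: w0 wh; lra. Qed.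
Let hler : h <= r. Proof. by move: hr r0; lra. Qed.
Let h3r : 3 * h ^+ 2 < r ^+ 2.
Proof.
apply: (@le_lt_trans _ _ (3 * (11 / 20 * r) ^+ 2)); last by have := exprn_gt0 2 r0; rewrite exprMn; lra.
by rewrite ler_pM2l // ler_pXn2r ?nnegrE ?(ltW h0) // mulr_ge0 // ltW.
Qed.
Let h3 : 3 * h ^+ 2 < 1.
Proof. by apply: (lt_trans h3r); rewrite expr_lt1 // ltW. Qed.
Let h1 : h < 1. Proof. exact: le_lt_trans r1. Qed.

Let Q := cubecyl z0 h.
Let V j := u j \_ Q.
Let G j i := Du j i \_ Q.
Let q := p \_ Q.
Let gq i := Dp i \_ Q.
Let phi := cutoff z0 h w.
Let mV j : measurable_fun setT (V j). Proof. by apply: measurable_cut; exact: (integrable_u Hu h0 h3). Qed.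
Let mG j i : measurable_fun setT (G j i). Proof. by apply: measurable_cut; exact: (integrable_Du Hu h0 h3). Qed.
Let mq : measurable_fun setT q. Proof. by apply: measurable_cut; exact: (integrable_p Hp h0 h3). Qed.
Let mgq i : measurable_fun setT (gq i). Proof. by apply: measurable_cut; exact: (integrable_Dp Hp h0 h3). Qed.

Let I := `]tstart z0 h, z0.2[%classic.
Let mI : measurable I. Proof. exact: measurable_itv. Qed.

Lemma measurable_restrict_u s j : 0 < s <= 1 -> measurable_fun setT (u j \_ (halfcyl z0 s)).
Proof.
move=> /andP[s0 s1]; have mD s := @measurable_halfcyl R z0 s.
have m1 := measurable_Lmn (@measurable_halfball R z0.1 1) (Hu j).1.
apply/(measurable_restrictT _ (mD s)); apply: (@measurable_funS _ _ _ _ (halfcyl z0 1)) => //.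
  move=> [x t] [/= [ex x3]]; rewrite in_itv /= => /andP[t1 t2]; split=> /=.
    by split=> //; apply: (lt_le_trans ex).
  rewrite in_itv /= t2 andbT (le_lt_trans _ t1) // tstart_le // (ltW s0) //.
exact/(measurable_restrictT _ (mD 1)).
Qed.

Let mU j := @measurable_restrict_u r j.

Let VleU t j x : `|V j (x, t)| <= euclid (fun j => (u j \_ (halfcyl z0 r)) (x, t)).
Proof.
rewrite /V patchE; case: ifPn => [/[!inE] Qx|_]; last by rewrite (_ : point = 0 :> R) // normr0 sqrtr_ge0.
have Ux i : (u i \_ (halfcyl z0 r)) (x, t) = u i (x, t).
  by rewrite patchE mem_set //; apply: (cubecyl_halfcyl _ h3r Qx); rewrite h0.
rewrite -sqrtr_sqr /euclid ler_sqrt; last by apply: sumr_ge0 => i _; exact: sqr_ge0.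
by rewrite (bigD1 j) //= Ux lerDl sumr_ge0 // => i _; exact: sqr_ge0.
Qed.

Let A x t := cutheat z0 h w (x, t).
Let E (z : spacetime R) := (\sum_(j < 3) V j z ^+ 2) * cutheat z0 h w z +
  (\sum_(i < 3) V i z * 'D_(dirx i) phi z) * ((\sum_(j < 3) V j z ^+ 2) + 2 * q z).

Let Z := slice_mass z0 u h.
Let GG := slice_dissipation z0 Du h.
Let H t := ((4 / (2 * h) ^+ 2)%:E * Z t + GG t)%E.
Let Y := slice_gradp z0 h Dp.
Let N := wnorm z0 r u.
Let sb t := slice_bound (4 * C / w ^+ 2) (4 * C / w) (2 * h) (N t) (Z t) (H t) (Y t).

Let E0 z : ~ Q z -> E z = 0.
Proof.
move=> nQ; have V0 j : V j z = 0 by rewrite /V patchE memNset.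
by rewrite /E !big1 ?mul0r ?addr0 // => j _; rewrite V0 ?expr2 mul0r.
Qed.

Let slice t : I t -> (forall j, line_acl (cubea z0 h) (cubeb z0 h) (fun x => V j (x, t)) (fun i x => G j i (x, t))) ->
  line_acl (cubea z0 h) (cubeb z0 h) (fun x => q (x, t)) (fun i x => gq i (x, t)) ->
  (forall j, leb3.-integrable setT (EFin \o (fun x => V j (x, t)))) ->
  leb3.-integrable setT (EFin \o (fun x => q (x, t))) ->
  \int[leb3]_x (\sum_(i < 3) V i (x, t) * 'D_(dirx i) phi (x, t)) = 0 ->
  leb3.-integrable setT (EFin \o (fun x => E (x, t))) ->
  ((\int[leb3]_x E (x, t))%:E <= sb t + sb t + sb t)%E.
Proof.
move=> tI lu lp iV iq d0 iE.
have sup (f : spacetime R -> R) : supported (cubea z0 h) (cubeb z0 h) (fun x => (f \_ Q) (x, t)).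
  by move=> x nx; rewrite patchE memNset // => -[].
have l0 : 0 < 2 * h by move: h0; lra.
have [bx bt] := cutoff_bounds z0 w0 wh C1 hC.
have r1' : 0 < r <= 1 by rewrite r0 ltW.
apply: (@energy_slice_le R (cubea z0 h) (cubeb z0 h) (2 * h) l0 (fun j => cube_sides z0 j h0)
  (fun j x => V j (x, t)) (fun j i x => G j i (x, t)) (fun x => q (x, t)) (fun i x => gq i (x, t)) (N t)
  _ (fun j => sup (u j)) _ (fun j i => sup (Du j i)) _ (sup p) _ (fun i => sup (Dp i)) lu lp iV iq
  (wnorm_ge0 _ _ _ _) _ (fun x => cutheat z0 h w (x, t)) (fun i x => 'D_(dirx i) phi (x, t)) _ _ _ _ _ d0 iE).
- by move=> j; exact: (measurable_section1 t (mV j)).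
- by move=> j i; exact: (measurable_section1 t (mG j i)).
- exact: (measurable_section1 t mq).
- by move=> i; exact: (measurable_section1 t (mgq i)).
- move=> j c c0; apply: (wnorm_weak (fun j => mU j r1')) => //; exact: (measurable_section1 t (mV j)).
- move=> i; under eq_fun do rewrite cutoff_dirx //=.
  apply: measurable_funM => //; apply: measurable_tens3 => j.
  by apply: smooth1_measurable; apply: smooth1_derf; exact: smooth1_cutx.
- by move=> x; exact: bt.
- by move=> i x; exact: bx.
Qed.

Let mZ : measurable_fun setT Z.
Proof.
apply: (measurable_fun_fubini_tonelli_G (m1 := leb3) (fun z => (\sum_(j < 3) V j z ^+ 2)%:E)).
  by apply/measurable_EFinP; apply: measurable_sum => j; exact: measurable_funX.
by move=> z; rewrite lee_fin sumr_ge0 // => j _; exact: sqr_ge0.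
Qed.

Let mGG : measurable_fun setT GG.
Proof.
apply: (measurable_fun_fubini_tonelli_G (m1 := leb3) (fun z => (\sum_(j < 3) \sum_(i < 3) G j i z ^+ 2)%:E)).
  by apply/measurable_EFinP; apply: measurable_sum => j; apply: measurable_sum => i; exact: measurable_funX.
by move=> z; rewrite lee_fin sumr_ge0 // => j _; rewrite sumr_ge0 // => i _; exact: sqr_ge0.
Qed.

Let Z0 t : (0 <= Z t)%E.
Proof. by apply: integral_ge0 => x _; rewrite lee_fin sumr_ge0 // => j _; exact: sqr_ge0. Qed.

Let GG0 t : (0 <= GG t)%E.
Proof.
by apply: integral_ge0 => x _; rewrite lee_fin sumr_ge0 // => j _; rewrite sumr_ge0 // => i _; exact: sqr_ge0.
Qed.

Let k4 : (0 <= (4 / (2 * h) ^+ 2)%:E :> \bar R)%E.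
Proof. by rewrite lee_fin divr_ge0 // sqr_ge0. Qed.

Let H0 t : (0 <= H t)%E. Proof. by rewrite adde_ge0 ?mule_ge0. Qed.
Let mkZ : measurable_fun setT (fun t => (4 / (2 * h) ^+ 2)%:E * Z t)%E.
Proof. exact: emeasurable_funM. Qed.
Let mH : measurable_fun setT H. Proof. exact: emeasurable_funD. Qed.

Let Iout t : ~ I t -> Z t = 0%E.
Proof.
move=> nI; apply: integral0_eq => x _; rewrite big1 // => j _.
by rewrite patchE memNset ?expr0n // => -[].
Qed.

(** The zero order part contributes at most [4 / (2 h) ^ 2 * M * h ^ 2 = M] and the dissipation at
    most [M]. *)
Let hH : (\int[leb1]_t H t <= (2 * M)%:E)%E.
Proof.
rewrite /H (ge0_integralD _ measurableT (fun t _ => mule_ge0 k4 (Z0 t)) mkZ (fun t _ => GG0 t) mGG).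
rewrite (ge0_integralZl _ measurableT mZ (fun t _ => Z0 t) k4).
have -> : (2 * M)%:E = (M%:E + M%:E)%E by rewrite -EFinD; congr EFin; ring.
apply: leeD; last exact: bM.2.
apply: (@le_trans _ _ ((4 / (2 * h) ^+ 2)%:E * (M%:E * (h ^+ 2)%:E))%E); last first.
  rewrite -!EFinM lee_fin le_eqVlt; apply/orP; left; apply/eqP; field.
  by rewrite gt_eqF.
apply: lee_wpmul2l => //; rewrite -(leb1_time z0 h0) -/I.
apply: (@le_trans _ _ (\int[leb1]_t (M%:E * (\1_I t)%:E))%E).
  apply: ae_ge0_le_integral => //.
  - by move=> t _; rewrite mule_ge0 ?lee_fin // indicE ler0n.
  - apply: emeasurable_funM => //; apply/measurable_EFinP; exact: measurable_indic.
  - apply: filterS bM.1 => t Zt _; have [tI|nI] := pselect (I t).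
      by rewrite indicE mem_set // mule1.
    by rewrite -/Z Iout // mule_ge0 ?lee_fin // indicE ler0n.
rewrite ge0_integralZl //.
- by rewrite integral_indic // setIT.
- by apply/measurable_EFinP; exact: measurable_indic.
Qed.

Lemma energy_time_bound : (\int[leb1]_(t in I) (sb t + sb t + sb t) <= energy_rhs%:E)%E.
Proof.
have c4 : 0 <= 4 * C by move: C1; lra.
have r1' : 0 < r <= 1 by rewrite r0 ltW.
have hh : 0 < h <= r by rewrite h0.
have ww : 0 < w <= r by rewrite w0; move: hler wh w0; lra.
apply: (energy_time_le c4 ww hh M0 al0 P0 _ mZ mH _ _ Z0 H0 _ _ bM.1 hN hH hP).
- by apply: measurable_wnorm => j; exact: mU.
- exact: measurable_slice_gradp.
- by move=> t; exact: wnorm_ge0.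
- exact: mI.
- by rewrite leb1_time.
Qed.

Let e (z : spacetime R) := sqnorm u z * ('D_dirt phi z + laplacian phi z) +
  (\sum_(i < 3) u i z * 'D_(dirx i) phi z) * (sqnorm u z + 2 * p z).

(** The derivatives of the cutoff vanish in the unit half cylinder outside the small cylinder [Q],
    so the fields may be cut to [Q], where the slice estimates hold. *)
Let integrandE (t1 : R) : t1 <= z0.2 ->
  e \_ (Om `*` `]tstart z0 1, t1[%classic) = E \_ [set z | z.2 < t1].
Proof.
move=> t1b; apply/funext => -[x t].
have [[Qx tt]|nQ] := pselect (Q (x, t) /\ t < t1).
  have [Ox +] : halfcyl z0 1 (x, t) by apply: (@cubecyl_halfcyl R z0 h 1); rewrite ?h0 ?ltW // expr1n.
  rewrite /= in_itv /= => /andP[ta tb].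
  rewrite !patchE !mem_set //; last by split=> //=; rewrite in_itv /= ta.
  have VE j : V j (x, t) = u j (x, t) by rewrite /V patchE mem_set.
  have qE : q (x, t) = p (x, t) by rewrite /q patchE mem_set.
  by rewrite /e /E qE /sqnorm; congr (_ * _ + _ * (_ + _)); apply: eq_bigr => j _; rewrite VE.
rewrite patchE; case: ifPn => [/[!inE] -[/= [ex x3]]|_]; last first.
  rewrite patchE; case: ifPn => // /[!inE] /= tt.
  by rewrite E0 // => Qx; apply: nQ.
rewrite in_itv /= => /andP[ta tt].
have nQ' : ~ Q (x, t) by move=> Qx; apply: nQ.
rewrite patchE mem_set //= E0 //.
have nn : ~ ((forall j, coords z0.1 j - h < coords x j < coords z0.1 j + h) /\ z0.2 - h ^+ 2 < t).
  move=> [hx ht]; apply: nQ'; split; first exact/(cubeP z0 x h0).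
  by rewrite /= in_itv /= ht /= (lt_le_trans tt).
rewrite /e -/(cutheat z0 h w (x, t)) (@cutheat_out R z0 h w w0 wh (x, t) nn) mulr0 add0r big1 ?mul0r // => i _.
by rewrite (@cutoff_dirx_out R z0 h w w0 wh i (x, t) nn) mulr0.
Qed.

Lemma energy_rhs_ge0 : 0 <= energy_rhs.
Proof.
rewrite -lee_fin; apply: le_trans energy_time_bound; apply: integral_ge0 => t _.
have sb0 : (0 <= sb t)%E.
  apply: (@slice_bound_time_ge0 R (4 * C) r w h N Z H Y); rewrite ?w0 ?h0 //=.
  - by move: C1; lra.
  - by move: hler wh w0; lra.
  - by move=> s; exact: wnorm_ge0.
exact: (adde_ge0 (adde_ge0 sb0 sb0) sb0).
Qed.

Lemma energy_rhs_bound (t1 : R) : t1 <= z0.2 ->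
  \int[leb4]_(z in Om `*` `]tstart z0 1, t1[%classic) e z <= energy_rhs.
Proof.
move=> t1b; rewrite Rintegral_mkcond integrandE //.
pose E1 := E \_ [set z : spacetime R | z.2 < t1].
have mE : measurable_fun setT E.
  have mV2 : measurable_fun setT (fun z => \sum_(j < 3) V j z ^+ 2).
    by apply: measurable_sum => j; exact: measurable_funX.
  have mphi i : measurable_fun setT (fun z => 'D_(dirx i) phi z).
    under eq_fun do rewrite cutoff_dirx //=.
    apply: measurable_funM.
      apply: (measurableT_comp _ measurable_fst); apply: measurable_tens3 => j.
      by apply: smooth1_measurable; apply: smooth1_derf; exact: smooth1_cutx.
    by apply: (measurableT_comp _ measurable_snd); apply: smooth1_measurable; exact: smooth1_cutt.
  apply: measurable_funD; apply: measurable_funM => //; first exact: measurable_cutheat.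
    by apply: measurable_sum => j; exact: measurable_funM.
  by apply: measurable_funD => //; exact: measurable_funM.
have mS : measurable [set z : spacetime R | z.2 < t1].
  rewrite (_ : [set z | _] = setT `*` `]-oo, t1[%classic).
    by apply: measurableX => //; exact: measurable_itv.
  by apply/seteqP; split=> z /=; rewrite in_itv //= => -[].
have mE1 : measurable_fun setT E1 by apply/(measurable_restrictT _ mS); exact: measurable_funTS.
(* An integrand that is not integrable has integral zero by convention, and then the bound holds
   because [energy_rhs] is nonnegative. *)
have [iE1|nE1] := pselect (leb4.-integrable setT (EFin \o E1)); last first.
  by rewrite Rintegral_nonintegrable //; exact: energy_rhs_ge0.
rewrite -lee_fin (@Rintegral_prod2 _ _ _ _ R leb3 leb1 _ iE1).
apply: le_trans energy_time_bound; rewrite [leRHS]integral_mkcond.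
have iV : {ae leb1, forall t, forall j, leb3.-integrable setT (EFin \o (fun x => V j (x, t)))}.
  by apply: ae_forall_ord => j; exact: (@ae_integrable_snd _ _ _ _ R leb3 leb1 _ (integrable_u Hu h0 h3 j)).
have iq := @ae_integrable_snd _ _ _ _ R leb3 leb1 _ (integrable_p Hp h0 h3).
have iE := @ae_integrable_snd _ _ _ _ R leb3 leb1 _ iE1.
(* Almost every time meets all the requirements of [slice] at once. *)
have good := ae_and (ae_and (slices_acl Hu Hp h0 h3) (slices_solenoidal Hu dv fl h0 h3 w0 wh)) (ae_and (ae_and iV iq) iE).
have sb0 t : (0 <= sb t)%E.
  apply: (@slice_bound_time_ge0 R (4 * C) r w h N Z H Y); rewrite ?w0 ?h0 //=.
  - by move: C1; lra.
  - by move: hler wh w0; lra.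
  - by move=> s; exact: wnorm_ge0.
apply: Rintegral_le_ae.
- exact: (@integrable_Rintegral_fst _ _ _ _ R leb3 leb1 E1 iE1).
- apply/(measurable_restrictT _ mI); apply: measurable_funTS.
  have ms : measurable_fun setT sb.
    apply: (@measurable_slice_bound_time R (4 * C) w h N Z H Y) => //; last exact: measurable_slice_gradp.
    by apply: measurable_wnorm => j; apply: mU; rewrite r0 ltW.
  exact: (emeasurable_funD (emeasurable_funD ms ms) ms).
- by move=> t; rewrite patchE; case: ifP => // _; exact: (adde_ge0 (adde_ge0 (sb0 _) (sb0 _)) (sb0 _)).
apply: filterS good => t [[acl sol] [[iVt iqt] iEt]].
have [tI|ntI] := pselect (I t); last first.
  rewrite Rintegral_eq0; last by move=> x; rewrite /E1 patchE; case: ifP => // _; rewrite E0 // => -[].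
  by rewrite patchE; case: ifP => // _; exact: (adde_ge0 (adde_ge0 (sb0 _) (sb0 _)) (sb0 _)).
rewrite patchE mem_set //.
have [tt|tt] := ltP t t1; last first.
  rewrite Rintegral_eq0; last by move=> x; rewrite /E1 patchE memNset //= => /(le_lt_trans tt); rewrite ltxx.
  exact: (adde_ge0 (adde_ge0 (sb0 _) (sb0 _)) (sb0 _)).
have E1E x : E1 (x, t) = E (x, t) by rewrite /E1 patchE mem_set.
have [lu lp] := acl tI.
have EE : (fun x => E1 (x, t)) = (fun x => E (x, t)) by apply/funext => x; exact: E1E.
rewrite EE; apply: slice => //; first exact: sol.
by rewrite -EE.
Qed.

End energy_step.

Lemma ae_interval (R : realType) (P : R -> Prop) (s t : R) : {ae leb1, forall x, P x} -> s < t ->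
  exists2 x, s < x < t & P x.
Proof.
move=> [N [mN N0 sub]] st; apply/not_exists2P => nP.
have : (leb1 `]s, t[%classic <= leb1 N)%E.
  apply: le_measure; rewrite ?inE //.
  move=> x; rewrite /= in_itv /= => xI; apply: sub => /= Px.
  by case: (nP x) => [/(_ xI)|/(_ Px)].
by rewrite leb1_oo // N0 lee_fin leNgt subr_gt0 st.
Qed.

(** * From the energy inequality to the energy on the smaller cylinder *)

Section energy_decay.
Variable R : realType.
Variables (z0 : spacetime R) (u : 'I_3 -> spacetime R -> R) (Du : 'I_3 -> 'I_3 -> spacetime R -> R)
  (p : spacetime R -> R) (Dp : 'I_3 -> spacetime R -> R).
Let Om := halfball z0.1 1.
Let a := tstart z0 1.
Let b := z0.2.
Hypothesis Hsup : forall i, Lmn 2%:E +oo%E Om a b (u i).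
Hypothesis Hu : forall i, W10 2%:E 2%:E Om a b (u i) (Du i).

Let W := halfcyl z0 1.
Let U j := u j \_ W.
Let DU j i := Du j i \_ W.
Let mOm : measurable Om := @measurable_halfball R z0.1 1.
Let mU j : measurable_fun setT (U j) := measurable_Lmn mOm (Hu j).1.
Let mDU j i : measurable_fun setT (DU j i) := measurable_Lmn mOm ((Hu j).2 i).1.

(** This bound and [dissipation_bounded] are qualitative: they guarantee finite integrals and start
    the iteration, in the limit of which their size disappears. *)
Lemma mass_bounded : exists2 M, 0 <= M & {ae leb1, forall t,
  (\int[leb3]_x (\sum_(j < 3) U j (x, t) ^+ 2)%:E <= M%:E)%E}.
Proof.
have hS j : exists M : R, {ae leb1, forall t, (slice_power 2 (U j) t <= M%:E)%E} := Lmn_sup (Hsup j).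
have [f hf] := choice hS.
exists (\sum_(j < 3) `|f j|); first by apply: sumr_ge0.
apply: filterS (ae_forall_ord hf) => t ht.
under eq_integral do rewrite -sumEFin.
rewrite ge0_integral_sum //.
- rewrite -sumEFin; apply: lee_sum => j _; apply: (@le_trans _ _ (f j)%:E); last by rewrite lee_fin ler_norm.
  apply: le_trans (ht j); rewrite le_eqVlt; apply/orP; left; apply/eqP; apply: eq_integral => x _.
  by rewrite powR_mulrn // real_normK ?num_real.
- by move=> j; apply/measurable_EFinP; apply: measurable_funX; exact: (measurable_section1 t (mU j)).
- by move=> j x _; rewrite lee_fin sqr_ge0.
Qed.

Lemma dissipation_bounded : exists2 M, 0 <= M &
  (\int[leb4]_z (\sum_(j < 3) \sum_(i < 3) DU j i z ^+ 2)%:E <= M%:E)%E.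
Proof.
set S := (\int[leb4]_z _)%E.
have S0 : (0 <= S)%E.
  by apply: integral_ge0 => z _; rewrite lee_fin sumr_ge0 // => j _; rewrite sumr_ge0 // => i _; exact: sqr_ge0.
suff fS : (S < +oo)%E.
  by exists (fine S); [exact: fine_ge0|rewrite fineK // ge0_fin_numE].
rewrite /S.
have mG j i : measurable_fun setT (fun z => (DU j i z ^+ 2)%:E).
  by apply/measurable_EFinP; exact: measurable_funX.
have G0 j i z : (0 <= (DU j i z ^+ 2)%:E)%E by rewrite lee_fin sqr_ge0.
rewrite (_ : (\int[leb4]_z _)%E = (\int[leb4]_z \sum_(j < 3) \sum_(i < 3) (DU j i z ^+ 2)%:E)%E); last first.
  by apply: eq_integral => z _; rewrite -sumEFin; apply: eq_bigr => j _; rewrite sumEFin.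
rewrite ge0_integral_sum //; last 2 first.
- by move=> j; apply: emeasurable_sum => i; exact: mG.
- by move=> j z _; apply: sume_ge0 => i _; exact: G0.
apply: lte_sum_pinfty => j _; rewrite ge0_integral_sum //.
apply: lte_sum_pinfty => i _.
rewrite (@fubini_tonelli2 _ _ _ _ R leb3 leb1 _ (mG j i) (G0 j i)).
have F := Lmn_sqr_fin ((Hu j).2 i).1; apply: le_lt_trans F; rewrite le_eqVlt; apply/orP; left; apply/eqP.
apply: eq_integral => t _; apply: eq_integral => x _.
by rewrite powR_mulrn // real_normK ?num_real.
Qed.

Variables (h w X : R).
Hypotheses (w0 : 0 < w) (wh : 2 * w < h) (h3 : 3 * h ^+ 2 < 1) (X0 : 0 <= X).
Let phi := cutoff z0 h w.
Let rho := h - 2 * w.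
Hypothesis hX : {ae leb1, forall t, a < t < b ->
  \int[leb3]_(x in Om) (phi (x, t) * sqnorm u (x, t)) +
  2 * \int[leb4]_(z in Om `*` `]a, t[%classic) (phi z * sqnorm_grad Du z) <= X}.

Let h0 : 0 < h. Proof. by move: w0 wh; lra. Qed.
Let rho0 : 0 < rho. Proof. by rewrite /rho; move: w0 wh; lra. Qed.
Let rho3 : 3 * rho ^+ 2 < 1.
Proof.
apply: le_lt_trans h3; rewrite ler_pM2l // ler_pXn2r ?nnegrE ?(ltW h0) ?(ltW rho0) //.
by rewrite /rho; move: w0; lra.
Qed.
Let rho1 : rho < 1.
Proof.
rewrite -(ltr_pXn2r (n := 2)) ?nnegrE ?(ltW rho0) // expr1n.
by have := exprn_gt0 2 rho0; move: rho3; lra.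
Qed.
Let Q := cubecyl z0 rho.
Let QW : Q `<=` W.
Proof. by apply: cubecyl_halfcyl; rewrite ?rho0 ?(ltW rho1) // expr1n. Qed.

Let phi_in x t : Q (x, t) -> phi (x, t) = 1.
Proof.
move=> [/= /(cubeP _ _ rho0)[bx _]]; rewrite in_itv /= => /andP[t1 t2].
by apply: (cutoff_in w0 wh) => //=; rewrite (ltW t2) andbT; exact: ltW.
Qed.

Let phi0 z : 0 <= phi z. Proof. exact: cutoff_ge0. Qed.
Let sq0 (v : 'I_3 -> R) : 0 <= \sum_(j < 3) v j ^+ 2.
Proof. by apply: sumr_ge0 => j _; exact: sqr_ge0. Qed.
Let sqq0 (v : 'I_3 -> 'I_3 -> R) : 0 <= \sum_(j < 3) \sum_(i < 3) v j i ^+ 2.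
Proof. by apply: sumr_ge0 => j _; exact: sq0. Qed.

Let ps0 z : 0 <= phi z * sqnorm u z. Proof. exact: mulr_ge0 (phi0 z) (sq0 _). Qed.
Let pg0 z : 0 <= phi z * sqnorm_grad Du z. Proof. exact: mulr_ge0 (phi0 z) (sqq0 _). Qed.

Let L1 t := \int[leb3]_(x in Om) (phi (x, t) * sqnorm u (x, t)).
Let L2 t := \int[leb4]_(z in Om `*` `]a, t[%classic) (phi z * sqnorm_grad Du z).

Let L10 t : 0 <= L1 t. Proof. by apply: Rintegral_ge0 => x _; exact: ps0. Qed.
Let L20 t : 0 <= L2 t. Proof. by apply: Rintegral_ge0 => x _; exact: pg0. Qed.

Let mass : {ae leb1, forall t, (slice_mass z0 u rho t <= X%:E)%E}.
Proof.
have [M M0 hM] := mass_bounded.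
apply: filterS (ae_and hX hM) => t [hXt hMt].
have [tI|ntI] := pselect (tstart z0 rho < t < z0.2); last first.
  rewrite /slice_mass integral0_eq ?lee_fin // => x _; rewrite big1 // => j _.
  by rewrite patchE memNset ?expr0n // => -[_ /=]; rewrite in_itv.
have tab : a < t < b.
  by case/andP: tI => t1 t2; rewrite t2 andbT (le_lt_trans _ t1) // tstart_le // (ltW rho0) ltW.
(* The energy inequality is stated with real-valued integrals, which would be zero for an infinite
   mass; the qualitative bound identifies them with the extended ones. *)
have L1E : (\int[leb3]_(x in Om) (phi (x, t) * sqnorm u (x, t))%:E = (L1 t)%:E)%E.
  rewrite /L1 /Rintegral fineK // ge0_fin_numE; last by apply: integral_ge0 => x _; rewrite lee_fin ps0.
  apply: le_lt_trans (ltry M); apply: le_trans hMt; rewrite integral_mkcond.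
  apply: le_integral_ge0 => [x _|x _]; first by rewrite patchE; case: ifP => // _; rewrite lee_fin ps0.
  rewrite patchE; case: ifPn => [/[!inE] Ox|_].
  - rewrite lee_fin /sqnorm (_ : \sum_(j < 3) U j (x, t) ^+ 2 = \sum_(j < 3) u j (x, t) ^+ 2).
      by apply: ler_piMl => //; exact: cutoff_le1.
    by apply: eq_bigr => j _; rewrite /U patchE mem_set //; split=> //=; rewrite in_itv.
  - by rewrite lee_fin.
apply: (@le_trans _ _ (L1 t)%:E); last first.
  by rewrite lee_fin; have := hXt tab; rewrite -/(L1 t) -/(L2 t); have := L20 t; lra.
rewrite -L1E integral_mkcond; apply: le_integral_ge0 => [x _|x _]; first by rewrite lee_fin.
have [Qx|nQ] := pselect (Q (x, t)); last first.
  rewrite big1; last by move=> j _; rewrite patchE memNset ?expr0n.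
  by rewrite patchE; case: ifP => // _; rewrite lee_fin ps0.
rewrite patchE mem_set; last by case: (QW Qx).
rewrite phi_in // mul1r lee_fin /sqnorm; apply: ler_sum => j _.
by rewrite patchE mem_set.
Qed.

Let G (z : spacetime R) : \bar R := (\sum_(j < 3) \sum_(i < 3) (Du j i \_ Q) z ^+ 2)%:E.
Let mG : measurable_fun setT G.
Proof.
apply/measurable_EFinP; apply: measurable_sum => j; apply: measurable_sum => i; apply: measurable_funX.
by apply: measurable_cut; exact: (integrable_Du Hu rho0 rho3).
Qed.
Let G0 z : (0 <= G z)%E. Proof. by rewrite lee_fin. Qed.

Let before t : measurable [set z : spacetime R | z.2 < t].
Proof.
rewrite (_ : [set z | _] = setT `*` `]-oo, t[%classic).
  by apply: measurableX => //; exact: measurable_itv.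
by apply/seteqP; split=> z /=; rewrite in_itv //= => -[].
Qed.

Let dissipation_before t : t < z0.2 -> 2 * L2 t <= X ->
  (\int[leb1]_(s in `]-oo, t[%classic) slice_dissipation z0 Du rho s <= X%:E)%E.
Proof.
move=> tb ht; have [M M0 hM] := dissipation_bounded.
have -> : (\int[leb1]_(s in `]-oo, t[%classic) slice_dissipation z0 Du rho s =
    \int[leb4]_z (G \_ [set z | (z.2 < t)%R]) z)%E.
  rewrite (@fubini_tonelli2 _ _ _ _ R leb3 leb1 (G \_ [set z | z.2 < t])).
  - rewrite integral_mkcond; apply: eq_integral => s _; rewrite /fubini_G [LHS]patchE; case: ifPn => [|/negP].
      rewrite inE /= in_itv /= => st; apply: eq_integral => x _.
      by rewrite patchE mem_set.
    rewrite inE /= in_itv /= => st; rewrite integral0_eq // => x _.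
    by rewrite patchE memNset.
  - by apply/(measurable_restrictT _ (before t)); exact: measurable_funTS.
  - by move=> z; rewrite patchE; case: ifP.
have L2E : (\int[leb4]_(z in Om `*` `]a, t[%classic) (phi z * sqnorm_grad Du z)%:E = (L2 t)%:E)%E.
  rewrite /L2 /Rintegral fineK // ge0_fin_numE; last by apply: integral_ge0 => x _; rewrite lee_fin pg0.
  apply: le_lt_trans (ltry M); apply: le_trans hM; rewrite integral_mkcond.
  apply: le_integral_ge0 => [z _|z _]; first by rewrite patchE; case: ifP => // _; rewrite lee_fin pg0.
  rewrite patchE; case: ifPn => [/[!inE] Oz|_].
  - have Wz : W z.
      case: Oz => Ox; rewrite /= in_itv /= => /andP[t1 t2]; split=> //=.
      by rewrite in_itv /= t1 (lt_trans t2).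
    rewrite lee_fin /sqnorm_grad (_ : \sum_(j < 3) \sum_(i < 3) DU j i z ^+ 2 = \sum_(j < 3) \sum_(i < 3) Du j i z ^+ 2).
      by apply: ler_piMl => //; exact: cutoff_le1.
    by apply: eq_bigr => j _; apply: eq_bigr => i _; rewrite /DU patchE mem_set.
  - by rewrite lee_fin.
apply: (@le_trans _ _ (L2 t)%:E); last by rewrite lee_fin; have := L20 t; lra.
rewrite -L2E [leRHS]integral_mkcond; apply: le_integral_ge0 => [z _|[x s] _].
  by rewrite patchE; case: ifP.
rewrite [leLHS]patchE; case: ifPn => [/[!inE] /= st|_]; last first.
  by rewrite patchE; case: ifP => // _; rewrite lee_fin pg0.
have [Qx|nQ] := pselect (Q (x, s)); last first.
  rewrite /G big1; last by move=> j _; rewrite big1 // => i _; rewrite patchE memNset ?expr0n.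
  by rewrite patchE; case: ifP => // _; rewrite lee_fin pg0.
have [Ox +] := QW Qx; rewrite /= in_itv /= => /andP[s1 s2].
rewrite patchE mem_set; last by split=> //=; rewrite in_itv /= s1.
rewrite phi_in // mul1r lee_fin /sqnorm_grad; apply: ler_sum => j _; apply: ler_sum => i _.
by rewrite patchE mem_set.
Qed.

(** The inequality is available at almost every time before the final one only. The mass bound is a
    statement about almost every time anyway; the dissipation up to the final time follows by
    monotone convergence along admissible times. *)
Lemma energy_decay : bounded_energy z0 u Du rho X.
Proof.
split; first exact: mass.
have good t' : t' < z0.2 -> exists2 t, t' < t < z0.2 & 2 * L2 t <= X.
  move=> tt; have m : Num.max t' a < z0.2.
    by rewrite gt_max tt /a /tstart expr1n ltrBlDr ltrDl ltr01.
  have [t /andP[+ tb] ht] := ae_interval hX m.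
  rewrite gt_max => /andP[t1 t2]; exists t; first by rewrite t1.
  by have := ht; rewrite /a t2 tb => /(_ isT); rewrite -/(L1 t) -/(L2 t); have := L10 t; lra.
pose F (n : nat) : set R := `]-oo, (z0.2 - n.+1%:R^-1)[%classic.
have GG0 s : (0 <= slice_dissipation z0 Du rho s)%E by apply: integral_ge0 => x _; exact: G0.
have mGG : measurable_fun setT (slice_dissipation z0 Du rho).
  exact: (measurable_fun_fubini_tonelli_G (m1 := leb3) G mG G0).
have hF n : (\int[leb1]_(s in F n) slice_dissipation z0 Du rho s <= X%:E)%E.
  have n0 : z0.2 - n.+1%:R^-1 < z0.2 by rewrite ltrBlDr ltrDl invr_gt0 ltr0n.
  have [t /andP[t1 t2] ht] := good _ n0.
  apply: le_trans (dissipation_before t2 ht); apply: ge0_subset_integral => //; try exact: measurable_itv.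
  - exact: measurable_funTS.
  - by move=> s; rewrite /F /= !in_itv /= => /lt_trans; apply.
have cvF : (\int[leb1]_(s in F n) slice_dissipation z0 Du rho s @[n --> \oo] -->
    \int[leb1]_(s in \bigcup_n F n) slice_dissipation z0 Du rho s)%E.
  apply: ge0_nondecreasing_set_cvg_integral => //.
  - move=> n m nm; apply/subsetPset => s; rewrite /F /= !in_itv /= => /lt_le_trans; apply.
    by rewrite lerD2l lerN2 lef_pV2 ?posrE ?ltr0n // ler_nat.
  - by move=> n; exact: measurable_itv.
  - by move=> n; exact: measurable_funTS.
have -> : (\int[leb1]_t slice_dissipation z0 Du rho t =
    \int[leb1]_(s in \bigcup_n F n) slice_dissipation z0 Du rho s)%E.
  rewrite [RHS]integral_mkcond; apply: eq_integral => s _; rewrite patchE; case: ifPn => // /negP ns.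
  apply: integral0_eq => x _; rewrite big1 // => j _; rewrite big1 // => i _.
  rewrite patchE memNset ?expr0n // => -[_ /=]; rewrite in_itv /= => /andP[_ s2]; apply: ns.
  rewrite inE; have s0 : 0 < z0.2 - s by rewrite subr_gt0.
  have [n _ hn] := near_infty_natSinv_lt (PosNum s0).
  exists n => //; rewrite /F /= in_itv /=; have := hn n (leqnn n); rewrite /= ltrBrDr addrC -ltrBrDr.
  by [].
rewrite -(cvg_lim (@ereal_hausdorff R) cvF); apply: lime_le; first by apply/cvg_ex; eexists; exact: cvF.
exact: nearW.
Qed.

End energy_decay.

(** * Iteration over the radii *)

Lemma geometric_small (R : realType) (M e : R) : 0 <= M -> 0 < e -> exists n, M / 2 ^+ n <= e.
Proof.
move=> M0 e0; have := archi_boundP (divr_ge0 M0 (ltW e0)); set n := Num.bound _ => hn; exists n.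
rewrite ler_pdivrMr ?exprn_gt0 // mulrC -ler_pdivrMr //; apply: (le_trans (ltW hn)).
by rewrite -natrX ler_nat ltnW // ltn_expl.
Qed.

(* Along the radii [11 r / 20 - d] with [d] shrinking by 5/6 at each step, the halving of the bound
   beats the growth of [(r / d)^2], because [(6 / 5)^2 / 2 < 1]. *)
Lemma absorb_iteration (R : realType) (r S M0 : R) (B : R -> R -> Prop) : 0 < r -> 0 <= S -> 0 <= M0 ->
  (forall h, 0 < h <= 11 / 20 * r -> B h M0) ->
  (forall h w M, 0 < w -> 2 * w < h -> h <= 11 / 20 * r -> 0 <= M -> B h M ->
    B (h - 2 * w) (M / 2 + (r / w) ^+ 2 * S)) ->
  (forall h M M', M <= M' -> B h M -> B h M') ->
  forall n, B (r / 2) (M0 / 2 ^+ n + 600 * 20 ^+ 2 * S).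
Proof.
move=> r0 S0 M00 init step mono n.
(* The step multiplies [K] by [(6/5) ^ 2 / 2 = 18/25] and, with [w = d / 12], adds [12 ^ 2 = 144];
   every [K] from 3600/7 on is stable under this. *)
have [K [K0 K1 KE]] : exists K : R, [/\ 0 <= K, 18 / 25 * K + 144 <= K & K = 600] by exists 600; split; lra.
have P d : 0 < d <= r / 20 -> B (11 / 20 * r - d) (M0 / 2 ^+ n + K * (r / d) ^+ 2 * S).
  elim: n d => [|n IH] d /andP[d0 dr].
    apply: (mono _ M0); last by apply: init; lra.
    by rewrite expr0 divr1 lerDl mulr_ge0 // mulr_ge0 ?sqr_ge0.
  have d56 : 0 < 5 / 6 * d <= r / 20 by apply/andP; split; lra.
  (* The cutoff of width [d / 12] leads from distance [5 d / 6] to distance [d], as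
     [2 w = d / 6]. *)
  have w0 : 0 < d / 12 by lra.
  have b := IH _ d56; pose M := M0 / 2 ^+ n + K * (r / (5 / 6 * d)) ^+ 2 * S.
  have M0' : 0 <= M by rewrite addr_ge0 ?divr_ge0 ?exprn_ge0 // mulr_ge0 // mulr_ge0 ?sqr_ge0.
  have := step _ _ M w0 _ _ M0' b; rewrite (_ : 11 / 20 * r - 5 / 6 * d - 2 * (d / 12) = 11 / 20 * r - d); last by field.
  have k1 : 2 * (d / 12) < 11 / 20 * r - 5 / 6 * d by lra.
  have k2 : 11 / 20 * r - 5 / 6 * d <= 11 / 20 * r by lra.
  move=> /(_ k1 k2); apply: mono.
  have -> : M / 2 + (r / (d / 12)) ^+ 2 * S = M0 / 2 ^+ n.+1 + (18 / 25 * K + 144) * (r / d) ^+ 2 * S.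
    rewrite /M (exprS 2 n); field; rewrite gt_eqF //= gt_eqF // exprn_gt0 //.
  by rewrite lerD2l ler_wpM2r // ler_wpM2r ?sqr_ge0.
(* The distance [r / 20] leads from [11 r / 20] to [r / 2]; hence the factor [20 ^ 2]. *)
have r20 : 0 < r / 20 <= r / 20 by apply/andP; split; lra.
have := P _ r20; rewrite (_ : 11 / 20 * r - r / 20 = r / 2); last by field.
by rewrite -KE (_ : r / (r / 20) = 20) //; field; rewrite gt_eqF.
Qed.

Lemma step_cst_ge0 (R : realType) (c : R) : 0 <= c -> 0 <= step_cst c.
Proof.
move=> c0; apply: addr_ge0; first apply: addr_ge0.
- by apply: mulr_ge0 => //; apply: mulr_ge0; [exact: mulr_ge0|exact: energy_cst_ge0].
- exact: powR_ge0.
- by apply: mulr_ge0 => //; apply: mulr_ge0; [exact: mulr_ge0|exact: pressure_cst_ge0].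
Qed.

(** * The energy bound at half the radius *)

Section main_bound.
Variable R : realType.
Variables (z0 : spacetime R) (u : 'I_3 -> spacetime R -> R) (Du : 'I_3 -> 'I_3 -> spacetime R -> R)
  (p : spacetime R -> R) (Dp : 'I_3 -> spacetime R -> R).
Hypothesis su : suitable z0 1 u Du p Dp.
Let Om := halfball z0.1 1.
Let a := tstart z0 1.
Let b := z0.2.

Let Hsup i : Lmn 2%:E +oo%E Om a b (u i).
Proof. by case: su => ? [? [? [[h _ _ _] _ _ _ _]]]; exact: h. Qed.
Let Hu i : W10 2%:E 2%:E Om a b (u i) (Du i).
Proof. by case: su => ? [? [? [[_ h _ _] _ _ _ _]]]; exact: h. Qed.
Let Hp : W10 (9 / 8)%:E (3 / 2)%:E Om a b p Dp.
Proof. by case: su => ? [? [? [[]]]]. Qed.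
Let dv : {ae leb4, forall z, halfcyl z0 1 z -> \sum_(i < 3) Du i i z = 0}.
Proof. by case: su => ? [? [? [_ _ h _ _]]]; apply: filterS h => z h /h[]. Qed.
Let fl i : flat_trace z0 1 (u i) (Du i ord_max) (fun=> 0).
Proof. by case: su => ? [? [? [_ _ _ h _]]]; exact: h. Qed.
Let lei : local_energy_inequality z0 1 u Du p.
Proof. by case: su => ? [? [? []]]. Qed.

Lemma bounded_energy_init : exists2 M, 0 <= M & forall h, 0 < h -> 3 * h ^+ 2 < 1 -> bounded_energy z0 u Du h M.
Proof.
have [M1 M10 h1] := mass_bounded Hsup Hu; have [M2 M20 h2] := dissipation_bounded Hu.
exists (M1 + M2); first exact: addr_ge0.
move=> h h0 h3.
have hl : h <= 1.
  rewrite -(ler_pXn2r (n := 2)) ?nnegrE ?(ltW h0) // expr1n.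
  by have := exprn_gt0 2 h0; move: h3; lra.
have QW z : cubecyl z0 h z -> halfcyl z0 1 z.
  by apply: cubecyl_halfcyl; rewrite ?h0 // expr1n.
have le (f : spacetime R -> R) z : (f \_ (cubecyl z0 h)) z ^+ 2 <= (f \_ (halfcyl z0 1)) z ^+ 2.
  rewrite patchE; case: ifPn => [/[!inE] Qz|_]; last by rewrite expr0n sqr_ge0.
  by rewrite patchE mem_set //; exact: QW.
split.
  apply: filterS h1 => t h1; apply: le_trans (_ : M1%:E <= _)%E; last by rewrite lee_fin lerDl.
  apply: le_trans h1; apply: le_integral_ge0 => x _.
    by rewrite lee_fin sumr_ge0 // => j _; exact: sqr_ge0.
  by rewrite lee_fin; apply: ler_sum => j _; exact: le.
apply: le_trans (_ : M2%:E <= _)%E; last by rewrite lee_fin lerDr.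
apply: le_trans h2.
pose G (z : spacetime R) : \bar R := (\sum_(j < 3) \sum_(i < 3) (Du j i \_ (cubecyl z0 h)) z ^+ 2)%:E.
have G0 z : (0 <= G z)%E.
  by rewrite lee_fin sumr_ge0 // => j _; rewrite sumr_ge0 // => i _; exact: sqr_ge0.
have mG : measurable_fun setT G.
  apply/measurable_EFinP; apply: measurable_sum => j; apply: measurable_sum => i; apply: measurable_funX.
  by apply: measurable_cut; exact: (integrable_Du Hu h0 h3).
have -> : (\int[leb1]_t slice_dissipation z0 Du h t = \int[leb4]_z G z)%E.
  by rewrite (@fubini_tonelli2 _ _ _ _ R leb3 leb1 G mG G0).
apply: le_integral_ge0 => z _ //.
by rewrite lee_fin; apply: ler_sum => j _; apply: ler_sum => i _; exact: le.
Qed.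

Variables (r C al P : R).
Hypotheses (r01 : 0 < r < 1) (C1 : 1 <= C).
Hypothesis hC : forall a b w : R, 0 < w -> forall s, `|derive1 (plateau a b w) s| <= C / w /\
  `|derive1 (derive1 (plateau a b w)) s| <= C / w ^+ 2.
Hypotheses (al0 : 0 <= al) (P0 : 0 <= P).
Hypothesis hN : (\int[leb1]_t (wnorm z0 r u t `^ 3) <= (r ^+ 2 * al)%:E)%E.
Hypothesis hP : forall h, 0 < h <= r -> 3 * h ^+ 2 < r ^+ 2 ->
  ((\int[leb1]_t (wnorm z0 r u t `^ 3)) `^ (1 / 3) *
  (\int[leb1]_t (slice_gradp z0 h Dp t `^ (4 / 3))) `^ (2 / 3) <= (r `^ (5 / 3) * P)%:E)%E.

Let r0 : 0 < r. Proof. by case/andP: r01. Qed.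
Let S := step_cst (4 * C) * (r * (al `^ (4 / 3) + al `^ (2 / 3) + P)).

Let small h : 0 < h -> h <= 11 / 20 * r -> [/\ 0 < h <= r, 3 * h ^+ 2 < r ^+ 2 & 3 * h ^+ 2 < 1].
Proof.
move=> h0 hr; have r1 : r < 1 by case/andP: r01.
have h3r : 3 * h ^+ 2 < r ^+ 2.
  apply: (@le_lt_trans _ _ (3 * (11 / 20 * r) ^+ 2)); last by have := exprn_gt0 2 r0; rewrite exprMn; lra.
  by rewrite ler_pM2l // ler_pXn2r ?nnegrE ?(ltW h0) // mulr_ge0 // ltW.
split=> //; first by rewrite h0; move: r0; lra.
by apply: (lt_trans h3r); rewrite expr_lt1 // ltW.
Qed.

Lemma energy_step h w M : 0 < w -> 2 * w < h -> h <= 11 / 20 * r -> 0 <= M ->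
  bounded_energy z0 u Du h M -> bounded_energy z0 u Du (h - 2 * w) (M / 2 + (r / w) ^+ 2 * S).
Proof.
move=> w0 wh hr M0 bM; have h0 : 0 < h by lra.
have [hr' h3r h3] := small h0 hr.
have -> : M / 2 + (r / w) ^+ 2 * S = energy_rhs r w C M al P by rewrite /energy_rhs /S; ring.
have hPh := hP hr' h3r.
apply: (energy_decay Hsup Hu w0 wh h3).
  exact: (energy_rhs_ge0 Hu Hp r01 w0 wh hr C1 M0 al0 P0 hN hPh bM).
apply: filterS lei => t ht tI; apply: le_trans (ht tI (cutoff z0 h w) _ _ _) _.
- exact: test_fun_cutoff.
- by move=> z; exact: cutoff_ge0.
- exact: cutoff_boundary.
- apply: (energy_rhs_bound Hu Hp dv fl r01 w0 wh hr C1 hC M0 al0 P0 hN hPh bM).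
  by case/andP: tI => _ /ltW.
Qed.

Let S0 : 0 <= S.
Proof.
apply: mulr_ge0; last by rewrite mulr_ge0 ?addr_ge0 ?powR_ge0 // ltW.
by apply: step_cst_ge0; move: C1; lra.
Qed.

(** The initial bound depends on the solution, but its contribution is halved in every step and so
    falls below any [e]; the remaining constant does not see the solution. *)
Lemma bounded_energy_half e : 0 < e -> bounded_energy z0 u Du (r / 2) (e + 600 * 20 ^+ 2 * S).
Proof.
move=> e0; have [M0 M00 init] := bounded_energy_init.
have [n hn] := geometric_small M00 e0.
have mono h M M' : M <= M' -> bounded_energy z0 u Du h M -> bounded_energy z0 u Du h M'.
  move=> MM [b1 b2]; split; last by apply: le_trans b2 _; rewrite lee_fin.
  by apply: filterS b1 => t /le_trans; apply; rewrite lee_fin.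
apply: (mono _ (M0 / 2 ^+ n + 600 * 20 ^+ 2 * S)); first by rewrite lerD2r.
apply: (absorb_iteration (B := bounded_energy z0 u Du) r0 S0 M00 _ energy_step mono) => h /andP[h0 hr].
by have [_ _ h3] := small h0 hr; exact: init.
Qed.

End main_bound.

(** * Return to the scale-invariant quantities *)

Section scale_invariant.
Variable R : realType.
Variables (z0 : spacetime R) (u : 'I_3 -> spacetime R -> R) (Du : 'I_3 -> 'I_3 -> spacetime R -> R).

Lemma ae_neq (c : R) : {ae leb1, forall t : R, t <> c}.
Proof.
exists [set c]; split=> //; first exact: lebesgue_measure_set1.
by move=> t /= /contrapT.
Qed.

(** [Aplus] refers to the closed time interval and [bounded_energy] to the open one; the two end
    times form a null set. *)
Lemma Aplus_le s X : 0 < s -> 0 <= X -> bounded_energy z0 u Du s X -> (Aplus z0 s u <= (s^-1 * X)%:E)%E.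
Proof.
move=> s0 X0 [hX _]; apply/ess_supP.
apply: filterS (ae_and hX (ae_and (ae_neq (tstart z0 s)) (ae_neq z0.2))) => t [Xt [t1 t2]].
rewrite patchE; case: ifPn => [/[!inE]|_]; last by rewrite lee_fin mulr_ge0 // invr_ge0 ltW.
rewrite /= in_itv /= => /andP[l1 l2].
have tI : tstart z0 s < t < z0.2.
  by rewrite !lt_neqAle l1 l2 !andbT; apply/andP; split; apply/eqP => // e; apply: t1.
rewrite EFinM; apply: lee_wpmul2l; first by rewrite lee_fin invr_ge0 ltW.
apply: le_trans Xt; rewrite integral_mkcond; apply: le_integral_ge0 => x _.
  by rewrite patchE; case: ifP => // _; rewrite lee_fin sumr_ge0 // => j _; exact: sqr_ge0.
rewrite patchE; case: ifPn => [/[!inE] hx|_]; last by rewrite lee_fin sumr_ge0 // => j _; exact: sqr_ge0.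
rewrite lee_fin; apply: ler_sum => j _; rewrite patchE mem_set //; split=> /=; first exact: halfball_cube.
by rewrite in_itv.
Qed.

Lemma Bplus_le s X : 0 < s -> (forall j i, measurable_fun setT (Du j i \_ (cubecyl z0 s))) ->
  bounded_energy z0 u Du s X -> (Bplus z0 s Du <= (s^-1 * X)%:E)%E.
Proof.
move=> s0 mD [_ hX]; rewrite /Bplus EFinM; apply: lee_wpmul2l; first by rewrite lee_fin invr_ge0 ltW.
apply: le_trans hX.
pose G (z : spacetime R) : \bar R := (\sum_(j < 3) \sum_(i < 3) (Du j i \_ (cubecyl z0 s)) z ^+ 2)%:E.
have G0 z : (0 <= G z)%E.
  by rewrite lee_fin sumr_ge0 // => j _; rewrite sumr_ge0 // => i _; exact: sqr_ge0.
have mG : measurable_fun setT G.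
  by apply/measurable_EFinP; apply: measurable_sum => j; apply: measurable_sum => i; exact: measurable_funX.
have -> : (\int[leb1]_t slice_dissipation z0 Du s t = \int[leb4]_z G z)%E.
  by rewrite (@fubini_tonelli2 _ _ _ _ R leb3 leb1 G mG G0).
rewrite integral_mkcond; apply: le_integral_ge0 => z _.
  rewrite patchE; case: ifP => // _; rewrite lee_fin sumr_ge0 // => j _.
  by rewrite sumr_ge0 // => i _; exact: sqr_ge0.
rewrite patchE; case: ifPn => [/[!inE] -[hx ht]|_]; last exact: G0.
rewrite lee_fin; apply: ler_sum => j _; apply: ler_sum => i _; rewrite patchE mem_set //.
by split=> //; exact: halfball_cube.
Qed.

Lemma Cinfplus_ge0 s : (0 <= Cinfplus z0 s u)%E.
Proof.
apply: mule_ge0; first by rewrite lee_fin invr_ge0 sqr_ge0.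
apply: integral_ge0 => t _; apply: expe_ge0; apply: (@ereal_sup_ge _ _ _).
by eexists; [exists 1 => //=|rewrite mule_ge0 ?poweR_ge0].
Qed.

Lemma D1plus_ge0 s (Dp : 'I_3 -> spacetime R -> R) : (0 <= D1plus z0 s Dp)%E.
Proof.
apply: mule_ge0; first by rewrite lee_fin powR_ge0.
by apply: integral_ge0 => t _; exact: poweR_ge0.
Qed.

End scale_invariant.

Unset Implicit Arguments.
Set Strict Implicit.

Theorem lemma3p6 (R : realType) :
  exists c : R,
    forall (z0 : spacetime R)
      (u : 'I_3 -> spacetime R -> R) (Du : 'I_3 -> 'I_3 -> spacetime R -> R)
      (p : spacetime R -> R) (Dp : 'I_3 -> spacetime R -> R),
    suitable z0 1 u Du p Dp ->
    forall r : R, 0 < r < 1 ->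
      (Aplus z0 (r / 2) u + Bplus z0 (r / 2) Du <=
       c%:E * (Cinfplus z0 r u `^ (4 / 3) + Cinfplus z0 r u `^ (2 / 3) +
               D1plus z0 r Dp `^ (2 / 3) * Cinfplus z0 r u `^ (1 / 3)))%E.
Proof.
have [C C1 hC] := plateau_deriv_bound R.
(* The numeral is hidden behind [k] so that the arithmetic below treats it as a variable. *)
have [k [k0 kE]] : exists k : R, 0 <= k /\ k = 600 * 20 ^+ 2.
  by eexists; split; last reflexivity; apply: mulr_ge0; [|apply: exprn_ge0]; exact: ler0n.
have K0 : 0 <= step_cst (4 * C) by apply: step_cst_ge0; lra.
(* The 4 is the 2 from dividing by [r / 2], once for the mass and once for the dissipation. *)
pose K := 4 * k * step_cst (4 * C).
have KK0 : 0 <= K by rewrite /K mulr_ge0 // mulr_ge0.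
(* 16 is the largest of the factors [8 ^ (4/3) = 16], [8 ^ (2/3) = 4] and 6 that relate the bounds
   for the data to the claimed quantities; the [+ 1] keeps the constant positive, which matters if
   the right-hand side is infinite. *)
exists (K * 16 + 1) => z0 u Du p Dp su r /[dup] r01 /andP[r0 r1].
have c0 := Cinfplus_ge0 z0 u r; have d0 := D1plus_ge0 z0 r Dp.
set c := Cinfplus z0 r u in c0 *; set d := D1plus z0 r Dp in d0 *.
have t10 : (0 <= c `^ (4 / 3))%E by exact: poweR_ge0.
have t20 : (0 <= c `^ (2 / 3))%E by exact: poweR_ge0.
have t30 : (0 <= d `^ (2 / 3) * c `^ (1 / 3))%E by rewrite mule_ge0 ?poweR_ge0.
(* Once the sum is finite, so are [c] and the product of the last term; [d] itself may still be
   infinite when [c] is zero, so only the product is turned into a real number. *)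
have [Too|Tfin] := eqVneq (c `^ (4 / 3) + c `^ (2 / 3) + d `^ (2 / 3) * c `^ (1 / 3))%E +oo%E.
  by rewrite Too gt0_muley ?leey // lte_fin ltr_wpDl // mulr_ge0.
have cfin : c \is a fin_num.
  rewrite ge0_fin_numE // ltey; apply/eqP => cy; move/eqP: Tfin; apply.
  rewrite cy poweRyr // addye; last by rewrite gt_eqF // (lt_le_trans (ltNyr 0)) // poweR_ge0.
  by rewrite addye // gt_eqF // (lt_le_trans (ltNyr 0)) // mule_ge0 ?poweR_ge0.
have tfin : (d `^ (2 / 3) * c `^ (1 / 3))%E \is a fin_num.
  rewrite ge0_fin_numE // ltey; apply/eqP => ty; move/eqP: Tfin; apply.
  by rewrite ty addey // gt_eqF // (lt_le_trans (ltNyr 0)) // adde_ge0.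
pose ga := fine c; pose pi' := fine (d `^ (2 / 3) * c `^ (1 / 3))%E.
have cE : c = ga%:E by rewrite /ga fineK.
have tE : (d `^ (2 / 3) * c `^ (1 / 3) = pi'%:E)%E by rewrite /pi' fineK.
have ga0 : 0 <= ga by rewrite -lee_fin -cE.
have pi0 : 0 <= pi' by rewrite -lee_fin -tE.
have Hu i : W10 2%:E 2%:E (halfball z0.1 1) (tstart z0 1) z0.2 (u i) (Du i).
  by case: su => ? [? [? [[_ h _ _] _ _ _ _]]]; exact: h.
have Hp : W10 (9 / 8)%:E (3 / 2)%:E (halfball z0.1 1) (tstart z0 1) z0.2 p Dp.
  by case: su => ? [? [? [[]]]].
have mU j : measurable_fun setT (u j \_ (halfcyl z0 r)).
  by apply: (measurable_restrict_u Hu); rewrite r0 ltW.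
have hw : (\int[leb1]_t (wnorm z0 r u t `^ 3) <= (8 * r ^+ 2)%:E * c)%E by exact: integral_wnorm.
have hN : (\int[leb1]_t (wnorm z0 r u t `^ 3) <= (r ^+ 2 * (8 * ga))%:E)%E.
  by apply: le_trans hw _; rewrite cE -EFinM lee_fin mulrA [8 * _]mulrC.
have hP h : 0 < h <= r -> 3 * h ^+ 2 < r ^+ 2 -> ((\int[leb1]_t (wnorm z0 r u t `^ 3)) `^ (1 / 3) *
    (\int[leb1]_t (slice_gradp z0 h Dp t `^ (4 / 3))) `^ (2 / 3) <= (r `^ (5 / 3) * (6 * pi'))%:E)%E.
  move=> /[dup] hr /andP[h0 hr'] h3; have h31 : 3 * h ^+ 2 < 1.
    by apply: (lt_trans h3); rewrite expr_lt1 // ltW.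
  apply: (product_bound (Cc := c) (Dd := d)) => //.
  - by apply: integral_ge0 => t _; exact: poweR_ge0.
  - by apply: integral_ge0 => t _; exact: poweR_ge0.
  - apply: integral_slice_gradp => // j; apply: measurable_cut; exact: (integrable_Dp Hp h0 h31).
  - by rewrite tE.
have al0 : 0 <= 8 * ga by rewrite mulr_ge0.
have P0 : 0 <= 6 * pi' by rewrite mulr_ge0.
pose T := ga `^ (4 / 3) + ga `^ (2 / 3) + pi'.
have T0 : 0 <= T by rewrite !addr_ge0 ?powR_ge0.
have -> : (c `^ (4 / 3) + c `^ (2 / 3) + d `^ (2 / 3) * c `^ (1 / 3))%E = T%:E.
  by rewrite tE cE !poweR_EFin -!EFinD.
have hT : (8 * ga) `^ (4 / 3) + (8 * ga) `^ (2 / 3) + 6 * pi' <= 16 * T.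
  have e8 : 8 = 2 `^ 3 :> R by rewrite powR_mulrn //; ring.
  have E1 : (8 * ga) `^ (4 / 3) = 16 * ga `^ (4 / 3).
    rewrite powRM // {1}e8 -powRrM (_ : 3 * (4 / 3) = 4%:R :> R); last by field.
    by rewrite powR_mulrn //; congr (_ * _); ring.
  have E2 : (8 * ga) `^ (2 / 3) = 4 * ga `^ (2 / 3).
    rewrite powRM // {1}e8 -powRrM (_ : 3 * (2 / 3) = 2%:R :> R); last by field.
    by rewrite powR_mulrn //; congr (_ * _); ring.
  by rewrite E1 E2 /T; have := powR_ge0 ga (2 / 3); lra.
(* The slack [e] takes up the remainder of the iteration. It is run with remainder [e * r / 4]
   because mass and dissipation together carry the factor [4 / r]. *)
apply/lee_addgt0Pr => e e0.
have er : 0 < e * r / 4 by rewrite divr_gt0 // mulr_gt0.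
have := bounded_energy_half su r01 C1 hC al0 P0 hN hP er; rewrite -kE.
set X := _ + _ => bX.
have r20 : 0 < r / 2 by rewrite divr_gt0.
have r23 : 3 * (r / 2) ^+ 2 < 1.
  have : r ^+ 2 < 1 by rewrite expr_lt1 // ltW.
  by rewrite exprMn exprVn; lra.
have X0 : 0 <= X.
  apply: addr_ge0; [exact: ltW|apply: mulr_ge0 => //; apply: mulr_ge0 => //; apply: mulr_ge0; first exact: ltW].
  by rewrite !addr_ge0 ?powR_ge0.
have mD j i : measurable_fun setT (Du j i \_ (cubecyl z0 (r / 2))).
  by apply: measurable_cut; exact: (integrable_Du Hu r20 r23).
apply: le_trans (leeD (Aplus_le r20 X0 bX) (Bplus_le r20 mD bX)) _.
rewrite -!EFinM -!EFinD lee_fin.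
have -> : (r / 2)^-1 * X + (r / 2)^-1 * X = e + K * ((8 * ga) `^ (4 / 3) + (8 * ga) `^ (2 / 3) + 6 * pi').
  by rewrite /X /K; field; rewrite gt_eqF.
apply: (@le_trans _ _ (e + K * (16 * T))); first by rewrite lerD2l ler_wpM2l.
have -> : (K * 16 + 1) * T + e = e + K * (16 * T) + T by ring.
by rewrite lerDl.
Qed.
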